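(* Let $d\geq 2$. For all $\varphi,\psi\in\mathcal{C}^\infty(S\mathbb{T}^d)$ one has, as $t\to+\infty$, $$\mathscr{C}_{\varphi,\psi}(t)=(2\pi)^d\left(P_0\varphi,P_0\psi\right)_{L^2(\mathbb{S}^{d-1})}+\left(\frac{2\pi}{t}\right)^{\frac{d-1}{2}}\sum_{\pm}e^{\mp i\frac{\pi}{4}(d-1)}\left(\frac{e^{\pm it\sqrt{-\Delta}}}{\sqrt{-\Delta}^{\frac{d-1}{2}}}\Pi_0^\pm\varphi,\Pi_0^\pm\psi\right)_{L^2(\mathbb{T}^d)}+\mathcal{O}_{\varphi,\psi}\left(\frac{1}{t^{\frac{d-1}{2}+1}}\right),$$ where $(P_0f)(\theta)=\frac{1}{(2\pi)^d}\int_{\mathbb{T}^d}f(x,\theta)\,dx$ and $$(\Pi_0^\pm f)(x)=\sum_{\xi\in\mathbb{Z}^d\setminus\{0\}}\hat f_\xi\left(\pm\frac{\xi}{|\xi|}\right)e^{i\xi\cdot x}\quad\text{for}\quad f(x,\theta)=\sum_{\xi\in\mathbb{Z}^d}\hat f_\xi(\theta)e^{i\xi\cdot x}.$$ Equivalently, for every $\psi\in\mathcal{C}^\infty(S\mathbb{T}^d)$ one has, as $t\to+\infty$, $$t^{\frac{d-1}{2}}\left(\psi\circ e^{-tV}(x,\theta)-\frac{1}{(2\pi)^d}\int_{\mathbb{T}^d}\psi(y,\theta)\,dy\right)=(2\pi)^{\frac{d-1}{2}}\sum_{\pm}\mathbf{P}_\pm^\dagger\,\frac{e^{\pm i\left(t\sqrt{-\Delta}-\frac{\pi}{4}(d-1)\right)}}{(-\Delta)^{\frac{d-1}{4}}}\,\mathbf{P}_\pm(\psi)+\mathcal{O}_{\mathcal{D}'(S\mathbb{T}^d)}(t^{-1}),$$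 where $$\mathbf{P}_\pm:\psi\in\mathcal{C}^\infty(S\mathbb{T}^d)\mapsto\sum_{\xi\in\mathbb{Z}^d\setminus\{0\}}\frac{1}{(2\pi)^d}\int_{\mathbb{T}^d}\psi\left(y,\pm\frac{\xi}{|\xi|}\right)e^{i(y-x)\cdot\xi}\,dy\in\mathcal{C}^\infty(\mathbb{T}^d)$$ and $$\mathbf{P}_\pm^\dagger:f\in\mathcal{C}^\infty(\mathbb{T}^d)\mapsto\sum_{\xi\in\mathbb{Z}^d\setminus\{0\}}\frac{1}{(2\pi)^d}\left(\int_{\mathbb{T}^d}f(y)e^{i(y-x)\cdot\xi}\,dy\right)\delta_0\left(\theta\mp\frac{\xi}{|\xi|}\right)\in\mathcal{D}'(S\mathbb{T}^d).$$
   Context: $\mathbb{T}^d=\mathbb{R}^d/2\pi\mathbb{Z}^d$ is the flat torus with Lebesgue measure $dx$ (total mass $(2\pi)^d$), and $S\mathbb{T}^d=\mathbb{T}^d\times\mathbb{S}^{d-1}\ni(x,\theta)$ carries the Liouville measure $dx\otimes d\mathrm{Vol}(\theta)$, where $d\mathrm{Vol}$ is the standard volume measure on $\mathbb{S}^{d-1}$. The geodesic vector field is $V=\theta\cdot\partial_x$, with flow $e^{tV}(x,\theta)=(x+t\theta,\theta)$; acting on functions, $(e^{tV}\varphi)(x,\theta)=\varphi(x+t\theta,\theta)$. The correlation function is $$\mathscr{C}_{\varphi,\psi}(t)=\left(e^{tV}\varphi,\psi\right)_{L^2(S\mathbb{T}^d)}=\int_{\mathbb{T}^d\times\mathbb{S}^{d-1}}\varphi(x+t\theta,\theta)\overline{\psi(x,\theta)}\,dx\,d\mathrm{Vol}(\theta).$$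 All $L^2$ inner products are $(u,v)=\int u\bar v$. $\Delta=\sum_{j=1}^d\partial_{x_j}^2$ is the Laplacian on $\mathbb{T}^d$; functions of $\sqrt{-\Delta}$ act as Fourier multipliers ($\sqrt{-\Delta}\,e^{i\xi\cdot x}=|\xi|e^{i\xi\cdot x}$) and negative powers are applied only to functions with zero mean on $\mathbb{T}^d$. The sums $\sum_\pm$ run over the two choices of sign (upper signs together, lower signs together). $\delta_0(\theta\mp\xi/|\xi|)$ is the Dirac mass on $\mathbb{S}^{d-1}$ at $\pm\xi/|\xi|$. The notation $\mathcal{O}_{\mathcal{D}'(S\mathbb{T}^d)}(t^{-1})$ denotes a $t$-dependent distribution whose pairing with any fixed test function in $\mathcal{C}^\infty(S\mathbb{T}^d)$ is $\mathcal{O}(t^{-1})$. *)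

(* Defs.v *)
From HB Require Import structures.
From mathcomp Require Import all_boot all_order all_algebra.
From mathcomp Require Import complex.
From mathcomp Require Import all_classical all_reals all_analysis.
From mathcomp Require Import measurable_realfun measurable_fun_approximation.
Set Implicit Arguments.
Unset Strict Implicit.
Unset Printing Implicit Defensive.
Import Order.TTheory GRing.Theory Num.Theory.
Import numFieldNormedType.Exports.
Local Open Scope classical_set_scope.
Local Open Scope ring_scope.

(* Row vectors carry the product sigma-algebra, generated by the coordinates. *)
Definition rV_display : measure_display. Proof. exact: default_measure_display. Qed.

Section measurable_rV.
Context {R : realType} {n : nat}.

Definition rV_coord (i : 'I_n) (v : 'rV[R]_n) : measurableTypeR R := v 0 i.

Let rV_set0 : g_sigma_preimage rV_coord set0.
Proof. exact: sigma_algebra0. Qed.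

Let rV_setC A : g_sigma_preimage rV_coord A -> g_sigma_preimage rV_coord (~` A).
Proof. exact: sigma_algebraC. Qed.

Let rV_bigcup (F : _^nat) : (forall i, g_sigma_preimage rV_coord (F i)) ->
  g_sigma_preimage rV_coord (\bigcup_i (F i)).
Proof. exact: sigma_algebra_bigcup. Qed.

HB.instance Definition _ := @isMeasurable.Build rV_display
  'rV[R]_n (g_sigma_preimage rV_coord) rV_set0 rV_setC rV_bigcup.

Lemma measurable_rV_coord (i : 'I_n) :
  measurable_fun [set: 'rV[R]_n] (rV_coord i).
Proof.
move=> _ Y mY; rewrite setTI; apply: sub_sigma_algebra => /=.
rewrite -bigcup_seq/=; exists i => /=; first by rewrite mem_index_enum.
by exists Y => //; rewrite setTI.
Qed.

Lemma measurable_fun_rVP d (T : measurableType d) (f : T -> 'rV[R]_n) :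
  (forall i, measurable_fun [set: T] (rV_coord i \o f)) ->
  measurable_fun [set: T] f.
Proof.
move=> mf _ A; rewrite setTI.
suff : measurable `<=` [set B | measurable (f @^-1` B)] by apply.
apply: smallest_sub.
  split; first by rewrite /= preimage_set0.
    by move=> B /= mB; rewrite setTD preimage_setC; exact: measurableC.
  by move=> F /= mF; rewrite preimage_bigcup; exact: bigcup_measurable.
move=> B; rewrite -bigcup_seq/= => -[i _ [C mC <-]] /=.
by rewrite setTI -comp_preimage -[X in measurable X]setTI; exact: mf.
Qed.

End measurable_rV.

Section lebesgue_measure_rV.
Context {R : realType}.
Local Open Scope ereal_scope.

Section step.
Variable n : nat.

Definition rV_cons (p : measurableTypeR R * 'rV[R]_n) : 'rV[R]_n.+1 :=
  \row_(i < n.+1) if unlift ord0 i is Some j then p.2 0%R j else p.1.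

Definition rV_uncons (v : 'rV[R]_n.+1) : measurableTypeR R * 'rV[R]_n :=
  (v 0%R 0%R, \row_(j < n) v 0%R (lift ord0 j)).

Lemma rV_consK : cancel rV_cons rV_uncons.
Proof.
move=> [x v]; congr pair; first by rewrite mxE unlift_none.
by apply/rowP => j; rewrite !mxE liftK.
Qed.

Lemma measurable_rV_cons : measurable_fun setT rV_cons.
Proof.
apply: measurable_fun_rVP => i.
case: (unliftP ord0 i) => [j|] ->.
  rewrite (_ : _ \o _ = rV_coord j \o snd); last first.
    by apply/funext => p; rewrite /= /rV_coord /rV_cons mxE liftK.
  by apply: measurableT_comp => //; exact: measurable_rV_coord.
rewrite (_ : _ \o _ = fst)//.
by apply/funext => p; rewrite /= /rV_coord /rV_cons mxE unlift_none.
Qed.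

Lemma measurable_rV_uncons : measurable_fun setT rV_uncons.
Proof.
apply: measurable_fun_pair; first exact: (measurable_rV_coord ord0).
apply: measurable_fun_rVP => j.
rewrite (_ : _ \o _ = rV_coord (lift ord0 j)); first exact: measurable_rV_coord.
by apply/funext => v; rewrite /= /rV_coord mxE.
Qed.

HB.instance Definition _ :=
  isMeasurableFun.Build _ _ _ _ rV_cons measurable_rV_cons.

Variable mu : {sigma_finite_measure set 'rV[R]_n -> \bar R}.

Definition lebesgue_rV_step : set 'rV[R]_n.+1 -> \bar R :=
  pushforward (@lebesgue_measure R \x mu) rV_cons.

Let step0 : lebesgue_rV_step set0 = 0.
Proof. exact: measure0. Qed.

Let step_ge0 A : 0 <= lebesgue_rV_step A.
Proof. exact: measure_ge0. Qed.

Let step_sigma_additive : semi_sigma_additive lebesgue_rV_step.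
Proof. exact: measure_semi_sigma_additive. Qed.

HB.instance Definition _ := isMeasure.Build _ _ _ lebesgue_rV_step
  step0 step_ge0 step_sigma_additive.

Let step_sigma_finite : sigma_finite setT lebesgue_rV_step.
Proof.
have /sigma_finiteP[F [TF ndF Foo]] :=
  sigma_finiteT (@lebesgue_measure R : {sigma_finite_measure set _ -> \bar R}).
have /sigma_finiteP[G [TG ndG Goo]] := sigma_finiteT mu.
exists (fun k => rV_uncons @^-1` (F k `*` G k)).
  apply/esym/seteqP; split=> // v _.
  have [i _ Fi] : (\bigcup_i F i) (rV_uncons v).1 by rewrite -TF.
  have [j _ Gj] : (\bigcup_i G i) (rV_uncons v).2 by rewrite -TG.
  exists (maxn i j) => //; split.
  - by move: Fi; apply/subsetPset/ndF/leq_maxl.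
  - by move: Gj; apply/subsetPset/ndG/leq_maxr.
move=> k; have [mF Fk] := Foo k; have [mG Gk] := Goo k; split.
  rewrite -[X in measurable X]setTI; apply: measurable_rV_uncons => //.
  exact: measurableX.
rewrite /lebesgue_rV_step /pushforward -comp_preimage.
rewrite (_ : rV_uncons \o rV_cons = id) ?preimage_id; last first.
  exact/funext/rV_consK.
by rewrite product_measure1E// lte_mul_pinfty// ge0_fin_numE.
Qed.

HB.instance Definition _ := Measure_isSigmaFinite.Build _ _ _ lebesgue_rV_step
  step_sigma_finite.

End step.
Arguments rV_cons {n}.
Arguments rV_uncons {n}.
Arguments rV_consK {n}.

(* Lebesgue measure on R^n: R^(n+1) is identified with R * R^n. *)
Fixpoint lebesgue_rV (n : nat) : {sigma_finite_measure set 'rV[R]_n -> \bar R} :=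
  match n with
  | 0 => \d_(0 : 'rV[R]_0)%R
  | m.+1 => lebesgue_rV_step (lebesgue_rV m)
  end.

End lebesgue_measure_rV.
Arguments rV_cons {R n}.
Arguments rV_uncons {R n}.
Arguments rV_consK {R n}.

Section euclidean.
Context {R : realType} {n : nat}.

Definition dotR (u v : 'rV[R]_n) : R := \sum_(i < n) u 0 i * v 0 i.

(* The library norm of a row vector is the sup norm. *)
Definition enorm (v : 'rV[R]_n) : R := Num.sqrt (dotR v v).

Definition direction (v : 'rV[R]_n) : 'rV[R]_n := (enorm v)^-1 *: v.

Definition sphere : set 'rV[R]_n := [set v | enorm v = 1].

Definition punctured_ball : set 'rV[R]_n := [set v | 0 < enorm v <= 1].

Lemma measurable_enorm : measurable_fun setT (enorm : 'rV[R]_n -> R).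
Proof.
have mdot : measurable_fun setT (fun v : 'rV[R]_n => dotR v v).
  apply: measurable_sum => i.
  by apply: measurable_funM; exact: (measurable_rV_coord i).
rewrite (_ : enorm = (@powR R ^~ 2^-1) \o (fun v => dotR v v)).
  by apply: measurableT_comp => //; exact: measurable_powR.
apply/funext => v; rewrite /= powR12_sqrt// /dotR.
by apply: sumr_ge0 => i _; rewrite -expr2 sqr_ge0.
Qed.

Lemma measurable_direction : measurable_fun setT direction.
Proof.
apply: measurable_fun_rVP => i.
have mV : measurable_fun setT (fun v : 'rV[R]_n => enorm v `^ (- 1)).
  exact: (measurableT_comp (measurable_powR (-1)) measurable_enorm).
have := measurable_funM mV (measurable_rV_coord i).
congr measurable_fun; apply/funext => v /=.
by rewrite /rV_coord mxE powR_inv1// sqrtr_ge0.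
Qed.

HB.instance Definition _ :=
  isMeasurableFun.Build _ _ _ _ direction measurable_direction.

Lemma measurable_punctured_ball : measurable punctured_ball.
Proof.
rewrite (_ : punctured_ball = enorm @^-1` `]0, 1]%classic).
  by rewrite -[X in measurable X]setTI; apply: measurable_enorm.
by apply/seteqP; split=> v /=; rewrite in_itv.
Qed.

Lemma punctured_ball_le1 v i : punctured_ball v -> `|v 0 i| <= 1.
Proof.
move=> /andP[_ v1]; apply: le_trans v1.
rewrite -sqrtr_sqr; apply: ler_wsqrtr.
rewrite /dotR (bigD1 i)//= -expr2 lerDl.
by apply: sumr_ge0 => j _; rewrite -expr2 sqr_ge0.
Qed.

End euclidean.

Section sphere_measure.
Context {R : realType} {n : nat}.
Local Open Scope ereal_scope.

Lemma lebesgue_rV_box m : exists B : set 'rV[R]_m,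
  [/\ measurable B, lebesgue_rV m B < +oo &
      forall v : 'rV[R]_m, (forall i, `|v 0 i| <= 1)%R -> B v].
Proof.
elim: m => [|m [B [mB Boo HB]]].
  by exists setT; split=> //=; rewrite diracT ltry.
exists (rV_uncons @^-1` ([set` `[(-1)%R, 1%R]] `*` B)); split.
- rewrite -[X in measurable X]setTI; apply: measurable_rV_uncons => //.
  exact: measurableX.
- rewrite /= /lebesgue_rV_step /pushforward -comp_preimage.
  rewrite (_ : rV_uncons \o rV_cons = id) ?preimage_id; last first.
    exact/funext/rV_consK.
  rewrite product_measure1E// lte_mul_pinfty//.
    by rewrite /= lebesgue_measure_itv/=; case: ifP.
- move=> v Hv; split=> /=.
    by have := Hv ord0; rewrite in_itv/= ler_norml.
  by apply: HB => i; rewrite mxE.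
Qed.

(* Polar coordinates dx = r^(n-1) dr dVol(theta): the part of the unit ball
   lying over A has Lebesgue measure Vol(A) / n. *)
Definition sphere_vol : set 'rV[R]_n -> \bar R :=
  fun A => n%:R%:E * lebesgue_rV n (punctured_ball `&` direction @^-1` A).

Let vol0 : sphere_vol set0 = 0.
Proof. by rewrite /sphere_vol preimage_set0 setI0 measure0 mule0. Qed.

Let vol_ge0 A : 0 <= sphere_vol A.
Proof. by rewrite /sphere_vol mule_ge0. Qed.

Let vol_sigma_additive : semi_sigma_additive sphere_vol.
Proof.
pose mu := mscale (@NngNum R n%:R (ler0n R n))
  (mrestr (lebesgue_rV n) measurable_punctured_ball).
suff -> : sphere_vol = pushforward mu direction.
  exact: measure_semi_sigma_additive.
by apply/funext => A; rewrite /sphere_vol setIC.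
Qed.

HB.instance Definition _ := isMeasure.Build _ _ _ sphere_vol
  vol0 vol_ge0 vol_sigma_additive.

Let vol_finite : fin_num_fun sphere_vol.
Proof.
move=> A mA; rewrite /sphere_vol fin_numM// ge0_fin_numE//.
have [B [mB Boo HB]] := lebesgue_rV_box n.
apply: le_lt_trans Boo; apply: le_measure; rewrite ?inE//.
  apply: measurableI; first exact: measurable_punctured_ball.
  by rewrite -[X in measurable X]setTI; exact: measurable_direction.
by move=> v [Bv _]; apply: HB => i; exact: punctured_ball_le1.
Qed.

HB.instance Definition _ := Measure_isFinite.Build _ _ _ sphere_vol vol_finite.

End sphere_measure.

Local Open Scope complex_scope.

Section complex_valued.
Context {R : realType}.

Definition expi (x : R) : R[i] := cos x +i* sin x.

Definition cintegral d (T : measurableType d) (mu : {measure set T -> \bar R})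
    (D : set T) (f : T -> R[i]) : R[i] :=
  (\int[mu]_(x in D) complex.Re (f x)) +i* (\int[mu]_(x in D) complex.Im (f x)).

Definition abs_summable (I : choiceType) (D : set I) (a : I -> R[i]) : Prop :=
  summable D (fun k => (complex.Re (a k))%:E) /\
  summable D (fun k => (complex.Im (a k))%:E).

(* Sum of an absolutely summable family, as the difference of the sums of the
   positive and negative parts; a dummy value otherwise. *)
Definition rsum (I : choiceType) (D : set I) (a : I -> R) : R :=
  fine (\esum_(k in D) ((EFin \o a)^\+ k)%E) -
  fine (\esum_(k in D) ((EFin \o a)^\- k)%E).

Definition csum (I : choiceType) (D : set I) (a : I -> R[i]) : R[i] :=
  rsum D (fun k => complex.Re (a k)) +i* rsum D (fun k => complex.Im (a k)).

Definition iter_derive (V : normedModType R) (w : seq V) (f : V -> R) : V -> R :=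
  foldr (fun v g => 'D_v g) f w.

(* C^oo on an open set U: the iterated directional derivatives of all orders
   exist and are continuous on U. *)
Definition smooth_on (V : normedModType R) (U : set V) (f : V -> R) : Prop :=
  forall (w : seq V) (x : V), U x ->
    {for x, continuous (iter_derive w f)} /\
    forall v, derivable (iter_derive w f) x v.

Definition csmooth_on (V : normedModType R) (U : set V) (f : V -> R[i]) : Prop :=
  smooth_on U (fun x => complex.Re (f x)) /\
  smooth_on U (fun x => complex.Im (f x)).

Definition bigO_pinfty (f : R -> R[i]) (g : R -> R) : Prop :=
  exists2 K : R, 0 < K & \forall t \near +oo, `|f t| <= (K * `|g t|)%:C.

End complex_valued.

(* A function on the torus is a 2 pi Z^d-periodic function on R^d.  A function
   on S T^d is a function f of x and theta, periodic in x, of which only the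
   values at theta on the unit sphere matter. *)
Section torus.
Context {R : realType} {d : nat}.
Local Notation E := 'rV[R]_d.
Local Notation Zd := 'rV[int]_d.
Implicit Types (k : Zd) (x theta : E) (s : bool).
Implicit Types (u : E -> R[i]) (f phi psi : E -> E -> R[i]).

Definition zvec k : E := map_mx intr k.

Definition Zd_nonzero : set Zd := [set k | k != 0].

Definition periodic u : Prop := forall k x, u (x + (2 * pi) *: zvec k) = u x.

Definition smooth_torus u : Prop := periodic u /\ csmooth_on setT u.

(* Pull-back by the submersion (x, v) |-> (x, v / |v|) of R^d x (R^d \ 0) onto
   R^d x S^(d-1); f is smooth iff its pull-back is. *)
Definition pull_back f : E * E -> R[i] := fun p => f p.1 (direction p.2).

Definition smooth_storus f : Prop :=
  (forall theta, sphere theta -> periodic (f ^~ theta)) /\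
  csmooth_on [set p : E * E | p.2 != 0] (pull_back f).

Definition torus_cube : set E := [set x | forall i, 0 <= x 0 i < 2 * pi].

Definition torus_int u : R[i] := cintegral (lebesgue_rV d) torus_cube u.

Definition sphere_int u : R[i] := cintegral sphere_vol sphere u.

Definition storus_int f : R[i] :=
  cintegral (lebesgue_rV d \x sphere_vol)%E (torus_cube `*` sphere)
    (fun p => f p.1 p.2).

Definition torus_inner (u v : E -> R[i]) : R[i] :=
  torus_int (fun x => u x * (v x)^*).

Definition sphere_inner (u v : E -> R[i]) : R[i] :=
  sphere_int (fun theta => u theta * (v theta)^*).

Definition storus_inner (f g : E -> E -> R[i]) : R[i] :=
  storus_int (fun x theta => f x theta * (g x theta)^*).

(* e^(tV) acting on functions. *)
Definition geodesic_pull (t : R) f : E -> E -> R[i] :=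
  fun x theta => f (x + t *: theta) theta.

Definition correlation phi psi (t : R) : R[i] :=
  storus_inner (geodesic_pull t phi) psi.

Definition torus_mean u : R[i] := ((2 * pi) ^- d)%:C * torus_int u.

Definition P0 f : E -> R[i] := fun theta => torus_mean (f ^~ theta).

Definition fourier u k : R[i] :=
  torus_mean (fun x => u x * expi (- dotR (zvec k) x)).

(* m(sqrt(- Delta)); the value m 0 is irrelevant when u has zero mean. *)
Definition fourier_mult (m : R -> R[i]) u : E -> R[i] := fun x =>
  csum setT (fun k => m (enorm (zvec k)) * fourier u k * expi (dotR (zvec k) x)).

(* true stands for the upper sign. *)
Definition pm s : R := if s then 1 else - 1.

Definition signed_direction s k : E := pm s *: direction (zvec k).

Definition Pi0 s f : E -> R[i] := fun x =>
  csum Zd_nonzero (fun k =>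
    fourier (f ^~ (signed_direction s k)) k * expi (dotR (zvec k) x)).

Definition Pop_term s f (x : E) k : R[i] :=
  torus_mean (fun y =>
    f y (signed_direction s k) * expi (dotR (y - x) (zvec k))).

Definition Pop s f : E -> R[i] := fun x => csum Zd_nonzero (Pop_term s f x).

(* A distribution on S T^d is given by its (bilinear) pairing with test
   functions. *)
Local Notation distr := ((E -> E -> R[i]) -> R[i]).

(* Linearity, and continuity with respect to some C^N norm. *)
Definition is_distribution (T : distr) : Prop :=
  (forall (c : R[i]) phi psi, smooth_storus phi -> smooth_storus psi ->
     T (fun x theta => c * phi x theta + psi x theta) = c * T phi + T psi) /\
  (exists (N : nat) (K : R), forall phi, smooth_storus phi -> forall M : R,
     (forall (w : seq (E * E)) x theta,
        (size w <= N)%N -> {in w, forall v, `|v| <= 1} -> sphere theta ->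
        `|iter_derive w (fun p => complex.Re (pull_back phi p)) (x, theta)| <= M /\
        `|iter_derive w (fun p => complex.Im (pull_back phi p)) (x, theta)| <= M) ->
     `|T phi| <= (K * M)%:C).

Definition function_distr f : distr :=
  fun phi => storus_int (fun x theta => f x theta * phi x theta).

(* a(x) (x) delta_0(theta - omega) *)
Definition tensor_dirac (a : E -> R[i]) (omega : E) : distr :=
  fun phi => torus_int (fun x => a x * phi x omega).

Definition Pop_dag_term s u k : distr :=
  tensor_dirac (fun x =>
    torus_mean (fun y => u y * expi (dotR (y - x) (zvec k))))
    (signed_direction s k).

Definition Pop_dag s u : distr :=
  fun phi => csum Zd_nonzero (fun k => Pop_dag_term s u k phi).

Definition bigO_distr (T : R -> distr) (g : R -> R) : Prop :=
  (forall t, 0 < t -> is_distribution (T t)) /\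
  forall phi, smooth_storus phi -> bigO_pinfty (fun t => T t phi) g.

End torus.

(* Main.v *)
(* Off the sphere, f(x, theta) is extended by f(x, v / |v|) times a cut-off of class C^M, so that
   on the sphere it is a Fourier series in (x, v) with fast decaying coefficients c(k, l).  The
   correlation of two such series is a sum over k, l, l' of coefficients times J(t k + l + l'),
   where J(xi) is the integral of e^(i xi . theta) over the sphere.  The terms with k = 0 give the
   leading term; for k <> 0, J(xi) = (2 pi / |xi|)^((d-1)/2) 2 cos(|xi| - pi (d-1) / 4)
   + O(|xi|^(-(d+1)/2)) and |t k + q| = t |k| + q . k / |k| + O(|q|^2 / t) produce the
   oscillating terms, the error being summable in k, l, l'.

   The asymptotics of J is obtained by induction on d by steps of 2, from recurrences satisfied by
   J and by the integral of theta_1 sin(r theta_1), which hold because the even moments of theta_1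
   are explicit.  It starts from S^0 and from S^1, where
   J = 8 int_0^1 cos(r (1 - x^2)) (2 - x^2)^(-1/2) dx is a Fresnel integral with an amplitude. *)
Require Import Defs.
From HB Require Import structures.
From mathcomp Require Import all_boot all_order all_algebra.
From mathcomp Require Import finmap complex.
From mathcomp Require Import all_classical all_reals all_analysis.
From mathcomp Require Import measurable_realfun.
From mathcomp Require Import zify ring lra.
Set Implicit Arguments.
Unset Strict Implicit.
Unset Printing Implicit Defensive.
Import Order.TTheory GRing.Theory Num.Theory.
Import numFieldNormedType.Exports.
Local Open Scope classical_set_scope.
Local Open Scope ring_scope.
Local Open Scope complex_scope.
Import ComplexField.Normc.

(** All estimates must be uniform in the frequencies, and each of them asks for finitely many
    derivatives only; a power of a positive part is therefore a sufficient cut-off, at the price of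
    a representation that changes with the required order. J depends on |xi| alone because its
    Taylor coefficients are even moments, which come from Gaussian integrals over R^d. Values of J
    in different dimensions are thus compared coefficient by coefficient, through uniqueness of
    sums, with no change of variables on the sphere. Fourier series on a box come from discrete
    inversion, which is exact on a grid: summation by parts gives decay uniformly in the mesh, and
    the coefficients are limits of the discrete ones along an ultrafilter. Pairings are kept
    bilinear in f and g and the conjugate is restored at the end. The main estimate is stated for
    arbitrary sums of the two families of modes, so that it yields both the formula with inner
    products and the one with operators, where the same modes are summed in two different ways. *)

Section modulus.
Context {R : realType}.
Implicit Types z w : R[i].

Lemma normc_ge0 z : 0 <= normc z.
Proof. by case: z => a b; exact: sqrtr_ge0. Qed.

Lemma normc_real (x : R) : normc x%:C = `|x|.
Proof. by rewrite /= expr0n/= addr0 sqrtr_sqr. Qed.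

Lemma normc_sum (I : Type) (r : seq I) (P : pred I) (F : I -> R[i]) :
  normc (\sum_(i <- r | P i) F i) <= \sum_(i <- r | P i) normc (F i).
Proof.
elim/big_ind2: _ => //; first by rewrite normc0.
by move=> x1 x2 y1 y2 h1 h2; apply: le_trans (le_normcD _ _) _; exact: lerD.
Qed.

Lemma normc_conj z : normc z^* = normc z.
Proof. by case: z => a b /=; rewrite sqrrN. Qed.

Lemma normc_Re z : `|complex.Re z| <= normc z.
Proof.
by case: z => a b /=; rewrite -sqrtr_sqr ler_wsqrtr// lerDl sqr_ge0.
Qed.

Lemma normc_Im z : `|complex.Im z| <= normc z.
Proof.
by case: z => a b /=; rewrite -sqrtr_sqr ler_wsqrtr// lerDr sqr_ge0.
Qed.

Lemma normc_le_ReIm z : normc z <= `|complex.Re z| + `|complex.Im z|.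
Proof.
case: z => a b /=; rewrite -(ger0_norm (addr_ge0 (normr_ge0 a) (normr_ge0 b))).
rewrite -[X in _ <= X]sqrtr_sqr; apply: ler_wsqrtr.
rewrite sqrrD !real_normK ?num_real// addrAC lerDl.
by rewrite mulrn_wge0// mulr_ge0.
Qed.

Lemma normc_norm z : `|z| = (normc z)%:C.
Proof. by rewrite normc_def; case: z. Qed.

Lemma normc_expi (x : R) : normc (expi x) = 1.
Proof. by rewrite /= cos2Dsin2 sqrtr1. Qed.

Lemma normc_distC z w : normc (z - w) = normc (w - z).
Proof. by rewrite -normcN opprB. Qed.

Lemma Re_sum (I : Type) (r : seq I) (P : pred I) (F : I -> R[i]) :
  complex.Re (\sum_(i <- r | P i) F i) = \sum_(i <- r | P i) complex.Re (F i).
Proof. by apply: (big_morph (@complex.Re R)) => // -[? ?] []. Qed.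

Lemma Im_sum (I : Type) (r : seq I) (P : pred I) (F : I -> R[i]) :
  complex.Im (\sum_(i <- r | P i) F i) = \sum_(i <- r | P i) complex.Im (F i).
Proof. by apply: (big_morph (@complex.Im R)) => // -[? ?] []. Qed.

Lemma expiD (x y : R) : expi (x + y) = expi x * expi y.
Proof. by rewrite /expi cosD sinD; congr (_ +i* _); rewrite addrC. Qed.

Lemma expi0 : expi (0 : R) = 1.
Proof. by rewrite /expi cos0 sin0. Qed.

Lemma conj_expi (x : R) : (expi x)^* = expi (- x).
Proof. by rewrite /expi cosN sinN. Qed.

Lemma eq_normc_le0 z : (forall e, 0 < e -> normc z <= e) -> z = 0.
Proof.
move=> h; apply: eq0_normc; apply/eqP; rewrite eq_le normc_ge0 andbT.
by apply/ler_addgt0Pl => e /h; rewrite addr0.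
Qed.

End modulus.

(** * Unordered sums *)

Section unordered_sums.
Context {R : realType}.
Local Notation C := R[i].

(** Absolute summability is carried with its bound, since the bounds become the constants of the
    final error terms. *)
Definition asum (I : choiceType) (a : I -> C) (B : R) : Prop :=
  forall F : {fset I}, \sum_(i <- F) normc (a i) <= B.

(** Convergence along the net of finite sets, as a relation: two expressions are shown equal by
    exhibiting both as sums of one family. *)
Definition hsum (I : choiceType) (a : I -> C) (s : C) : Prop :=
  forall e : R, 0 < e -> exists F0 : {fset I}, forall F : {fset I},
    (F0 `<=` F)%fset -> normc (\sum_(i <- F) a i - s) <= e.

Section one_index.
Variable I : choiceType.
Implicit Types (a b : I -> C) (F G : {fset I}).

Lemma big_fset_split (V : nmodType) (f : I -> V) F G : (F `<=` G)%fset ->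
  \sum_(i <- G) f i = \sum_(i <- F) f i + \sum_(i <- (G `\` F)%fset) f i.
Proof.
move=> FG; rewrite (big_fsetID _ (mem F)) /=.
have -> : [fset x | x in G & x \in F]%fset = F.
  apply/fsetP => x; rewrite !inE /=.
  by apply/andP/idP => [[]//|xF]; split => //; exact: (fsubsetP FG).
suff -> : [fset x | x in G & x \notin F]%fset = (G `\` F)%fset by [].
by apply/fsetP => x; rewrite !inE /= andbC.
Qed.

Lemma le_big_fset (f : I -> R) F G : (forall i, 0 <= f i) -> (F `<=` G)%fset ->
  \sum_(i <- F) f i <= \sum_(i <- G) f i.
Proof.
by move=> f0 FG; rewrite (big_fset_split _ FG) lerDl; apply: sumr_ge0.
Qed.

Lemma asum_ge0 a B : asum a B -> 0 <= B.
Proof. by move=> /(_ fset0); rewrite big_seq_fset0. Qed.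

Lemma asum_term a B i : asum a B -> normc (a i) <= B.
Proof. by move=> /(_ [fset i]%fset); rewrite big_seq_fset1. Qed.

(** [F0] nearly attains the supremum of the partial sums, so a disjoint set cannot add more than
    [e]. *)
Lemma asum_tail a B : asum a B -> forall e, 0 < e -> exists F0, forall F,
  [disjoint F & F0]%fset -> \sum_(i <- F) normc (a i) <= e.
Proof.
move=> aB e e0.
pose S := [set x : R | exists F, x = \sum_(i <- F) normc (a i)].
have hS : has_sup S.
  split; first by exists (\sum_(i <- (fset0 : {fset I})) normc (a i)); exists fset0.
  by exists B => _ [F ->].
have [_ [F0 ->] h] := sup_adherent e0 hS.
exists F0 => F dF.
have : \sum_(i <- (F0 `|` F)%fset) normc (a i) <= sup S.
  by apply: sup_upper_bound => //; exists (F0 `|` F)%fset.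
rewrite (big_fset_split _ (fsubsetUl F0 F)).
have -> : ((F0 `|` F) `\` F0 = F)%fset.
  apply/fsetP => x; rewrite !inE; case: (boolP (x \in F)) => xF.
    by rewrite orbT andbT; exact: (fdisjointP dF).
  by rewrite orbF andNb.
by lra.
Qed.

Lemma eq_hsum a b s : a =1 b -> hsum a s -> hsum b s.
Proof. by move=> /funext ->. Qed.

Lemma eq_asum a b B : a =1 b -> asum a B -> asum b B.
Proof. by move=> /funext ->. Qed.

Lemma hsum_uniq a s t : hsum a s -> hsum a t -> s = t.
Proof.
move=> hs ht; apply/eqP; rewrite -subr_eq0; apply/eqP/eq_normc_le0 => e e0.
have e2 : 0 < e / 2 by rewrite divr_gt0.
have [F hF] := hs _ e2; have [G hG] := ht _ e2.
have := hF _ (fsubsetUl F G); have := hG _ (fsubsetUr F G).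
set S := \sum_(_ <- _) _ => h1 h2.
have -> : s - t = (S - t) - (S - s) by ring.
by apply: le_trans (le_normcD _ _) _; rewrite normcN; lra.
Qed.

Lemma hsum0 : hsum (fun _ : I => 0) 0.
Proof.
move=> e e0; exists fset0 => F _; rewrite big1// subrr normc0; exact: ltW.
Qed.

Lemma hsumD a b s t : hsum a s -> hsum b t -> hsum (fun i => a i + b i) (s + t).
Proof.
move=> hs ht e e0; have e2 : 0 < e / 2 by rewrite divr_gt0.
have [F hF] := hs _ e2; have [G hG] := ht _ e2.
exists (F `|` G)%fset => H; rewrite fsubUset => /andP[/hF h1 /hG h2].
rewrite big_split /= (_ : _ - _ = (\sum_(i <- H) a i - s) + (\sum_(i <- H) b i - t)).
  by apply: le_trans (le_normcD _ _) _; lra.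
by ring.
Qed.

Lemma hsumZ c a s : hsum a s -> hsum (fun i => c * a i) (c * s).
Proof.
move=> hs e e0; have c1 : 0 < normc c + 1 by have := normc_ge0 c; lra.
have [F hF] := hs (e / (normc c + 1)) (divr_gt0 e0 c1).
exists F => G /hF h; rewrite -mulr_sumr -mulrBr normcM.
apply: (@le_trans _ _ ((normc c + 1) * (e / (normc c + 1)))); last first.
  by rewrite mulrCA divff ?mulr1// gt_eqF.
by apply: ler_pM; rewrite ?normc_ge0// lerDl.
Qed.

Lemma hsumN a s : hsum a s -> hsum (fun i => - a i) (- s).
Proof.
by move=> /(hsumZ (-1)); rewrite mulN1r; apply: eq_hsum => i; rewrite mulN1r.
Qed.

Lemma hsumB a b s t : hsum a s -> hsum b t -> hsum (fun i => a i - b i) (s - t).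
Proof. by move=> h1 h2; apply: hsumD h1 _; exact: hsumN. Qed.

Lemma hsum_conj a s : hsum a s -> hsum (fun i => (a i)^*) s^*.
Proof.
move=> hs e /hs[F hF]; exists F => G /hF.
by rewrite -rmorph_sum -rmorphB /= normc_conj.
Qed.

Lemma hsum_fin (J : Type) (r : seq J) (a : J -> I -> C) (s : J -> C) :
  (forall j, hsum (a j) (s j)) ->
  hsum (fun i => \sum_(j <- r) a j i) (\sum_(j <- r) s j).
Proof.
move=> h; elim: r => [|j r ih].
  by rewrite big_nil; apply: eq_hsum hsum0 => i; rewrite big_nil.
rewrite big_cons; apply: eq_hsum (hsumD (h j) ih) => i.
by rewrite big_cons.
Qed.

Lemma hsum_norm a s B : hsum a s -> asum a B -> normc s <= B.
Proof.
move=> hs aB; apply/ler_addgt0Pl => e /hs[F /(_ F (fsubset_refl _)) h].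
rewrite (_ : s = \sum_(i <- F) a i - (\sum_(i <- F) a i - s)); last by ring.
apply: le_trans (le_normcD _ _) _; rewrite normcN.
by rewrite addrC lerD// (le_trans (normc_sum _ _ _)).
Qed.

Lemma asum_le a b B c : 0 <= c -> (forall i, normc (b i) <= c * normc (a i)) ->
  asum a B -> asum b (c * B).
Proof.
move=> c0 ba aB F; apply: (@le_trans _ _ (\sum_(i <- F) c * normc (a i))).
  by apply: ler_sum => i _.
by rewrite -mulr_sumr ler_wpM2l.
Qed.

Lemma asum_le1 a b B : (forall i, normc (b i) <= normc (a i)) ->
  asum a B -> asum b B.
Proof.
by move=> h aB; rewrite -(mul1r B); apply: asum_le aB => // i; rewrite mul1r.
Qed.

Lemma asumD a b A B : asum a A -> asum b B -> asum (fun i => a i + b i) (A + B).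
Proof.
move=> aA bB F; apply: le_trans (lerD (aA F) (bB F)); rewrite -big_split /=.
by apply: ler_sum => i _; exact: le_normcD.
Qed.

End one_index.

Section csum_facts.
Variable I : choiceType.
Implicit Types (a b : I -> C) (F G : {fset I}).

Lemma esum_fset_le (f : I -> R) (B : R) :
  (forall F, \sum_(i <- F) f i <= B) -> (forall i, 0 <= f i) ->
  (\esum_(i in setT) (f i)%:E <= B%:E)%E.
Proof.
move=> h f0; apply: ub_ereal_sup => _ [X [finX _] <-].
have -> : X = [set` fset_set X] by rewrite fset_setK.
by rewrite fsbig_finite//= set_fsetK sumEFin lee_fin.
Qed.

Lemma le_esum_fset (f : I -> R) F : (forall i, 0 <= f i) ->
  ((\sum_(i <- F) f i)%:E <= \esum_(i in setT) (f i)%:E)%E.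
Proof.
move=> f0; apply: ereal_sup_ubound; exists [set` F] => //.
by rewrite fsbig_finite//= set_fsetK sumEFin.
Qed.

Let pos_sum (f : I -> R) (B : R) : (forall F, \sum_(i <- F) f i <= B) ->
  (forall i, 0 <= f i) -> forall e, 0 < e -> exists F0, forall F, (F0 `<=` F)%fset ->
  `|\sum_(i <- F) f i - fine (\esum_(i in setT) (f i)%:E)| <= e.
Proof.
move=> fB f0 e e0.
have fin : \esum_(i in setT) (f i)%:E \is a fin_num.
  rewrite ge0_fin_numE; first by apply: le_lt_trans (esum_fset_le fB f0) (ltry _).
  by apply: esum_ge0 => i _; rewrite lee_fin.
have [_ [X [finX _] <-] h] := @ub_ereal_sup_adherent _ _ _ e0 fin.
exists (fset_set X) => F XF.
move: h; rewrite -/(esum _ _) fsbig_finite//= sumEFin -{1}(fineK fin) -EFinB lte_fin.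
have := le_esum_fset F f0; rewrite -{1}(fineK fin) lee_fin.
have := le_big_fset f0 XF.
set A := \sum_(_ <- F) _; set A' := \sum_(_ <- _) _; set S := fine _ => h1 h2 h3.
by rewrite ler_norml; lra.
Qed.

Lemma rsum_hsum (f : I -> R) (B : R) : (forall F, \sum_(i <- F) `|f i| <= B) ->
  forall e, 0 < e -> exists F0, forall F, (F0 `<=` F)%fset ->
  `|\sum_(i <- F) f i - rsum setT f| <= e.
Proof.
move=> fB e e0; have e2 : 0 < e / 2 by rewrite divr_gt0.
pose fp i := Num.max (f i) 0; pose fn i := Num.max (- f i) 0.
have hp : ((EFin \o f)^\+ = fun i => (fp i)%:E)%E.
  by apply/funext => i; rewrite funeposE /fp /= EFin_max.
have hn : ((EFin \o f)^\- = fun i => (fn i)%:E)%E.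
  by apply/funext => i; rewrite funenegE /fn /= EFin_max.
have fp0 i : 0 <= fp i by rewrite /fp le_max lexx orbT.
have fn0 i : 0 <= fn i by rewrite /fn le_max lexx orbT.
have [F1 h1] : exists F0, forall F, (F0 `<=` F)%fset ->
    `|\sum_(i <- F) fp i - fine (\esum_(i in setT) (fp i)%:E)| <= e / 2.
  apply: (@pos_sum fp B) => // F; apply: le_trans (fB F).
  by apply: ler_sum => i _; rewrite /fp ge_max normr_ge0 ler_norm.
have [F2 h2] : exists F0, forall F, (F0 `<=` F)%fset ->
    `|\sum_(i <- F) fn i - fine (\esum_(i in setT) (fn i)%:E)| <= e / 2.
  apply: (@pos_sum fn B) => // F; apply: le_trans (fB F).
  by apply: ler_sum => i _; rewrite /fn ge_max normr_ge0 -normrN ler_norm.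
exists (F1 `|` F2)%fset => F; rewrite fsubUset => /andP[/h1 {}h1 /h2 {}h2].
rewrite /rsum hp hn.
have -> : \sum_(i <- F) f i = \sum_(i <- F) fp i - \sum_(i <- F) fn i.
  rewrite -sumrB; apply: eq_bigr => i _; rewrite /fp /fn.
  by case: (lerP 0 (f i)) => h; rewrite ?maxEle; do !case: ifPn; lra.
by move: h1 h2; rewrite !ler_norml; lra.
Qed.

(** The passage from the [csum] of the statement to [hsum]: under the bound, the extended sums of
    the positive and negative parts are finite, so [csum] does not take a dummy value. *)
Lemma asum_hsum a B : asum a B -> hsum a (csum setT a).
Proof.
move=> aB e e0; have e2 : 0 < e / 2 by rewrite divr_gt0.
have [F1 h1] : exists F0, forall F, (F0 `<=` F)%fset ->
    `|\sum_(i <- F) complex.Re (a i) - rsum setT (fun k => complex.Re (a k))| <= e / 2.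
  apply: (@rsum_hsum _ B) => // F; apply: le_trans (aB F).
  by apply: ler_sum => i _; exact: normc_Re.
have [F2 h2] : exists F0, forall F, (F0 `<=` F)%fset ->
    `|\sum_(i <- F) complex.Im (a i) - rsum setT (fun k => complex.Im (a k))| <= e / 2.
  apply: (@rsum_hsum _ B) => // F; apply: le_trans (aB F).
  by apply: ler_sum => i _; exact: normc_Im.
exists (F1 `|` F2)%fset => F; rewrite fsubUset => /andP[/h1 {}h1 /h2 {}h2].
apply: le_trans (normc_le_ReIm _) _.
rewrite -Re_sum in h1; rewrite -Im_sum in h2.
move: h1 h2; rewrite /csum; case: (\sum_(i <- F) a i) => x y /=.
lra.
Qed.

Lemma csum_mkcond (D : set I) a :
  csum D a = csum setT (fun k => if k \in D then a k else 0).
Proof.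
rewrite /csum /rsum.
congr ((fine _ - fine _) +i* (fine _ - fine _)); rewrite esum_mkcond;
  apply: eq_esum => i _; rewrite ?funeposE ?funenegE /=;
  by case: (i \in D); rewrite ?oppe0 ?oppr0 ?maxxx.
Qed.

Lemma asum_abs_summable (D : set I) a B :
  asum (fun k => if k \in D then a k else 0) B -> abs_summable D a.
Proof.
move=> aB; split; rewrite /summable esum_mkcond.
- apply: (@le_lt_trans _ _ B%:E); last exact: ltry.
  rewrite (eq_esum (b := fun i => `|complex.Re (if i \in D then a i else 0)|%:E)).
    apply: esum_fset_le => // F; apply: le_trans (aB F).
    by apply: ler_sum => i _; exact: normc_Re.
  by move=> i _; case: ifPn; rewrite /= ?normr0.
- apply: (@le_lt_trans _ _ B%:E); last exact: ltry.
  rewrite (eq_esum (b := fun i => `|complex.Im (if i \in D then a i else 0)|%:E)).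
    apply: esum_fset_le => // F; apply: le_trans (aB F).
    by apply: ler_sum => i _; exact: normc_Im.
  by move=> i _; case: ifPn; rewrite /= ?normr0.
Qed.

End csum_facts.

Section two_indices.
Variables I J : choiceType.

(** Extension by zero along an injection. The partial inverse [g] is given as data so that the
    preimage of a finite set is [pmap g]. *)
Lemma hsum_inj (f : J -> I) (g : I -> option J) (b : J -> C) (c : I -> C) t :
  pcancel f g -> ocancel g f ->
  (forall j, c (f j) = b j) -> (forall i, g i = None -> c i = 0) ->
  hsum b t -> hsum c t.
Proof.
move=> fg gf cb c0 ht e /ht[F0 hF0].
exists [fset f j | j in F0]%fset => F FF.
pose G := [fset j in pmap g F]%fset.
have mG j : (j \in G) = (f j \in F).
  rewrite !inE mem_pmap; apply/mapP/idP => [[i iF gi]|fF].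
    by have := gf i; rewrite -gi /= => ->.
  by exists (f j) => //; rewrite fg.
suff -> : \sum_(i <- F) c i = \sum_(j <- G) b j.
  apply: hF0; apply/fsubsetP => j jF0; rewrite mG; apply: (fsubsetP FF).
  by apply/imfsetP; exists j.
rewrite -(@big_fset_incl _ _ _ _ [fset f j | j in G]%fset).
- rewrite big_imfset /=; last by move=> x y _ _; exact: pcan_inj fg _ _.
  by apply: eq_bigr => j _; rewrite cb.
- by apply/fsubsetP => _ /imfsetP[j jG ->]; rewrite -mG.
- move=> i iF /negP nG; apply: c0; case E : (g i) => [j|//]; case: nG.
  have := gf i; rewrite E /= => <-; apply/imfsetP; exists j => //.
  by rewrite /= mG; have := gf i; rewrite E /= => ->.
Qed.

Lemma asum_inj (f : J -> I) (b : J -> C) (c : I -> C) B :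
  injective f -> (forall j, normc (b j) <= normc (c (f j))) ->
  asum c B -> asum b B.
Proof.
move=> fi bc cB F; apply: le_trans (cB [fset f j | j in F]%fset).
rewrite big_imfset /=; last by move=> x y _ _; exact: fi.
by apply: ler_sum => j _.
Qed.

Variable kappa : J -> I.

(** Rotating each fibre sum by the phase [z i] turns a sum of moduli over [F] into a single sum over
    [J], dominated termwise by [b']. The family [b] may depend on [i] because Fourier coefficients
    will be evaluated at a direction that moves with the frequency. *)
Lemma fiber_sum_asum (b : I -> J -> C) (b' : J -> C) s B :
  (forall i j, normc (b i j) <= normc (b' j)) ->
  (forall i, hsum (fun j => if kappa j == i then b i j else 0) (s i)) ->
  asum b' B -> asum s B.
Proof.
move=> bb' hs b'B F.
pose z i := if s i == 0 then 0 else (normc (s i))%:C / s i.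
have zs i : (normc (s i))%:C = z i * s i.
  rewrite /z; case: eqP => [->|/eqP s0]; first by rewrite normc0 mul0r.
  by rewrite divfK.
have z1 i : normc (z i) <= 1.
  rewrite /z; case: eqP => [_|/eqP s0]; first by rewrite normc0 ler01.
  rewrite normcM normcV normc_real ger0_norm ?normc_ge0// divff//.
  by apply: contra s0 => /eqP /eq0_normc ->.
have H := hsum_fin F (fun i => hsumZ (z i) (hs i)).
have -> : \sum_(i <- F) normc (s i) = normc (\sum_(i <- F) z i * s i).
  rewrite -(eq_bigr _ (fun i _ => zs i)) -rmorph_sum normc_real ger0_norm//.
  by apply: sumr_ge0 => i _; exact: normc_ge0.
apply: (hsum_norm H); apply: asum_le1 b'B => j.
case: (boolP (kappa j \in F)) => kF.
  rewrite (big_fsetD1 _ kF) /= eqxx big1_fset ?addr0; last first.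
    move=> i; rewrite !inE eq_sym => /andP[/negPf -> _] _; by rewrite mulr0.
  rewrite normcM; apply: le_trans (bb' (kappa j) j).
  by rewrite ler_piMl ?normc_ge0.
rewrite big_seq big1 ?normc0 ?normc_ge0// => i iF.
by case: eqP => [ji|]; rewrite ?mulr0//; move: kF; rewrite ji iF.
Qed.

(** Fubini for families: the error of a partial sum of fibre sums over [F] is the sum of the [b j]
    with [kappa j] outside [F], and such [j] avoid the set [F0] that carries almost all the mass. *)
Lemma fiber_hsum (b : J -> C) s S B :
  asum b B -> hsum b S ->
  (forall i, hsum (fun j => if kappa j == i then b j else 0) (s i)) ->
  hsum s S.
Proof.
move=> bB hS hs e e0; have [F0 hF0] := asum_tail bB e0.
exists [fset kappa j | j in F0]%fset => F FF.
have H := hsumB (hsum_fin F hs) hS.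
apply: (hsum_norm H) => G.
have -> : \sum_(j <- G) normc (\sum_(i <- F) (if kappa j == i then b j else 0) - b j) =
    \sum_(j <- [fset j in G | kappa j \notin F]%fset) normc (b j).
  rewrite (big_fsetID _ (fun j => kappa j \in F)) /=.
  rewrite big1_fset ?add0r; last first.
    move=> j; rewrite !inE /= => /andP[_ kF] _.
    rewrite (big_fsetD1 _ kF) /= eqxx big1_fset ?addr0 ?subrr ?normc0//.
    by move=> i; rewrite !inE eq_sym => /andP[/negPf -> _].
  apply: eq_big_seq => j; rewrite !inE /= => /andP[_ kF].
  rewrite big_seq big1 ?sub0r ?normcN// => i iF.
  by case: eqP => // ji; move: kF; rewrite ji iF.
apply: hF0; apply/fdisjointP => j; rewrite !inE /= => /andP[_ kF].
apply: contra kF => jF0; apply: (fsubsetP FF).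
by apply/imfsetP; exists j.
Qed.

End two_indices.

Lemma asum_prod (I J : choiceType) (a : I -> C) (b : J -> C) A B :
  asum a A -> asum b B -> asum (fun p : I * J => a p.1 * b p.2) (A * B).
Proof.
move=> aA bB F.
pose F1 := [fset p.1 | p in F]%fset; pose F2 := [fset p.2 | p in F]%fset.
have FF : (F `<=` F1 `*` F2)%fset.
  apply/fsubsetP => p pF; rewrite in_fsetM; apply/andP.
  by split; apply/imfsetP; exists p.
apply: (@le_trans _ _ (\sum_(p <- (F1 `*` F2)%fset) normc (a p.1 * b p.2))).
  by apply: le_big_fset => // i; exact: normc_ge0.
under eq_bigr do rewrite normcM.
rewrite /fsetM big_imfset2 /=; last by move=> [? ?] [? ?] _ _ /= [-> ->].
under eq_bigr do rewrite -mulr_sumr.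
rewrite -mulr_suml; apply: ler_pM => //; by apply: sumr_ge0 => i _; exact: normc_ge0.
Qed.

Lemma hsum_prod (I J : choiceType) (a : I -> C) (b : J -> C) A B s t :
  asum a A -> asum b B -> hsum a s -> hsum b t ->
  hsum (fun p : I * J => a p.1 * b p.2) (s * t).
Proof.
move=> aA bB hs ht; have abAB := asum_prod aA bB.
suff h : hsum (fun i => a i * t) (csum setT (fun p : I * J => a p.1 * b p.2)).
  have h2 : hsum (fun i => a i * t) (s * t).
    by rewrite mulrC; apply: eq_hsum (hsumZ t hs) => i; rewrite mulrC.
  rewrite (hsum_uniq h2 h); exact: asum_hsum abAB.
apply: (fiber_hsum (kappa := fst) abAB (asum_hsum abAB)) => i.
apply: (@hsum_inj _ _ (fun j => (i, j)) (fun p => if p.1 == i then Some p.2 else None)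
  (fun j => a i * b j)).
- by move=> j /=; rewrite eqxx.
- by move=> [i' j] /=; case: eqP => //= ->.
- by move=> j /=; rewrite eqxx.
- by move=> [i' j] /=; case: eqP.
- exact: hsumZ.
Qed.

End unordered_sums.

(** * Lebesgue measure on R^n and moments of the sphere *)

Section product_integral.
Context d1 d2 (T1 : measurableType d1) (T2 : measurableType d2) (R : realType).
Variables (m1 : {sigma_finite_measure set T1 -> \bar R})
  (m2 : {sigma_finite_measure set T2 -> \bar R}).

Let prodT (f : T1 -> R) (g : T2 -> R) :
  m1.-integrable setT (EFin \o f) -> m2.-integrable setT (EFin \o g) ->
  (m1 \x m2)%E.-integrable setT (fun z => (f z.1 * g z.2)%:E) /\
  \int[(m1 \x m2)%E]_z (f z.1 * g z.2) = \int[m1]_x f x * \int[m2]_x g x.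
Proof.
move=> fi gi.
have mf : measurable_fun setT f by apply/measurable_EFinP; exact: measurable_int fi.
have mg : measurable_fun setT g by apply/measurable_EFinP; exact: measurable_int gi.
have mfg : measurable_fun setT (fun z : T1 * T2 => f z.1 * g z.2).
  by apply: measurable_funM; [exact: (measurableT_comp mf)|exact: (measurableT_comp mg)].
have fgi : (m1 \x m2)%E.-integrable setT (fun z => (f z.1 * g z.2)%:E).
  apply/integrableP; split; first exact/measurable_EFinP.
  rewrite fubini_tonelli1//=; last first.
    by apply/measurable_EFinP; exact: (measurableT_comp _ mfg).
  under eq_integral => x _.
    rewrite /fubini_F /=.
    under eq_integral do rewrite normrM EFinM.
    rewrite ge0_integralZl//; last first.
      by apply/measurable_EFinP; exact: measurableT_comp.
    over.
  have Gfin : (\int[m2]_y `|g y|%:E < +oo)%E by have /integrableP[_] := gi.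
  have Ffin : (\int[m1]_y `|f y|%:E < +oo)%E by have /integrableP[_] := fi.
  rewrite /= ge0_integralZr//; last 2 first.
    by apply/measurable_EFinP; exact: measurableT_comp.
    by apply: integral_ge0 => y _; rewrite lee_fin.
  by rewrite lte_mul_pinfty ?ge0_fin_numE//; apply: integral_ge0.
split => //; rewrite /Rintegral -fubini1//.
rewrite (_ : integral m1 setT _ =
    \int[m1]_x ((f x)%:E * \int[m2]_y (g y)%:E))%E.
  rewrite -(fineK (integrable_fin_num _ gi))//.
  by rewrite integralZr// fineM//; exact: integrable_fin_num.
apply: eq_integral => x _; rewrite /fubini_F /=.
under eq_integral do rewrite EFinM.
by rewrite integralZl.
Qed.

Variables (D1 : set T1) (D2 : set T2) (f : T1 -> R) (g : T2 -> R).
Hypotheses (mD1 : measurable D1) (mD2 : measurable D2).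
Hypotheses (fi : m1.-integrable D1 (EFin \o f)) (gi : m2.-integrable D2 (EFin \o g)).

Let restr : (fun z : T1 * T2 => (f z.1 * g z.2)) \_ (D1 `*` D2) =
  (fun z => (f \_ D1) z.1 * (g \_ D2) z.2).
Proof.
apply/funext => -[x y]; rewrite /patch /=.
have -> : ((x, y) \in D1 `*` D2) = (x \in D1) && (y \in D2).
  apply/idP/andP; rewrite !inE => //=.
by case: (x \in D1); case: (y \in D2); rewrite /= ?mulr0 ?mul0r.
Qed.

Let fi' : m1.-integrable setT (EFin \o (f \_ D1)).
Proof.
have := fi; rewrite integrable_mkcond//; apply: eq_integrable => // x _ /=.
by rewrite /patch; case: ifP.
Qed.

Let gi' : m2.-integrable setT (EFin \o (g \_ D2)).
Proof.
have := gi; rewrite integrable_mkcond//; apply: eq_integrable => // x _ /=.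
by rewrite /patch; case: ifP.
Qed.

Lemma integrable_prod_mul :
  (m1 \x m2)%E.-integrable (D1 `*` D2) (fun z => (f z.1 * g z.2)%:E).
Proof.
rewrite integrable_mkcond; last exact: measurableX.
have [+ _] := prodT fi' gi'; apply: eq_integrable => // z _.
have := congr1 (fun h => (h z)%:E) restr; rewrite /= => <-.
by rewrite /patch; case: ifP.
Qed.

Lemma Rintegral_prod_mul :
  \int[(m1 \x m2)%E]_(z in D1 `*` D2) (f z.1 * g z.2) =
  \int[m1]_(x in D1) f x * \int[m2]_(x in D2) g x.
Proof.
rewrite [LHS]Rintegral_mkcond restr (prodT fi' gi').2.
by rewrite -!Rintegral_mkcond.
Qed.

End product_integral.

(** * Scaling and iterated integration on R^n *)

Section scaling1.
Context {R : realType}.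
Local Notation mu := (@lebesgue_measure R).

Definition scaleR (c : R) (x : measurableTypeR R) : measurableTypeR R := c * x.

Lemma measurable_scaleR (c : R) : measurable_fun setT (scaleR c).
Proof. exact: mulrl_measurable. Qed.

Let push c : {measure set _ -> \bar R} :=
  measure_function_pushforward__canonical__measure_function_Measure mu
    (measurable_scaleR c).

(** By uniqueness it suffices to look at half-open intervals; for c < 0 the preimage is half-open on
    the other side, with the same length. *)
Lemma lebesgue_measure_scale (c : R) (A : set R) : c != 0 -> measurable A ->
  (mu ((fun x => c * x)%R @^-1` A) = `|c|^-1%:E * mu A)%E.
Proof.
move=> c0 mA.
have cp : 0 < `|c| by rewrite normr_gt0.
pose nu := mscale (NngNum (ltW cp)) (push c).
suff h : (mu A = `|c|%:E * mu ((fun x => c * x)%R @^-1` A))%E.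
  by rewrite h muleA -EFinM mulVf ?gt_eqF// mul1e.
rewrite (@lebesgue_measure_unique R nu)// => X [[a b] /= _ <-].
rewrite /nu /mscale /push /pushforward /= lebesgue_measure_itv /= lte_fin /scaleR /pushforward.
case: (ltrgtP c 0) c0 => // h _.
- rewrite (_ : _ @^-1` _ = `[b / c, a / c[%classic); last first.
    apply/seteqP; split => x /=; rewrite !in_itv /=;
      by rewrite ler_ndivrMr// ltr_ndivlMr// !(mulrC x) andbC.
  rewrite lebesgue_measure_itv /= !lte_fin ltr_ndivlMr// divfK ?lt_eqF//.
  case: ifPn => // ab; last by rewrite mule0.
  rewrite -!EFinB -EFinM ltr0_norm//; congr EFin; field; exact: ltr0_neq0.
- rewrite (_ : _ @^-1` _ = `]a / c, b / c]%classic); last first.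
    apply/seteqP; split => x /=; rewrite !in_itv /=;
      by rewrite ler_pdivlMr// ltr_pdivrMr// !(mulrC x).
  rewrite lebesgue_measure_itv /= !lte_fin ltr_pdivrMr// divfK ?gt_eqF//.
  case: ifPn => // ab; last by rewrite mule0.
  rewrite -!EFinB -EFinM gtr0_norm//; congr EFin; field; exact: lt0r_neq0.
Qed.

Lemma ge0_integral_scale (c : R) (f : R -> \bar R) : c != 0 ->
  measurable_fun setT f -> (forall x, 0 <= f x)%E ->
  (\int[mu]_x f (c * x)%R = `|c|^-1%:E * \int[mu]_x f x)%E.
Proof.
move=> c0 mf f0.
have cp : 0 <= `|c|^-1 by rewrite invr_ge0.
transitivity (\int[mscale (NngNum cp) mu]_x f x)%E; last first.
  by rewrite ge0_integral_mscale.
transitivity (\int[push c]_x f x)%E.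
  by rewrite ge0_integral_pushforward//; exact: measurable_scaleR.
apply: eq_measure_integral => A mA _.
by rewrite /mscale /= /pushforward lebesgue_measure_scale.
Qed.

End scaling1.

Section rV_integrals.
Context {R : realType}.
Local Notation mu := (@lebesgue_measure R).
Local Notation lam := (@lebesgue_rV R).

Lemma measurable_fun_rV_cons n d (T : measurableType d) (f : 'rV[R]_n.+1 -> T) :
  measurable_fun setT f -> measurable_fun setT (f \o rV_cons).
Proof. by move=> mf; apply: measurableT_comp => //; exact: measurable_rV_cons. Qed.

Lemma ge0_integral_rVS n (f : 'rV[R]_n.+1 -> \bar R) :
  measurable_fun setT f -> (forall x, 0 <= f x)%E ->
  (\int[lam n.+1]_x f x = \int[mu]_x \int[lam n]_v f (rV_cons (x, v)))%E.
Proof.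
move=> mf f0; rewrite /= (ge0_integral_pushforward (@measurable_rV_cons R n))//.
rewrite preimage_setT fubini_tonelli1//.
  exact: measurable_fun_rV_cons.
by move=> p; exact: f0.
Qed.

Lemma rV_mul n (D : set 'rV[R]_n.+1) (D1 : set (measurableTypeR R)) (D2 : set 'rV[R]_n)
  (F : 'rV[R]_n.+1 -> R) (g : measurableTypeR R -> R) (h : 'rV[R]_n -> R) :
  measurable D -> measurable D1 -> measurable D2 -> rV_cons @^-1` D = D1 `*` D2 ->
  measurable_fun setT F -> (forall x v, F (rV_cons (x, v)) = g x * h v) ->
  mu.-integrable D1 (EFin \o g) -> (lam n).-integrable D2 (EFin \o h) ->
  (lam n.+1).-integrable D (EFin \o F) /\
  \int[lam n.+1]_(x in D) F x = \int[mu]_(x in D1) g x * \int[lam n]_(x in D2) h x.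
Proof.
move=> mD mD1 mD2 DD mF Fgh gi hi.
have FE : (EFin \o F) \o rV_cons = (fun z => (g z.1 * h z.2)%:E).
  by apply/funext => -[x v] /=; rewrite Fgh.
have mF' : measurable_fun setT (EFin \o F) by exact/measurable_EFinP.
have H := integrable_prod_mul mD1 mD2 gi hi.
split.
  apply: (integrable_pushforward (@measurable_rV_cons R n)) => //.
  by rewrite DD FE.
rewrite -(Rintegral_prod_mul mD1 mD2 gi hi) /Rintegral /=.
rewrite (integral_pushforward (@measurable_rV_cons R n))//.
  by rewrite DD [_ \o _]FE.
by rewrite DD [_ \o _]FE.
Qed.

Lemma measurable_scale_rV n (c : R) :
  measurable_fun setT (fun v : 'rV[R]_n => c *: v).
Proof.
apply: measurable_fun_rVP => i.
rewrite (_ : _ \o _ = (fun v => c * rV_coord i v)); last first.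
  by apply/funext => v; rewrite /= /rV_coord mxE.
by apply: measurable_funM => //; exact: measurable_rV_coord.
Qed.

Lemma rV_cons_scale n (c x : R) (v : 'rV[R]_n) :
  rV_cons (c * x, c *: v) = c *: rV_cons (x, v).
Proof.
apply/rowP => i; rewrite !mxE /=.
by case: unliftP => [j|] _ //; rewrite mxE.
Qed.

Lemma ge0_integral_rV_scale n (c : R) (f : 'rV[R]_n -> \bar R) : c != 0 ->
  measurable_fun setT f -> (forall x, 0 <= f x)%E ->
  (\int[lam n]_x f (c *: x)%R = (`|c| ^- n)%:E * \int[lam n]_x f x)%E.
Proof.
move=> c0; elim: n f => [|n IH] f mf f0.
  rewrite expr0 invr1 mul1e; apply: eq_integral => x _; congr f.
  by apply/rowP => -[].
rewrite ge0_integral_rVS//; last first.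
  by apply: measurableT_comp => //; exact: measurable_scale_rV.
rewrite ge0_integral_rVS//.
pose H (y : measurableTypeR R) := (\int[lam n]_v f (rV_cons (y, v)))%E.
have mfc := measurable_fun_rV_cons mf.
have mH : measurable_fun setT H.
  by apply: (measurable_fun_fubini_tonelli_F _ mfc) => z; exact: f0.
have H0 y : (0 <= H y)%E by apply: integral_ge0.
transitivity (\int[mu]_y ((`|c| ^- n)%:E * H (c * y)%R))%E.
  apply: eq_integral => y _; rewrite -IH//; last first.
    exact: (measurableT_comp mfc (measurable_pair1 _)).
  by apply: eq_integral => v _; rewrite rV_cons_scale.
rewrite ge0_integralZl//; last exact: (measurableT_comp mH (measurable_scaleR c)).
rewrite ge0_integral_scale// muleA -EFinM; congr ((_ %:E) * _)%E.
by rewrite exprS invfM mulrC.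
Qed.

Lemma measurable_dotR n (w : 'rV[R]_n) : measurable_fun setT (dotR w).
Proof.
apply: measurable_sum => i; apply: measurable_funM => //.
exact: (measurable_rV_coord i).
Qed.

Lemma measurable_dotRR n : measurable_fun setT (fun v : 'rV[R]_n => dotR v v).
Proof.
apply: measurable_sum => i.
by apply: measurable_funM; exact: (measurable_rV_coord i).
Qed.

End rV_integrals.

(** * Gaussian moments *)

Section layer_cake.
Context d (T : measurableType d) (R : realType).
Variable m : {sigma_finite_measure set T -> \bar R}.
Local Notation mu := (@lebesgue_measure R).

(** Tonelli on the region [r x <= rho]. With [r] a norm it does the work of polar coordinates: a
    radial density is written as a tail integral, and the inner integrals over balls scale by
    homogeneity. *)
Lemma layer_cake (r : T -> R) (F : T -> R) (q : measurableTypeR R -> R) :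
  measurable_fun setT r -> measurable_fun setT F -> measurable_fun setT q ->
  (forall x, 0 <= r x) -> (forall x, 0 <= F x) -> (forall x, 0 <= x -> 0 <= q x) ->
  (\int[m]_x ((F x)%:E * \int[mu]_(rho in `[r x, +oo[) (q rho)%:E) =
   \int[mu]_(rho in `[0%R, +oo[) ((q rho)%:E * \int[m]_(x in [set x | r x <= rho]%R) (F x)%:E))%E.
Proof.
move=> mr mF mq r0 F0 q0.
pose H (z : T * measurableTypeR R) : \bar R := (F z.1 * q z.2 * (if (r z.1 <= z.2)%R then 1 else 0))%:E.
have mle : measurable_fun setT (fun z : T * measurableTypeR R => ((if (r z.1 <= z.2)%R then 1 else 0) : R)).
  apply: measurable_fun_ifT => //.
  apply: measurable_fun_ler => //.
  exact: (measurableT_comp mr).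
have mH : measurable_fun setT H.
  apply/measurable_EFinP; apply: measurable_funM => //; apply: measurable_funM.
    exact: (measurableT_comp mF).
  exact: (measurableT_comp mq).
have H0 z : (0 <= H z)%E.
  rewrite lee_fin; case: (lerP (r z.1) z.2) => h; last by rewrite mulr0.
  by rewrite mulr1 mulr_ge0// q0// (le_trans _ h).
transitivity (\int[m]_x \int[mu]_rho H (x, rho))%E.
  apply: eq_integral => x _; rewrite -ge0_integralZl//=; last 3 first.
  - by apply/measurable_EFinP; exact: measurable_funTS.
  - move=> y; rewrite in_itv/= andbT lee_fin => ry.
    by rewrite q0// (le_trans _ ry).
  - by rewrite lee_fin.
  rewrite integral_mkcond; apply: eq_integral => y _; rewrite /patch /H /=.
  rewrite mem_setE in_itv/= andbT.
  by case: (r x <= y); rewrite ?mulr1 ?mulr0.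
rewrite fubini_tonelli//.
rewrite [in RHS]integral_mkcond; apply: eq_integral => y _; rewrite /patch.
rewrite mem_setE in_itv/= andbT; case: (lerP 0 y) => y0; last first.
  rewrite integral0_eq// => x _; rewrite /H /=.
  by rewrite leNgt (lt_le_trans y0)//= mulr0.
have ms : measurable [set x | r x <= y].
  rewrite (_ : [set _ | _] = r @^-1` `]-oo, y]%classic).
    by rewrite -[X in measurable X]setTI; exact: mr.
  by apply/seteqP; split => x /=; rewrite in_itv.
rewrite -ge0_integralZl//=; last 3 first.
- by apply/measurable_EFinP; exact: measurable_funTS.
- by move=> x _; rewrite lee_fin.
- by rewrite lee_fin q0.
rewrite [in RHS]integral_mkcond; apply: eq_integral => x _; rewrite /patch /H /=.
have -> : (x \in [set x | r x <= y]) = (r x <= y) by rewrite mem_setE.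
by case: (r x <= y); rewrite ?mulr1 ?mulr0// mulrC.
Qed.

End layer_cake.

Section gaussian_moments.
Context {R : realType}.
Local Notation mu := (@lebesgue_measure R).

(* The k-th moment of e^(-x^2) on [0, +oo[. *)
Fixpoint half_moment (k : nat) : R :=
  match k with
  | 0 => Num.sqrt pi / 2
  | 1 => 1 / 2
  | k'.+2 => k'.+1%:R / 2 * half_moment k'
  end.

Lemma half_momentS k : half_moment k.+2 = k.+1%:R / 2 * half_moment k.
Proof. by []. Qed.

Lemma half_moment_gt0 k : 0 < half_moment k.
Proof.
elim/ltn_ind: k => -[|[|k]] IH.
- by rewrite divr_gt0// sqrtr_gt0 pi_gt0.
- by rewrite divr_gt0.
- by rewrite half_momentS mulr_gt0 ?divr_gt0 ?ltr0n// IH.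
Qed.

Let is_derive_gauss (x : R) : is_derive x 1 (fun y => - gauss_fun y) (2 * x * gauss_fun x).
Proof.
have h : is_derive x 1 (fun y : R => - y ^+ 2) (- (2 * x)).
  by apply: is_derive_eq; rewrite /GRing.scale /= mulr1; ring.
have := @is_derive1_comp _ expR (fun y : R => - y ^+ 2) x _ _ _ h.
move=> /(_ _ (is_derive_expR _)) h2.
have h3 : is_derive x 1 (fun y => - gauss_fun y) (- (expR (- x ^+ 2) * - (2 * x))).
  exact: is_deriveN.
by apply: is_derive_eq; rewrite /gauss_fun; ring.
Qed.

Lemma gauss_tail (r : R) : 0 <= r ->
  (\int[mu]_(x in `[r, +oo[) (2 * x * gauss_fun x)%:E = (gauss_fun r)%:E)%E.
Proof.
move=> r0; rewrite (@ge0_continuous_FTC2y _ _ (fun y => - gauss_fun y) r 0).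
- by rewrite sub0e EFinN oppeK.
- move=> x rx; rewrite mulr_ge0 ?gauss_fun_ge0// mulr_ge0//; exact: le_trans rx.
- apply: continuous_subspaceT => x; apply: cvgM; last exact: continuous_gauss_fun.
  by apply: cvgM => //; exact: cvg_cst.
- rewrite -oppr0; apply: cvgN; exact: cvg_gauss_fun.
- by move=> x _; apply: ex_derive.
- apply: cvg_at_right_filter; apply: cvgN; exact: continuous_gauss_fun.
- by move=> x _; rewrite derive1E; apply: derive_val.
Qed.

Lemma int_pow (k : nat) (a : R) : 0 <= a ->
  (\int[mu]_(x in `[0%R, a]) (k.+1%:R * x ^+ k)%:E = (a ^+ k.+1)%:E)%E.
Proof.
rewrite le_eqVlt => /predU1P[<-|a0].
  by rewrite set_itv1 integral_set1 expr0n.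
rewrite (@continuous_FTC2 _ _ (fun x => x ^+ k.+1))//.
- by rewrite expr0n /= sube0.
- apply: continuous_subspaceT => x; apply: cvgM; [exact: cvg_cst|exact: exprn_continuous].
- split.
  + by move=> x _; exact: exprn_derivable.
  + apply: cvg_at_right_filter; exact: exprn_continuous.
  + apply: cvg_at_left_filter; exact: exprn_continuous.
- move=> x _; rewrite derive1E; have := @exp_derive _ k.+1 x 1.
  by rewrite /= scaler1 => ->.
Qed.

Lemma measurable_powgauss k : measurable_fun (setT : set (measurableTypeR R))
   (fun x : measurableTypeR R => x ^+ k * gauss_fun x).
Proof. by apply: measurable_funM; [exact: exprn_measurable|exact: measurable_gauss_fun]. Qed.

Lemma half_momentE k :
  (\int[mu]_(x in `[0%R, +oo[) (x ^+ k * gauss_fun x)%:E = (half_moment k)%:E)%E.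
Proof.
elim/ltn_ind: k => -[|[|k]] IH.
- under eq_integral do rewrite expr0 mul1r.
  by rewrite integral0y_gauss.
- have := gauss_tail (lexx 0); rewrite /gauss_fun expr0n oppr0 expR0 => h.
  rewrite -[RHS](_ : (2^-1%:E * 1%:E)%E = _); last by rewrite -EFinM mulr1 /= div1r.
  rewrite -h -ge0_integralZl//=; last 2 first.
    + apply/measurable_EFinP; apply: measurable_funTS.
      apply: measurable_funM; last exact: measurable_gauss_fun.
      exact: mulrl_measurable.
    + move=> x; rewrite in_itv/= andbT => x0.
      by rewrite lee_fin !mulr_ge0// expR_ge0.
  apply: eq_integral => x _; rewrite -EFinM; congr EFin.
  by rewrite expr1; field.
(* Layer cake in dimension 1. As e^(-x^2) is the tail of [q], one order of integration gives k + 1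
   times the k-th moment; in the other order the inner integral of [F] over |x| <= rho is rho^(k+1),
   which gives twice the moment of order k + 2. *)
- pose F (x : measurableTypeR R) : R := if 0 <= x then k.+1%:R * x ^+ k else 0.
  pose q (x : measurableTypeR R) : R := 2 * x * gauss_fun x.
  have := @layer_cake _ _ R mu (fun x : measurableTypeR R => `|x|) F q.
  have mF : measurable_fun setT F.
    apply: measurable_fun_ifT => //; first exact: measurable_fun_ler.
    by apply: measurable_funM => //; exact: exprn_measurable.
  have mq : measurable_fun setT q.
    apply: measurable_funM; last exact: measurable_gauss_fun.
    exact: mulrl_measurable.
  have F0 x : 0 <= F x by rewrite /F; case: ifPn => // x0; rewrite mulr_ge0// exprn_ge0.
  have q0 x : 0 <= x -> 0 <= q x by move=> x0; rewrite /q !mulr_ge0 ?gauss_fun_ge0.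
  move=> /(_ (@normr_measurable R setT) mF mq (fun x => normr_ge0 _) F0 q0).
  under eq_integral do rewrite gauss_tail// -EFinM.
  rewrite [X in X = _ -> _](_ : _ = (k.+1%:R%:E * (half_moment k)%:E)%E); last first.
    rewrite -IH// -ge0_integralZl//=; last 2 first.
    + by apply/measurable_EFinP; apply: measurable_funTS; exact: measurable_powgauss.
    + move=> x; rewrite in_itv/= andbT => x0.
      by rewrite lee_fin mulr_ge0 ?gauss_fun_ge0// exprn_ge0.
    rewrite [RHS]integral_mkcond; apply: eq_integral => x _.
    rewrite /patch mem_setE in_itv /= andbT /F.
    case: ifPn => x0; last by rewrite mul0r.
    by rewrite ger0_norm// -EFinM mulrA.
  rewrite [X in _ = X -> _](_ : _ = (2%:E * \int[mu]_(x in `[0%R, +oo[) (x ^+ k.+2 * gauss_fun x)%:E)%E); last first.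
    rewrite -ge0_integralZl//=; last 2 first.
    + by apply/measurable_EFinP; apply: measurable_funTS; exact: measurable_powgauss.
    + move=> x; rewrite in_itv/= andbT => x0.
      by rewrite lee_fin mulr_ge0 ?gauss_fun_ge0// exprn_ge0.
    apply: eq_integral => x; rewrite inE/= in_itv/= andbT => x0.
    rewrite (_ : integral _ _ _ = (x ^+ k.+1)%:E); last first.
      rewrite -int_pow// integral_mkcond [RHS]integral_mkcond.
      apply: eq_integral => y _; rewrite /patch [in RHS]mem_setE in_itv /= /F.
      case: ifPn => [|]; rewrite ?notin_setE ?inE /= => h.
        move: h; case: (lerP 0 y) => y0 //=.
        by rewrite ger0_norm// => ->.
      move: h; case: (lerP 0 y) => y0 //=.
      by rewrite ger0_norm// => /negP/negPf ->.
    rewrite -!EFinM; congr EFin; rewrite /q !exprS; ring.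
  move=> h.
  rewrite half_momentS mulrAC mulrC EFinM (EFinM k.+1%:R).
  by rewrite h muleA -EFinM mulVf// mul1e.
Qed.

End gaussian_moments.

Section odd_integral.
Context d (T : measurableType d) (R : realType) (m : {measure set T -> \bar R}).

(** The positive and negative parts have equal integrals; when these are infinite, [fine] still
    sends their difference to 0. *)
Lemma Rintegral_odd (D : set T) (s : T -> T) (f : T -> R) :
  (forall g : T -> \bar R, measurable_fun setT g -> (forall x, 0 <= g x)%E ->
    \int[m]_(x in D) g (s x) = \int[m]_(x in D) g x)%E ->
  measurable_fun setT f -> (forall x, f (s x) = - f x) -> \int[m]_(x in D) f x = 0.
Proof.
move=> inv mf fs; rewrite /Rintegral integralE.
have -> : (\int[m]_(x in D) (fun x => (f x)%:E)^\- x =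
    \int[m]_(x in D) (fun x => (f x)%:E)^\+ x)%E.
  rewrite -inv//; last first.
    by apply: measurable_funeneg; exact/measurable_EFinP.
  apply: eq_integral => x _.
  by rewrite funeposE funenegE fs -EFinN opprK.
set a := integral _ _ _; have : (0 <= a)%E by exact: integral_ge0.
by case: a => [r _||] //; rewrite /= ?subrr.
Qed.

Lemma Rintegral_sum (I : Type) (r : seq I) (D : set T) (f : I -> T -> R) :
  measurable D -> (forall i, m.-integrable D (EFin \o f i)) ->
  m.-integrable D (EFin \o (fun x => \sum_(i <- r) f i x)) /\
  \int[m]_(x in D) (\sum_(i <- r) f i x) = \sum_(i <- r) \int[m]_(x in D) f i x.
Proof.
move=> mD fi; elim: r => [|i r [IH1 IH2]].
  split.
    by apply: (eq_integrable mD (fun=> 0%E)) (integrable0 _ _) => // x _ /=; rewrite big_nil.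
  by rewrite big_nil; under eq_Rintegral do rewrite big_nil; rewrite /Rintegral integral0.
have E : (fun x => \sum_(j <- i :: r) f j x) = (fun x => f i x + \sum_(j <- r) f j x).
  by apply/funext => x; rewrite big_cons.
rewrite E; split; last by rewrite big_cons RintegralD// IH2.
by apply: (eq_integrable mD) (integrableD mD (fi i) IH1).
Qed.

End odd_integral.

Section gaussian_rV.
Context {R : realType}.
Local Notation mu := (@lebesgue_measure R).
Local Notation lam := (@lebesgue_rV R).

(* Normalized moments of the measure e^(-x^2) dx. *)
Definition gmom (k : nat) : R :=
  if odd k then 0 else 2 * half_moment k / Num.sqrt pi.

Let sqrtpi_neq0 : Num.sqrt pi != 0 :> R.
Proof. by rewrite gt_eqF// sqrtr_gt0 pi_gt0. Qed.

Lemma gmom0 : gmom 0 = 1.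
Proof. by rewrite /gmom /= mulrCA divff// mulr1 divff. Qed.

Lemma gmomSS k : gmom k.+2 = k.+1%:R / 2 * gmom k.
Proof.
by rewrite /gmom /= negbK; case: odd; rewrite ?mulr0//; ring.
Qed.

Lemma gmom_fact j : gmom j.*2 * (4 ^+ j * j`!%:R) = j.*2`!%:R.
Proof.
elim: j => [|j IH]; first by rewrite gmom0 expr0 !mul1r.
rewrite doubleS gmomSS !factS !natrM -IH exprS -doubleS -[j.+1.*2]mul2n natrM.
by field.
Qed.

Let powgauss_int k : (\int[mu]_x (`|x| ^+ k * gauss_fun x)%:E = (2 * half_moment k)%:E)%E.
Proof.
rewrite ge0_symfun_integralT.
- rewrite EFinM -half_momentE; congr (_ * _)%E.
  rewrite (_ : [set x | _] = `[0%R, +oo[%classic); last first.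
    by apply/seteqP; split => x /=; rewrite in_itv/= andbT.
  by apply: eq_integral => x; rewrite inE/= in_itv/= andbT => x0; rewrite ger0_norm.
- by move=> x; rewrite mulr_ge0 ?gauss_fun_ge0// exprn_ge0.
- move=> x; apply: cvgM; last exact: continuous_gauss_fun.
  apply: (@continuous_comp _ _ _ (fun y : R => `|y|) (fun y : R => y ^+ k));
    [exact: norm_continuous|exact: exprn_continuous].
- by move=> x /=; rewrite normrN /gauss_fun sqrrN.
Qed.

Lemma integrable_powgauss k : mu.-integrable setT
  (EFin \o (fun x : measurableTypeR R => x ^+ k * gauss_fun x)).
Proof.
apply/integrableP; split; first by apply/measurable_EFinP; exact: measurable_powgauss.
under eq_integral do rewrite /= normrM normrX (ger0_norm (gauss_fun_ge0 _)).
by rewrite powgauss_int ltry.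
Qed.

Lemma Rintegral_powgauss k :
  \int[mu]_x (x ^+ k * gauss_fun x) = Num.sqrt pi * gmom k.
Proof.
rewrite /gmom; case: ifPn => ok.
  rewrite mulr0; apply: (@Rintegral_odd _ _ _ _ _ (scaleR (-1))).
  - move=> g mg g0; have := @ge0_integral_scale R (-1) g.
    by rewrite oppr_eq0 oner_eq0 normrN normr1 invr1 mul1e; exact.
  - exact: measurable_powgauss.
  - move=> x; rewrite /scaleR mulN1r /gauss_fun sqrrN exprNn -signr_odd ok.
    by rewrite expr1 mulN1r mulNr.
rewrite mulrC divfK// /Rintegral -[RHS]/(fine (2 * half_moment k)%:E) -powgauss_int.
congr fine; apply: eq_integral => x _; congr (_ * _)%:E.
by rewrite -normrX ger0_norm// exprn_even_ge0.
Qed.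

(** This is the m-th moment of a sum of two independent centred Gaussian variables with squared
    scales a^2 and b. Terms with an odd moment vanish, so the halved exponents are exact wherever
    they count; what remains is C(2j, 2i) g(2i) g(2j - 2i) = g(2j) C(j, i) and the binomial formula
    for (a^2 + b)^j. *)
Lemma gmom_binomial m (a b : R) :
  \sum_(k < m.+1) ('C(m, k))%:R * a ^+ k * b ^+ (m - k)./2 * (gmom k * gmom (m - k)) =
  gmom m * (a ^+ 2 + b) ^+ m./2.
Proof.
case: (boolP (odd m)) => om.
  have -> : gmom m = 0 by rewrite /gmom om.
  rewrite mul0r big1// => k _.
  have ko : odd (m - k) = ~~ odd k by rewrite oddB ?om// -ltnS.
  by rewrite (_ : gmom k * _ = 0) ?mulr0// /gmom ko; case: odd; rewrite ?mul0r ?mulr0.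
have [j ->] : exists j, m = j.*2 by exists m./2; rewrite -[LHS]odd_double_half (negPf om).
rewrite doubleK addrC exprDn mulr_sumr.
have E (f : nat -> R) n : (forall i, odd i -> f i = 0) ->
    \sum_(k < n.*2.+1) f k = \sum_(i < n.+1) f i.*2.
  move=> f0; elim: n => [|n IH]; first by rewrite !big_ord_recl !big_ord0.
  rewrite doubleS 2!big_ord_recr /= IH [in RHS]big_ord_recr /= (f0 n.*2.+1) ?addr0//.
  by rewrite /= odd_double.
rewrite (E (fun k => ('C(j.*2, k))%:R * a ^+ k * b ^+ (j.*2 - k)./2 *
  (gmom k * gmom (j.*2 - k)))); last first.
  by move=> i oi; rewrite /gmom oi mul0r mulr0.
apply: eq_bigr => i _.
have ij : (i <= j)%N by rewrite -ltnS.
rewrite -doubleB doubleK -exprM mul2n -[X in _ = _ * X]mulr_natl.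
suff h : ('C(j.*2, i.*2))%:R * (gmom i.*2 * gmom (j - i).*2) = gmom j.*2 * 'C(j, i)%:R :> R.
  rewrite [RHS]mulrA -h; ring.
have f0 n : n`!%:R != 0 :> R by rewrite pnatr_eq0 -lt0n fact_gt0.
have p0 n : 4 ^+ n != 0 :> R by rewrite expf_neq0.
have H1 := gmom_fact i; have H2 := gmom_fact (j - i); have H3 := gmom_fact j.
have ij2 : (i.*2 <= j.*2)%N by rewrite leq_double.
have B1 := bin_fact ij2; have B2 := bin_fact ij.
have B1' : ('C(j.*2, i.*2))%:R * (i.*2`!%:R * (j - i).*2`!%:R) = j.*2`!%:R :> R.
  by rewrite -!natrM -B1 doubleB.
have B2' : ('C(j, i))%:R * (i`!%:R * (j - i)`!%:R) = j`!%:R :> R.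
  by rewrite -!natrM -B2.
apply: (mulIf (x := 4 ^+ j * (i`!%:R * (j - i)`!%:R))); first by rewrite !mulf_neq0.
transitivity (j.*2`!%:R : R).
  have -> : 4 ^+ j = 4 ^+ i * 4 ^+ (j - i) :> R by rewrite -exprD subnKC.
  by rewrite -B1' -H1 -H2; ring.
by rewrite -H3 -B2'; ring.
Qed.

Definition gaussV n (x : 'rV[R]_n) : R := expR (- dotR x x).

Lemma measurable_gaussV n : measurable_fun setT (@gaussV n).
Proof.
apply: measurableT_comp => //; apply: measurableT_comp => //.
exact: measurable_dotRR.
Qed.

Lemma dotR_cons n (w : 'rV[R]_n.+1) (x : R) (v : 'rV[R]_n) :
  dotR w (rV_cons (x, v)) = w 0 0 * x + dotR (rV_uncons w).2 v.
Proof.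
rewrite /dotR big_ord_recl !mxE unlift_none; congr (_ + _).
by apply: eq_bigr => i _; rewrite !mxE liftK.
Qed.

Lemma dotRR_cons n (w : 'rV[R]_n.+1) :
  dotR w w = w 0 0 ^+ 2 + dotR (rV_uncons w).2 (rV_uncons w).2.
Proof.
rewrite /dotR big_ord_recl; congr (_ + _).
by apply: eq_bigr => i _; rewrite !mxE.
Qed.

Lemma gaussV_cons n (x : R) (v : 'rV[R]_n) :
  gaussV (rV_cons (x, v)) = gauss_fun x * gaussV v.
Proof.
rewrite /gaussV /gauss_fun dotRR_cons -expRD opprD; congr (expR (- _ - _)).
  by rewrite mxE unlift_none.
by congr dotR; apply/rowP => i; rewrite !mxE liftK.
Qed.

(** Rotation invariance is gained one coordinate at a time: splitting off the first coordinate and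
    expanding the power gives exactly the sum of [gmom_binomial], with a^2 + b the squared norm of
    [w]. *)
Lemma gaussian_moment n (w : 'rV[R]_n) m :
  (lam n).-integrable setT (fun x => (dotR w x ^+ m * gaussV x)%:E) /\
  \int[lam n]_x (dotR w x ^+ m * gaussV x) =
  Num.sqrt pi ^+ n * gmom m * dotR w w ^+ m./2.
Proof.
elim: n w m => [|n IH] w m.
  have E x : dotR w x = 0 by rewrite /dotR big_ord0.
  have G (x : 'rV[R]_0) : gaussV x = 1 :> R by rewrite /gaussV /dotR big_ord0 oppr0 expR0.
  have mf : measurable_fun setT (fun x : 'rV[R]_0 => (dotR w x ^+ m * gaussV x)%:E).
    apply/measurable_EFinP; apply: measurable_funM; last exact: measurable_gaussV.
    by apply: measurable_funX; exact: measurable_dotR.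
  split.
    apply/integrableP; split => //.
    rewrite integral_dirac//; first by rewrite diracE in_setT mul1e ltry.
    by apply: (@measurableT_comp _ _ _ _ _ _ (abse : \bar R -> \bar R) _ _ _ mf); exact: abse_measurable.
  rewrite /Rintegral integral_dirac//.
  rewrite diracE in_setT mul1e /= !E G mulr1 expr0 mul1r.
  case: m {mf} => [|[|m]]; first by rewrite gmom0 !expr0 mul1r.
    by rewrite expr0n mul0r.
  by rewrite /= !exprS !mul0r mulr0.
set w' := (rV_uncons w).2; set a := w 0 0.
pose F (k : nat) (x : 'rV[R]_n.+1) : R := x 0 0 ^+ k * gauss_fun (x 0 0) *
   (dotR w' (rV_uncons x).2 ^+ (m - k) * gaussV (rV_uncons x).2).
have FE k (x : measurableTypeR R) (v : 'rV[R]_n) : F k (rV_cons (x, v)) =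
    (x ^+ k * gauss_fun x) * (dotR w' v ^+ (m - k) * gaussV v).
  by rewrite /F rV_consK /= !mxE unlift_none.
have mF k : measurable_fun setT (F k).
  have m0 : measurable_fun setT (fun x : 'rV[R]_n.+1 => x 0 0) by exact: (measurable_rV_coord ord0).
  have mt : measurable_fun setT (fun x : 'rV[R]_n.+1 => (rV_uncons x).2).
    by apply: measurableT_comp => //; exact: measurable_rV_uncons.
  apply: measurable_funM; first exact: (measurableT_comp (measurable_powgauss k) m0).
  apply: measurable_funM; last exact: (measurableT_comp (@measurable_gaussV n) mt).
  by apply: measurable_funX; exact: (measurableT_comp (measurable_dotR _) mt).
have H k := @rV_mul R n setT setT setT (F k) _ _ measurableT measurableT measurableT
  (etrans (preimage_setT _) (esym (setXTT _))) (mF k) (FE k) (integrable_powgauss k) (IH w' (m - k)%N).1.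
have E x : dotR w x ^+ m * gaussV x = \sum_(k < m.+1) ('C(m, k))%:R * a ^+ k * F k x.
  have -> : x = rV_cons (rV_uncons x).
    apply/rowP => i; rewrite !mxE /=.
    by case: unliftP => [j|] ->; rewrite ?mxE.
  case: (rV_uncons x) => y v; rewrite dotR_cons gaussV_cons -/a -/w'.
  rewrite addrC exprDn mulr_suml; apply: eq_bigr => k _.
  by rewrite FE exprMn -[_ *+ 'C(m, k)]mulr_natl; ring.
have HI (k : 'I_m.+1) : (lam n.+1).-integrable setT
    (fun x => (('C(m, k))%:R * a ^+ k * F k x)%:E).
  by have := integrableZl measurableT ('C(m, k)%:R * a ^+ k) (H k).1.
have [SI1 SI2] := Rintegral_sum (index_enum 'I_m.+1) measurableT HI.
split; first by apply: eq_integrable SI1 => // x _ /=; rewrite E.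
under eq_Rintegral do rewrite E.
rewrite SI2.
rewrite dotRR_cons -/a -/w' -mulrA -gmom_binomial mulr_sumr; apply: eq_bigr => k _.
rewrite RintegralZl//; last exact: (H k).1.
by rewrite (H k).2 Rintegral_powgauss (IH _ _).2 exprS; ring.
Qed.

End gaussian_rV.

Section dot_algebra.
Context {R : realType} {n : nat}.
Implicit Types u v w : 'rV[R]_n.

Lemma dotRC u v : dotR u v = dotR v u.
Proof. by apply: eq_bigr => i _; rewrite mulrC. Qed.

Lemma dotRDl u v w : dotR (u + v) w = dotR u w + dotR v w.
Proof. by rewrite -big_split; apply: eq_bigr => i _; rewrite mxE mulrDl. Qed.

Lemma dotRDr u v w : dotR u (v + w) = dotR u v + dotR u w.
Proof. by rewrite !(dotRC u) dotRDl. Qed.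

Lemma dotRZl c u v : dotR (c *: u) v = c * dotR u v.
Proof. by rewrite mulr_sumr; apply: eq_bigr => i _; rewrite mxE mulrA. Qed.

Lemma dotRZr c u v : dotR u (c *: v) = c * dotR u v.
Proof. by rewrite dotRC dotRZl dotRC. Qed.

Lemma dotRNl u v : dotR (- u) v = - dotR u v.
Proof. by rewrite -scaleN1r dotRZl mulN1r. Qed.

Lemma dotRNr u v : dotR u (- v) = - dotR u v.
Proof. by rewrite dotRC dotRNl dotRC. Qed.

Lemma dot0R v : dotR 0 v = 0.
Proof. by rewrite -(scale0r v) dotRZl mul0r. Qed.

Lemma dotR0 v : dotR v 0 = 0.
Proof. by rewrite dotRC dot0R. Qed.

Lemma dotRR_ge0 v : 0 <= dotR v v.
Proof. by apply: sumr_ge0 => i _; rewrite -expr2 sqr_ge0. Qed.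

Lemma enorm_ge0 v : 0 <= enorm v.
Proof. exact: sqrtr_ge0. Qed.

Lemma enorm_sqr v : enorm v ^+ 2 = dotR v v.
Proof. by rewrite sqr_sqrtr// dotRR_ge0. Qed.

Lemma enormZ c v : enorm (c *: v) = `|c| * enorm v.
Proof.
by rewrite /enorm dotRZl dotRZr mulrA -expr2 sqrtrM ?sqr_ge0// sqrtr_sqr.
Qed.

Lemma enormN v : enorm (- v) = enorm v.
Proof. by rewrite -scaleN1r enormZ normrN normr1 mul1r. Qed.

Lemma enorm0 : enorm (0 : 'rV[R]_n) = 0.
Proof. by rewrite /enorm dot0R sqrtr0. Qed.

Lemma enorm_eq0 v : (enorm v == 0) = (v == 0).
Proof.
apply/idP/eqP => [|->]; last by rewrite enorm0.
rewrite sqrtr_eq0 => h; apply/rowP => i; rewrite mxE.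
have : dotR v v = 0 by apply/eqP; rewrite eq_le h dotRR_ge0.
move/eqP; rewrite psumr_eq0 => [/allP/(_ i)|j _]; last by rewrite -expr2 sqr_ge0.
by rewrite mem_index_enum -expr2 sqrf_eq0 => /(_ isT)/eqP.
Qed.

Lemma enorm_gt0 v : (0 < enorm v) = (v != 0).
Proof. by rewrite lt_neqAle enorm_ge0 andbT eq_sym enorm_eq0. Qed.

Lemma direction_sphere v : v != 0 -> sphere (direction v).
Proof.
move=> v0; rewrite /sphere /= enormZ ger0_norm ?invr_ge0 ?enorm_ge0//.
by rewrite mulVf// enorm_eq0.
Qed.

Lemma direction_id v : sphere v -> direction v = v.
Proof. by rewrite /sphere /direction /= => ->; rewrite invr1 scale1r. Qed.

Lemma scale_direction v : v != 0 -> v = enorm v *: direction v.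
Proof. by move=> v0; rewrite scalerA divff ?enorm_eq0// scale1r. Qed.

Lemma directionZ c v : 0 < c -> direction (c *: v) = direction v.
Proof.
move=> c0; rewrite /direction enormZ gtr0_norm// scalerA invfM.
by rewrite mulrAC mulVf ?gt_eqF// mul1r.
Qed.

Lemma directionN v : direction (- v) = - direction v.
Proof. by rewrite /direction enormN scalerN. Qed.

Lemma cauchy_schwarz u v : `|dotR u v| <= enorm u * enorm v.
Proof.
have [->|v0] := eqVneq v 0; first by rewrite dotR0 normr0 mulr_ge0 ?enorm_ge0.
have vp : 0 < dotR v v by rewrite -enorm_sqr exprn_gt0// enorm_gt0.
rewrite -(@ler_pXn2r _ 2)//; last by rewrite nnegrE mulr_ge0 ?enorm_ge0.
rewrite real_normK ?num_real// exprMn !enorm_sqr.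
have := dotRR_ge0 (dotR v v *: u - dotR u v *: v).
rewrite dotRDl !dotRDr !dotRNl !dotRNr !dotRZl !dotRZr (dotRC v u) => h.
rewrite -(ler_pM2l vp) -subr_ge0; apply: le_trans h _; rewrite le_eqVlt; apply/orP; left.
by apply/eqP; ring.
Qed.

Lemma enormD u v : enorm (u + v) <= enorm u + enorm v.
Proof.
rewrite -(@ler_pXn2r _ 2) ?nnegrE ?enorm_ge0 ?addr_ge0 ?enorm_ge0//.
rewrite enorm_sqr dotRDl !dotRDr (dotRC v u) sqrrD !enorm_sqr.
have := le_trans (ler_norm _) (cauchy_schwarz u v); lra.
Qed.

End dot_algebra.

Lemma int_pow_tail (R : realType) (k : nat) (r : R) : 0 <= r <= 1 ->
  (\int[@lebesgue_measure R]_(x in `[r, 1%R]) (k.+1%:R * x ^+ k)%:E = (1 - r ^+ k.+1)%:E)%E.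
Proof.
move=> /andP[r0]; rewrite le_eqVlt => /predU1P[->|r1].
  by rewrite set_itv1 integral_set1 expr1n subrr.
rewrite (@continuous_FTC2 _ _ (fun x => x ^+ k.+1))//.
- by rewrite expr1n -EFinB.
- apply: continuous_subspaceT => x; apply: cvgM; [exact: cvg_cst|exact: exprn_continuous].
- split.
  + by move=> x _; exact: exprn_derivable.
  + apply: cvg_at_right_filter; exact: exprn_continuous.
  + apply: cvg_at_left_filter; exact: exprn_continuous.
- move=> x _; rewrite derive1E; have := @exp_derive _ k.+1 x 1.
  by rewrite /= scaler1 => ->.
Qed.

(** * Polar coordinates and even moments of the sphere *)

Section polar.
Context {R : realType}.
Local Notation mu := (@lebesgue_measure R).
Local Notation lam := (@lebesgue_rV R).
Variable e : nat.
Local Notation d := e.+1.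
Local Notation E := 'rV[R]_d.

Let pushm : {measure set E -> \bar R} :=
  measure_function_pushforward__canonical__measure_function_Measure
    (mscale (@NngNum R d%:R (ler0n R d)) (mrestr (lam d) (@measurable_punctured_ball R d)))
    (@measurable_direction R d).

Lemma measurable_sphere : measurable (@sphere R d).
Proof.
rewrite (_ : sphere = enorm @^-1` [set 1]).
  by rewrite -[X in measurable X]setTI; exact: measurable_enorm.
by [].
Qed.

Lemma punctured_ball_neq0 (x : E) : punctured_ball x -> x != 0.
Proof. by rewrite /punctured_ball /= => /andP[+ _]; rewrite enorm_gt0. Qed.

Lemma ge0_integral_sphere (f : E -> \bar R) :
  measurable_fun setT f -> (forall x, 0 <= f x)%E ->
  (\int[sphere_vol]_(x in sphere) f x =
   d%:R%:E * \int[lam d]_(x in punctured_ball) f (direction x))%E.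
Proof.
move=> mf f0.
transitivity (\int[pushm]_(x in sphere) f x)%E.
  apply: eq_measure_integral => A mA _.
  by rewrite /= /sphere_vol /pushforward /mscale /= /mrestr setIC.
rewrite (ge0_integral_pushforward (@measurable_direction R d))//; last 2 first.
  exact: measurable_sphere.
  exact: measurable_funTS.
rewrite ge0_integral_mscale//=; last 2 first.
  by rewrite -[X in measurable X]setTI; apply: measurable_direction => //; exact: measurable_sphere.
  by apply: measurable_funTS; exact: (measurableT_comp mf (@measurable_direction R d)).
congr (_ * _)%E.
have mS : measurable (direction @^-1` (@sphere R d)).
  by rewrite -[X in measurable X]setTI; apply: measurable_direction => //; exact: measurable_sphere.
have mpb := @measurable_punctured_ball R d.
have mfS : measurable_fun (direction @^-1` (@sphere R d)) (f \o direction).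
  by apply: measurable_funTS; exact: (measurableT_comp mf (@measurable_direction R d)).
have N0 : mrestr (lam d) mpb (~` punctured_ball) = 0%E.
  by rewrite /mrestr setICl measure0.
rewrite (ge0_negligible_integral (measurableC mpb) mS mfS (fun x _ => f0 _) N0).
rewrite (_ : _ `\` _ = punctured_ball); last first.
  rewrite setDE setCK; apply/seteqP; split => [x []//|x px]; split => //=.
  by apply: direction_sphere; exact: punctured_ball_neq0.
apply: eq_measure_integral => A mA Apb.
by rewrite -[RHS]/(lam d A) -{2}(setIidl Apb).
Qed.

(** The origin is fixed by dilation by 2, which forces its finite measure to equal 2^(-d) times
    itself. *)
Let lam0 : lam d [set 0] = 0%E.
Proof.
have m0 : measurable [set (0 : E)].
  rewrite (_ : [set 0] = (@enorm R d) @^-1` [set 0]).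
    by rewrite -[X in measurable X]setTI; exact: measurable_enorm.
  by apply/seteqP; split => x /=; [move=> ->; rewrite enorm0|move/eqP; rewrite enorm_eq0 => /eqP].
have [B [mB Boo HB]] := @lebesgue_rV_box R d.
have fin : lam d [set 0] \is a fin_num.
  rewrite ge0_fin_numE//; apply: le_lt_trans Boo; apply: le_measure; rewrite ?inE//.
  by move=> _ ->; apply: HB => i; rewrite mxE normr0 ler01.
have mI : measurable_fun setT (fun x : E => (\1_[set (0 : E)] x : R)%:E).
  by apply/measurable_EFinP; exact: measurable_indic.
have two0 : (2 : R) != 0 by rewrite pnatr_eq0.
have I0 (x : E) : (0 <= (\1_[set (0 : E)] x : R)%:E)%E by rewrite lee_fin.
have := ge0_integral_rV_scale two0 mI I0.
rewrite (eq_integral (fun x => (\1_[set (0 : E)] x)%:E)); last first.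
  move=> x _; rewrite !indicE; congr (_%:R%:E); congr nat_of_bool.
  apply/idP/idP; rewrite !inE /=; last by move=> ->; rewrite scaler0.
  by move/eqP; rewrite scaler_eq0 pnatr_eq0 /= => /eqP.
rewrite integral_indic// setIT; move: fin.
change (lam d [set 0] \is a fin_num -> lam d [set 0] = ((`|2| ^- d)%:E * lam d [set (0 : E)%R])%E ->
  lam d [set 0] = 0%E).
case: (lam d [set 0]) => // a _; rewrite -EFinM => -[] h; congr EFin.
have : `|2| ^- d < 1 :> R.
  by rewrite invf_lt1 ?exprn_gt0// ger0_norm// exprn_egt1// ltr1n.
move=> hh; have : (1 - `|2| ^- d) * a = 0 by rewrite mulrBl mul1r -h subrr.
by move/eqP; rewrite mulf_eq0 subr_eq0 eq_sym lt_eqF//= => /eqP.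
Qed.

Let mball (a : R) : measurable [set x : E | enorm x <= a].
Proof.
rewrite (_ : [set x : E | enorm x <= a] = (@enorm R d) @^-1` `]-oo, a]%classic).
  by rewrite -[X in measurable X]setTI; exact: measurable_enorm.
by apply/seteqP; split => x /=; rewrite in_itv.
Qed.

Let ball_scale (F : E -> R) (k : nat) (a : R) : measurable_fun setT F ->
  (forall x, 0 <= F x) -> (forall c x, 0 < c -> F (c *: x) = c ^+ k * F x) -> 0 < a ->
  (\int[lam d]_(x in [set x | enorm x <= a]%R) (F x)%:E =
   (a ^+ (k + d))%:E * \int[lam d]_(x in [set x | enorm x <= 1]%R) (F x)%:E)%E.
Proof.
move=> mF F0 Fk a0; have ai : 0 < a^-1 by rewrite invr_gt0.
pose f (x : E) := (F x * (if enorm x <= 1 then 1 else 0))%:E.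
have E1 (b : R) (g : E -> R) : (\int[lam d]_(x in [set x | enorm x <= b]%R) (g x)%:E =
    \int[lam d]_x (g x * (if enorm x <= b then 1 else 0))%:E)%E.
  rewrite integral_mkcond; apply: eq_integral => x _; rewrite /patch.
  case: ifPn; rewrite ?notin_setE ?inE /=; first by move=> ->; rewrite mulr1.
  by move/negP/negPf => ->; rewrite mulr0.
rewrite !E1 -/(f _).
have mf : measurable_fun setT f.
  apply/measurable_EFinP; apply: measurable_funM => //; apply: measurable_fun_ifT => //.
  by apply: measurable_fun_ler => //; exact: measurable_enorm.
have f0 x : (0 <= f x)%E by rewrite lee_fin; case: ifP; rewrite ?mulr1 ?mulr0.
have := @ge0_integral_rV_scale R d a^-1 f (lt0r_neq0 ai) mf f0.
rewrite ger0_norm ?ltW// => h.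
have E2 : (\int[lam d]_x (F x * (if enorm x <= 1 then 1 else 0))%:E =
    (a ^+ d)^-1%:E * \int[lam d]_x f (a^-1 *: x)%R)%E.
  rewrite h muleA -EFinM exprVn invrK mulVf ?mul1e//.
  by rewrite expf_neq0// gt_eqF.
rewrite E2 exprD.
have mfc := measurableT_comp mf (@measurable_scale_rV R d a^-1).
have ak0 : (0 <= (a ^+ k)%:E)%E by rewrite lee_fin exprn_ge0// ltW.
rewrite muleA -EFinM mulfK ?expf_neq0 ?gt_eqF// -ge0_integralZl//.
apply: eq_integral => x _; rewrite /f -EFinM mulrA; congr (_ * _)%:E.
  by rewrite Fk// mulrA -exprMn divff ?gt_eqF// expr1n mul1r.
by rewrite enormZ gtr0_norm// ler_pdivrMl// mulr1.
Qed.

(* The integral of <w, x>^(2n) over S^e for |w| = 1, obtained by computing the integral of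
   <w, x>^(2n) e^(-|x|^2) over R^d in Cartesian and in polar coordinates. *)
Definition sphere_moment (n : nat) : R :=
  Num.sqrt pi ^+ d * gmom n.*2 / half_moment (n.*2 + e).

Variables (w : E) (n : nat).
Hypothesis w1 : dotR w w = 1.

Let F (x : E) : R := dotR w x ^+ n.*2.
Let F0 (x : E) : R := dotR w (direction x) ^+ n.*2.

Let mF : measurable_fun setT F.
Proof. by apply: measurable_funX; exact: measurable_dotR. Qed.

Let mF0 : measurable_fun setT F0.
Proof. exact: (measurableT_comp mF (@measurable_direction R d)). Qed.

Let F_ge0 x : 0 <= F x.
Proof. by rewrite exprn_even_ge0// odd_double. Qed.

Let F0_ge0 x : 0 <= F0 x.
Proof. exact: F_ge0. Qed.

Let FF0 x : x != 0 -> F x = F0 x * enorm x ^+ n.*2.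
Proof.
by move=> x0; rewrite /F {1}(scale_direction x0) dotRZr exprMn mulrC.
Qed.

Let I := (\int[lam d]_(x in [set x | enorm x <= 1]%R) (F x)%:E)%E.
Let A := (\int[lam d]_(x in punctured_ball) (F0 x)%:E)%E.

Let qg (x : measurableTypeR R) : R := 2 * x * gauss_fun x.

Let menorm : measurable_fun setT (@enorm R d).
Proof. exact: measurable_enorm. Qed.

(** The Gaussian is the tail integral of 2 rho e^(-rho^2) from |x|; after exchange, the integral of
    [F] over the ball of radius rho is rho^(2n + d) [I] by homogeneity, which leaves a half moment
    of order 2n + d + 1. *)
Let gauss_ball : ((Num.sqrt pi ^+ d * gmom n.*2)%:E = (2 * half_moment (n.*2 + e).+2)%:E * I)%E.
Proof.
have [int1 int2] := gaussian_moment w n.*2.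
rewrite w1 expr1n mulr1 in int2; rewrite -int2 /Rintegral fineK; last exact: integrable_fin_num.
have mq : measurable_fun setT qg.
  apply: measurable_funM; last exact: measurable_gauss_fun.
  exact: mulrl_measurable.
have q0 x : 0 <= x -> 0 <= qg x by move=> x0; rewrite /qg !mulr_ge0 ?gauss_fun_ge0.
have := @layer_cake _ _ _ (lam d) (@enorm R d) F qg menorm mF mq (@enorm_ge0 _ _) F_ge0 q0.
move=> H; transitivity (\int[lam d]_x ((F x)%:E *
    \int[mu]_(rho in `[enorm x, +oo[) (qg rho)%:E))%E.
  apply: eq_integral => x _; rewrite gauss_tail ?enorm_ge0// -EFinM.
  by rewrite /gauss_fun enorm_sqr.
rewrite {}H.
have I0 : (0 <= I)%E by apply: integral_ge0 => x _; rewrite lee_fin.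
set k := (n.*2 + e).+2.
pose pg (x : measurableTypeR R) : \bar R := (x ^+ k * gauss_fun x)%:E.
have mpg : measurable_fun (`[0%R, +oo[%classic : set (measurableTypeR R)) pg.
  by apply/measurable_EFinP; apply: measurable_funTS; exact: measurable_powgauss.
have pg0 x : `[0%R, +oo[%classic x -> (0 <= pg x)%E.
  rewrite /= in_itv/= andbT => x0.
  by rewrite lee_fin mulr_ge0 ?gauss_fun_ge0// exprn_ge0.
have m2pg : measurable_fun (`[0%R, +oo[%classic : set (measurableTypeR R)) (fun x => 2%:E * pg x)%E.
  by apply: emeasurable_funM.
have two0 : (0 <= 2%:E :> \bar R)%E by rewrite lee_fin.
have pg20 x : `[0%R, +oo[%classic x -> (0 <= 2%:E * pg x)%E.
  by move=> x0; rewrite mule_ge0// pg0.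
rewrite EFinM -half_momentE -/pg.
rewrite -(ge0_integralZl mu _ mpg pg0 two0)// -(ge0_integralZr mu _ m2pg pg20 I0)//.
apply: eq_integral => a; rewrite inE/= in_itv/= andbT.
rewrite le_eqVlt => /predU1P[<-|a0].
  by rewrite /pg /qg /k exprS !(mulr0, mul0r) mule0 !mul0e.
rewrite (ball_scale (k := n.*2) mF F_ge0)//; last first.
  by move=> c x _; rewrite /F dotRZr exprMn.
rewrite muleA -!EFinM; congr (_%:E * _)%E.
by rewrite /qg /k addnS !exprS; ring.
Qed.

Let mpb := @measurable_punctured_ball R d.

Let I_pb : I = (\int[lam d]_(x in punctured_ball) (F x)%:E)%E.
Proof.
have m0 : measurable [set (0 : E)].
  rewrite (_ : [set 0] = (@enorm R d) @^-1` [set 0]).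
    by rewrite -[X in measurable X]setTI; exact: measurable_enorm.
  by apply/seteqP; split => x /=; [move=> ->; rewrite enorm0|move/eqP; rewrite enorm_eq0 => /eqP].
have mF' : measurable_fun [set x : E | enorm x <= 1] (fun x => (F x)%:E).
  by apply: measurable_funTS; exact/measurable_EFinP.
rewrite /I (ge0_negligible_integral m0 (mball 1) mF' (fun x _ => F_ge0 x) lam0).
congr integral; apply/seteqP; split => x /=.
  by move=> [x1 /eqP x0]; rewrite /punctured_ball /= enorm_gt0 x0 x1.
by rewrite /punctured_ball /= enorm_gt0 => /andP[/eqP x0 x1].
Qed.

Let A_fin : A \is a fin_num.
Proof.
rewrite ge0_fin_numE; last by apply: integral_ge0 => x _; rewrite lee_fin.
apply: (@le_lt_trans _ _ (\int[lam d]_(x in punctured_ball) (cst 1 x))%E).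
  apply: ge0_le_integral => //.
  - by move=> x _; rewrite lee_fin.
  - by apply: measurable_funTS; exact/measurable_EFinP.
  - move=> x px; rewrite lee_fin /F0 -[leRHS](expr1n _ n.*2).
    rewrite -[leLHS]ger0_norm; last exact: F0_ge0.
    rewrite normrX lerXn2r ?nnegrE//.
    have -> : 1 = enorm w * enorm (direction x).
      by rewrite (direction_sphere (punctured_ball_neq0 px)) /enorm w1 sqrtr1 mulr1.
    exact: cauchy_schwarz.
rewrite integral_cst// mul1e.
have [B [mB Boo HB]] := @lebesgue_rV_box R d.
apply: le_lt_trans Boo; apply: le_measure; rewrite ?inE//.
by move=> x px; apply: HB => i; exact: punctured_ball_le1.
Qed.

(** [F0] and [F] are the extensions of the same function on the sphere, homogeneous of degrees 0 and
    2n, whose radial integrals are 1 / d and 1 / (2n + d). They are compared by layer cake, as 1 -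
    |x|^(2n) is the integral of 2n rho^(2n - 1) from |x| to 1. *)
Let A_I : (A * d%:R%:E = I * (n.*2 + d)%:R%:E)%E.
Proof.
rewrite I_pb; have [n0|n0] := eqVneq n 0%N.
  rewrite n0 /= add0n; congr (_ * _)%E; apply: eq_integral => x.
  by rewrite inE => px; rewrite FF0 ?n0 ?mulr1// punctured_ball_neq0.
pose k := n.*2.-1.
have kE : n.*2 = k.+1 by rewrite prednK// double_gt0 lt0n.
have kp : k = n.-1.*2.+1 by rewrite /k -[n in LHS]prednK ?lt0n// doubleS.
pose q (x : measurableTypeR R) : R := if x <= 1 then k.+1%:R * x ^+ k else 0.
pose G (x : E) : R := F0 x * (if (0 < enorm x <= 1) then 1 else 0).
have mq : measurable_fun setT q.
  apply: measurable_fun_ifT => //; first exact: measurable_fun_ler.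
  by apply: measurable_funM => //; exact: exprn_measurable.
have mG : measurable_fun setT G.
  apply: measurable_funM => //; apply: measurable_fun_ifT => //.
  apply: measurable_and; first exact: measurable_fun_ltr.
  exact: measurable_fun_ler.
have q0 x : 0 <= x -> 0 <= q x.
  by move=> x0; rewrite /q; case: ifP => // _; rewrite mulr_ge0// exprn_ge0.
have G0 x : 0 <= G x by rewrite /G; case: ifP; rewrite ?mulr1 ?mulr0.
have pbE x : (x \in punctured_ball) = (0 < enorm x <= 1) by apply/idP/idP; rewrite inE.
have H := @layer_cake _ _ _ (lam d) (@enorm R d) G q menorm mG mq (@enorm_ge0 _ _) G0 q0.
pose D (x : E) : R := F0 x * (1 - enorm x ^+ n.*2).
have D0 x : punctured_ball x -> (0 <= (D x)%:E)%E.
  rewrite /punctured_ball /= => /andP[_ x1]; rewrite lee_fin mulr_ge0// subr_ge0.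
  by rewrite exprn_ile1 ?enorm_ge0.
have mD : measurable_fun punctured_ball (fun x => (D x)%:E).
  apply/measurable_EFinP; apply: measurable_funTS; apply: measurable_funM => //.
  by apply: measurable_funB => //; exact: measurable_funX.
have mFp : measurable_fun punctured_ball (fun x => (F x)%:E).
  by apply/measurable_EFinP; exact: measurable_funTS.
have AE : (A = \int[lam d]_(x in punctured_ball) (D x)%:E +
               \int[lam d]_(x in punctured_ball) (F x)%:E)%E.
  have Fp0 x : punctured_ball x -> (0 <= (F x)%:E)%E by rewrite lee_fin.
  rewrite -(ge0_integralD _ mpb D0 mD Fp0 mFp).
  apply: eq_integral => x; rewrite inE => px.
  rewrite -EFinD FF0 ?punctured_ball_neq0// /D; congr EFin; ring.
have HL : (\int[lam d]_x ((G x)%:E * \int[mu]_(rho in `[enorm x, +oo[) (q rho)%:E) =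
           \int[lam d]_(x in punctured_ball) (D x)%:E)%E.
  rewrite [RHS]integral_mkcond; apply: eq_integral => x _; rewrite /patch /G /D.
  rewrite pbE; case: ifPn => [/andP[x0 x1]|_]; last by rewrite mulr0 mul0e.
  rewrite mulr1.
  have -> : (\int[mu]_(rho in `[enorm x, +oo[) (q rho)%:E)%E =
      (\int[mu]_(rho in `[enorm x, 1%R]) (k.+1%:R * rho ^+ k)%:E)%E.
    rewrite integral_mkcond [RHS]integral_mkcond; apply: eq_integral => y _.
    rewrite /patch !mem_setE !in_itv /= andbT /q.
    by case: (enorm x <= y) => //=; case: (y <= 1).
  by rewrite int_pow_tail ?enorm_ge0// -EFinM kE.
pose G1 (x : E) : R := F0 x * (if 0 < enorm x then 1 else 0).
have mG1 : measurable_fun setT G1.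
  apply: measurable_funM => //; apply: measurable_fun_ifT => //.
  exact: measurable_fun_ltr.
have G1p : forall x, 0 <= G1 x.
  by move=> x; rewrite /G1; case: (0 < enorm x); rewrite ?mulr1 ?mulr0.
have G1h c x : 0 < c -> G1 (c *: x) = c ^+ 0 * G1 x.
  by move=> c0; rewrite /G1 /F0 mul1r directionZ// enormZ gtr0_norm// pmulr_rgt0.
have BA : (\int[lam d]_(x in [set x | enorm x <= 1]%R) (G1 x)%:E = A)%E.
  rewrite integral_mkcond [RHS]integral_mkcond; apply: eq_integral => x _.
  rewrite /patch /G1 pbE.
  have -> : (x \in [set x | enorm x <= 1]) = (enorm x <= 1) by apply/idP/idP; rewrite inE.
  by case: (enorm x <= 1); case: (0 < enorm x); rewrite //= ?mulr1 ?mulr0.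
pose Q (x : measurableTypeR R) : \bar R := ((k + d).+1%:R * x ^+ (k + d))%:E.
have mQ : measurable_fun (`[0%R, 1%R]%classic : set (measurableTypeR R)) Q.
  by apply/measurable_EFinP; apply: measurable_funTS; apply: measurable_funM.
have Q0 x : `[0%R, 1%R]%classic x -> (0 <= Q x)%E.
  by rewrite /= in_itv/= => /andP[x0 _]; rewrite lee_fin mulr_ge0// exprn_ge0.
have A0 : (0 <= A)%E by apply: integral_ge0 => x _; rewrite lee_fin.
(* As k + 1 = 2n, this is the integral of 2n rho^(2n - 1) rho^d over [0, 1], the factor rho^d being
   the scaling of the ball. *)
pose c : R := k.+1%:R / (k + d).+1%:R.
have c0 : (0 <= c%:E)%E by rewrite lee_fin divr_ge0.
have cA0 : (0 <= c%:E * A)%E by rewrite mule_ge0.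
have HR : (\int[mu]_(rho in `[0%R, +oo[) ((q rho)%:E *
    \int[lam d]_(x in [set x | enorm x <= rho]%R) (G x)%:E) = c%:E * A)%E.
  transitivity (\int[mu]_(rho in `[0%R, 1%R]) (Q rho * (c%:E * A)))%E; last first.
    rewrite (ge0_integralZr mu _ mQ Q0 cA0)// int_pow ?ler01//.
    by rewrite expr1n mul1e.
  rewrite integral_mkcond [RHS]integral_mkcond; apply: eq_integral => y _.
  rewrite /patch !mem_setE !in_itv /= andbT /q.
  case: (lerP 0 y) => //= y0; case: (lerP y 1) => [y1|_]; last by rewrite mul0e.
  move: y0; rewrite le_eqVlt => /predU1P[<-|y0].
    by rewrite /Q kp addSn !exprS !(mul0r, mulr0) !mul0e.
  have -> : (\int[lam d]_(x in [set x | enorm x <= y]%R) (G x)%:E =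
     \int[lam d]_(x in [set x | enorm x <= y]%R) (G1 x)%:E)%E.
    apply: eq_integral => x; rewrite inE /= => xy.
    by rewrite /G /G1 (le_trans xy y1) andbT.
  rewrite (ball_scale (k := 0) mG1)// BA muleA -EFinM /Q muleA -EFinM.
  congr (_%:E * _)%E; rewrite add0n exprD /c.
  have := pnatr_eq0 R (k + d).+1; set z := (k + d).+1%:R => /negbT z0.
  by field.
have := AE; rewrite -HL H HR -/A.
rewrite -(fineK A_fin); set a := fine A.
have : (\int[lam d]_(x in punctured_ball) (F x)%:E)%E \is a fin_num.
  move: A_fin; rewrite AE fin_numD => /andP[_].
  by [].
case: (\int[lam d]_(x in punctured_ball) (F x)%:E)%E => // i _.
rewrite -EFinM -EFinD => -[] ai; rewrite -!EFinM; congr EFin.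
have -> : i = a - c * a by rewrite {1}ai; ring.
rewrite kE /c -addSn mulrBl [X in _ - X]mulrAC divfK ?pnatr_eq0// natrD; ring.
Qed.

Lemma sphere_moment_even :
  (\int[sphere_vol]_(x in sphere) (dotR w x ^+ n.*2)%:E = (sphere_moment n)%:E)%E.
Proof.
rewrite (ge0_integral_sphere (f := fun x => (F x)%:E))//; last exact/measurable_EFinP.
rewrite -/A muleC A_I.
have := gauss_ball; have h0 : 2 * half_moment (n.*2 + e).+2 != 0 :> R.
  by rewrite mulf_neq0// gt_eqF// half_moment_gt0.
case: I => [i| |].
- rewrite -EFinM => H; have h := EFin_inj H; rewrite -EFinM /sphere_moment; congr EFin.
  rewrite h half_momentS addnS.
  have hh := lt0r_neq0 (@half_moment_gt0 R (n.*2 + e)).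
  by field.
- by rewrite mulry gtr0_sg ?mul1e// mulr_gt0// half_moment_gt0.
- by rewrite mulrNy gtr0_sg ?mul1e// mulr_gt0// half_moment_gt0.
Qed.

End polar.

(** * Complex-valued integrals of series *)

Section complex_integral.
Context d (T : measurableType d) (R : realType) (mu : {measure set T -> \bar R}).
Variable D : set T.
Hypotheses (mD : measurable D) (muD : (mu D < +oo)%E).
Implicit Types f g : T -> R[i].

Definition cbounded (f : T -> R[i]) (B : R) : Prop :=
  [/\ measurable_fun D (fun x => complex.Re (f x)),
      measurable_fun D (fun x => complex.Im (f x)) &
      forall x, D x -> normc (f x) <= B].

Lemma bounded_integrable (f : T -> R) (B : R) : measurable_fun D f ->
  (forall x, D x -> `|f x| <= B) -> mu.-integrable D (EFin \o f).
Proof.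
move=> mf fB; apply: (measurable_bounded_integrable mD muD mf).
exists `|B|; split; first exact: num_real.
move=> M BM x Dx; apply: le_trans (fB _ Dx) _.
by apply: le_trans (ltW BM); exact: ler_norm.
Qed.

Lemma cbounded_Re f B : cbounded f B ->
  mu.-integrable D (EFin \o (fun x => complex.Re (f x))).
Proof.
move=> [mr _ fB]; apply: (bounded_integrable mr (B := B)) => x Dx.
exact: le_trans (normc_Re _) (fB _ Dx).
Qed.

Lemma cbounded_Im f B : cbounded f B ->
  mu.-integrable D (EFin \o (fun x => complex.Im (f x))).
Proof.
move=> [_ mi fB]; apply: (bounded_integrable mi (B := B)) => x Dx.
exact: le_trans (normc_Im _) (fB _ Dx).
Qed.

Lemma eq_cintegral f g : {in D, f =1 g} -> cintegral mu D f = cintegral mu D g.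
Proof.
by move=> fg; congr (_ +i* _); apply: eq_Rintegral => x xD; rewrite fg.
Qed.

Lemma eq_cbounded f g B : (forall x, D x -> f x = g x) -> cbounded f B -> cbounded g B.
Proof.
move=> fg [mr mi fB]; split.
- by apply: eq_measurable_fun mr => x /set_mem Dx; rewrite fg.
- by apply: eq_measurable_fun mi => x /set_mem Dx; rewrite fg.
- by move=> x Dx; rewrite -fg// fB.
Qed.

Lemma cbounded_cst (c : R[i]) : cbounded (fun=> c) (normc c).
Proof. by split => //; exact: measurable_cst. Qed.

Lemma cboundedD f g A B : cbounded f A -> cbounded g B ->
  cbounded (fun x => f x + g x) (A + B).
Proof.
move=> [fr fi fA] [gr gi gB]; split.
- apply: (eq_measurable_fun (fun x => complex.Re (f x) + complex.Re (g x))).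
    by move=> x _; case: (f x) => ? ?; case: (g x).
  exact: measurable_funD.
- apply: (eq_measurable_fun (fun x => complex.Im (f x) + complex.Im (g x))).
    by move=> x _; case: (f x) => ? ?; case: (g x).
  exact: measurable_funD.
- by move=> x Dx; apply: le_trans (le_normcD _ _) _; rewrite lerD ?fA ?gB.
Qed.

Lemma cboundedM f g A B : cbounded f A -> cbounded g B ->
  cbounded (fun x => f x * g x) (A * B).
Proof.
move=> [fr fi fA] [gr gi gB]; split.
- apply: (eq_measurable_fun (fun x => complex.Re (f x) * complex.Re (g x) -
     complex.Im (f x) * complex.Im (g x))).
    by move=> x _; case: (f x) => ? ?; case: (g x).
  by apply: measurable_funB; exact: measurable_funM.
- apply: (eq_measurable_fun (fun x => complex.Re (f x) * complex.Im (g x) +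
     complex.Im (f x) * complex.Re (g x))).
    by move=> x _; case: (f x) => ? ?; case: (g x).
  by apply: measurable_funD; exact: measurable_funM.
- by move=> x Dx; rewrite normcM ler_pM ?normc_ge0 ?fA ?gB.
Qed.

Lemma cboundedZ c f A : cbounded f A -> cbounded (fun x => c * f x) (normc c * A).
Proof. by move=> fA; apply: cboundedM => //; exact: cbounded_cst. Qed.

Lemma cbounded_sum (I : Type) (r : seq I) (f : I -> T -> R[i]) (B : I -> R) :
  (forall i, cbounded (f i) (B i)) ->
  cbounded (fun x => \sum_(i <- r) f i x) (\sum_(i <- r) B i).
Proof.
move=> h; elim: r => [|i r IH].
  rewrite big_nil; apply: (eq_cbounded (f := fun=> 0)); first by move=> x _; rewrite big_nil.
  by have := cbounded_cst 0; rewrite normc0.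
rewrite big_cons; apply: (eq_cbounded (f := fun x => f i x + \sum_(i <- r) f i x)).
  by move=> x _; rewrite big_cons.
exact: cboundedD.
Qed.

Lemma cintegralD f g A B : cbounded f A -> cbounded g B ->
  cintegral mu D (fun x => f x + g x) = cintegral mu D f + cintegral mu D g.
Proof.
move=> fA gB; rewrite /cintegral.
have -> : (fun x => complex.Re (f x + g x)) = (fun x => complex.Re (f x) + complex.Re (g x)).
  by apply/funext => x; case: (f x) => ? ?; case: (g x).
have -> : (fun x => complex.Im (f x + g x)) = (fun x => complex.Im (f x) + complex.Im (g x)).
  by apply/funext => x; case: (f x) => ? ?; case: (g x).
rewrite !RintegralD//; [exact: cbounded_Im fA|exact: cbounded_Im gB
  |exact: cbounded_Re fA|exact: cbounded_Re gB].
Qed.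

Lemma cintegralZ c f A : cbounded f A ->
  cintegral mu D (fun x => c * f x) = c * cintegral mu D f.
Proof.
move=> fA; rewrite /cintegral; case: c => a b.
have fr := cbounded_Re fA; have fi := cbounded_Im fA.
have ZI (k : R) (h : T -> R) : mu.-integrable D (EFin \o h) ->
    mu.-integrable D (EFin \o (fun x => k * h x)).
  by move=> hi; apply: (eq_integrable mD) (integrableZl mD k hi).
have -> : (fun x => complex.Re ((a +i* b) * f x)) =
    (fun x => a * complex.Re (f x) - b * complex.Im (f x)).
  by apply/funext => x; case: (f x).
have -> : (fun x => complex.Im ((a +i* b) * f x)) =
    (fun x => a * complex.Im (f x) + b * complex.Re (f x)).
  by apply/funext => x; case: (f x).
rewrite RintegralB ?RintegralD ?RintegralZl//; exact: ZI.
Qed.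

Lemma cintegral_conj f A : cbounded f A ->
  cintegral mu D (fun x => (f x)^*) = (cintegral mu D f)^*.
Proof.
move=> fA; rewrite /cintegral.
have -> : (fun x => complex.Re (f x)^*) = (fun x => complex.Re (f x)).
  by apply/funext => x; case: (f x).
have -> : (fun x => complex.Im (f x)^*) = (fun x => -1 * complex.Im (f x)).
  by apply/funext => x; case: (f x) => a b /=; rewrite mulN1r.
by rewrite RintegralZl//= ?mulN1r//; exact: cbounded_Im fA.
Qed.

Lemma cintegral0 : cintegral mu D (fun=> 0) = 0.
Proof. by rewrite /cintegral /Rintegral !integral0. Qed.

Lemma cintegral_sum (I : Type) (r : seq I) (f : I -> T -> R[i]) (B : I -> R) :
  (forall i, cbounded (f i) (B i)) ->
  cintegral mu D (fun x => \sum_(i <- r) f i x) = \sum_(i <- r) cintegral mu D (f i).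
Proof.
move=> h; elim: r => [|i r IH].
  rewrite big_nil -[RHS]cintegral0; congr cintegral.
  by apply/funext => x; rewrite big_nil.
rewrite big_cons -IH -(cintegralD (h i) (cbounded_sum r h)).
by congr cintegral; apply/funext => x; rewrite big_cons.
Qed.

(** The factor 2 comes from bounding the real and the imaginary part separately. *)
Lemma normc_cintegral f B : 0 <= B -> cbounded f B ->
  normc (cintegral mu D f) <= 2 * fine (mu D) * B.
Proof.
move=> B0 fB; have [mr mi hB] := fB.
have H (h : T -> R) : measurable_fun D h -> (forall x, D x -> `|h x| <= B) ->
    `|\int[mu]_(x in D) h x| <= fine (mu D) * B.
  move=> mh hh; have hi := bounded_integrable mh hh.
  apply: le_trans (le_normr_Rintegral mD hi) _.
  rewrite mulrC -Rintegral_cst//; apply: le_Rintegral => //.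
  - by apply: (eq_integrable mD) (integrable_abse hi).
  - by apply: (bounded_integrable (B := B)) => // x _; rewrite ger0_norm.
apply: le_trans (normc_le_ReIm _) _; rewrite -mulrA mulr_natl mulr2n lerD// H// => x Dx.
  by apply: le_trans (normc_Re _) (hB _ Dx).
by apply: le_trans (normc_Im _) (hB _ Dx).
Qed.

End complex_integral.

(** [F0] depends on the tail bound only, so the estimate is uniform in any parameter of [b] that
    this bound does not see. *)
Lemma hsum_tail (R : realType) (I : choiceType) (b : I -> R[i]) s (F0 : {fset I}) e :
  hsum b s -> (forall F, [disjoint F & F0]%fset -> \sum_(i <- F) normc (b i) <= e) ->
  forall F, (F0 `<=` F)%fset -> normc (\sum_(i <- F) b i - s) <= e.
Proof.
move=> hs he F F0F; apply/ler_addgt0Pl => e' /hs[G hG].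
have := hG _ (fsubsetUr F G); rewrite (big_fset_split _ (fsubsetUl F G)).
set H := ((F `|` G) `\` F)%fset => h.
have {}he : \sum_(i <- H) normc (b i) <= e.
  apply: he; apply/fdisjointP => i; rewrite !inE => /andP[iF _].
  by apply: contra iF; exact: (fsubsetP F0F).
set X := \sum_(i <- F) b i in h *; set Y := \sum_(i <- H) b i in h.
rewrite (_ : X - s = (X + Y - s) - Y); last by ring.
apply: le_trans (le_normcD _ _) _; rewrite normcN lerD//.
exact: le_trans (normc_sum _ _ _) he.
Qed.

Section integral_sum_swap.
Context d (T : measurableType d) (R : realType) (mu : {measure set T -> \bar R}).
Variable D : set T.
Hypotheses (mD : measurable D) (muD : (mu D < +oo)%E).
Variables (I : choiceType) (a : I -> R[i]) (f : I -> T -> R[i]) (g : T -> R[i]) (B : R).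
Hypotheses (aB : asum a B) (f1 : forall i, cbounded D (f i) 1).
Hypothesis hg : forall x, D x -> hsum (fun i => a i * f i x) (g x).

Let af i : cbounded D (fun x => a i * f i x) (normc (a i)).
Proof. by rewrite -[normc _]mulr1; exact: cboundedZ. Qed.

Let afB x : D x -> asum (fun i => a i * f i x) B.
Proof.
move=> Dx; apply: asum_le1 aB => i; rewrite normcM ler_piMr ?normc_ge0//.
by have [_ _] := f1 i; apply.
Qed.

Let approx e : 0 < e -> exists F0 : {fset I}, forall F, (F0 `<=` F)%fset ->
  forall x, D x -> normc (\sum_(i <- F) a i * f i x - g x) <= e.
Proof.
move=> e0; have [F0 hF0] := asum_tail aB e0.
exists F0 => F F0F x Dx; apply: (hsum_tail (hg Dx) _ F0F) => G dG.
apply: le_trans (hF0 _ dG); apply: ler_sum => i _.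
rewrite normcM ler_piMr ?normc_ge0//.
by have [_ _] := f1 i; apply.
Qed.

(** Measurability asks for a sequence, while the index type is arbitrary: finite sets [F n] with
    uniform error 1 / (n + 1) are chosen. The map [h] stands for the real or the imaginary part. *)
Let measurable_limit (h : R[i] -> R) : (forall z w, `|h z - h w| <= normc (z - w)) ->
  (forall F : {fset I}, measurable_fun D (fun x => h (\sum_(i <- F) a i * f i x))) ->
  measurable_fun D (fun x => h (g x)).
Proof.
move=> hlip mh.
have /choice[F hF] n : exists F : {fset I}, forall x, D x ->
    normc (\sum_(i <- F) a i * f i x - g x) <= n.+1%:R^-1.
  have n0 : 0 < n.+1%:R^-1 :> R by rewrite invr_gt0.
  have [F0 hF0] := approx n0.
  by exists F0 => x Dx; exact: (hF0 F0 (fsubset_refl _)).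
apply: (@measurable_fun_cvg _ _ _ D (fun n x => h (\sum_(i <- F n) a i * f i x))) => //.
move=> x Dx; apply/cvgrPdist_le => e e0; near=> n.
rewrite distrC; apply: le_trans (hlip _ _) _; apply: le_trans (hF n x Dx) _.
apply: ltW; near: n; exact: (near_infty_natSinv_lt (PosNum e0)).
Unshelve. all: end_near. Qed.

Lemma cbounded_hsum : cbounded D g B.
Proof.
split.
- apply: (measurable_limit (h := @complex.Re R)).
    by move=> z w; rewrite (_ : _ - _ = complex.Re (z - w)) ?normc_Re//; case: z w => ? ? [].
  by move=> F; have [] := cbounded_sum F af.
- apply: (measurable_limit (h := @complex.Im R)).
    by move=> z w; rewrite (_ : _ - _ = complex.Im (z - w)) ?normc_Im//; case: z w => ? ? [].
  by move=> F; have [] := cbounded_sum F af.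
- by move=> x Dx; exact: (hsum_norm (hg Dx) (afB Dx)).
Qed.

Lemma cintegral_hsum : hsum (fun i => a i * cintegral mu D (f i)) (cintegral mu D g).
Proof.
move=> e e0; set c := 2 * fine (mu D) + 1.
have c0 : 0 < c.
  by rewrite /c ltr_wpDl// mulr_ge0// fine_ge0.
have [F0 h] := approx (divr_gt0 e0 c0).
exists F0 => F F0F.
have gB := cbounded_hsum; have aF := cbounded_sum F af.
have mgB := cboundedZ (-1) gB.
have -> : \sum_(i <- F) a i * cintegral mu D (f i) - cintegral mu D g =
    cintegral mu D (fun x => \sum_(i <- F) a i * f i x + -1 * g x).
  rewrite (cintegralD mD muD aF mgB) (cintegralZ mD muD _ gB) mulN1r; congr (_ - _).
  rewrite (cintegral_sum mD muD F af); apply: eq_bigr => i _.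
  by rewrite (cintegralZ mD muD _ (f1 i)).
have cb : cbounded D (fun x => \sum_(i <- F) a i * f i x + -1 * g x) (e / c).
  have [? ? _] := cboundedD aF mgB; split => // x Dx.
  by rewrite mulN1r; exact: h.
apply: le_trans (normc_cintegral mD muD (ltW (divr_gt0 e0 c0)) cb) _.
apply: (@le_trans _ _ (c * (e / c))); last by rewrite mulrCA divff ?mulr1// gt_eqF.
by rewrite ler_pM2r ?divr_gt0// lerDl.
Qed.

End integral_sum_swap.

Section product_cintegral.
Context d1 d2 (T1 : measurableType d1) (T2 : measurableType d2) (R : realType).
Variables (m1 : {sigma_finite_measure set T1 -> \bar R})
  (m2 : {sigma_finite_measure set T2 -> \bar R}).
Variables (D1 : set T1) (D2 : set T2).
Hypotheses (mD1 : measurable D1) (mD2 : measurable D2).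
Hypotheses (fin1 : (m1 D1 < +oo)%E) (fin2 : (m2 D2 < +oo)%E).

Lemma cintegral_prod (f : T1 -> R[i]) (g : T2 -> R[i]) A B :
  cbounded D1 f A -> cbounded D2 g B ->
  cintegral (m1 \x m2)%E (D1 `*` D2) (fun z => f z.1 * g z.2) =
  cintegral m1 D1 f * cintegral m2 D2 g.
Proof.
move=> fA gB.
have fr := cbounded_Re mD1 fin1 fA; have fi := cbounded_Im mD1 fin1 fA.
have gr := cbounded_Re mD2 fin2 gB; have gi := cbounded_Im mD2 fin2 gB.
have mD := measurableX mD1 mD2.
rewrite /cintegral.
have -> : (fun z : T1 * T2 => complex.Re (f z.1 * g z.2)) = (fun z =>
    complex.Re (f z.1) * complex.Re (g z.2) - complex.Im (f z.1) * complex.Im (g z.2)).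
  by apply/funext => z; case: (f z.1) => ? ?; case: (g z.2).
have -> : (fun z : T1 * T2 => complex.Im (f z.1 * g z.2)) = (fun z =>
    complex.Re (f z.1) * complex.Im (g z.2) + complex.Im (f z.1) * complex.Re (g z.2)).
  by apply/funext => z; case: (f z.1) => ? ?; case: (g z.2).
have irr := integrable_prod_mul mD1 mD2 fr gr.
have iii := integrable_prod_mul mD1 mD2 fi gi.
have iri := integrable_prod_mul mD1 mD2 fr gi.
have iir := integrable_prod_mul mD1 mD2 fi gr.
rewrite RintegralB// RintegralD//.
by rewrite (Rintegral_prod_mul mD1 mD2 fr gr) (Rintegral_prod_mul mD1 mD2 fi gi)
  (Rintegral_prod_mul mD1 mD2 fr gi) (Rintegral_prod_mul mD1 mD2 fi gr).
Qed.

End product_cintegral.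

Section series_sums.
Context {R : realType}.

Lemma hsum_series (a : nat -> R) (B s : R) : asum (fun n => (a n)%:C) B ->
  series a @ \oo --> s -> hsum (fun n => (a n)%:C) s%:C.
Proof.
move=> aB cs; have [S hS] : exists S, hsum (fun n => (a n)%:C) S.
  by eexists; exact: asum_hsum aB.
suff -> : s%:C = S by [].
apply/eqP; rewrite -subr_eq0; apply/eqP/eq_normc_le0 => e e0.
have e2 : 0 < e / 2 by rewrite divr_gt0.
have [F hF] := hS _ e2.
move/cvgrPdist_le : cs => /(_ _ e2)[N _ hN].
pose M := maxn N (\max_(i <- F) i.+1).
have FM : (F `<=` [fset i in iota 0 M])%fset.
  apply/fsubsetP => i iF; rewrite inE /= mem_iota /= add0n /M leq_max; apply/orP; right.
  by rewrite (big_rem i)//= leq_maxl.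
have h1 := hF _ FM; have h2 := hN M (leq_maxl _ _).
have E : \sum_(i <- [fset i in iota 0 M]%fset) (a i)%:C = (series a M)%:C.
  rewrite big_imfset//= undup_id ?iota_uniq// /series /= rmorph_sum.
  by rewrite /index_iota subn0.
rewrite E in h1.
rewrite (_ : s%:C - S = (s - series a M)%:C + ((series a M)%:C - S)); last first.
  by rewrite rmorphB /=; ring.
by apply: le_trans (le_normcD _ _) _; rewrite normc_real; lra.
Qed.

Lemma asum_series (a : nat -> R) (B : R) : (forall N, \sum_(0 <= i < N) `|a i| <= B) ->
  asum (fun n => (a n)%:C) B.
Proof.
move=> aB F; set M := (\max_(i <- F) i.+1)%N; apply: le_trans (aB M).
have FM : (F `<=` [fset i in iota 0 M])%fset.
  apply/fsubsetP => i iF; rewrite inE /= mem_iota /= add0n.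
  by rewrite /M (big_rem i)//= leq_maxl.
apply: le_trans (le_big_fset _ FM) _; first by move=> i; exact: normc_ge0.
rewrite big_imfset//= undup_id ?iota_uniq// /index_iota subn0.
by apply: ler_sum => i _; rewrite -normc_real.
Qed.

Lemma exp_partial_le (r : R) N : 0 <= r -> \sum_(0 <= i < N) (r ^+ i / i`!%:R) <= expR r.
Proof.
move=> r0; have nd : nondecreasing_seq (series (exp_coeff r)).
  by apply/nondecreasing_seqP => n; rewrite /series /= big_nat_recr//= lerDl exp_coeff_ge0.
exact: (nondecreasing_cvgn_le nd (is_cvg_series_exp_coeff r) N).
Qed.

Lemma even_exp_partial_le (r : R) N : 0 <= r ->
  \sum_(0 <= i < N) (r ^+ i.*2 / i.*2`!%:R) <= expR r.
Proof.
move=> r0; apply: le_trans (exp_partial_le N.*2 r0).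
elim: N => [|N IH]; first by rewrite !big_geq.
rewrite doubleS !big_nat_recr//= -addrA lerD// lerDl.
by rewrite divr_ge0// exprn_ge0.
Qed.

Lemma odd_exp_partial_le (r : R) N : 0 <= r ->
  \sum_(0 <= i < N) (r ^+ i.*2.+1 / i.*2.+1`!%:R) <= expR r.
Proof.
move=> r0; apply: le_trans (exp_partial_le N.*2 r0).
elim: N => [|N IH]; first by rewrite !big_geq.
rewrite doubleS !big_nat_recr//= -addrA lerD// lerDr.
by rewrite divr_ge0// exprn_ge0.
Qed.

Lemma asum_cos_coeff (r : R) : asum (fun n => (cos_coeff' r n)%:C) (expR `|r|).
Proof.
apply: asum_series => N; apply: le_trans (even_exp_partial_le N (normr_ge0 r)).
apply: ler_sum => i _; rewrite /cos_coeff' -exprnP !normrM !normrX normrN1 expr1n.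
by rewrite mul1r normfV normr_nat.
Qed.

Lemma asum_sin_coeff (r : R) : asum (fun n => (sin_coeff' r n)%:C) (expR `|r|).
Proof.
apply: asum_series => N; apply: le_trans (odd_exp_partial_le N (normr_ge0 r)).
apply: ler_sum => i _; rewrite /sin_coeff' -exprnP !normrM !normrX normrN1 expr1n.
by rewrite mul1r normfV normr_nat.
Qed.

End series_sums.

(** * The Fourier transform of the sphere *)

Section trigonometric_moments.
Context d (T : measurableType d) (R : realType) (mu : {measure set T -> \bar R}).
Variable D : set T.
Hypotheses (mD : measurable D) (muD : (mu D < +oo)%E).
Variable s : T -> R.
Hypotheses (ms : measurable_fun D s) (s1 : forall x, D x -> `|s x| <= 1).
Variable w : T -> R.
Hypotheses (mw : measurable_fun D w) (w1 : forall x, D x -> `|w x| <= 1).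

Lemma cbounded_real (f : T -> R) B : measurable_fun D f -> (forall x, D x -> `|f x| <= B) ->
  cbounded D (fun x => (f x)%:C) B.
Proof.
move=> mf fB; split; [exact: mf|exact: measurable_cst|].
by move=> x Dx; rewrite normc_real fB.
Qed.

Lemma cintegral_real (f : T -> R) :
  cintegral mu D (fun x => (f x)%:C) = (\int[mu]_(x in D) f x)%:C.
Proof. by rewrite /cintegral /= /Rintegral integral0. Qed.

Let cb n : cbounded D (fun x => (w x * s x ^+ n)%:C) 1.
Proof.
apply: cbounded_real; first by apply: measurable_funM => //; exact: measurable_funX.
move=> x Dx; rewrite normrM normrX -[1]mulr1.
by apply: ler_pM => //; [exact: w1|rewrite exprn_ile1// s1].
Qed.

(** The weight is there for the circle. On the sphere [w] is 1 and [s] is a linear form; on [0, 1]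
    they will be (2 - x^2)^(-1/2) and 1 - x^2. *)
Lemma hsum_cos (r : R) :
  hsum (fun n => (cos_coeff' r n * \int[mu]_(x in D) (w x * s x ^+ n.*2))%:C)
    (\int[mu]_(x in D) (w x * cos (r * s x)))%:C.
Proof.
have := @cintegral_hsum _ _ _ mu D mD muD nat (fun n => (cos_coeff' r n)%:C)
  (fun n x => (w x * s x ^+ n.*2)%:C) (fun x => (w x * cos (r * s x))%:C) _ (asum_cos_coeff r).
rewrite cintegral_real => h; apply: eq_hsum; last first.
  apply: h => [n|x Dx]; first exact: cb.
  have H : (fun n => (w x)%:C * (cos_coeff' (r * s x) n)%:C) =
      (fun n => (cos_coeff' r n)%:C * (w x * s x ^+ n.*2)%:C).
    by apply/funext => n; rewrite -!rmorphM /=; congr (_%:C); rewrite /cos_coeff' exprMn; ring.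
  rewrite -H rmorphM; apply: hsumZ; apply: hsum_series; first exact: asum_cos_coeff.
  exact: cvg_cos_coeff'.
by move=> n /=; rewrite cintegral_real -rmorphM.
Qed.

Lemma hsum_sin (r : R) :
  hsum (fun n => (sin_coeff' r n * \int[mu]_(x in D) (w x * s x ^+ n.+1.*2))%:C)
    (\int[mu]_(x in D) (w x * (s x * sin (r * s x))))%:C.
Proof.
have := @cintegral_hsum _ _ _ mu D mD muD nat (fun n => (sin_coeff' r n)%:C)
  (fun n x => (w x * s x ^+ n.+1.*2)%:C) (fun x => (w x * (s x * sin (r * s x)))%:C) _ (asum_sin_coeff r).
rewrite cintegral_real => h; apply: eq_hsum; last first.
  apply: h => [n|x Dx]; first exact: cb.
  have H : (fun n => (w x * s x)%:C * (sin_coeff' (r * s x) n)%:C) =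
      (fun n => (sin_coeff' r n)%:C * (w x * s x ^+ n.+1.*2)%:C).
    apply/funext => n; rewrite -!rmorphM /=; congr (_%:C).
    by rewrite /sin_coeff' exprMn doubleS !exprS; ring.
  rewrite -H.
  rewrite (_ : (w x * (s x * sin (r * s x)))%:C = (w x * s x)%:C * (sin (r * s x))%:C); last first.
    by rewrite -rmorphM mulrA.
  apply: hsumZ; apply: hsum_series; first exact: asum_sin_coeff.
  exact: cvg_sin_coeff'.
by move=> n /=; rewrite cintegral_real -rmorphM.
Qed.

End trigonometric_moments.

(** * Recurrences from S^e to S^(e + 2) *)

Section sphere_bessel.
Context {R : realType}.

Lemma sphere_moment_dim e n :
  @sphere_moment R e.+2 n = 2 * pi / (n.*2 + e).+1%:R * @sphere_moment R e n.
Proof.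
rewrite /sphere_moment 2!addnS half_momentS !exprS.
have h := lt0r_neq0 (@half_moment_gt0 R (n.*2 + e)).
have : Num.sqrt pi ^+ 2 = pi :> R by rewrite sqr_sqrtr// pi_ge0.
move: (Num.sqrt pi) => q <-.
have h1 : (n.*2 + e).+1%:R != 0 :> R by rewrite pnatr_eq0.
rewrite -[(_ + _).+1%:R]natr1 natrD in h1 *.
by field; rewrite h h1.
Qed.

Lemma sphere_momentS e n :
  @sphere_moment R e n.+1 = n.*2.+1%:R / (n.*2 + e).+1%:R * @sphere_moment R e n.
Proof.
rewrite /sphere_moment doubleS gmomSS 2!addSn half_momentS.
have h := lt0r_neq0 (@half_moment_gt0 R (n.*2 + e)).
have h1 : (n.*2 + e).+1%:R != 0 :> R by rewrite pnatr_eq0.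
rewrite -[(_ + _).+1%:R]natr1 natrD in h1 *.
by field; rewrite h h1.
Qed.

(* J_e(r) = int cos(r <w, x>) and P_e(r) = int <w, x> sin(r <w, x>) over S^e,
   |w| = 1, through their Taylor coefficients. *)
Definition is_bessel_cos e (r v : R) :=
  hsum (fun n => (cos_coeff' r n * @sphere_moment R e n)%:C) v%:C.

Definition is_bessel_sin e (r v : R) :=
  hsum (fun n => (sin_coeff' r n * @sphere_moment R e n.+1)%:C) v%:C.

(** With nu = (e - 1) / 2, the sums are (2 pi)^(nu + 1) r^(-nu) times the Bessel functions of order
    nu (cosine) and nu + 1 (sine), so raising e by 2 raises nu by 1. On Taylor coefficients this is
    an identity between consecutive moments. *)
Lemma is_bessel_cos_dim e r v v' : r != 0 -> is_bessel_sin e r v ->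
  is_bessel_cos e.+2 r v' -> v' = 2 * pi / r * v.
Proof.
move=> r0 hv hv'; apply: (@complexI R).
have h := hsumZ (2 * pi / r)%:C hv; rewrite -rmorphM in h.
apply: (hsum_uniq hv'); apply: eq_hsum h => n; rewrite -rmorphM /=; congr (_%:C).
rewrite sphere_momentS sphere_moment_dim /cos_coeff' /sin_coeff' factS natrM exprS.
have h1 : n.*2.+1%:R != 0 :> R by rewrite pnatr_eq0.
have h2 : (n.*2 + e).+1%:R != 0 :> R by rewrite pnatr_eq0.
have h3 : n.*2`!%:R != 0 :> R by rewrite pnatr_eq0 -lt0n fact_gt0.
rewrite -[n.*2.+1%:R]natr1 in h1 *; rewrite -[(_ + _).+1%:R]natr1 natrD in h2 *.
by field; rewrite h3 r0 h1 h2.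
Qed.

(** The three-term Bessel recurrence, with 2 (nu + 1) = e + 1. The n-th coefficient on the left
    matches the one of index n + 1 on the right, hence the reindexing by [succn]; the terms of index
    0 on the right cancel. *)
Lemma is_bessel_sin_dim e r v w v' : r != 0 -> is_bessel_cos e r v ->
  is_bessel_sin e r w -> is_bessel_sin e.+2 r v' ->
  v' = 2 * pi / r * (e.+1%:R / r * w - v).
Proof.
move=> r0 hv hw hv'; apply: (@complexI R).
have h := hsumZ (2 * pi / r)%:C (hsumB (hsumZ (e.+1%:R / r)%:C hw) hv).
rewrite -rmorphM -rmorphB -rmorphM in h.
have {}hv' := hsum_inj (f := succn) (g := fun i => if i is j.+1 then Some j else None)
  (c := fun i : nat => (2 * pi / r)%:C * ((e.+1%:R / r)%:C * (sin_coeff' r i * @sphere_moment R e i.+1)%:C -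
       (cos_coeff' r i * @sphere_moment R e i)%:C)) _ _ _ _ hv'.
apply: hsum_uniq _ h; apply: hv' => //; first by case.
- move=> n; rewrite -!rmorphM -rmorphB -rmorphM /=; congr (_%:C).
  rewrite sphere_moment_dim (sphere_momentS e n.+1) /cos_coeff' /sin_coeff' doubleS 2!factS !natrM !exprS.
  rewrite -!exprnP !exprS.
  have h1 : n.*2.+3%:R != 0 :> R by rewrite pnatr_eq0.
  have h2 : (n.*2.+2 + e).+1%:R != 0 :> R by rewrite pnatr_eq0.
  have h3 : n.*2`!%:R != 0 :> R by rewrite pnatr_eq0 -lt0n fact_gt0.
  have h4 : n.*2.+2%:R != 0 :> R by rewrite pnatr_eq0.
  have h5 : n.*2.+1%:R != 0 :> R by rewrite pnatr_eq0.
  have E (k : nat) : k.+1%:R = k%:R + 1 :> R by rewrite natr1.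
  rewrite !addSn !E in h1 h2 h4 h5 *; rewrite natrD in h2 *.
  by field; rewrite h3 r0 h1 h2 h4 h5.
- case=> // _; rewrite -!rmorphM -rmorphB -rmorphM /=.
  rewrite sphere_momentS /cos_coeff' /sin_coeff' /= !fact0 !expr0 !expr1.
  rewrite (_ : _ * _ = 0) //.
  have h2 : (0 + e).+1%:R != 0 :> R by rewrite pnatr_eq0.
  rewrite add0n in h2 *; rewrite -exprnP expr0 factS fact0.
  rewrite -[e.+1%:R]natr1 in h2 *. by field; rewrite r0 h2 double0 addr0 oner_eq0.
Qed.

Lemma gmom_even n : gmom n.*2 = 2 * half_moment n.*2 / Num.sqrt pi :> R.
Proof. by rewrite /gmom odd_double. Qed.

Lemma bessel1 r v : is_bessel_cos 0 r v -> v = 2 * cos r.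
Proof.
move=> hv; apply: (@complexI R); apply: (hsum_uniq hv).
have h : hsum (fun n => (cos_coeff' r n)%:C) (cos r)%:C.
  by apply: hsum_series; [exact: asum_cos_coeff|exact: cvg_cos_coeff'].
have := hsumZ 2%:C h; rewrite -rmorphM; apply: eq_hsum => n; rewrite -rmorphM /=; congr (_%:C).
rewrite mulrC; congr (_ * _); rewrite /sphere_moment addn0 expr1 gmom_even.
have h0 := lt0r_neq0 (@half_moment_gt0 R n.*2).
have h1 : Num.sqrt pi != 0 :> R by rewrite gt_eqF// sqrtr_gt0 pi_gt0.
by field; rewrite h1 h0.
Qed.

Lemma bessel1_sin r v : is_bessel_sin 0 r v -> v = 2 * sin r.
Proof.
move=> hv; apply: (@complexI R); apply: (hsum_uniq hv).
have h : hsum (fun n => (sin_coeff' r n)%:C) (sin r)%:C.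
  by apply: hsum_series; [exact: asum_sin_coeff|exact: cvg_sin_coeff'].
have := hsumZ 2%:C h; rewrite -rmorphM; apply: eq_hsum => n; rewrite -rmorphM /=; congr (_%:C).
rewrite mulrC; congr (_ * _); rewrite /sphere_moment addn0 expr1 gmom_even.
have h0 := lt0r_neq0 (@half_moment_gt0 R n.+1.*2).
have h1 : Num.sqrt pi != 0 :> R by rewrite gt_eqF// sqrtr_gt0 pi_gt0.
by field; rewrite h1 h0.
Qed.

(** The two expansions are carried together because the recurrences mix the cosine and the sine
    integrals. *)
Definition bessel_asymp e := exists2 C : R, 0 < C & forall r v w, 1 <= r ->
  is_bessel_cos e r v -> is_bessel_sin e r w ->
  `|v - 2 * (2 * pi / r) `^ (e%:R / 2) * cos (r - pi / 4 * e%:R)| <= C * r `^ (- (e%:R / 2 + 1)) /\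
  `|w - 2 * (2 * pi / r) `^ (e%:R / 2) * sin (r - pi / 4 * e%:R)| <= C * r `^ (- (e%:R / 2 + 1)).

Lemma bessel_asymp0 : bessel_asymp 0.
Proof.
exists 1 => // r v w r1 /bessel1 -> /bessel1_sin ->.
by rewrite mul0r mulr0 subr0 powRr0 mulr1 !subrr !normr0 mul1r powR_ge0.
Qed.

Hypothesis ex_bessel : forall e r, (exists v, is_bessel_cos e r v) /\ (exists w, is_bessel_sin e r w).

Lemma bessel_asymp_dim e : bessel_asymp e -> bessel_asymp e.+2.
Proof.
move=> [C C0 hC]; set a : R := e%:R / 2.
have p0 := pi_gt0 R; have p2 : 0 < 2 * pi :> R by lra.
set K := (2 * pi) `^ a.
have K0 : 0 < K by exact: powR_gt0.
have eS : e.+2%:R / 2 = a + 1 :> R by rewrite -addn2 natrD /a; field.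
(* The recurrences multiply the old remainders by 2 pi / r; the sine recurrence has the further term
   (e + 1) w / r, with |w| at most 2 K + C times r^(-a). *)
exists (2 * pi * (C + e.+1%:R * (2 * K + C))).
  have : 0 < e.+1%:R :> R by rewrite ltr0n.
  by move=> e0; rewrite !mulr_gt0// !addr_gt0// !mulr_gt0// addr_gt0// mulr_gt0.
move=> r v' w' r1 hv' hw'.
have r0 : 0 < r by lra.
have [[v hv] [w hw]] := ex_bessel e r.
have [H1 H2] := hC r v w r1 hv hw.
have rn0 : r != 0 by rewrite gt_eqF.
rewrite (is_bessel_cos_dim rn0 hw hv') (is_bessel_sin_dim rn0 hv hw hw').
have phE : r - pi / 4 * e.+2%:R = (r - pi / 4 * e%:R) - pi / 2.
  by rewrite -addn2 natrD; field.
rewrite phE eS -/a in H1 H2 *; set th := r - _ in H1 H2 *.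
have -> : cos (th - pi / 2) = sin th.
  by rewrite cosB cos_pihalf sin_pihalf mulr0 mulr1 add0r.
have -> : sin (th - pi / 2) = - cos th.
  by rewrite sinB cos_pihalf sin_pihalf mulr0 mulr1 add0r.
set u := r `^ (- a).
have u0 : 0 < u by exact: powR_gt0.
have E1 : r `^ (- (a + 1)) = u / r.
  by rewrite opprD powRD ?rn0 ?implybT// powR_inv1// ltW.
have E2 : r `^ (- (a + 1 + 1)) = u / r / r.
  by rewrite opprD powRD ?rn0 ?implybT// E1 powR_inv1// ltW.
have E3 : (2 * pi / r) `^ a = K * u.
  by rewrite powRM ?ltW ?invr_gt0// -powR_inv1 ?ltW// -powRrM mulN1r.
have E4 : (2 * pi / r) `^ (a + 1) = K * u * (2 * pi / r).
  have nz : 2 * pi / r != 0 by rewrite gt_eqF// divr_gt0.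
  rewrite powRD; last by rewrite nz implybT.
  by rewrite E3 powRr1// divr_ge0// ltW.
rewrite E1 E3 in H1 H2; rewrite E2 E4.
have ri : 0 < r^-1 by rewrite invr_gt0.
have pr : 0 < 2 * pi / r by rewrite divr_gt0.
have ru : 0 < u / r / r by rewrite !mulr_gt0.
have e0 : 0 < e.+1%:R :> R by rewrite ltr0n.
have Kp : 0 < 2 * K + C by lra.
split.
  rewrite (_ : _ - _ = (2 * pi / r) * (w - 2 * (K * u) * sin th)); last by ring.
  rewrite normrM (gtr0_norm pr).
  apply: (@le_trans _ _ ((2 * pi / r) * (C * (u / r)))); first by rewrite ler_pM2l.
  rewrite (_ : _ * (C * _) = 2 * pi * C * (u / r / r)); last by field.
  by rewrite ler_pM2r// ler_pM2l// lerDl mulr_ge0// ltW.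
have wB : `|w| <= (2 * K + C) * u.
  rewrite (_ : w = (w - 2 * (K * u) * sin th) + 2 * (K * u) * sin th); last by ring.
  apply: le_trans (ler_normD _ _) _.
  have -> : (2 * K + C) * u = C * u + 2 * K * u by ring.
  apply: lerD.
    apply: le_trans H2 _; rewrite ler_pM2l//.
    by apply: ler_piMr; [exact: ltW|rewrite invf_le1].
  rewrite normrM gtr0_norm; last by rewrite !mulr_gt0.
  rewrite mulrA ler_piMr ?ler_norml ?sin_geN1 ?sin_le1//.
  by rewrite !mulr_ge0// ltW.
rewrite (_ : _ - _ = (2 * pi / r) * (e.+1%:R / r * w - (v - 2 * (K * u) * cos th))); last by ring.
rewrite normrM (gtr0_norm pr).
rewrite (_ : _ * (u / r / r) = (2 * pi / r) * (C * (u / r) + e.+1%:R / r * ((2 * K + C) * u))); last by field.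
rewrite ler_pM2l//; apply: le_trans (ler_normB _ _) _; rewrite addrC; apply: lerD => //.
rewrite normrM gtr0_norm ?divr_gt0//.
by rewrite ler_pM2l// divr_gt0.
Qed.

End sphere_bessel.

(** * One-variable calculus *)

Section calculus.
Context {R : realType}.
Local Notation mu := (@lebesgue_measure R).

Lemma is_derive_continuous (f : R -> R) (x df : R) : is_derive x 1 f df -> {for x, continuous f}.
Proof.
by move=> h; apply/differentiable_continuous/derivable1_diffP; exact: ex_derive.
Qed.

Lemma is_derive_cos_comp (g : R -> R) (x dg : R) : is_derive x 1 g dg ->
  is_derive x 1 (fun y => cos (g y)) (- sin (g x) * dg).
Proof. by move=> h; exact: (is_derive1_comp (is_derive_cos (g x)) h). Qed.

Lemma is_derive_sin_comp (g : R -> R) (x dg : R) : is_derive x 1 g dg ->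
  is_derive x 1 (fun y => sin (g y)) (cos (g x) * dg).
Proof. by move=> h; exact: (is_derive1_comp (is_derive_sin (g x)) h). Qed.

Lemma is_derive_inv (g : R -> R) (x dg : R) : g x != 0 -> is_derive x 1 g dg ->
  is_derive x 1 (fun y => (g y)^-1) (- dg / g x ^+ 2).
Proof.
move=> g0 h; have h1 : derivable g x 1 by exact: ex_derive.
apply: DeriveDef; first exact: derivableV.
have e : 'D_1 g x = dg by exact: derive_val.
by rewrite deriveV// e /GRing.scale /= -exprVn mulNr mulrC mulNr.
Qed.

Lemma ftcR (f F : R -> R) (a b : R) : a <= b ->
  (forall x, a <= x <= b -> is_derive x 1 F (f x)) ->
  (forall x, a <= x <= b -> {for x, continuous f}) ->
  \int[mu]_(x in `[a, b]) f x = F b - F a.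
Proof.
move=> ab hF cf; move: ab; rewrite le_eqVlt => /predU1P[E|ab].
  by rewrite E set_itv1 Rintegral_set1 subrr.
have hc x : a <= x <= b -> {for x, continuous F}.
  by move=> /hF; exact: is_derive_continuous.
rewrite /Rintegral (@continuous_FTC2 _ f F)//.
- apply: continuous_in_subspaceT => x; rewrite inE /= in_itv /=; exact: cf.
- split.
  + by move=> x; rewrite in_itv/= => /andP[ax xb]; have h := hF x; rewrite (ltW ax) (ltW xb) in h; have {}h := h isT; exact: ex_derive.
  + by apply: cvg_at_right_filter; apply: hc; rewrite lexx ltW.
  + by apply: cvg_at_left_filter; apply: hc; rewrite lexx ltW.
- move=> x; rewrite in_itv/= => /andP[ax xb]; have h := hF x; rewrite (ltW ax) (ltW xb) in h; have {}h := h isT.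
  by rewrite derive1E; exact: derive_val.
Qed.

Lemma integrable_itv (f : R -> R) (a b : R) :
  (forall x, a <= x <= b -> {for x, continuous f}) ->
  mu.-integrable `[a, b] (EFin \o f).
Proof.
move=> cf; apply: continuous_compact_integrable; first exact: segment_compact.
by apply: continuous_in_subspaceT => x; rewrite inE /= in_itv /=; exact: cf.
Qed.

Lemma norm_int01 (f : R -> R) M : (forall x, 0 <= x <= 1 -> {for x, continuous f}) ->
  (forall x, 0 <= x <= 1 -> `|f x| <= M) -> `|\int[mu]_(x in `[0, 1]) f x| <= M.
Proof.
move=> cf fM; have fi := integrable_itv cf.
have mI : measurable (`[0, 1]%classic : set R) by [].
apply: le_trans (@le_normr_Rintegral _ (measurableTypeR R) R mu _ f mI fi) _.
apply: (@le_trans _ _ (\int[mu]_(x in `[0, 1]) (cst M x))).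
  apply: le_Rintegral => //.
  - by apply: (@eq_integrable _ (measurableTypeR R) R mu _ mI) (integrable_abse fi).
  - by apply: integrable_itv => x _; exact: cst_continuous.
rewrite (@Rintegral_cst _ (measurableTypeR R) R mu _ mI).
have /= -> := @lebesgue_measure_itv R `[0, 1].
by rewrite lte_fin ltr01 oppr0 adde0 mulr1.
Qed.

Lemma bounded01 (f : R -> R) : (forall x, 0 <= x <= 1 -> {for x, continuous f}) ->
  exists2 M, 0 <= M & forall x, 0 <= x <= 1 -> `|f x| <= M.
Proof.
move=> cf.
have cf' : {within `[0, 1], continuous f}.
  by apply: continuous_in_subspaceT => x; rewrite inE /= in_itv /=; exact: cf.
have [c _ hc] := EVT_max ler01 cf'; have [c' _ hc'] := EVT_min ler01 cf'.
exists (`|f c| + `|f c'|); first exact: addr_ge0.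
move=> x x01; have h1 := hc x; have h2 := hc' x; rewrite in_itv/= x01 in h1 h2.
have {}h1 := h1 isT; have {}h2 := h2 isT.
have := ler_norm (f c); have := ler_norm (- f c'); rewrite normrN.
have := normr_ge0 (f c); have := normr_ge0 (f c').
by rewrite ler_norml; lra.
Qed.

Lemma is_derive_int01 (g g' : R -> R -> R) (a M : R) :
  (forall T v : R, is_derive T 1 (g ^~ v) (g' T v)) ->
  (forall T v, 0 <= v <= 1 -> {for v, continuous (g T)}) ->
  (forall T v, a - 1 < T < a + 1 -> 0 <= v <= 1 -> `|g' T v| <= M) ->
  is_derive a 1 (fun T => \int[mu]_(v in `[0, 1]) g T v) (\int[mu]_(v in `[0, 1]) g' a v).
Proof.
move=> hg cg hM.
have mI : measurable (`[0, 1]%classic : set R) by [].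
have Ia : (`](a - 1), (a + 1)[%classic : set R) a.
  by rewrite /= in_itv/= ltrBlDr ltrDl ltr01.
have E T v : partial1of2 g T v = g' T v.
  by rewrite partial1of2E; have h := hg T v; exact: derive_val.
have M0 : 0 <= M.
  have := hM a 0; rewrite lexx ler01 ltrBlDr ltrDl ltr01 => /(_ isT isT).
  exact: le_trans.
have hi x : (`](a - 1), (a + 1)[%classic : set R) x -> mu.-integrable `[0, 1] (EFin \o g x).
  by move=> _; apply: integrable_itv => v; exact: cg.
have hd x y : (`](a - 1), (a + 1)[%classic : set R) x -> (`[0, 1]%classic : set R) y ->
    derivable (g ^~ y) x 1.
  by move=> _ _; have h := hg x y; exact: ex_derive.
have hG : mu.-integrable `[0, 1] (EFin \o (fun _ : R => M)).
  by apply: integrable_itv => x _; exact: cst_continuous.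
have hub x y : (`](a - 1), (a + 1)[%classic : set R) x -> (`[0, 1]%classic : set R) y ->
    `|partial1of2 g x y| <= M.
  by rewrite /= !in_itv/= E; exact: hM.
have HD := @derivable_under_integral R _ (measurableTypeR R) mu g _ mI a _ _ Ia hi hd (fun=> M) (fun _ => M0) hG hub.
have HV := @differentiation_under_integral R _ (measurableTypeR R) mu g _ mI a _ _ Ia hi hd (fun=> M) (fun _ => M0) hG hub.
apply: DeriveDef => //; rewrite -derive1E HV.
by apply: eq_Rintegral => v _; rewrite E.
Qed.

Lemma const_is_derive0 (f : R -> R) (x y : R) : (forall z : R, is_derive z 1 f 0) -> f x = f y.
Proof. exact: is_derive_0_is_cst. Qed.

Lemma deriv_le (f g : R -> R) (df dg : R -> R) (a b : R) : a <= b ->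
  (forall x, a <= x <= b -> is_derive x 1 f (df x)) ->
  (forall x, a <= x <= b -> is_derive x 1 g (dg x)) ->
  (forall x, a <= x <= b -> df x <= dg x) -> f b - f a <= g b - g a.
Proof.
rewrite le_eqVlt => /predU1P[->|ab] hf hg hle; first by rewrite !subrr.
have hd x : a <= x <= b -> is_derive x 1 (fun y => g y - f y) (dg x - df x).
  by move=> xab; have h1 := hf x xab; have h2 := hg x xab; exact: is_deriveB.
have [||c] := @MVT _ (fun y => g y - f y) (fun x => dg x - df x) a b ab.
- by move=> x; rewrite in_itv/= => /andP[ax xb]; apply: hd; rewrite !ltW.
- apply: continuous_in_subspaceT => x; rewrite inE /= in_itv /= => /hd.
  exact: is_derive_continuous.
rewrite in_itv/= => /andP[ac cb] E.
have h := hle c; rewrite (ltW ac) (ltW cb) in h; have {}h := h isT.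
have : 0 <= (dg c - df c) * (b - a) by rewrite mulr_ge0 ?subr_ge0// ltW.
by rewrite -E; lra.
Qed.

Lemma sin_lip (x y : R) : `|sin x - sin y| <= `|x - y|.
Proof.
wlog xy : x y / y <= x.
  by move=> h; have /orP[/h//|/h h2] := le_total y x; rewrite [leLHS]distrC [leRHS]distrC.
rewrite (ger0_norm (x := x - y)) ?subr_ge0// ler_norml; apply/andP; split.
- have := @deriv_le (fun z => - sin z) id (fun z => - cos z) (fun=> 1) y x xy.
  have h1 (z : R) : y <= z <= x -> is_derive z 1 (fun z => - sin z) (- cos z).
    by move=> _; exact: is_deriveN.
  have h3 (z : R) : y <= z <= x -> - cos z <= 1 by move=> _; rewrite lerNl cos_geN1.
  by move=> /(_ h1 (fun z _ => is_derive_id z 1) h3); lra.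
- have := @deriv_le sin id cos (fun=> 1) y x xy.
  move=> /(_ (fun z _ => is_derive_sin z) (fun z _ => is_derive_id z 1)) h.
  by apply: h => z _; exact: cos_le1.
Qed.

Lemma cos_lip (x y : R) : `|cos x - cos y| <= `|x - y|.
Proof.
have E (z : R) : cos z = sin (z + pi / 2) by rewrite sinD cos_pihalf sin_pihalf mulr0 mulr1 add0r.
rewrite !E; apply: le_trans (sin_lip _ _) _.
by rewrite (_ : _ - _ = x - y)//; ring.
Qed.

Lemma cos_ge_quad (x : R) : 1 - x ^+ 2 / 2 <= cos x.
Proof.
have -> : cos x = 1 - 2 * sin (x / 2) ^+ 2.
  rewrite -{1}[x](_ : x / 2 + x / 2 = x); last by field.
  by rewrite cosD -!expr2 cos2sin2; ring.
have := sin_lip (x / 2) 0; rewrite sin0 !subr0 => h.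
have : sin (x / 2) ^+ 2 <= (x / 2) ^+ 2.
  by rewrite -real_normK ?num_real// -[leRHS]real_normK ?num_real// lerXn2r ?nnegrE.
by rewrite expr_div_n => h2; nra.
Qed.

End calculus.

(** * Fresnel integrals *)

Section fresnel.
Context {R : realType}.
Local Notation mu := (@lebesgue_measure R).

Lemma eq_is_derive (f g : R -> R) (x df : R) : f =1 g -> is_derive x 1 f df -> is_derive x 1 g df.
Proof. by move=> /funext ->. Qed.

Lemma is_derive_quad (a b x : R) : is_derive x 1 (fun y : R => a * y ^+ 2 + b) (2 * a * x).
Proof. by apply: is_derive_eq; rewrite /GRing.scale /=; ring. Qed.

Lemma is_derive_quad' (a b x : R) : is_derive x 1 (fun y : R => y ^+ 2 * a + b) (2 * a * x).
Proof. by apply: (eq_is_derive _ (is_derive_quad a b x)) => y; rewrite mulrC. Qed.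

Lemma is_deriveM1 (f g : R -> R) (x df dg : R) : is_derive x 1 f df -> is_derive x 1 g dg ->
  is_derive x 1 (fun y => f y * g y) (f x * dg + g x * df).
Proof. by move=> h1 h2; exact: is_deriveM. Qed.

Lemma is_deriveD1 (f g : R -> R) (x df dg : R) : is_derive x 1 f df -> is_derive x 1 g dg ->
  is_derive x 1 (fun y => f y + g y) (df + dg).
Proof. by move=> h1 h2; exact: is_deriveD. Qed.

Lemma is_deriveZ1 (c : R) (f : R -> R) (x df : R) : is_derive x 1 f df ->
  is_derive x 1 (fun y => c * f y) (c * df).
Proof. by move=> h; exact: is_deriveZ. Qed.

Lemma is_deriveX1 (n : nat) (x : R) : is_derive x 1 (fun y : R => y ^+ n.+1) (n.+1%:R * x ^+ n).
Proof.
apply: DeriveDef; first exact: exprn_derivable.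
by have := @exp_derive _ n.+1 x 1; rewrite /= scaler1.
Qed.

Lemma is_derive_const (c x : R) : is_derive x 1 (fun _ : R => c) 0.
Proof. exact: is_derive_cst. Qed.

Lemma is_derive_id1 (x : R) : is_derive x 1 (fun y : R => y) 1.
Proof. exact: is_derive_id. Qed.

(* The Fresnel integral int_0^T cos(x^2 + al) dx, rescaled to [0, 1] so as to be
   differentiable in T at every point. *)
Definition fresnel (al T : R) : R := T * \int[mu]_(v in `[0, 1]) cos (T ^+ 2 * v ^+ 2 + al).

Let cont_quad (f : R -> R) (a b x : R) : continuous f ->
  {for x, continuous (fun y : R => f (a * y ^+ 2 + b))}.
Proof.
move=> cf; apply: (continuous_comp (f := fun y : R => a * y ^+ 2 + b)); last exact: cf.
exact: (is_derive_continuous (is_derive_quad a b x)).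
Qed.

Lemma fresnel0 al : fresnel al 0 = 0.
Proof. by rewrite /fresnel mul0r. Qed.

Lemma is_derive_fresnel (al T : R) : is_derive T 1 (fresnel al) (cos (T ^+ 2 + al)).
Proof.
have h : is_derive T 1 (fun T : R => \int[mu]_(v in `[0, 1]) cos (T ^+ 2 * v ^+ 2 + al))
    (\int[mu]_(v in `[0, 1]) (- sin (T ^+ 2 * v ^+ 2 + al) * (2 * v ^+ 2 * T))).
  apply: (@is_derive_int01 _ (fun T v => cos (T ^+ 2 * v ^+ 2 + al))
    (fun T v => - sin (T ^+ 2 * v ^+ 2 + al) * (2 * v ^+ 2 * T)) T (2 * (`|T| + 1))).
  - move=> S v; apply: is_derive_cos_comp; exact: is_derive_quad'.
  - by move=> S v _; apply: cont_quad; exact: continuous_cos.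
  - move=> S v /andP[S1 S2] /andP[v0 v1].
    rewrite normrM normrN -[leRHS]mul1r; apply: ler_pM => //.
      by rewrite ler_norml sin_geN1 sin_le1.
    have v2 : `|v ^+ 2| <= 1 by rewrite normrX ger0_norm// exprn_ile1.
    rewrite 2!normrM (ger0_norm (x := 2))// -mulrA ler_pM2l//.
    rewrite -[leRHS]mul1r; apply: ler_pM => //.
    by rewrite ler_norml; have := ler_norm T; have := ler_norm (- T); rewrite normrN; lra.
apply: is_derive_eq (is_deriveM1 (is_derive_id1 T) h) _; rewrite mulr1.
have c1 (v : R) : {for v, continuous (fun v : R => T * (- sin (T ^+ 2 * v ^+ 2 + al) * (2 * v ^+ 2 * T)))}.
  apply: cvgM; first exact: cvg_cst.
  apply: cvgM; first by apply: cvgN; apply: cont_quad; exact: continuous_sin.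
  apply: cvgM; last exact: cvg_cst.
  by apply: cvgM; [exact: cvg_cst|exact: exprn_continuous].
have c2 (v : R) : {for v, continuous (fun v : R => - sin (T ^+ 2 * v ^+ 2 + al) * (2 * v ^+ 2 * T))}.
  apply: cvgM; first by apply: cvgN; apply: cont_quad; exact: continuous_sin.
  apply: cvgM; last exact: cvg_cst.
  by apply: cvgM; [exact: cvg_cst|exact: exprn_continuous].
have c3 (v : R) : {for v, continuous (fun v : R => cos (T ^+ 2 * v ^+ 2 + al))}.
  by apply: cont_quad; exact: continuous_cos.
rewrite -(@RintegralZl _ (measurableTypeR R) R mu)//; last by apply: integrable_itv => v _; exact: c2.
rewrite -(@RintegralD _ (measurableTypeR R) R mu)//; [|by apply: integrable_itv => v _; exact: c1
  |by apply: integrable_itv => v _; exact: c3].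
(* The integrand is the derivative in v of v cos(T^2 v^2 + al). *)
transitivity (1 * cos (T ^+ 2 * 1 ^+ 2 + al) - 0 * cos (T ^+ 2 * 0 ^+ 2 + al)); last first.
  by rewrite mul0r subr0 mul1r expr1n mulr1.
apply: (@ftcR R _ (fun v => v * cos (T ^+ 2 * v ^+ 2 + al))) => [|v _|v _].
- exact: ler01.
- apply: is_derive_eq (is_deriveM1 (is_derive_id1 v)
    (is_derive_cos_comp (is_derive_quad (T ^+ 2) al v))) _; ring.
- by apply: cvgD; [exact: c1|exact: c3].
Qed.

Let oneDsq_gt0 (v : R) : 0 < 1 + v ^+ 2.
Proof. by have := sqr_ge0 v; lra. Qed.

Let cont_w (v : R) : {for v, continuous (fun v : R => (1 + v ^+ 2)^-1)}.
Proof.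
apply: cvgV; first by rewrite gt_eqF.
by apply: cvgD; [exact: cvg_cst|exact: exprn_continuous].
Qed.

(* Its derivative in T shows that it is a combination of products of two Fresnel integrals. *)
Definition fresnel_prod (be T : R) : R :=
  \int[mu]_(v in `[0, 1]) (sin (T ^+ 2 * (1 + v ^+ 2) + be) * (1 + v ^+ 2)^-1).

Let cont_p (f : R -> R) (a be v : R) : continuous f ->
  {for v, continuous (fun v : R => f (a * (1 + v ^+ 2) + be))}.
Proof.
move=> cf; rewrite (_ : (fun v => _) = (fun v => f (a * v ^+ 2 + (a + be)))); last first.
  by apply/funext => x; congr f; ring.
exact: cont_quad.
Qed.

Lemma is_derive_fresnel_prod (be T : R) : is_derive T 1 (fresnel_prod be)
  (2 * (cos (T ^+ 2 + be) * fresnel 0 T - sin (T ^+ 2 + be) * fresnel (- (pi / 2)) T)).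
Proof.
have h : is_derive T 1 (fresnel_prod be)
    (\int[mu]_(v in `[0, 1]) (cos (T ^+ 2 * (1 + v ^+ 2) + be) * (2 * T))).
  apply: (@is_derive_int01 _ (fun T v => sin (T ^+ 2 * (1 + v ^+ 2) + be) * (1 + v ^+ 2)^-1)
    (fun T v => cos (T ^+ 2 * (1 + v ^+ 2) + be) * (2 * T)) T (2 * (`|T| + 1))).
  - move=> S v; have := is_derive_sin_comp (is_derive_quad' (1 + v ^+ 2) be S).
    move=> /(is_deriveZ1 (1 + v ^+ 2)^-1) h.
    have {}h := eq_is_derive (fun y => mulrC _ _) h.
    apply: is_derive_eq h _.
    have := lt0r_neq0 (oneDsq_gt0 v) => h0; by field.
  - by move=> S v _; apply: cvgM; [apply: cont_p; exact: continuous_sin|exact: cont_w].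
  - move=> S v /andP[S1 S2] _.
    rewrite normrM -[leRHS]mul1r; apply: ler_pM => //.
      by rewrite ler_norml cos_geN1 cos_le1.
    rewrite normrM (ger0_norm (x := 2))// ler_pM2l//.
    by rewrite ler_norml; have := ler_norm T; have := ler_norm (- T); rewrite normrN; lra.
apply: is_derive_eq h _.
have c3 al (v : R) : {for v, continuous (fun v : R => cos (T ^+ 2 * v ^+ 2 + al))}.
  by apply: cont_quad; exact: continuous_cos.
have i3 al : mu.-integrable `[0, 1] (EFin \o (fun v => cos (T ^+ 2 * v ^+ 2 + al))).
  by apply: integrable_itv => v _; exact: c3.
have i4 al k : mu.-integrable `[0, 1] (EFin \o (fun v => k * cos (T ^+ 2 * v ^+ 2 + al))).
  by apply: integrable_itv => v _; apply: cvgM; [exact: cvg_cst|exact: c3].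
transitivity (\int[mu]_(v in `[0, 1]) (2 * T * cos (T ^+ 2 + be) * cos (T ^+ 2 * v ^+ 2 + 0) -
   2 * T * sin (T ^+ 2 + be) * cos (T ^+ 2 * v ^+ 2 + - (pi / 2)))).
  apply: eq_Rintegral => v _.
  have -> : cos (T ^+ 2 * v ^+ 2 + - (pi / 2)) = sin (T ^+ 2 * v ^+ 2).
    by rewrite cosB cos_pihalf sin_pihalf mulr0 mulr1 add0r.
  rewrite addr0 (_ : T ^+ 2 * (1 + v ^+ 2) + be = (T ^+ 2 + be) + T ^+ 2 * v ^+ 2); last by ring.
  by rewrite cosD; ring.
rewrite (@RintegralB _ (measurableTypeR R) R mu)//; try exact: i4.
rewrite (@RintegralZl _ (measurableTypeR R) R mu)//; try exact: i3.
rewrite (@RintegralZl _ (measurableTypeR R) R mu)//; try exact: i3.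
by rewrite /fresnel; ring.
Qed.

(** The phase - pi / 2 gives the sine Fresnel integral. Both sides vanish at 0 and have the same
    derivative; this is the real part of the square of the complex Fresnel integral, and the next
    lemma is its imaginary part. *)
Lemma fresnel_sqr T : fresnel 0 T ^+ 2 - fresnel (- (pi / 2)) T ^+ 2 = fresnel_prod 0 T.
Proof.
pose f T := fresnel 0 T * fresnel 0 T +
  (-1) * (fresnel (- (pi / 2)) T * fresnel (- (pi / 2)) T) + (-1) * fresnel_prod 0 T.
have h : forall z : R, is_derive z 1 f 0.
  move=> z.
  have h1 := is_derive_fresnel 0 z; have h2 := is_derive_fresnel (- (pi / 2)) z.
  have h3 := is_deriveD1 (is_deriveD1 (is_deriveM1 h1 h1) (is_deriveZ1 (-1) (is_deriveM1 h2 h2)))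
     (is_deriveZ1 (-1) (is_derive_fresnel_prod 0 z)).
  apply: is_derive_eq h3 _.
  have -> : cos (z ^+ 2 + - (pi / 2)) = sin (z ^+ 2).
    by rewrite cosB cos_pihalf sin_pihalf mulr0 mulr1 add0r.
  by rewrite addr0; ring.
have := const_is_derive0 T 0 h; rewrite /f !fresnel0.
have -> : fresnel_prod 0 0 = 0.
  rewrite /fresnel_prod; under eq_Rintegral do rewrite expr0n mul0r addr0 sin0 mul0r.
  by rewrite /Rintegral integral0.
by rewrite !expr2; lra.
Qed.

(** Equal derivatives again; the constant pi / 4 is minus the value of [fresnel_prod] at 0, the
    integral of 1 / (1 + v^2) over [0, 1]. *)
Lemma fresnel_mul T : 2 * fresnel 0 T * fresnel (- (pi / 2)) T =
  pi / 4 + fresnel_prod (- (pi / 2)) T.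
Proof.
pose f T := 2 * (fresnel 0 T * fresnel (- (pi / 2)) T) + (-1) * fresnel_prod (- (pi / 2)) T.
have h : forall z : R, is_derive z 1 f 0.
  move=> z.
  have h1 := is_derive_fresnel 0 z; have h2 := is_derive_fresnel (- (pi / 2)) z.
  have h3 := is_deriveD1 (is_deriveZ1 2 (is_deriveM1 h1 h2))
     (is_deriveZ1 (-1) (is_derive_fresnel_prod (- (pi / 2)) z)).
  apply: is_derive_eq h3 _.
  have -> : cos (z ^+ 2 + - (pi / 2)) = sin (z ^+ 2).
    by rewrite cosB cos_pihalf sin_pihalf mulr0 mulr1 add0r.
  have -> : sin (z ^+ 2 + - (pi / 2)) = - cos (z ^+ 2).
    by rewrite sinB cos_pihalf sin_pihalf mulr0 mulr1 add0r.
  by rewrite addr0; ring.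
have := const_is_derive0 T 0 h; rewrite /f !fresnel0.
have -> : fresnel_prod (- (pi / 2)) 0 = - (pi / 4).
  have hw : mu.-integrable `[0, 1] (EFin \o (fun v : R => (1 + v ^+ 2)^-1)).
    by apply: integrable_itv => v _; exact: cont_w.
  have mI : measurable (`[0, 1]%classic : set R) by [].
  have E : \int[mu]_(v in `[0, 1]) ((-1) * (1 + v ^+ 2)^-1) =
      (-1) * \int[mu]_(v in `[0, 1]) (1 + v ^+ 2)^-1.
    by rewrite (@RintegralZl _ (measurableTypeR R) R mu).
  rewrite -atan1 -integral0_oneDsqr//.
  transitivity ((-1) * \int[mu]_(v in `[0, 1]) (1 + v ^+ 2)^-1); last by rewrite mulN1r.
  rewrite -E.
  by apply: eq_Rintegral => v _; rewrite expr0n mul0r add0r sinN sin_pihalf.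
by lra.
Qed.

Lemma fresnel_prod_le1 be T : `|fresnel_prod be T| <= 1.
Proof.
apply: norm_int01 => x /andP[x0 x1].
  by apply: cvgM; [apply: cont_p; exact: continuous_sin|exact: cont_w].
rewrite normrM -[leRHS]mul1r; apply: ler_pM => //.
  by rewrite ler_norml sin_geN1 sin_le1.
rewrite normfV gtr0_norm// invf_le1//.
by have := sqr_ge0 x; lra.
Qed.

Lemma fresnel_cos al T :
  fresnel al T = cos al * fresnel 0 T - sin al * fresnel (- (pi / 2)) T.
Proof.
have c3 al' (v : R) : {for v, continuous (fun v : R => cos (T ^+ 2 * v ^+ 2 + al'))}.
  by apply: cont_quad; exact: continuous_cos.
have i3 al' : mu.-integrable `[0, 1] (EFin \o (fun v => cos (T ^+ 2 * v ^+ 2 + al'))).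
  by apply: integrable_itv => v _; exact: c3.
have i4 al' k : mu.-integrable `[0, 1] (EFin \o (fun v => k * cos (T ^+ 2 * v ^+ 2 + al'))).
  by apply: integrable_itv => v _; apply: cvgM; [exact: cvg_cst|exact: c3].
rewrite /fresnel [in LHS](_ : Rintegral _ _ _ = \int[mu]_(v in `[0, 1])
  (cos al * cos (T ^+ 2 * v ^+ 2 + 0) - sin al * cos (T ^+ 2 * v ^+ 2 + - (pi / 2)))).
  rewrite (@RintegralB _ (measurableTypeR R) R mu)//; try exact: i4.
  rewrite (@RintegralZl _ (measurableTypeR R) R mu)//; try exact: i3.
  rewrite (@RintegralZl _ (measurableTypeR R) R mu)//; try exact: i3.
  by ring.
apply: eq_Rintegral => v _.
have -> : cos (T ^+ 2 * v ^+ 2 + - (pi / 2)) = sin (T ^+ 2 * v ^+ 2).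
  by rewrite cosB cos_pihalf sin_pihalf mulr0 mulr1 add0r.
by rewrite addr0 cosD; ring.
Qed.

(** For the cosine and sine integrals a and b, |a^2 - b^2| <= 1 and |2 a b| <= pi / 4 + 1 <= 2
    exclude a^2 > 4 or b^2 > 4: both squares would exceed 3, but a^2 b^2 <= 1. *)
Lemma fresnel_bounded al T : `|fresnel al T| <= 4.
Proof.
have h1 := fresnel_prod_le1 0 T; have h2 := fresnel_prod_le1 (- (pi / 2)) T.
have h3 := fresnel_mul T; rewrite -fresnel_sqr in h1.
have hp : pi < 4 :> R by have /andP[_] := @pihalf_02 R; lra.
set a := fresnel 0 T in h1 h3 *; set b := fresnel (- (pi / 2)) T in h1 h3 *.
have ab : `|2 * a * b| <= 2.
  rewrite h3; apply: le_trans (ler_normD _ _) _.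
  by rewrite gtr0_norm ?divr_gt0 ?pi_gt0//; lra.
have : a ^+ 2 <= 4 /\ b ^+ 2 <= 4.
  have ab1 : a ^+ 2 * b ^+ 2 <= 1.
    by rewrite -exprMn; move: ab; rewrite ler_norml => /andP[? ?]; nra.
  have A0 := sqr_ge0 a; have B0 := sqr_ge0 b.
  move: h1 ab1 A0 B0; rewrite ler_norml => /andP[].
  move: (a ^+ 2) (b ^+ 2) => A B g1 g2 g3 A0 B0.
  by split; rewrite leNgt; apply/negP => g4; nra.
move=> [a4 b4]; rewrite fresnel_cos -/a -/b.
have sq (x : R) : x ^+ 2 <= 4 -> `|x| <= 2.
  by move=> h; rewrite ler_norml; apply/andP; split; nra.
apply: le_trans (ler_normB _ _) _; rewrite (normrM (cos al)) (normrM (sin al)).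
have := sq _ a4; have := sq _ b4.
have hc : `|cos al| <= 1 by rewrite ler_norml cos_geN1 cos_le1.
have hs : `|sin al| <= 1 by rewrite ler_norml sin_geN1 sin_le1.
move=> hb ha.
have := ler_pM (normr_ge0 _) (normr_ge0 _) hc ha.
have := ler_pM (normr_ge0 _) (normr_ge0 _) hs hb.
by lra.
Qed.

End fresnel.

(** * Asymptotics of Fresnel integrals *)

Section fresnel_asymptotics.
Context {R : realType}.
Local Notation mu := (@lebesgue_measure R).

Let cont_quad (f : R -> R) (a b x : R) : continuous f ->
  {for x, continuous (fun y : R => f (a * y ^+ 2 + b))}.
Proof.
move=> cf; apply: (continuous_comp (f := fun y : R => a * y ^+ 2 + b)); last exact: cf.
exact: (is_derive_continuous (is_derive_quad a b x)).
Qed.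

Lemma int_by_parts01 (u v u' v' : R -> R) :
  (forall x : R, 0 <= x <= 1 -> is_derive x 1 u (u' x)) ->
  (forall x : R, 0 <= x <= 1 -> is_derive x 1 v (v' x)) ->
  (forall x : R, 0 <= x <= 1 -> {for x, continuous u'}) ->
  (forall x : R, 0 <= x <= 1 -> {for x, continuous v'}) ->
  \int[mu]_(x in `[0, 1]) (u' x * v x) =
  u 1 * v 1 - u 0 * v 0 - \int[mu]_(x in `[0, 1]) (u x * v' x).
Proof.
move=> hu hv cu' cv'.
have cu (x : R) : 0 <= x <= 1 -> {for x, continuous u} by move/hu/is_derive_continuous.
have cv (x : R) : 0 <= x <= 1 -> {for x, continuous v} by move/hv/is_derive_continuous.
have c1 (x : R) : 0 <= x <= 1 -> {for x, continuous (fun x => u' x * v x)}.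
  by move=> h; apply: cvgM; [exact: cu'|exact: cv].
have c2 (x : R) : 0 <= x <= 1 -> {for x, continuous (fun x => u x * v' x)}.
  by move=> h; apply: cvgM; [exact: cu|exact: cv'].
have i1 := integrable_itv c1; have i2 := integrable_itv c2.
have mI : measurable (`[0, 1]%classic : set R) by [].
have hd (x : R) : 0 <= x <= 1 -> is_derive x 1 (fun x => u x * v x) (u' x * v x + u x * v' x).
  by move=> h; apply: is_derive_eq (is_deriveM1 (hu x h) (hv x h)) _; ring.
have hc (x : R) : 0 <= x <= 1 -> {for x, continuous (fun x => u' x * v x + u x * v' x)}.
  by move=> h; apply: cvgD; [exact: c1|exact: c2].
have := ftcR ler01 hd hc.
by rewrite (@RintegralD _ (measurableTypeR R) R mu)// => <-; rewrite addrK.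
Qed.

Lemma is_derive_fresnel_scale (al T x : R) : T != 0 ->
  is_derive x 1 (fun x : R => T^-1 * fresnel al (T * x)) (cos (T ^+ 2 * x ^+ 2 + al)).
Proof.
move=> T0.
have h0 : is_derive x 1 (fun x : R => T * x) T.
  by apply: is_derive_eq (is_deriveZ1 T (is_derive_id1 x)) _; rewrite mulr1.
have h := is_derive1_comp (is_derive_fresnel al (T * x)) h0.
apply: is_derive_eq (is_deriveZ1 T^-1 h) _.
by rewrite exprMn mulrC mulfK.
Qed.

(* van der Corput, by parts against the bounded Fresnel integral *)
Lemma fresnel_amplitude (al T M : R) (g g' : R -> R) : 0 < T ->
  (forall x : R, 0 <= x <= 1 -> is_derive x 1 g (g' x)) ->
  (forall x : R, 0 <= x <= 1 -> {for x, continuous g'}) ->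
  `|g 1| <= M -> (forall x : R, 0 <= x <= 1 -> `|g' x| <= M) ->
  `|\int[mu]_(x in `[0, 1]) (cos (T ^+ 2 * x ^+ 2 + al) * g x)| <= 8 * M / T.
Proof.
move=> T0 hg cg' gM g'M; have T0' := lt0r_neq0 T0.
have Ti : 0 < T^-1 by rewrite invr_gt0.
pose H x := T^-1 * fresnel al (T * x).
have hH (x : R) : is_derive x 1 H (cos (T ^+ 2 * x ^+ 2 + al)) by exact: is_derive_fresnel_scale.
have cH (x : R) : {for x, continuous H} by exact: is_derive_continuous (hH x).
have HT x : `|H x| <= 4 * T^-1.
  by rewrite normrM gtr0_norm// mulrC ler_pM2r// fresnel_bounded.
have := @int_by_parts01 H g (fun x => cos (T ^+ 2 * x ^+ 2 + al)) g'.
move=> /(_ (fun x _ => hH x) hg (fun x _ => @cont_quad cos (T ^+ 2) al x (@continuous_cos R)) cg') ->.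
have -> : H 0 = 0 by rewrite /H mulr0 fresnel0 mulr0.
rewrite mul0r subr0; apply: le_trans (ler_normB _ _) _.
have h2 : `|\int[mu]_(x in `[0, 1]) (H x * g' x)| <= 4 * T^-1 * M.
  apply: norm_int01 => x h; first by apply: cvgM; [exact: cH|exact: cg'].
  by rewrite normrM; apply: ler_pM => //; exact: g'M.
have h1 : `|H 1 * g 1| <= 4 * T^-1 * M by rewrite normrM; apply: ler_pM.
by lra.
Qed.

(** [fresnel_prod] is itself a Fresnel integral, with phase T^2 + be - pi / 2 and amplitude 1 / (1 +
    v^2), which together with its derivative is bounded by 2. *)
Lemma fresnel_prod_le (be T : R) : 0 < T -> `|fresnel_prod be T| <= 16 / T.
Proof.
move=> T0.
have w0 (v : R) : 0 < 1 + v ^+ 2 by have := sqr_ge0 v; lra.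
have h (x : R) : is_derive x 1 (fun v : R => (1 + v ^+ 2)^-1) (- (2 * x) / (1 + x ^+ 2) ^+ 2).
  apply: is_derive_inv; first exact: lt0r_neq0.
  by apply: is_derive_eq (is_deriveD1 (is_derive_const 1 x) (is_deriveX1 1 x)) _; rewrite expr1 add0r.
have := @fresnel_amplitude (T ^+ 2 + be - pi / 2) T 2 (fun v => (1 + v ^+ 2)^-1)
  (fun x => - (2 * x) / (1 + x ^+ 2) ^+ 2) T0 (fun x _ => h x).
have -> : \int[mu]_(x in `[0, 1])
    (cos (T ^+ 2 * x ^+ 2 + (T ^+ 2 + be - pi / 2)) * (1 + x ^+ 2)^-1) = fresnel_prod be T.
  apply: eq_Rintegral => v _; congr (_ * _).
  rewrite (_ : _ + _ = (T ^+ 2 * (1 + v ^+ 2) + be) - pi / 2); last by ring.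
  by rewrite cosB cos_pihalf sin_pihalf mulr0 mulr1 add0r.
rewrite (_ : 8 * 2 = 16 :> R); last by ring.
apply.
- move=> x _; apply: cvgM.
    by apply: cvgN; apply: cvgM; [exact: cvg_cst|exact: cvg_id].
  apply: cvgV; first by rewrite expf_neq0// lt0r_neq0.
  apply: (continuous_comp (f := fun y : R => 1 + y ^+ 2) (g := fun y : R => y ^+ 2)); last exact: exprn_continuous.
  by apply: cvgD; [exact: cvg_cst|exact: exprn_continuous].
- rewrite expr1n ger0_norm ?invr_ge0; last lra.
  by apply: (@le_trans _ _ 1); [rewrite invf_le1; lra|lra].
- move=> x /andP[x0 x1]; rewrite normrM normrN normfV.
  have w2 : 0 < (1 + x ^+ 2) ^+ 2 by rewrite exprn_gt0.
  rewrite (gtr0_norm w2) ler_pdivrMr// ger0_norm ?mulr_ge0//.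
  by have := sqr_ge0 x; have := sqr_ge0 (x ^+ 2); nra.
Qed.

(** The boundary terms of two integrations by parts of the tail beyond T are removed; what is left
    has derivative O(T^(-4)), hence a limit, reached with error O(T^(-3)). *)
Definition fresnel_corr (al T : R) : R :=
  fresnel al T - sin (T ^+ 2 + al) / (2 * T) + cos (T ^+ 2 + al) / (4 * T ^+ 3).

Lemma is_derive_fresnel_corr (al T : R) : 0 < T ->
  is_derive T 1 (fresnel_corr al) (- (3 / 4) * cos (T ^+ 2 + al) / T ^+ 4).
Proof.
move=> T0; have T0' := lt0r_neq0 T0.
have hq : is_derive T 1 (fun T : R => T ^+ 2 + al) (2 * T).
  by apply: is_derive_eq (is_deriveD1 (is_deriveX1 1 T) (is_derive_const al T)) _; rewrite expr1 addr0.
have h1 : is_derive T 1 (fun T : R => (2 * T)^-1) (- 2 / (2 * T) ^+ 2).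
  apply: is_derive_inv; first by rewrite mulf_neq0.
  by apply: is_derive_eq (is_deriveZ1 2 (is_derive_id1 T)) _; rewrite mulr1.
have h3 : is_derive T 1 (fun T : R => (4 * T ^+ 3)^-1) (- (12 * T ^+ 2) / (4 * T ^+ 3) ^+ 2).
  apply: is_derive_inv; first by rewrite mulf_neq0// expf_neq0.
  by apply: is_derive_eq (is_deriveZ1 4 (is_deriveX1 2 T)) _; ring.
have hs := is_deriveM1 (is_derive_sin_comp hq) h1.
have hc := is_deriveM1 (is_derive_cos_comp hq) h3.
have h := is_deriveD1 (is_deriveD1 (is_derive_fresnel al T) (is_deriveZ1 (-1) hs)) hc.
have {}h := eq_is_derive _ h.
apply: is_derive_eq (h (fresnel_corr al) _) _; last by field.
by move=> x; rewrite /fresnel_corr mulN1r.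
Qed.

Lemma fresnel_corr_cauchy (al a b : R) : 1 <= a -> a <= b ->
  `|fresnel_corr al b - fresnel_corr al a| <= (4 * a ^+ 3)^-1 - (4 * b ^+ 3)^-1.
Proof.
move=> a1 ab.
have h3 (T : R) : 0 < T -> is_derive T 1 (fun T : R => - (4 * T ^+ 3)^-1) (3 / 4 / T ^+ 4).
  move=> T0; have T0' := lt0r_neq0 T0.
  have h0 : 4 * T ^+ 3 != 0 by rewrite mulf_neq0// expf_neq0.
  have h := is_deriveZ1 (-1) (@is_derive_inv _ (fun T => 4 * T ^+ 3) T _ h0 (is_deriveZ1 4 (is_deriveX1 2 T))).
  apply: is_derive_eq (eq_is_derive _ h) _; last by field.
  by move=> y; rewrite mulN1r.
have pos x : a <= x <= b -> 0 < x by move=> /andP[? _]; lra.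
have cosT (x : R) : 0 < x -> - (3 / 4) * cos (x ^+ 2 + al) / x ^+ 4 <= 3 / 4 / x ^+ 4.
  move=> x0; rewrite ler_pM2r ?invr_gt0 ?exprn_gt0//.
  by have := cos_geN1 (x ^+ 2 + al); lra.
have cosT' (x : R) : 0 < x -> - 1 * (- (3 / 4) * cos (x ^+ 2 + al) / x ^+ 4) <= 3 / 4 / x ^+ 4.
  move=> x0; rewrite mulrA ler_pM2r ?invr_gt0 ?exprn_gt0//.
  by have := cos_le1 (x ^+ 2 + al); lra.
have k1 := deriv_le ab (fun x h => is_derive_fresnel_corr al (pos x h))
  (fun x h => h3 x (pos x h)) (fun x h => cosT x (pos x h)).
have k2 := deriv_le ab (fun x h => is_deriveZ1 (-1) (is_derive_fresnel_corr al (pos x h)))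
  (fun x h => h3 x (pos x h)) (fun x h => cosT' x (pos x h)).
by rewrite ler_norml; lra.
Qed.

(** The limit is the supremum of the lower bounds [fresnel_corr al T - (4 * T ^+ 3)^-1]; by [key],
    each lower bound lies below each upper bound. *)
Lemma fresnel_corr_lim (al : R) : exists L : R, forall T, 1 <= T ->
  `|fresnel_corr al T - L| <= (4 * T ^+ 3)^-1.
Proof.
pose S : set R := [set fresnel_corr al T - (4 * T ^+ 3)^-1 | T in [set T | 1 <= T]].
have key a b : 1 <= a -> 1 <= b ->
    fresnel_corr al a - (4 * a ^+ 3)^-1 <= fresnel_corr al b + (4 * b ^+ 3)^-1.
  move=> a1 b1.
  have pa (x : R) : 1 <= x -> 0 < (4 * x ^+ 3)^-1.
    by move=> x1; rewrite invr_gt0 mulr_gt0// exprn_gt0//; lra.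
  have := pa _ a1; have := pa _ b1.
  have /orP[ab|ba] := le_total a b.
    by have := fresnel_corr_cauchy al a1 ab; rewrite ler_norml => /andP[? ?]; lra.
  by have := fresnel_corr_cauchy al b1 ba; rewrite ler_norml => /andP[? ?]; lra.
have S0 : S !=set0 by exists (fresnel_corr al 1 - (4 * 1 ^+ 3)^-1); exists 1 => //=.
have ub b : 1 <= b -> ubound S (fresnel_corr al b + (4 * b ^+ 3)^-1).
  by move=> b1 _ [a /= a1 <-]; exact: key.
have hS : has_sup S by split => //; exists (fresnel_corr al 1 + (4 * 1 ^+ 3)^-1); exact: ub.
exists (sup S) => T T1.
have h1 : sup S <= fresnel_corr al T + (4 * T ^+ 3)^-1 by apply: ge_sup => //; exact: ub.
have h2 : fresnel_corr al T - (4 * T ^+ 3)^-1 <= sup S.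
  by apply: ub_le_sup; [exact: hS.2|exists T].
by rewrite ler_norml; lra.
Qed.

Lemma fresnel_lim_le (al L T : R) :
  (forall T, 1 <= T -> `|fresnel_corr al T - L| <= (4 * T ^+ 3)^-1) -> 1 <= T ->
  `|fresnel al T - L - sin (T ^+ 2 + al) / (2 * T)| <= T ^- 3 /\ `|fresnel al T - L| <= 2 / T.
Proof.
move=> hL T1; have := hL T T1; rewrite /fresnel_corr.
have T0 : 0 < T by lra.
have T3 : 0 < T ^- 3 by rewrite invr_gt0 exprn_gt0.
have TT : T ^- 3 <= T^-1.
  by rewrite lef_pV2 ?posrE ?exprn_gt0// exprS ler_peMr// ?expr_ge1 ?(ltW T0)//.
have e3 : (4 * T ^+ 3)^-1 = T ^- 3 / 4 by rewrite invfM mulrC.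
have e1 : (2 * T)^-1 = T^-1 / 2 by rewrite invfM mulrC.
rewrite e3 e1.
have c : `|cos (T ^+ 2 + al) * (T ^- 3 / 4)| <= T ^- 3 / 4.
  rewrite normrM (gtr0_norm (x := T ^- 3 / 4)) ?divr_gt0// ler_piMl ?divr_ge0 ?(ltW T3)//.
  by rewrite ler_norml cos_geN1 cos_le1.
have s : `|sin (T ^+ 2 + al) * (T^-1 / 2)| <= T^-1 / 2.
  have h : 0 < T^-1 / 2 by rewrite divr_gt0// invr_gt0.
  rewrite normrM (gtr0_norm h) ler_piMl ?(ltW h)//.
  by rewrite ler_norml sin_geN1 sin_le1.
move: c s; rewrite !ler_norml => /andP[? ?] /andP[? ?] /andP[? ?].
by split; apply/andP; split; lra.
Qed.

Lemma le_inv_eq0 (x C : R) : (forall T, 1 <= T -> `|x| <= C / T) -> x = 0.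
Proof.
move=> h; apply/eqP; rewrite -normr_le0 leNgt; apply/negP => x0.
have C0 : 0 < C by have := h 1 (lexx _); rewrite divr1; lra.
pose T := 1 + 2 * C / `|x|.
have T1 : 1 <= T by rewrite lerDl divr_ge0// mulr_ge0// ltW.
have := h T T1; rewrite ler_pdivlMr; last lra.
by rewrite mulrDr mulr1 mulrC divfK ?lt0r_neq0//; lra.
Qed.

(** The common value of the integrals of cos(x^2) and sin(x^2) over [0, +oo[. *)
Definition fresnel_const : R := Num.sqrt (pi / 8).

Lemma fresnel_asymp (al T : R) : 1 <= T ->
  `|fresnel al T - fresnel_const * (cos al - sin al) - sin (T ^+ 2 + al) / (2 * T)| <= T ^- 3.
Proof.
have [Lc hc] := fresnel_corr_lim 0; have [Ls hs] := fresnel_corr_lim (- (pi / 2)).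
have fin (x y a b e : R) : `|x| <= 4 -> `|y| <= 4 -> 0 <= e <= 2 -> `|x - a| <= e -> `|y - b| <= e ->
    `|x * y - a * b| <= 10 * e.
  move=> x4 y4 /andP[e0 e2] xa yb.
  rewrite (_ : x * y - a * b = (x - a) * y + a * (y - b)); last by ring.
  have a6 : `|a| <= 6.
    by move: x4 xa; rewrite !ler_norml => /andP[? ?] /andP[? ?]; apply/andP; split; lra.
  apply: le_trans (ler_normD _ _) _; rewrite !normrM.
  have := ler_pM (normr_ge0 _) (normr_ge0 _) xa y4.
  by have := ler_pM (normr_ge0 _) (normr_ge0 _) a6 yb; lra.
have inv2 (S : R) : 1 <= S -> 0 <= 2 / S <= 2.
  by move=> S1; rewrite divr_ge0/=; [rewrite ler_pdivrMr; lra|lra|lra].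
have lim2 (S : R) a1 a2 L1 L2 : 1 <= S -> 
    (forall T, 1 <= T -> `|fresnel_corr a1 T - L1| <= (4 * T ^+ 3)^-1) ->
    (forall T, 1 <= T -> `|fresnel_corr a2 T - L2| <= (4 * T ^+ 3)^-1) ->
    `|fresnel a1 S * fresnel a2 S - L1 * L2| <= 20 / S.
  move=> S1 h1 h2; have [_ k1] := fresnel_lim_le h1 S1; have [_ k2] := fresnel_lim_le h2 S1.
  have := fin _ _ _ _ _ (fresnel_bounded a1 S) (fresnel_bounded a2 S) (inv2 S S1) k1 k2.
  by lra.
have e56 (S : R) : 56 / S = 20 / S + 20 / S + 16 / S.
  by rewrite -!mulrDl; congr (_ / _); ring.
(* Since [fresnel_prod] tends to 0, the two product formulas become in the limit Lc^2 = Ls^2 and 2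
   Lc Ls = pi / 4. Each product contributes an error 20 / S and [fresnel_prod] an error 16 / S,
   whence 56 at most. *)
have e1 : Lc ^+ 2 - Ls ^+ 2 = 0.
  apply: (@le_inv_eq0 _ 56) => S S1.
  have h1 := lim2 _ _ _ _ _ S1 hc hc; have h2 := lim2 _ _ _ _ _ S1 hs hs.
  have h3 := @fresnel_prod_le 0 S (lt_le_trans ltr01 S1); rewrite -fresnel_sqr !expr2 in h3.
  rewrite e56 !expr2; move: h1 h2 h3; rewrite !ler_norml => /andP[? ?] /andP[? ?] /andP[? ?].
  by apply/andP; split; lra.
have e2 : 2 * (Lc * Ls) - pi / 4 = 0.
  apply: (@le_inv_eq0 _ 56) => S S1.
  have h1 := lim2 _ _ _ _ _ S1 hc hs.
  have h3 := @fresnel_prod_le (- (pi / 2)) S (lt_le_trans ltr01 S1).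
  have h4 := fresnel_mul S; rewrite e56; move: h1 h3; rewrite !ler_norml => /andP[? ?] /andP[? ?].
  by apply/andP; split; lra.
(* The two equations leave a common sign open. At T = 1 the corrected integral is at least 9/10 -
   1/2 + 1/8, while its distance to [Lc] is at most 1/4. *)
have Lc0 : 0 < Lc.
  have h := hc 1 (lexx _); rewrite /fresnel_corr /fresnel !expr1n !addr0 !mulr1 !mul1r in h.
  have hi : 9 / 10 <= \int[mu]_(v in `[0, 1]) cos (v ^+ 2).
    have cp (x : R) : {for x, continuous (fun v : R => 1 - v ^+ 4 / 2)}.
      apply: cvgB; first exact: cvg_cst.
      by apply: cvgM; [exact: exprn_continuous|exact: cvg_cst].
    have -> : 9 / 10 = \int[mu]_(v in `[0, 1]) (1 - v ^+ 4 / 2) :> R.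
      have hd (x : R) : 0 <= x <= 1 -> is_derive x 1 (fun v : R => v - v ^+ 5 / 10) (1 - x ^+ 4 / 2).
        move=> _; have h1 := is_deriveD1 (is_derive_id1 x) (is_deriveZ1 (- 10^-1) (is_deriveX1 4 x)).
        apply: is_derive_eq (eq_is_derive _ h1) _; last by field.
        by move=> y; rewrite mulNr mulrC.
      have := ftcR ler01 hd (fun x _ => cp x) => ->.
      by field.
    apply: le_Rintegral => //.
    - by apply: integrable_itv => x _; exact: cp.
    - apply: integrable_itv => x _.
      by have := @cont_quad cos 1 0 x (@continuous_cos R); under [fun y : R => _]eq_fun do rewrite mul1r addr0.
    - move=> x; rewrite /= in_itv/= => /andP[x0 x1]; apply: le_trans (cos_ge_quad _).
      by rewrite -exprM.
  have E : \int[mu]_(v in `[0, 1]) cos (1 * v ^+ 2 + 0) = \int[mu]_(v in `[0, 1]) cos (v ^+ 2).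
    by apply: eq_Rintegral => v _; rewrite mul1r addr0.
  have hcos := @cos_ge_quad R 1; have hsin := sin_le1 (1 : R); rewrite expr1n in hcos.
  rewrite E in h; move: h hi.
  by rewrite ler_norml; move: (\int[mu]_(v in _) _) => I /andP[? ?] ?; lra.
have eL : Lc = Ls.
  have p0 := @pi_gt0 R.
  have : (Lc - Ls) * (Lc + Ls) = 0 by rewrite -e1; ring.
  move/eqP; rewrite mulf_eq0 => /orP[|] /eqP h; first by lra.
  have hh : Ls = - Lc by lra.
  have h2 : 0 < Lc * Lc by exact: mulr_gt0.
  by exfalso; rewrite hh mulrN in e2; lra.
have Lv : Lc = fresnel_const.
  have : Lc ^+ 2 = pi / 8 by rewrite -eL in e2; rewrite expr2; lra.
  by rewrite /fresnel_const => <-; rewrite sqrtr_sqr gtr0_norm.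
move=> T1; have [L hL] := fresnel_corr_lim al.
suff -> : fresnel_const * (cos al - sin al) = L by have [] := fresnel_lim_le hL T1.
apply/eqP; rewrite -subr_eq0; apply/eqP; apply: (@le_inv_eq0 _ 6) => S S1.
have [_ h1] := fresnel_lim_le hL S1; have [_ h2] := fresnel_lim_le hc S1.
have [_ h3] := fresnel_lim_le hs S1.
rewrite fresnel_cos in h1; rewrite -eL Lv in h3; rewrite Lv in h2.
have hcs (b x : R) : `|b| <= 1 -> `|x| <= 2 / S -> `|b * x| <= 2 / S.
  by move=> b1 hx; rewrite normrM -[leRHS]mul1r; apply: ler_pM.
have hcos : `|cos al| <= 1 by rewrite ler_norml cos_geN1 cos_le1.
have hsin : `|sin al| <= 1 by rewrite ler_norml sin_geN1 sin_le1.
have := hcs _ _ hcos h2; have := hcs _ _ hsin h3.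
rewrite (_ : 6 / S = 2 / S + 2 / S + 2 / S); last by rewrite -!mulrDl; congr (_ / _); ring.
move: h1; rewrite !ler_norml => /andP[? ?] /andP[? ?] /andP[? ?].
by apply/andP; split; lra.
Qed.

End fresnel_asymptotics.

(** * The integral over [0, 1] that represents the circle *)

Section circle.
Context {R : realType}.
Local Notation mu := (@lebesgue_measure R).

(* Polynomials in x, p = (2 - x^2)^(-1/2) and q = (sqrt 2 + (2 - x^2)^(1/2))^-1, a ring stable
   under differentiation since p' = x p^3 and q' = x p q^2. *)
Inductive pq_poly :=
  PQcst of R | PQx | PQp | PQq | PQadd of pq_poly & pq_poly | PQmul of pq_poly & pq_poly.

Let y (x : R) := Num.sqrt (2 - x ^+ 2).
Let p (x : R) := (y x)^-1.

Fixpoint pq_eval (e : pq_poly) (x : R) : R :=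
  match e with
  | PQcst c => c | PQx => x | PQp => (Num.sqrt (2 - x ^+ 2))^-1
  | PQq => (Num.sqrt 2 + Num.sqrt (2 - x ^+ 2))^-1
  | PQadd a b => pq_eval a x + pq_eval b x
  | PQmul a b => pq_eval a x * pq_eval b x end.

Fixpoint pq_deriv (e : pq_poly) : pq_poly :=
  match e with
  | PQcst c => PQcst 0 | PQx => PQcst 1
  | PQp => PQmul PQx (PQmul PQp (PQmul PQp PQp))
  | PQq => PQmul PQx (PQmul PQp (PQmul PQq PQq))
  | PQadd a b => PQadd (pq_deriv a) (pq_deriv b)
  | PQmul a b => PQadd (PQmul a (pq_deriv b)) (PQmul b (pq_deriv a)) end.

Let pos2 (x : R) : 0 <= x <= 1 -> 0 < 2 - x ^+ 2.
Proof. by move=> /andP[? ?]; nra. Qed.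

Let y_gt0 (x : R) : 0 <= x <= 1 -> 0 < y x.
Proof. by move=> h; rewrite sqrtr_gt0 pos2. Qed.

Let y_sqr (x : R) : 0 <= x <= 1 -> y x ^+ 2 = 2 - x ^+ 2.
Proof. by move=> h; rewrite sqr_sqrtr// ltW// pos2. Qed.

Let s2_gt0 : 0 < Num.sqrt 2 :> R. Proof. by rewrite sqrtr_gt0. Qed.

Let is_derive_y (x : R) : 0 <= x <= 1 -> is_derive x 1 y (- x * p x).
Proof.
move=> h; have h2 : is_derive x 1 (fun x : R => 2 - x ^+ 2) (- (2 * x)).
  have h1 := is_deriveD1 (is_derive_const 2 x) (is_deriveZ1 (-1) (is_deriveX1 1 x)).
  apply: is_derive_eq (eq_is_derive _ h1) _; first by move=> z; rewrite mulN1r.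
  by rewrite expr1; ring.
have y0 := lt0r_neq0 (y_gt0 h).
have h3 := is_derive1_sqrt (pos2 h).
have h4 := @is_derive1_comp R Num.sqrt (fun x : R => 2 - x ^+ 2) x _ _ h3 h2.
apply: is_derive_eq h4 _.
by rewrite /p; rewrite -/(y x); field.
Qed.

Lemma is_derive_pq (e : pq_poly) (x : R) : 0 <= x <= 1 ->
  is_derive x 1 (pq_eval e) (pq_eval (pq_deriv e) x).
Proof.
move=> h; have y0 := lt0r_neq0 (y_gt0 h); have hy := is_derive_y h.
elim: e => [c|||| a ha b hb|a ha b hb] /=.
- exact: is_derive_const.
- exact: is_derive_id1.
- apply: is_derive_eq (is_derive_inv y0 hy) _; rewrite -/(y x) /p; by field.
- have s0 := lt0r_neq0 (addr_gt0 s2_gt0 (y_gt0 h)).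
  have h1 : is_derive x 1 (fun x : R => Num.sqrt 2 + y x) (- x * p x).
    by apply: is_derive_eq (is_deriveD1 (is_derive_const (Num.sqrt 2) x) hy) _; rewrite add0r.
  have h3 := @is_derive_inv R (fun x : R => Num.sqrt 2 + y x) x _ s0 h1.
  apply: is_derive_eq h3 _; rewrite -/(y x) /p; field.
  by rewrite ?s0 ?y0.
- exact: is_deriveD1.
- exact: is_deriveM1.
Qed.

Lemma continuous_pq (e : pq_poly) (x : R) : 0 <= x <= 1 -> {for x, continuous (pq_eval e)}.
Proof. by move/is_derive_pq => h; exact: is_derive_continuous (h e). Qed.

Let cont_quad (f : R -> R) (a b x : R) : continuous f ->
  {for x, continuous (fun y : R => f (a * y ^+ 2 + b))}.
Proof.
move=> cf; apply: (continuous_comp (f := fun y : R => a * y ^+ 2 + b)); last exact: cf.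
exact: (is_derive_continuous (is_derive_quad a b x)).
Qed.

(** The constant part of the amplitude gives a Fresnel integral. In the rest, x cos(T^2 x^2 + al) is
    a derivative up to 2 T^2; the boundary term at 0 disappears because m(0) = 0, and the remaining
    integral against m' is again oscillatory, so it gains one more factor 1 / T. *)
Lemma fresnel_expansion (k m : pq_poly) (k0 : R) :
  (forall x : R, 0 <= x <= 1 -> pq_eval k x = k0 + x * pq_eval m x) -> pq_eval m 0 = 0 ->
  exists2 C : R, 0 <= C & forall al T : R, 1 <= T ->
  `|\int[mu]_(x in `[0, 1]) (cos (T ^+ 2 * x ^+ 2 + al) * pq_eval k x) -
    (k0 * fresnel_const * (cos al - sin al) / T +
     sin (T ^+ 2 + al) * pq_eval k 1 / (2 * T ^+ 2))| <= C / T ^+ 3.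
Proof.
move=> hk hm.
have [M1 M10 hM1] := bounded01 (fun x => @continuous_pq (pq_deriv m) x).
have [M2 M20 hM2] := bounded01 (fun x => @continuous_pq (pq_deriv (pq_deriv m)) x).
pose M := M1 + M2.
(* |k0| is the error of [fresnel_asymp] for the constant part; 4 M is 8 M, from [fresnel_amplitude],
   divided by the 2 of 2 T^2. *)
exists (4 * M + `|k0|); first by rewrite addr_ge0// mulr_ge0// addr_ge0.
move=> al T T1; have T0 : 0 < T by lra.
have T0' := lt0r_neq0 T0.
pose I0 := \int[mu]_(x in `[0, 1]) (cos (T ^+ 2 * x ^+ 2 + al)).
pose I1 := \int[mu]_(x in `[0, 1]) ((2 * T ^+ 2 * x * cos (T ^+ 2 * x ^+ 2 + al)) * pq_eval m x).
pose I2 := \int[mu]_(x in `[0, 1]) (cos (T ^+ 2 * x ^+ 2 + (al - pi / 2)) * pq_eval (pq_deriv m) x).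
have cc a (x : R) : 0 <= x <= 1 -> {for x, continuous (fun x : R => cos (T ^+ 2 * x ^+ 2 + a))}.
  by move=> _; apply: (@cont_quad cos); exact: continuous_cos.
have c1 (x : R) : 0 <= x <= 1 ->
    {for x, continuous (fun x : R => 2 * T ^+ 2 * x * cos (T ^+ 2 * x ^+ 2 + al))}.
  by move=> h; apply: cvgM; [apply: cvgM; [exact: cvg_cst|exact: cvg_id]|exact: cc].
have c2 (x : R) : 0 <= x <= 1 -> {for x, continuous (fun x : R =>
    (2 * T ^+ 2 * x * cos (T ^+ 2 * x ^+ 2 + al)) * pq_eval m x)}.
  by move=> h; apply: cvgM; [exact: c1|exact: continuous_pq].
have mI : measurable (`[0, 1]%classic : set R) by [].
have i0 := integrable_itv (cc al); have i1 := integrable_itv c2.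
have E0 : \int[mu]_(x in `[0, 1]) (cos (T ^+ 2 * x ^+ 2 + al) * pq_eval k x) =
    k0 * I0 + (2 * T ^+ 2)^-1 * I1.
  transitivity (\int[mu]_(x in `[0, 1]) (k0 * cos (T ^+ 2 * x ^+ 2 + al) +
    (2 * T ^+ 2)^-1 * ((2 * T ^+ 2 * x * cos (T ^+ 2 * x ^+ 2 + al)) * pq_eval m x))).
    apply: eq_Rintegral => x; rewrite inE /= in_itv/= => h; rewrite hk//; by field.
  have j0 : mu.-integrable `[0, 1] (EFin \o (fun x => k0 * cos (T ^+ 2 * x ^+ 2 + al))).
    by apply: integrable_itv => x h; apply: cvgM; [exact: cvg_cst|exact: cc].
  have j1 : mu.-integrable `[0, 1] (EFin \o (fun x => (2 * T ^+ 2)^-1 *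
     ((2 * T ^+ 2 * x * cos (T ^+ 2 * x ^+ 2 + al)) * pq_eval m x))).
    by apply: integrable_itv => x h; apply: cvgM; [exact: cvg_cst|exact: c2].
  rewrite (@RintegralD _ (measurableTypeR R) R mu)//.
  by rewrite (@RintegralZl _ (measurableTypeR R) R mu)// (@RintegralZl _ (measurableTypeR R) R mu).
have E1 : I1 = sin (T ^+ 2 + al) * (pq_eval k 1 - k0) - I2.
  have hs (x : R) : 0 <= x <= 1 -> is_derive x 1 (fun x : R => sin (T ^+ 2 * x ^+ 2 + al))
      (2 * T ^+ 2 * x * cos (T ^+ 2 * x ^+ 2 + al)).
    by move=> _; apply: is_derive_eq (is_derive_sin_comp (is_derive_quad (T ^+ 2) al x)) _; rewrite mulrC.
  rewrite /I1 (int_by_parts01 hs (fun x => @is_derive_pq m x) c1 (fun x => @continuous_pq (pq_deriv m) x)).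
  rewrite hm mulr0 subr0 expr1n mulr1 (hk 1) ?lexx ?ler01// mul1r [k0 + _]addrC addrK.
  congr (_ - _); apply: eq_Rintegral => x _; congr (_ * _).
  by rewrite addrA cosB cos_pihalf sin_pihalf mulr0 mulr1 add0r.
have hI2 : `|I2| <= 8 * M / T.
  apply: (fresnel_amplitude _ T0 (fun x => @is_derive_pq (pq_deriv m) x) (fun x => @continuous_pq (pq_deriv (pq_deriv m)) x)).
    by apply: le_trans (hM1 1 _) _; rewrite ?lexx ?ler01// lerDl.
  by move=> x h; apply: le_trans (hM2 x h) _; rewrite lerDr.
have hF := fresnel_asymp al T1.
have FT : fresnel al T = T * I0 by [].
set F := fresnel al T in hF FT; set c := fresnel_const * (cos al - sin al) in hF *.
set s := sin (T ^+ 2 + al) in hF E1 *.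
rewrite E0 E1.
have -> : k0 * I0 + (2 * T ^+ 2)^-1 * (s * (pq_eval k 1 - k0) - I2) -
  (k0 * fresnel_const * (cos al - sin al) / T + s * pq_eval k 1 / (2 * T ^+ 2)) =
  k0 / T * (F - c - s / (2 * T)) - (2 * T ^+ 2)^-1 * I2.
  by rewrite FT /c; field.
apply: le_trans (ler_normB _ _) _; rewrite !normrM normfV (gtr0_norm T0).
have d0 : 0 < (2 * T ^+ 2)^-1 by rewrite invr_gt0 mulr_gt0// exprn_gt0.
rewrite (gtr0_norm d0).
have k1 : (2 * T ^+ 2)^-1 * `|I2| <= 4 * M / T ^+ 3.
  rewrite (_ : 4 * M / T ^+ 3 = (2 * T ^+ 2)^-1 * (8 * M / T)); first by rewrite ler_pM2l.
  by field.
have k2 : `|k0| / T * `|F - c - s / (2 * T)| <= `|k0| / T ^+ 3.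
  apply: ler_pM => //; first by rewrite divr_ge0// ltW.
  by rewrite ler_piMr// invf_le1.
by apply: le_trans (lerD k2 k1) _; rewrite [leRHS]mulrDl addrC.
Qed.

(** If 1 - x^2 is the cosine of an angle, the angle has differential 2 dx / sqrt(2 - x^2) and runs
    over a quarter of the circle. This is therefore one eighth of the moment of S^1, a fact that is
    proved below by comparing recurrences. *)
Definition circle_moment (n : nat) : R := \int[mu]_(x in `[0, 1]) (pq_eval PQp x * (1 - x ^+ 2) ^+ n.*2).

Let s_poly := PQadd (PQcst 1) (PQmul (PQcst (-1)) (PQmul PQx PQx)).

Fixpoint pq_exp (e : pq_poly) (n : nat) : pq_poly :=
  if n is n'.+1 then PQmul e (pq_exp e n') else PQcst 1.

Lemma pq_expE e n x : pq_eval (pq_exp e n) x = pq_eval e x ^+ n.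
Proof. by elim: n => [|n IH] //=; rewrite IH exprS. Qed.

Let s_polyE x : pq_eval s_poly x = 1 - x ^+ 2.
Proof. by rewrite /= mulN1r expr2. Qed.

(** atan(x / sqrt(2 - x^2)) is a primitive of (2 - x^2)^(-1/2). *)
Lemma circle_moment0 : circle_moment 0 = pi / 4.
Proof.
have hd (x : R) : 0 <= x <= 1 -> is_derive x 1 (fun x : R => atan (pq_eval (PQmul PQx PQp) x))
    (pq_eval PQp x).
  move=> h; have h1 := @is_derive_pq (PQmul PQx PQp) x h.
  have h2 := @is_derive1_comp R atan _ x _ _ (is_derive1_atan _) h1.
  apply: is_derive_eq h2 _.
  have y0 := lt0r_neq0 (y_gt0 h); have ys := y_sqr h; rewrite /= -/(y x).
  have -> : 1 + (x / y x) ^+ 2 = 2 / y x ^+ 2.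
    by rewrite expr_div_n -[X in X + _](@divff _ (y x ^+ 2)) ?expf_neq0// -mulrDl ys; congr (_ / _); ring.
  have -> : x * (x * ((y x)^-1 * ((y x)^-1 / y x))) + (y x)^-1 * 1 = (x ^+ 2 + y x ^+ 2) / y x ^+ 3.
    by field.
  rewrite (_ : x ^+ 2 + y x ^+ 2 = 2); last by rewrite ys; ring.
  by field.
have := ftcR ler01 hd (fun x h => @continuous_pq PQp x h).
rewrite /circle_moment => E.
transitivity (\int[mu]_(x in `[0, 1]) pq_eval PQp x).
  by apply: eq_Rintegral => x _; rewrite expr0 mulr1.
rewrite E /= mul0r atan0 subr0 mul1r expr1n.
by rewrite (_ : 2 - 1 = 1) ?sqrtr1 ?invr1 ?atan1//; ring.
Qed.

(** [F] is (1 - x^2)^(2n + 1) x sqrt(2 - x^2), that is cos^(2n + 1) sin in the angle. It vanishes at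
    both ends, and its derivative is a combination of the two integrands. *)
Lemma circle_momentS n : circle_moment n.+1 = (n.*2.+1%:R / n.*2.+2%:R) * circle_moment n.
Proof.
pose g n := PQmul PQp (pq_exp s_poly n.*2).
have gE m : circle_moment m = \int[mu]_(x in `[0, 1]) pq_eval (g m) x.
  by apply: eq_Rintegral => x _ /=; rewrite pq_expE s_polyE.
pose Fp := PQmul (PQmul (pq_exp s_poly n.*2.+1) PQx)
  (PQmul (PQadd (PQcst 2) (PQmul (PQcst (-1)) (PQmul PQx PQx))) PQp).
pose F (x : R) := pq_eval Fp x.
pose f (x : R) := 2 * n.*2.+2%:R * pq_eval (g n.+1) x - 2 * n.*2.+1%:R * pq_eval (g n) x.
have sd (x : R) m : pq_eval (pq_deriv (pq_exp s_poly m.+1)) x = m.+1%:R * (1 - x ^+ 2) ^+ m * (- (2 * x)).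
  elim: m => [|m IH]; first by rewrite /=; ring.
  have -> : pq_eval (pq_deriv (pq_exp s_poly m.+2)) x =
    pq_eval s_poly x * pq_eval (pq_deriv (pq_exp s_poly m.+1)) x +
    pq_eval (pq_exp s_poly m.+1) x * pq_eval (pq_deriv s_poly) x by [].
  rewrite IH pq_expE s_polyE (_ : pq_eval (pq_deriv s_poly) x = - (2 * x)); last by rewrite /=; ring.
  by rewrite -[m.+2%:R]natr1 [(_ - _) ^+ m.+1]exprS; ring.
have hd (x : R) : 0 <= x <= 1 -> is_derive x 1 F (f x).
  move=> h; have hF := @is_derive_pq Fp x h.
  apply: is_derive_eq hF _.
  have y0 := lt0r_neq0 (y_gt0 h); have ys := y_sqr h.
  have e1 a b : pq_eval (pq_deriv (PQmul a b)) x =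
    pq_eval a x * pq_eval (pq_deriv b) x + pq_eval b x * pq_eval (pq_deriv a) x by [].
  have e2 a b : pq_eval (PQmul a b) x = pq_eval a x * pq_eval b x by [].
  have hQ1 := sd x n.*2.
  have hQ0 : pq_eval (pq_exp s_poly n.*2.+1) x = (1 - x ^+ 2) ^+ n.*2.+1 by rewrite pq_expE s_polyE.
  rewrite /Fp; move: (pq_exp s_poly n.*2.+1) hQ1 hQ0 => Q hQ1 hQ0.
  rewrite !e1 !e2 hQ1 hQ0 /f /g !e2 !pq_expE s_polyE /= -/(y x).
  have -> : 2 + -1 * (x * x) = y x ^+ 2 by rewrite ys; ring.
  rewrite -[n.*2.+2%:R]natr1 [_ ^+ n.*2.+1]exprS; set S := (1 - x ^+ 2) ^+ n.*2.
  set N := n.*2.+1%:R.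
  transitivity (S / y x * (- (1 - x ^+ 2) * x ^+ 2 + y x ^+ 2 * (1 - x ^+ 2) - 2 * x ^+ 2 * N * y x ^+ 2)).
    by field.
  by rewrite ys; field.
have cg m (x : R) : 0 <= x <= 1 -> {for x, continuous (pq_eval (g m))}.
  by move=> h; exact: continuous_pq.
have ig m c : mu.-integrable `[0, 1] (EFin \o (fun x => c * pq_eval (g m) x)).
  by apply: integrable_itv => x h; apply: cvgM; [exact: cvg_cst|exact: cg].
have ig1 m : mu.-integrable `[0, 1] (EFin \o pq_eval (g m)) by apply: integrable_itv; exact: cg.
have cf (x : R) : 0 <= x <= 1 -> {for x, continuous f}.
  by move=> h; apply: cvgB; apply: cvgM; [exact: cvg_cst|exact: cg|exact: cvg_cst|exact: cg].
have mI : measurable (`[0, 1]%classic : set R) by [].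
have := ftcR ler01 hd cf.
rewrite /f (@RintegralB _ (measurableTypeR R) R mu)//.
rewrite (@RintegralZl _ (measurableTypeR R) R mu)// (@RintegralZl _ (measurableTypeR R) R mu)//.
rewrite -!gE /F.
have -> : pq_eval Fp 1 = 0.
  by rewrite /= (_ : 1 + -1 * (1 * 1) = 0) ?mul0r//; ring.
have -> : pq_eval Fp 0 = 0.
  by rewrite /= mulr0 mul0r.
rewrite subrr => /eqP; rewrite subr_eq0 => /eqP E.
have n0 : n.*2.+2%:R != 0 :> R by rewrite pnatr_eq0.
apply: (mulfI (x := 2 * n.*2.+2%:R)); first by rewrite mulf_neq0.
by rewrite E; field.
Qed.

Lemma circle_momentE n : 8 * circle_moment n = @sphere_moment R 1 n.
Proof.
elim: n => [|n IH].
  rewrite circle_moment0 /sphere_moment; have -> : @half_moment R (0.*2 + 1) = 2^-1.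
    by rewrite /= div1r.
  by rewrite /= gmom0 sqr_sqrtr ?pi_ge0//; field.
by rewrite circle_momentS sphere_momentS -IH addn1; ring.
Qed.

End circle.

Section bessel_circle.
Context {R : realType}.
Local Notation mu := (@lebesgue_measure R).

Let mI : measurable (`[0, 1]%classic : set (measurableTypeR R)). Proof. by []. Qed.

Let muI : (mu `[0%R, 1%R]%classic < +oo)%E.
Proof. by have /= -> := @lebesgue_measure_itv R `[0, 1]; rewrite lte_fin ltr01 oppr0 adde0 ltry. Qed.

Let s (x : measurableTypeR R) : R := 1 - x ^+ 2.

Let ms : measurable_fun (`[0, 1]%classic : set (measurableTypeR R)) s.
Proof.
by apply: measurable_funB; [exact: measurable_cst|apply: measurable_funX].
Qed.

Let s1 x : (`[0, 1]%classic : set R) x -> `|s x| <= 1.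
Proof. by rewrite /= in_itv/= => /andP[? ?]; rewrite /s ler_norml; apply/andP; split; nra. Qed.

Let w (x : measurableTypeR R) : R := pq_eval PQp x.

Let mw : measurable_fun (`[0, 1]%classic : set (measurableTypeR R)) w.
Proof.
have := integrable_itv (fun x => @continuous_pq R PQp x).
by move/(@measurable_int _ (measurableTypeR R)) => /measurable_EFinP.
Qed.

Let w1 x : (`[0, 1]%classic : set R) x -> `|w x| <= 1.
Proof.
rewrite /= in_itv/= => /andP[x0 x1]; have h : 1 <= 2 - x ^+ 2 by nra.
have h1 : 1 <= Num.sqrt (2 - x ^+ 2) by rewrite -[leLHS]sqrtr1; exact: ler_wsqrtr.
by rewrite /w /= ger0_norm ?invr_ge0 ?sqrtr_ge0// invf_le1// (lt_le_trans ltr01).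
Qed.

Lemma circle_bessel_cos (r : R) :
  is_bessel_cos 1 r (8 * \int[mu]_(x in `[0, 1]) (pq_eval PQp x * cos (r * (1 - x ^+ 2)))).
Proof.
have := @hsum_cos _ (measurableTypeR R) R mu _ mI muI s ms s1 w mw w1 r.
move/(hsumZ 8%:C); rewrite -rmorphM; apply: eq_hsum => n; rewrite -rmorphM; congr (_%:C).
by rewrite mulrCA -circle_momentE.
Qed.

Lemma circle_bessel_sin (r : R) :
  is_bessel_sin 1 r (8 * \int[mu]_(x in `[0, 1])
    (pq_eval PQp x * ((1 - x ^+ 2) * sin (r * (1 - x ^+ 2))))).
Proof.
have := @hsum_sin _ (measurableTypeR R) R mu _ mI muI s ms s1 w mw w1 r.
move/(hsumZ 8%:C); rewrite -rmorphM; apply: eq_hsum => n; rewrite -rmorphM; congr (_%:C).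
by rewrite mulrCA -circle_momentE.
Qed.

(** The quotient by x of p - 1 / sqrt 2, which equals x^2 p q / sqrt 2; making this quotient
    differentiable is the purpose of q. [m2] is the analogue for the amplitude [k2] of the sine
    integral. *)
Let m1 : @pq_poly R := PQmul (PQcst (Num.sqrt 2)^-1) (PQmul PQx (PQmul PQp PQq)).
Let m2 : @pq_poly R := PQadd m1 (PQmul (PQcst (-1)) (PQmul PQx PQp)).
Let k2 : @pq_poly R := PQmul PQp (PQadd (PQcst 1) (PQmul (PQcst (-1)) (PQmul PQx PQx))).

Let hm1 (x : R) : 0 <= x <= 1 -> pq_eval PQp x = (Num.sqrt 2)^-1 + x * pq_eval m1 x.
Proof.
move=> /andP[x0 x1] /=; have h : 0 < 2 - x ^+ 2 by nra.
have y0 : 0 < Num.sqrt (2 - x ^+ 2) by rewrite sqrtr_gt0.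
have ys : Num.sqrt (2 - x ^+ 2) ^+ 2 = 2 - x ^+ 2 by rewrite sqr_sqrtr// ltW.
have z0 : 0 < Num.sqrt 2 :> R by rewrite sqrtr_gt0.
have zs : Num.sqrt 2 ^+ 2 = 2 :> R by rewrite sqr_sqrtr.
move: (Num.sqrt (2 - x ^+ 2)) (Num.sqrt 2) y0 ys z0 zs => y z y0 ys z0 zs.
have yn := lt0r_neq0 y0; have zn := lt0r_neq0 z0; have yzn := lt0r_neq0 (addr_gt0 z0 y0).
transitivity (z^-1 + x ^+ 2 / (z * y * (z + y))); last by field; rewrite yzn zn yn.
rewrite (_ : x ^+ 2 = z ^+ 2 - y ^+ 2); last by rewrite ys zs; ring.
by field; rewrite yzn zn yn.
Qed.

Let hm2 (x : R) : 0 <= x <= 1 -> pq_eval k2 x = (Num.sqrt 2)^-1 + x * pq_eval m2 x.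
Proof.
move=> h; have := hm1 h; rewrite /m2 /k2.
have -> : pq_eval (PQadd m1 (PQmul (PQcst (-1)) (PQmul PQx PQp))) x =
  pq_eval m1 x + -1 * (x * pq_eval PQp x) by [].
have -> : pq_eval (PQmul PQp (PQadd (PQcst 1) (PQmul (PQcst (-1)) (PQmul PQx PQx)))) x =
  pq_eval PQp x * (1 + -1 * (x * x)) by [].
by move: (pq_eval PQp x) (pq_eval m1 x) => a b hab; rewrite -[(Num.sqrt 2)^-1](addrK (x * b)) -hab; ring.
Qed.

Lemma cos_piquarter : cos (pi / 4) = (Num.sqrt 2)^-1 :> R /\ sin (pi / 4) = (Num.sqrt 2)^-1 :> R.
Proof.
have c0 : 0 < cos (pi / 4) :> R.
  by apply: cos_gt0_pihalf; have := pi_gt0 R; lra.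
have e : sin (pi / 4) = cos (pi / 4) :> R.
  have := @tan_piquarter R; rewrite /tan => h.
  by rewrite -[LHS](divfK (lt0r_neq0 c0)) h mul1r.
suff c : cos (pi / 4) = (Num.sqrt 2)^-1 :> R by rewrite e c.
have h := @cos2Dsin2 R (pi / 4); rewrite e in h.
rewrite -[LHS]gtr0_norm// -sqrtr_sqr -sqrtrV//; congr Num.sqrt; lra.
Qed.

Lemma bessel_asymp1 : @bessel_asymp R 1.
Proof.
have [C1 C10 h1] := @fresnel_expansion R PQp m1 _ hm1 ltac:(by rewrite /= mul0r mulr0).
have [C2 C20 h2] := @fresnel_expansion R k2 m2 _ hm2 ltac:(by rewrite /= !mul0r !mulr0 addr0).
exists (8 * (C1 + C2) + 1); first by rewrite ltr_wpDl// mulr_ge0// addr_ge0.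
move=> r v w' r1 hv hw'.
have r0 : 0 < r by lra.
have T1 : 1 <= Num.sqrt r by rewrite -[leLHS]sqrtr1; exact: ler_wsqrtr.
have T0 : 0 < Num.sqrt r by lra.
have Tr : Num.sqrt r ^+ 2 = r by rewrite sqr_sqrtr// ltW.
have -> : v = 8 * \int[mu]_(x in `[0, 1]) (pq_eval PQp x * cos (r * (1 - x ^+ 2))).
  by apply: (@complexI R); exact: hsum_uniq hv (circle_bessel_cos r).
have -> : w' = 8 * \int[mu]_(x in `[0, 1]) (pq_eval PQp x * ((1 - x ^+ 2) * sin (r * (1 - x ^+ 2)))).
  by apply: (@complexI R); exact: hsum_uniq hw' (circle_bessel_sin r).
have -> : r `^ (- (1%:R / 2 + 1)) = Num.sqrt r ^- 3.
  rewrite powRN powRD ?lt0r_neq0 ?implybT// div1r powR12_sqrt ?ltW// powRr1 ?ltW//.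
  by rewrite -[X in _ * X]Tr -exprS.
have p0 := pi_gt0 R.
have pw : 2 * (2 * pi / r) `^ (1%:R / 2) * (Num.sqrt 2)^-1 =
    8 * ((Num.sqrt 2)^-1 * fresnel_const / Num.sqrt r).
  rewrite div1r powR12_sqrt ?divr_ge0 ?mulr_ge0 ?ltW// sqrtrM ?mulr_ge0 ?ltW// sqrtrV ?ltW//.
  have -> : 2 * pi = 4 ^+ 2 * (pi / 8) :> R by field.
  rewrite sqrtrM ?sqr_ge0// sqrtr_sqr ger0_norm// -/fresnel_const; by field; rewrite !lt0r_neq0// sqrtr_gt0.
have [cq sq] := cos_piquarter; rewrite mulr1 cosB sinB cq sq.
have -> : 2 * (2 * pi / r) `^ (1%:R / 2) * (cos r / Num.sqrt 2 + sin r / Num.sqrt 2) =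
    8 * ((Num.sqrt 2)^-1 * fresnel_const * (cos r + sin r) / Num.sqrt r).
  transitivity ((2 * (2 * pi / r) `^ (1%:R / 2) * (Num.sqrt 2)^-1) * (cos r + sin r)); first by ring.
  by rewrite pw; ring.
have -> : 2 * (2 * pi / r) `^ (1%:R / 2) * (sin r / Num.sqrt 2 - cos r / Num.sqrt 2) =
    8 * ((Num.sqrt 2)^-1 * fresnel_const * (sin r - cos r) / Num.sqrt r).
  transitivity ((2 * (2 * pi / r) `^ (1%:R / 2) * (Num.sqrt 2)^-1) * (sin r - cos r)); first by ring.
  by rewrite pw; ring.
have {h1} := h1 (- r) _ T1; have {h2} := h2 (pi / 2 - r) _ T1.
(* With T = sqrt r, a boundary term of order 1 / r would spoil the error r^(-3/2). It vanishes in
   both cases: for the cosine integral the phase at x = 1 is 0, for the sine integral the amplitude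
   [k2] is 0 there. *)
rewrite Tr subrr sin0 !mul0r addr0 cosN sinN opprK.
rewrite cosB sinB cos_pihalf sin_pihalf !mul0r !mul1r add0r subr0.
have -> : pq_eval k2 1 = 0 by rewrite /= (_ : 1 + _ = 0) ?mulr0//; ring.
rewrite mulr0 mul0r addr0.
have -> : \int[mu]_(x in `[0, 1]) (cos (r * x ^+ 2 + (pi / 2 - r)) * pq_eval k2 x) =
    \int[mu]_(x in `[0, 1]) (pq_eval PQp x * ((1 - x ^+ 2) * sin (r * (1 - x ^+ 2)))).
  apply: eq_Rintegral => x _.
  rewrite (_ : r * x ^+ 2 + (pi / 2 - r) = pi / 2 - r * (1 - x ^+ 2)); last by ring.
  by rewrite cosB cos_pihalf sin_pihalf mul0r mul1r add0r /=; ring.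
have -> : \int[mu]_(x in `[0, 1]) (cos (r * x ^+ 2 - r) * pq_eval PQp x) =
    \int[mu]_(x in `[0, 1]) (pq_eval PQp x * cos (r * (1 - x ^+ 2))).
  apply: eq_Rintegral => x _.
  by rewrite (_ : r * x ^+ 2 - r = - (r * (1 - x ^+ 2))) ?cosN 1?mulrC//; ring.
have T3 : 0 < Num.sqrt r ^- 3 by rewrite invr_gt0 exprn_gt0.
have q1 : 0 <= C1 * Num.sqrt r ^- 3 by rewrite mulr_ge0// ltW.
have q2 : 0 <= C2 * Num.sqrt r ^- 3 by rewrite mulr_ge0// ltW.
rewrite -!mulrBr !normrM (ger0_norm (x := 8))// => g2 g1.
split.
- by apply: le_trans (ler_wpM2l (ler0n _ 8) g1) _; rewrite (_ : (8 * (C1 + C2) + 1) / Num.sqrt r ^+ 3 =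
    8 * (C1 / Num.sqrt r ^+ 3) + 8 * (C2 / Num.sqrt r ^+ 3) + Num.sqrt r ^- 3); [lra|ring].
- by apply: le_trans (ler_wpM2l (ler0n _ 8) g2) _; rewrite (_ : (8 * (C1 + C2) + 1) / Num.sqrt r ^+ 3 =
    8 * (C1 / Num.sqrt r ^+ 3) + 8 * (C2 / Num.sqrt r ^+ 3) + Num.sqrt r ^- 3); [lra|ring].
Qed.

End bessel_circle.

(** * Oscillatory integrals over the sphere *)

Section sphere_fourier.
Context {R : realType} {e : nat}.
Local Notation E := 'rV[R]_e.+1.

Lemma sphere_vol_lty : (@sphere_vol R e.+1 sphere < +oo)%E.
Proof. by rewrite ltey_eq fin_num_measure//; exact: measurable_sphere. Qed.

Let mdot (w : E) : measurable_fun setT (dotR w).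
Proof. exact: measurable_dotR. Qed.

Let dot_le1 (w x : E) : dotR w w = 1 -> sphere x -> `|dotR w x| <= 1.
Proof.
move=> w1; rewrite /sphere /= => x1; apply: le_trans (cauchy_schwarz _ _) _.
by rewrite x1 mulr1 /enorm w1 sqrtr1.
Qed.

Let mcst : measurable_fun (@sphere R e.+1) (fun _ : E => 1 : R). Proof. exact: measurable_cst. Qed.

Let le11 : forall x : E, sphere x -> `|1 : R| <= 1. Proof. by move=> x _; rewrite normr1. Qed.

Lemma Rintegral_sphere_even (w : E) n : dotR w w = 1 ->
  \int[sphere_vol]_(x in sphere) (dotR w x ^+ n.*2) = @sphere_moment R e n.
Proof. by move=> w1; rewrite /Rintegral sphere_moment_even. Qed.

Lemma sphere_bessel_cos (w : E) (r : R) : dotR w w = 1 ->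
  is_bessel_cos e r (\int[sphere_vol]_(x in sphere) cos (r * dotR w x)).
Proof.
move=> w1; have ms := measurable_funTS (D := sphere) (mdot w).
have := @hsum_cos _ _ R sphere_vol sphere (@measurable_sphere R e) sphere_vol_lty _ ms
  (fun x => dot_le1 w1) _ mcst le11 r.
rewrite (_ : \int[_]_(_ in _) (1 * _) = \int[sphere_vol]_(x in sphere) cos (r * dotR w x)); last first.
  by apply: eq_Rintegral => x _; rewrite mul1r.
apply: eq_hsum => n; congr (_ * _)%:C; rewrite -(Rintegral_sphere_even n w1).
by apply: eq_Rintegral => x _; rewrite mul1r.
Qed.

Lemma sphere_bessel_sin (w : E) (r : R) : dotR w w = 1 ->
  is_bessel_sin e r (\int[sphere_vol]_(x in sphere) (dotR w x * sin (r * dotR w x))).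
Proof.
move=> w1; have ms := measurable_funTS (D := sphere) (mdot w).
have := @hsum_sin _ _ R sphere_vol sphere (@measurable_sphere R e) sphere_vol_lty _ ms
  (fun x => dot_le1 w1) _ mcst le11 r.
rewrite (_ : \int[_]_(_ in _) (1 * _) = \int[sphere_vol]_(x in sphere) (dotR w x * sin (r * dotR w x))); last first.
  by apply: eq_Rintegral => x _; rewrite mul1r.
apply: eq_hsum => n; congr (_ * _)%:C; rewrite -(Rintegral_sphere_even n.+1 w1).
by apply: eq_Rintegral => x _; rewrite mul1r.
Qed.

Lemma unit_direction (v : E) : exists2 w, dotR w w = 1 & v = enorm v *: w.
Proof.
have [->|v0] := eqVneq v 0; last first.
  exists (direction v); last exact: scale_direction.
  by rewrite -enorm_sqr; have := direction_sphere v0; rewrite /sphere /= => ->; rewrite expr1n.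
exists (delta_mx 0 ord0); last by rewrite enorm0 scale0r.
rewrite /dotR (bigD1 ord0)//= big1 ?addr0 ?mxE ?eqxx ?mulr1// => i i0.
by rewrite mxE (negbTE i0) andbF mul0r.
Qed.

Lemma ge0_integral_sphereN (f : E -> \bar R) :
  measurable_fun setT f -> (forall x, 0 <= f x)%E ->
  (\int[sphere_vol]_(x in sphere) f (- x)%R = \int[sphere_vol]_(x in sphere) f x)%E.
Proof.
move=> mf f0; have mN : measurable_fun setT (fun x : E => - x).
  have := @measurable_scale_rV R e.+1 (-1); congr measurable_fun.
  by apply/funext => x; rewrite scaleN1r.
have mfN : measurable_fun setT (fun x : E => f (- x)) by exact: measurableT_comp.
rewrite !ge0_integral_sphere//; congr (_ * _)%E.
have mP := @measurable_punctured_ball R e.+1.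
rewrite !(integral_mkcond punctured_ball).
have := @ge0_integral_rV_scale R e.+1 (-1)
  (fun x => (f (direction x) * (\1_(@punctured_ball R e.+1) x)%:E)%E).
rewrite normrN1 expr1n invr1 mul1e => H.
have ne1 : -1 != 0 :> R by rewrite oppr_eq0 oner_eq0.
have mfd : measurable_fun setT (fun x : E => f (direction x)).
  by apply: measurableT_comp => //; exact: measurable_direction.
transitivity (\int[lebesgue_rV e.+1]_x (f (direction (-1 *: x)) * (\1_(@punctured_ball R e.+1) (-1 *: x))%:E))%E.
  apply: eq_integral => x _; rewrite scaleN1r directionN patchE indicE.
  have -> : (- x \in punctured_ball) = (x \in @punctured_ball R e.+1).
    by apply/idP/idP => /set_mem h; apply/mem_set; move: h; rewrite /punctured_ball /= enormN.
  by case: ifP => _; rewrite ?mule1 ?mule0.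
rewrite H//; first last.
- by move=> x; rewrite mule_ge0// lee_fin.
- apply: emeasurable_funM => //; apply/measurable_EFinP; exact: measurable_indic.
by apply: eq_integral => x _; rewrite patchE indicE; case: ifP => _; rewrite ?mule1 ?mule0.
Qed.

(** The imaginary part is odd under the antipodal map, and the real part has the Taylor series in
    the norm of [v] that defines J. *)
Lemma sphere_fourier (v : E) (J : R) : is_bessel_cos e (enorm v) J ->
  sphere_int (fun x => expi (dotR v x)) = J%:C.
Proof.
move=> hJ; have [w w1 vw] := unit_direction v.
rewrite /sphere_int /cintegral /=; congr (_ +i* _).
  apply: (@complexI R); apply: hsum_uniq hJ.
  have := sphere_bessel_cos (enorm v) w1; congr (is_bessel_cos _ _ _).
  by apply: eq_Rintegral => x _; rewrite -dotRZl -vw.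
apply: (@Rintegral_odd _ E R sphere_vol sphere (fun x => - x)).
- by move=> g mg g0; exact: ge0_integral_sphereN.
- by apply: measurableT_comp; [exact: (continuous_measurable_fun (@continuous_sin R))|exact: mdot].
- by move=> x; rewrite dotRNr sinN.
Qed.

Lemma sphere_int_bound (f : E -> R[i]) : cbounded sphere f 1 ->
  normc (sphere_int f) <= 2 * fine (@sphere_vol R e.+1 sphere).
Proof.
move=> hf; rewrite -[leRHS]mulr1.
by apply: normc_cintegral => //; [exact: measurable_sphere|exact: sphere_vol_lty].
Qed.

Lemma cbounded_expi_dot (v : E) : cbounded sphere (fun x => expi (dotR v x)) 1.
Proof.
split.
- by apply: measurable_funTS; apply: measurableT_comp; [exact: (continuous_measurable_fun (@continuous_cos R))|exact: mdot].
- by apply: measurable_funTS; apply: measurableT_comp; [exact: (continuous_measurable_fun (@continuous_sin R))|exact: mdot].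
- by move=> x _; rewrite normc_expi.
Qed.

End sphere_fourier.

Lemma ex_bessel (R : realType) e (r : R) :
  (exists v, is_bessel_cos e r v) /\ (exists w, is_bessel_sin e r w).
Proof.
have [w w1 _] := unit_direction (0 : 'rV[R]_e.+1).
by split; eexists; [exact: sphere_bessel_cos r w1|exact: sphere_bessel_sin r w1].
Qed.

Lemma bessel_asympP (R : realType) e : @bessel_asymp R e.
Proof.
elim/ltn_ind: e => -[_|[_|e IH]]; [exact: bessel_asymp0|exact: bessel_asymp1|].
by apply: bessel_asymp_dim; [exact: ex_bessel|exact: IH].
Qed.

Section powers.
Context {R : realType}.

Lemma powRN_le (b x y : R) : 0 <= b -> 0 < x -> x <= y -> y `^ (- b) <= x `^ (- b).
Proof.
move=> b0 x0 xy; rewrite !powRN lef_pV2 ?posrE ?powR_gt0//; last exact: lt_le_trans xy.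
by apply: ge0_ler_powR; rewrite ?nnegrE ?(ltW x0)// (le_trans (ltW x0)).
Qed.

Lemma powR1N (b : R) : 1 `^ b = 1.
Proof. by rewrite /powR oner_eq0 ln1 mulr0 expR0. Qed.

Lemma powRN_half (b x : R) : 0 < x -> (x / 2) `^ (- b) = 2 `^ b * x `^ (- b).
Proof.
move=> x0; have h : 0 < x / 2 by rewrite divr_gt0.
have E : x `^ b = (x / 2) `^ b * 2 `^ b by rewrite -powRM ?(ltW h)// divfK.
rewrite !powRN E.
have h2 : 0 < (2 : R) `^ b by exact: powR_gt0.
have h3 : 0 < (x / 2) `^ b by exact: powR_gt0.
by field; rewrite !lt0r_neq0.
Qed.

Lemma powRN_lip (a m x y : R) : 0 <= a -> 0 < m -> m <= x -> m <= y ->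
  `|x `^ (- a) - y `^ (- a)| <= a * m `^ (- (a + 1)) * `|x - y|.
Proof.
move=> a0 m0; wlog yx : x y / y <= x.
  move=> H mx my; have /orP[xy|yx] := le_total x y; last exact: H.
  by rewrite [leLHS]distrC [in leRHS]distrC; exact: H.
move=> mx my; have y0 : 0 < y by exact: lt_le_trans my.
rewrite [X in _ <= _ * X]ger0_norm ?subr_ge0// distrC ger0_norm; last first.
  by rewrite subr_ge0; exact: powRN_le.
pose c := a * m `^ (- (a + 1)).
have h1 (z : R) : y <= z <= x -> is_derive z 1 (fun z : R => (-1) * z `^ (- a)) (a * z `^ (- a - 1)).
  move=> /andP[yz _]; have z0 : 0 < z by exact: lt_le_trans yz.
  by apply: is_derive_eq (is_deriveZ1 (-1) (is_derive1_powR (- a) z0)) _; ring.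
have h2 (z : R) : y <= z <= x -> is_derive z 1 (fun z : R => c * z) c.
  by move=> _; apply: is_derive_eq (is_deriveZ1 c (is_derive_id1 z)) _; rewrite mulr1.
have h3 (z : R) : y <= z <= x -> a * z `^ (- a - 1) <= c.
  move=> /andP[yz _]; rewrite /c opprD ler_wpM2l// -opprD; apply: powRN_le => //; first lra.
  exact: le_trans yz.
by have := deriv_le yx h1 h2 h3; rewrite -/c; lra.
Qed.

End powers.

(** * Asymptotics uniform in a shift of the frequency *)

Section sphere_asymptotics.
Context {R : realType} {e : nat}.
Local Notation E := 'rV[R]_e.+1.
Let a : R := e%:R / 2.

Definition sphere_hat (v : E) : R[i] := sphere_int (fun x => expi (dotR v x)).

Lemma normc_sphere_hat (v : E) : normc (sphere_hat v) <= 2 * fine (@sphere_vol R e.+1 sphere).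
Proof. by apply: sphere_int_bound; exact: cbounded_expi_dot. Qed.

Lemma bessel_bound (r J : R) : 0 <= r -> is_bessel_cos e r J ->
  `|J| <= 2 * fine (@sphere_vol R e.+1 sphere).
Proof.
move=> r0 hJ; have [w w1 _] := unit_direction (0 : E).
have wr : enorm (r *: w) = r by rewrite enormZ ger0_norm// /enorm w1 sqrtr1 mulr1.
rewrite -[r]wr in hJ; rewrite -normc_real -(sphere_fourier hJ).
exact: normc_sphere_hat.
Qed.

Let S := 2 * fine (@sphere_vol R e.+1 sphere).
Let K := (2 * pi) `^ a : R.

Let a0 : 0 <= a. Proof. by rewrite divr_ge0. Qed.

Let S0 : 0 <= S.
Proof. by rewrite mulr_ge0// fine_ge0. Qed.

Let K0 : 0 < K.
Proof. by apply: powR_gt0; have := pi_gt0 R; lra. Qed.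

Let powK (r : R) : 0 < r -> (2 * pi / r) `^ a = K * r `^ (- a).
Proof.
move=> r0; have p2 : 0 <= 2 * pi :> R by have := pi_gt0 R; lra.
rewrite powRM ?invr_ge0 ?(ltW r0)//; congr (_ * _).
by rewrite -powR_inv1 ?(ltW r0)// -powRrM mulN1r.
Qed.

(** For r <= 1 the factor r^(-(a + 1)) dominates both J and the main term. This range occurs because
    r will only be known to be at least t / 2. *)
Lemma bessel_asymp_gt0 : exists2 C : R, 0 < C & forall r J, 0 < r -> is_bessel_cos e r J ->
  `|J - 2 * K * r `^ (- a) * cos (r - pi / 4 * e%:R)| <= C * r `^ (- (a + 1)).
Proof.
have [C C0 hC] := @bessel_asympP R e.
exists (C + S + 2 * K); first by have := K0; have := S0; lra.
move=> r J r0 hJ; have g0 : 0 <= r `^ (- (a + 1)) by exact: powR_ge0.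
have /orP[r1|r1] := le_total 1 r.
  have [_ [w hw]] := ex_bessel e r.
  have [+ _] := hC r J w r1 hJ hw; rewrite -/a powK// mulrA => h.
  apply: le_trans h _; rewrite ler_wpM2r//; have := K0; have := S0; lra.
apply: le_trans (ler_normB _ _) _.
have h1 : `|J| <= S * r `^ (- (a + 1)).
  apply: le_trans (bessel_bound (ltW r0) hJ) _; rewrite -/S ler_peMr//.
  rewrite -[leLHS](powR1N (- (a + 1))); apply: powRN_le => //; have := a0; lra.
have h2 : `|2 * K * r `^ (- a) * cos (r - pi / 4 * e%:R)| <= 2 * K * r `^ (- (a + 1)).
  rewrite normrM (ger0_norm (x := _ * _)); last by rewrite !mulr_ge0// ?powR_ge0// ltW.
  have hr : r `^ (- a) <= r `^ (- (a + 1)).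
    rewrite opprD powRD ?lt0r_neq0 ?implybT// powR_inv1 ?(ltW r0)// ler_peMr ?powR_ge0//.
    by rewrite invf_ge1.
  have hc : `|cos (r - pi / 4 * e%:R)| <= 1 by rewrite ler_norml cos_geN1 cos_le1.
  rewrite -[leRHS]mulr1; apply: ler_pM => //; first by rewrite !mulr_ge0 ?powR_ge0// ltW.
  by rewrite ler_wpM2l// mulr_ge0// ltW.
apply: le_trans (lerD h1 h2) _; rewrite -mulrDl -addrA; apply: ler_wpM2r => //.
by rewrite lerDr ltW.
Qed.

(** Here t stands for t |k|, r for |t k + q| and p for the component of q along k. When t <= 2 q the
    weight (1 + q)^d compensates the power of t and boundedness suffices; otherwise r >= t / 2 and r
    differs from t + p by at most q^2 / t. *)
Lemma bessel_shift : exists2 C : R, 0 < C & forall (t p q r J : R), 1 <= t -> 0 <= q -> `|p| <= q ->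
  0 <= r -> r ^+ 2 = t ^+ 2 + 2 * t * p + q ^+ 2 -> (0 < e)%N -> is_bessel_cos e r J ->
  `|J - 2 * K * t `^ (- a) * cos (t + p - pi / 4 * e%:R)| <= C * (1 + q) ^+ e.+1 * t `^ (- (a + 1)).
Proof.
have [C C0 hC] := bessel_asymp_gt0; pose B : R := 2 `^ (a + 1).
have B0 : 0 < B by exact: powR_gt0.
(* In this order: the remainder at r, the change of amplitude from r to t, the change of phase from
   r to t + p, and the regime t <= 2 q. *)
pose C2 := C * B + 2 * K * a * B + 2 * K + (S + 2 * K) * B.
have [c1 [c2 [c3 c4]]] : 0 < C * B /\ 0 <= 2 * K * a * B /\ 0 < 2 * K /\ 0 <= (S + 2 * K) * B.
  have SK : 0 <= S + 2 * K by have := K0; have := S0; lra.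
  rewrite (mulr_gt0 C0 B0) (mulr_ge0 SK (ltW B0)) mulr_gt0//; split => //; split => //.
  by rewrite !mulr_ge0// ltW.
exists C2; first by rewrite /C2; lra.
move=> t p q r J t1 q0 pq r0 rE e0 hJ.
have t0 : 0 < t by lra.
have Gt : 0 < t `^ (- (a + 1)) by exact: powR_gt0.
have q1 : 1 <= 1 + q by lra.
have a10 : 0 <= a + 1 by have := a0; lra.
have /orP[tq|tq] := le_total t (2 * q).
  have big : 1 <= B * (1 + q) ^+ e.+1 * t `^ (- (a + 1)).
    have h1 : (2 * (1 + q)) `^ (- (a + 1)) <= t `^ (- (a + 1)) by apply: powRN_le => //; lra.
    have h2 : (1 + q) `^ (a + 1) <= (1 + q) ^+ e.+1.
      rewrite -powR_mulrn; last lra.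
      by apply: ler_powR => //; rewrite -natr1 lerD2r /a ler_pdivrMr// ler_peMr// ler1n.
    have qp : 0 < (1 + q) `^ (a + 1) by apply: powR_gt0; lra.
    apply: (@le_trans _ _ (B * (1 + q) `^ (a + 1) * (2 * (1 + q)) `^ (- (a + 1)))).
      rewrite powRN powRM//; last lra.
      by rewrite divff// lt0r_neq0// mulr_gt0.
    by apply: ler_pM => //; rewrite ?mulr_ge0 ?powR_ge0 ?(ltW B0) ?(ltW qp)// ler_pM2l.
  have h1 : `|J - 2 * K * t `^ (- a) * cos (t + p - pi / 4 * e%:R)| <= S + 2 * K.
    apply: le_trans (ler_normB _ _) _; apply: lerD; first exact: bessel_bound r0 hJ.
    rewrite normrM (ger0_norm (x := _ * _)); last by rewrite !mulr_ge0// ?powR_ge0// ltW.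
    rewrite -[leRHS]mulr1; apply: ler_pM => //; first by rewrite !mulr_ge0 ?powR_ge0// ltW.
      rewrite ler_piMr ?(ltW c3)// -[leRHS](powR1N (- a)); exact: powRN_le.
    by rewrite ler_norml cos_geN1 cos_le1.
  apply: le_trans h1 _; rewrite -mulrA.
  apply: (@le_trans _ _ ((S + 2 * K) * B * ((1 + q) ^+ e.+1 * t `^ (- (a + 1))))).
    have SK : 0 <= S + 2 * K by have := K0; have := S0; lra.
    by rewrite -mulrA ler_peMr// mulrA.
  have h4 : 0 <= (1 + q) ^+ e.+1 * t `^ (- (a + 1)).
    by apply: mulr_ge0 (ltW Gt); apply: exprn_ge0; lra.
  by apply: ler_wpM2r => //; rewrite /C2; lra.
have rt1 : `|r - t| <= q.
  move: pq; rewrite !ler_norml => /andP[p1 p2]; apply/andP; split.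
    rewrite lerBrDl -(@ler_pXn2r _ 2)// ?nnegrE//; last lra.
    by rewrite rE; nra.
  rewrite lerBlDl -(@ler_pXn2r _ 2)// ?nnegrE//; last lra.
  by rewrite rE; nra.
have rt : t / 2 <= r by move: rt1; rewrite ler_norml => /andP[? ?]; lra.
have r00 : 0 < r by apply: lt_le_trans rt; lra.
(* r^2 - (t + p)^2 = q^2 - p^2, to be divided by r + (t + p), which is at least t. *)
have hcos : `|r - (t + p)| <= q ^+ 2 / t.
  have pos : t <= r + (t + p) by move: pq; rewrite ler_norml => /andP[? ?]; lra.
  rewrite ler_pdivlMr//.
  apply: (@le_trans _ _ (`|r - (t + p)| * (r + (t + p)))); first by rewrite ler_wpM2l.
  have n0 : 0 <= r + (t + p) by lra.
  rewrite -[X in _ * X](ger0_norm n0).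
  rewrite -normrM -subr_sqr rE.
  rewrite (_ : _ - _ = q ^+ 2 - p ^+ 2); last by ring.
  have p2 : p ^+ 2 <= q ^+ 2 by rewrite -real_normK ?num_real// lerXn2r ?nnegrE.
  by rewrite ger0_norm ?subr_ge0//; have := sqr_ge0 p; lra.
have {}hC := hC r J r00 hJ.
have rG : r `^ (- (a + 1)) <= B * t `^ (- (a + 1)).
  by rewrite /B -powRN_half//; apply: powRN_le => //; lra.
have d1 : `|r `^ (- a) - t `^ (- a)| <= a * (B * t `^ (- (a + 1))) * q.
  have h : 0 < t / 2 by lra.
  have := @powRN_lip R a (t / 2) r t a0 h rt.
  have tt : t / 2 <= t by lra.
  move=> /(_ tt) h2; apply: le_trans h2 _; rewrite /B -powRN_half// ler_wpM2l//.
  by rewrite mulr_ge0// powR_ge0.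
have d2 : `|cos (r - pi / 4 * e%:R) - cos (t + p - pi / 4 * e%:R)| <= q ^+ 2 / t.
  apply: le_trans (cos_lip _ _) _; apply: le_trans hcos.
  by rewrite (_ : _ - _ - _ = r - (t + p))//; ring.
have tG : t `^ (- a) / t = t `^ (- (a + 1)).
  by rewrite opprD powRD ?lt0r_neq0 ?implybT// powR_inv1// ltW.
set c := cos (r - _) in hC d2; set c' := cos (t + _ - _) in d2 *.
have -> : J - 2 * K * t `^ (- a) * c' = (J - 2 * K * r `^ (- a) * c) +
   (2 * K * ((r `^ (- a) - t `^ (- a)) * c) + 2 * K * (t `^ (- a) * (c - c'))) by ring.
have c01 : `|c| <= 1 by rewrite ler_norml cos_geN1 cos_le1.
have h2 : `|2 * K * ((r `^ (- a) - t `^ (- a)) * c)| <= 2 * K * a * B * q * t `^ (- (a + 1)).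
  rewrite normrM (gtr0_norm c3) (_ : 2 * K * a * B * q * t `^ (- (a + 1)) =
    2 * K * (a * (B * t `^ (- (a + 1))) * q)); last by ring.
  rewrite ler_pM2l// normrM.
  by apply: le_trans (ler_pM (normr_ge0 _) (normr_ge0 _) d1 c01) _; rewrite mulr1.
have h3 : `|2 * K * (t `^ (- a) * (c - c'))| <= 2 * K * q ^+ 2 * t `^ (- (a + 1)).
  rewrite normrM (gtr0_norm c3) -[leRHS]mulrA ler_pM2l// normrM (ger0_norm (powR_ge0 _ _)) -tG.
  by apply: le_trans (ler_wpM2l (powR_ge0 _ _) d2) _; rewrite mulrCA mulrC -mulrA.
have h1 : `|J - 2 * K * r `^ (- a) * c| <= C * B * t `^ (- (a + 1)).
  by apply: le_trans hC _; rewrite -mulrA ler_pM2l.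
(* The phase error is quadratic in q and must fit into (1 + q)^d: the condition d >= 2 enters
   here. *)
have hq2 : (1 + q) ^+ 2 <= (1 + q) ^+ e.+1 by apply: ler_weXn2l.
set Q := (1 + q) ^+ e.+1 in hq2 *.
have Q1 : 1 <= Q by exact: exprn_ege1.
apply: le_trans (ler_normD _ _) _; apply: le_trans (lerD (lexx _) (ler_normD _ _)) _.
apply: le_trans (lerD h1 (lerD h2 h3)) _.
rewrite -!mulrDl ler_pM2r//.
have k1 : C * B <= C * B * Q by rewrite ler_peMr// ltW.
have k2 : 2 * K * a * B * q <= 2 * K * a * B * Q by rewrite ler_wpM2l//; nra.
have k3 : 2 * K * q ^+ 2 <= 2 * K * Q by rewrite ler_pM2l//; nra.
have k4 : 0 <= (S + 2 * K) * B * Q by rewrite mulr_ge0//; lra.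
by rewrite /C2 !mulrDl in k4 *; lra.
Qed.

Lemma expiN (x : R) : expi x + expi (- x) = (2 * cos x)%:C.
Proof. by rewrite /expi cosN sinN; simpc; congr (_ +i* _); ring. Qed.

(** One of the two exponentials of the cosine. The dependence on q is kept as a character at the
    stationary point [pm s *: direction k], so that a sum over q becomes a Fourier series evaluated
    at that point. *)
Definition wave (k q : E) (t : R) (s : bool) : R[i] :=
  expi (- (pm s * (pi / 4) * e%:R)) * (expi (pm s * (t * enorm k)) * expi (dotR (pm s *: direction k) q)).

Lemma sphere_hat_asymp : (0 < e)%N -> exists2 C : R, 0 < C & forall (k q : E) t,
  1 <= t -> 1 <= enorm k ->
  normc (sphere_hat (t *: k + q) -
    ((2 * pi / t) `^ a)%:C * \sum_(s : bool) (wave k q t s / (enorm k `^ a)%:C)) <=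
  C * (1 + enorm q) ^+ e.+1 * t `^ (- (a + 1)).
Proof.
move=> e0; have [C C0 hC] := bessel_shift; exists C => // k q t t1 k1.
have t0 : 0 < t by lra. have k0 : 0 < enorm k by lra.
have kn : k != 0 by rewrite -enorm_gt0.
pose u := t * enorm k; pose p := dotR (direction k) q.
have u1 : 1 <= u by rewrite -[1]mulr1 /u; apply: ler_pM.
have pq : `|p| <= enorm q.
  by apply: le_trans (cauchy_schwarz _ _) _; rewrite (direction_sphere kn) mul1r.
have rE : enorm (t *: k + q) ^+ 2 = u ^+ 2 + 2 * u * p + enorm q ^+ 2.
  rewrite !enorm_sqr dotRDl !dotRDr !dotRZl !dotRZr (dotRC q k) /u exprMn enorm_sqr.
  rewrite /p /direction dotRZl; field; exact: lt0r_neq0.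
have [[J hJ] _] := ex_bessel e (enorm (t *: k + q)).
rewrite /sphere_hat (sphere_fourier hJ).
have -> : ((2 * pi / t) `^ a)%:C * \sum_(s : bool) (wave k q t s / (enorm k `^ a)%:C) =
    (2 * K * u `^ (- a) * cos (u + p - pi / 4 * e%:R))%:C.
  rewrite -mulr_suml big_bool /wave /pm /= !mul1r !scale1r.
  rewrite -!expiD scaleN1r dotRNl -/u -/p.
  have -> : - (-1 * (pi / 4) * e%:R) + (-1 * u + - p) = - (- (pi / 4 * e%:R) + (u + p)) by ring.
  rewrite expiN -rmorphV /=; last first.
    by rewrite unitfE lt0r_neq0// powR_gt0.
  rewrite -!rmorphM /=; congr (_%:C).
  rewrite powK// /u !powRN powRM ?(ltW t0) ?(ltW k0)// addrC.
  have hk := powR_gt0 a k0; have ht := powR_gt0 a t0.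
  by field; rewrite !lt0r_neq0.
rewrite -rmorphB normc_real.
have := hC u p (enorm q) _ J u1 (enorm_ge0 _) pq (enorm_ge0 _) rE e0 hJ => h.
apply: le_trans h _; apply: ler_wpM2l.
  by rewrite mulr_ge0 ?exprn_ge0 ?(ltW C0)// addr_ge0 ?enorm_ge0.
apply: powRN_le => //; first by have := a0; lra.
by rewrite /u ler_peMr// ltW.
Qed.

End sphere_asymptotics.

(** * Fourier series of finitely differentiable functions *)

Section ultralimit.
Context {R : realType} {I : eqType}.

(** [v i] is the limit of [u s i] along an ultrafilter finer than infinity. The conclusion keeps
    what is used of it: simultaneous approximation on a finite list, at arbitrarily large s. *)
Lemma ultra_family (u : nat -> I -> R) (B : I -> R) : (forall s i, `|u s i| <= B i) ->
  exists v : I -> R, forall (l : seq I) (S : nat) (eps : R), 0 < eps ->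
    exists2 s, (S <= s)%N & forall i, i \in l -> `|u s i - v i| <= eps.
Proof.
move=> uB; have [U [UU hU]] := ultraFilterLemma (@eventually_filter).
have PU : ProperFilter U by exact: ultra_proper.
pose A i := [set x : R | U [set s | x <= u s i]].
have hA i : has_sup (A i).
  split; first by exists (- B i); apply: filterS filterT => s _ /=; have := uB s i; rewrite ler_norml => /andP[].
  exists (B i) => x /filter_ex[s /= h]; apply: le_trans h _; have := uB s i; rewrite ler_norml => /andP[_].
  by [].
exists (fun i => sup (A i)) => l S eps eps0.
suff : U [set s | (S <= s)%N /\ forall i, i \in l -> `|u s i - sup (A i)| <= eps].
  by move=> /filter_ex[s /= [? ?]]; exists s.
apply: filterI; first by apply: hU; exists S.
elim: l => [|i l IH]; first by apply: filterS filterT.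
have [x Ax hx] := sup_adherent eps0 (hA i).
have h2 : U [set s | u s i < sup (A i) + eps].
  have [h|h] := in_ultra_setVsetC [set s | sup (A i) + eps <= u s i] UU.
    have /(ub_le_sup (hA i).2) : A i (sup (A i) + eps) by exact: h.
    by rewrite gerDl leNgt eps0.
  by apply: filterS h => s /= /negP; rewrite -ltNge.
apply: filterS (filterI Ax (filterI h2 IH)) => s /= [h3 [h4 h5]] j.
rewrite inE => /predU1P[->|]; last exact: h5.
by rewrite ler_norml; lra.
Qed.

End ultralimit.

Section weights.
Context {R : realType}.

(** The product form reduces summability of [zweight K ^- 2] to one integer variable, and makes the
    weight of a pair of frequencies the product of the weights. *)
Definition zweight {n} (K : 'rV[int]_n) : R := \prod_i (1 + `|(K 0 i)%:~R|).

Lemma prod_ge1 (J : Type) (r : seq J) (P : pred J) (f : J -> R) :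
  (forall j, P j -> 1 <= f j) -> 1 <= \prod_(j <- r | P j) f j.
Proof.
move=> h; elim/big_rec: _ => // j x Pj x1.
by rewrite -[1]mulr1; apply: ler_pM => //; exact: h.
Qed.

Lemma zweight_ge1 n (K : 'rV[int]_n) : 1 <= zweight K.
Proof. by apply: prod_ge1 => i; rewrite lerDl. Qed.

Lemma zweight_gt0 n (K : 'rV[int]_n) : 0 < zweight K.
Proof. exact: lt_le_trans (zweight_ge1 K). Qed.

Lemma zweight_ge n (K : 'rV[int]_n) i : `|(K 0 i)%:~R| <= zweight K.
Proof.
rewrite /zweight (bigD1 i)//=; apply: (@le_trans _ _ (1 + `|(K 0 i)%:~R|)); first by rewrite lerDr.
by rewrite ler_peMr// ?addr_ge0//; apply: prod_ge1 => j; rewrite lerDl.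
Qed.

Lemma sum_inv_sqr N : \sum_(0 <= i < N) ((1 + i%:R) ^- 2 : R) <= 2.
Proof.
case: N => [|N]; first by rewrite big_geq.
suff h : \sum_(0 <= i < N.+1) ((1 + i%:R) ^- 2 : R) <= 2 - (N.+1%:R)^-1.
  by apply: le_trans h _; rewrite lerBlDr lerDl.
elim: N => [|N IH]; first by rewrite big_nat1 addr0 expr1n invr1; lra.
rewrite big_nat_recr//=; apply: le_trans (lerD IH (lexx _)) _.
have -> : 1 + N.+1%:R = N.+1%:R + 1 :> R by rewrite addrC.
have h0 : 0 < N.+1%:R :> R by rewrite ltr0n.
rewrite -[N.+2%:R]natr1; move: (N.+1%:R : R) h0 {IH} => x h0.
have h1 : x != 0 by exact: lt0r_neq0.
have h2 : 0 < x + 1 by lra.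
have h3 : x + 1 != 0 by exact: lt0r_neq0.
have E : x^-1 - (x + 1)^-1 = (x + 1) ^- 2 + (x * (x + 1) ^+ 2)^-1 by field; rewrite h1 h3.
have : 0 < (x * (x + 1) ^+ 2)^-1 by rewrite invr_gt0 mulr_gt0// exprn_gt0.
lra.
Qed.

Lemma le_asum (J : choiceType) (a : J -> R[i]) A B : A <= B -> asum a A -> asum a B.
Proof. by move=> AB h F; exact: le_trans (h F) AB. Qed.

Lemma asum_finType (J : finType) (a : J -> R[i]) : asum a (\sum_j normc (a j)).
Proof.
move=> F; rewrite big_uniq ?fset_uniq//= [leRHS](bigID (mem F))/= lerDl.
by apply: sumr_ge0 => i _; exact: normc_ge0.
Qed.

Lemma asum_finType1 (J : choiceType) (x : J) (a : J -> R[i]) : (forall y, y = x) ->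
  asum a (normc (a x)).
Proof.
move=> h F; have [->|[y yF]] := fset_0Vmem F; first by rewrite big_nil normc_ge0.
rewrite (_ : F = [fset x]%fset) ?big_seq_fset1//.
by apply/fsetP => z; rewrite (h z) inE eqxx -(h y).
Qed.

Let winv (z : int) : R[i] := ((1 + `|z%:~R : R|) ^- 2)%:C.

Lemma asum_int : asum winv 4.
Proof.
have a1 : asum (fun n : nat => (((1 + n%:R) ^- 2) : R)%:C) 2.
  apply: asum_series => N; apply: le_trans (sum_inv_sqr N).
  by apply: ler_sum => i _; rewrite ger0_norm// invr_ge0 exprn_ge0// addr_ge0.
have a2 : asum (fun _ : bool => (1 : R[i])) (2 : R).
  by have n1 := @normc1 R; apply: le_asum (asum_finType _); rewrite big_bool n1; exact: lexx.
have h := asum_prod a2 a1; rewrite (_ : 2 * 2 = 4 :> R) in h; last by ring.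
apply: (asum_inj (f := fun z : int => (z < 0, absz z)) _ _ h) => [z z' [e1 e2]|z].
  by rewrite (intEsign z) (intEsign z') e1 e2.
by rewrite /winv mul1r natr_absz intr_norm.
Qed.

Lemma asum_zweight n : asum (fun K : 'rV[int]_n => (zweight K ^- 2)%:C) (4 ^+ n).
Proof.
elim: n => [|n IH].
  apply: le_asum (asum_finType1 (x := 0 : 'rV[int]_0) _ _) => [|y]; last by apply/rowP => -[].
  by rewrite expr0 /zweight big_ord0 expr1n invr1 normc_real normr1.
rewrite exprS; have h := asum_prod asum_int IH.
apply: (asum_inj (f := fun K : 'rV[int]_n.+1 => (K 0 0, \row_j K 0 (lift ord0 j))) _ _ h).
  move=> K K' [e0 /rowP e1]; apply/rowP => i.
  case: (unliftP ord0 i) => [j|] -> //.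
  by have := e1 j; rewrite !mxE.
move=> K; rewrite normcM /winv !normc_real /= -normrM.
suff -> : zweight K = (1 + `|(K 0 0)%:~R|) * zweight (\row_j K 0 (lift ord0 j)) by rewrite exprMn invfM.
by rewrite /zweight big_ord_recl; congr (_ * _); apply: eq_bigr => i _; rewrite mxE.
Qed.

End weights.

Section trigonometric_bounds.
Context {R : realType}.

Lemma normc_expi_sub1 (x : R) : normc (expi x - 1) = 2 * `|sin (x / 2)|.
Proof.
rewrite -[RHS]ger0_norm ?mulr_ge0// -sqrtr_sqr /expi; simpc => /=; congr Num.sqrt.
have e : x = x / 2 + x / 2 by field.
have cs : cos x = 1 - 2 * sin (x / 2) ^+ 2.
  by rewrite [in LHS]e cosD -!expr2 cos2sin2; ring.
rewrite exprMn real_normK ?num_real// sqrrB1.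
have := cos2Dsin2 x; rewrite cs; move: (sin (x / 2)) (sin x) => a b; lra.
Qed.

Lemma sin_ge_cubic (x : R) : 0 <= x -> x - x ^+ 3 / 6 <= sin x.
Proof.
move=> x0.
have h1 (z : R) : 0 <= z <= x -> is_derive z 1 (fun z : R => z - z ^+ 3 / 6) (1 - z ^+ 2 / 2).
  move=> _; have h := is_deriveD1 (is_derive_id1 z) (is_deriveZ1 (- 6^-1) (is_deriveX1 2 z)).
  apply: is_derive_eq (eq_is_derive _ h) _; last by field.
  by move=> y; rewrite mulNr mulrC.
have := deriv_le x0 h1 (fun z _ => is_derive_sin z) (fun z _ => cos_ge_quad z).
by rewrite sin0 expr0n /= mul0r subr0 !subr0.
Qed.

(** The modulus is 2 |sin(x / 2)|. With y = |x| / 2 < 2 one has sin y >= y (1 - y^2 / 6) >= y /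
    3. *)
Lemma expi_sub1_ge (x : R) : `|x| <= pi -> `|x| / 3 <= normc (expi x - 1).
Proof.
wlog x0 : x / 0 <= x.
  move=> H hx; have /orP[?|?] := le_total 0 x; first exact: H.
  have := H (- x); rewrite normrN !normc_expi_sub1 mulNr sinN normrN; apply => //; lra.
rewrite normc_expi_sub1 ger0_norm// => hx.
have hp := @pihalf_lt2 R.
have := @sin_ge_cubic (x / 2); rewrite divr_ge0// => /(_ isT) h.
have : (x / 2) / 3 <= sin (x / 2) by nra.
by have := ler_norm (sin (x / 2)); lra.
Qed.

Lemma expi_eq1 (x : R) : `|x| < 2 * pi -> expi x = 1 -> x = 0.
Proof.
move=> hx e; have := normc_expi_sub1 x; rewrite e subrr normc0 => h.
have s0 : sin (x / 2) = 0 by apply/eqP; rewrite -normr_eq0; apply/eqP; lra.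
move: hx; rewrite ltr_norml => /andP[h1 h2].
have [x0|x0|//] := ltgtP x 0.
- have : 0 < sin (- (x / 2)) by apply: sin_gt0_pi; apply/andP; split; lra.
  by rewrite sinN s0 oppr0 ltxx.
- have : 0 < sin (x / 2) by apply: sin_gt0_pi; apply/andP; split; lra.
  by rewrite s0 ltxx.
Qed.

Lemma expi_lip (x y : R) : normc (expi x - expi y) <= 2 * `|x - y|.
Proof.
apply: le_trans (normc_le_ReIm _) _; rewrite /expi; simpc => /=.
by have := cos_lip x y; have := sin_lip x y; lra.
Qed.

Lemma expi_sum (I : Type) (r : seq I) (f : I -> R) :
  expi (\sum_(i <- r) f i) = \prod_(i <- r) expi (f i).
Proof.
elim: r => [|i r IH]; first by rewrite !big_nil expi0.
by rewrite !big_cons expiD IH.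
Qed.

Lemma expiMn (x : R) n : expi (x * n%:R) = expi x ^+ n.
Proof.
elim: n => [|n IH]; first by rewrite mulr0 expi0 expr0.
by rewrite -natr1 mulrDr mulr1 expiD IH exprSr.
Qed.

Lemma expi2pi (n : nat) : expi (2 * pi * n%:R) = 1 :> R[i].
Proof.
have e : expi (2 * pi) = 1 :> R[i].
  by rewrite /expi mulr_natl cos2pi sin2pi.
by rewrite expiMn e expr1n.
Qed.

Lemma expi2piz (z : int) : expi (2 * pi * z%:~R) = 1 :> R[i].
Proof.
case: z => n; first exact: expi2pi.
have := expi2pi n.+1; rewrite NegzE mulrNz mulrN => h.
by rewrite -conj_expi h conjc1.
Qed.

Lemma geometric_expi (N : nat) (x : R) : expi (x * N%:R) = 1 -> expi x != 1 ->
  \sum_(j < N) expi (x * j%:R) = 0.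
Proof.
move=> hN h1; under eq_bigr do rewrite expiMn.
have := subrX1 (expi x) N; rewrite -expiMn hN subrr => /esym/eqP.
by rewrite mulf_eq0 subr_eq0 (negbTE h1) => /eqP.
Qed.

End trigonometric_bounds.

Lemma hsum_finType (R : realType) (J : finType) (a : J -> R[i]) : hsum a (\sum_j a j).
Proof.
move=> e e0; exists [fset j in index_enum J]%fset => F hF.
rewrite (_ : \sum_(i <- F) a i = \sum_j a j) ?subrr ?normc0 ?(ltW e0)//.
rewrite big_uniq ?fset_uniq//=; apply: eq_bigl => j.
by apply: (fsubsetP hF); rewrite inE /= mem_index_enum.
Qed.

Lemma normcX (R : realType) (z : R[i]) n : normc (z ^+ n) = normc z ^+ n.
Proof. by elim: n => [|n IH]; rewrite ?normc1// !exprS normcM IH. Qed.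

(** * The discrete Fourier transform on grids *)

Section discrete_fourier.
Context {R : realType} {n : nat}.
Local Notation E := 'rV[R]_n.
Local Notation Z := 'rV[int]_n.
Implicit Types (F : E -> R[i]) (K : Z).

Definition unit_vec (j : 'I_n) : E := delta_mx 0 j.

Definition fbox : set E := [set z | forall i, - pi <= z 0 i < pi].

Definition fdiff (j : 'I_n) (h : R) F : E -> R[i] := fun z => F (z + h *: unit_vec j) - F z.

(* F takes the same values on both sides of the box, up to depth r beyond the face x_j = pi. *)
Definition wraps (j : 'I_n) (r : R) F := forall z, fbox z -> z 0 j <= - pi + r ->
  F (z + (2 * pi) *: unit_vec j) = F z.

Lemma unit_vecE j (z : E) (c : R) i : (z + c *: unit_vec j) 0 i = z 0 i + c * (i == j)%:R.
Proof. by rewrite !mxE eqxx. Qed.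

Lemma dotR_unit_vec (z : E) j : dotR z (unit_vec j) = z 0 j.
Proof.
rewrite /dotR (bigD1 j)//= big1 ?addr0 => [|i ij]; first by rewrite mxE !eqxx mulr1.
by rewrite mxE (negbTE ij) andbF mulr0.
Qed.

Variable s : nat.
Local Notation N := (s.+1.*2).

Definition step : R := pi / s.+1%:R.

Lemma step_gt0 : 0 < step. Proof. by rewrite divr_gt0// pi_gt0. Qed.

Lemma stepN : step * N%:R = 2 * pi.
Proof. by rewrite /step -mul2n natrM mulrCA divfK// pnatr_eq0. Qed.

Definition grid (a : {ffun 'I_n -> 'I_N}) : E := \row_i (- pi + step * (a i)%:R).

Lemma grid_fbox a : fbox (grid a).
Proof.
move=> i; rewrite mxE lerDl mulr_ge0 ?(ltW step_gt0)//=.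
rewrite -ltrBrDl opprK (_ : pi + pi = 2 * pi :> R); last by ring.
by rewrite -stepN ltr_pM2l ?step_gt0// ltr_nat.
Qed.

Definition dft F K : R[i] := \sum_a F (grid a) * expi (- dotR (zvec K) (grid a)).

Definition gshift (j : 'I_n) (a : {ffun 'I_n -> 'I_N}) : {ffun 'I_n -> 'I_N} :=
  [ffun i => if i == j then ordS (a i) else a i].

Lemma gshift_bij j : bijective (gshift j).
Proof.
exists (fun a : {ffun 'I_n -> 'I_N} => [ffun i => if i == j then ord_pred (a i) else a i]) => a;
  by apply/ffunP => i; rewrite !ffunE; case: (i == j); rewrite ?ordSK ?ord_predK.
Qed.

(** Only the last layer of the grid leaves the box, landing on x_j = pi; [wraps] at depth 0
    identifies it with the first layer. *)
Lemma sum_grid_shift j (G : E -> R[i]) : wraps j 0 G ->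
  \sum_a G (grid a + step *: unit_vec j) = \sum_a G (grid a).
Proof.
move=> hG; rewrite [RHS](reindex (gshift j)) /=; last by apply: onW_bij; exact: gshift_bij.
apply: eq_bigr => a _; have [h|h] := ltnP (a j).+1 N.
  congr G; apply/rowP => i; rewrite unit_vecE !mxE ffunE; case: eqP => [->|_]; last by rewrite mulr0 addr0.
  by rewrite /= modn_small// -natr1; ring.
have aj : (a j).+1 = N by apply/eqP; rewrite eqn_leq h andbT ltn_ord.
rewrite -(hG (grid (gshift j a))); last first.
- by rewrite mxE ffunE eqxx /= aj modnn mulr0.
- exact: grid_fbox.
congr G; apply/rowP => i; rewrite !unit_vecE !mxE ffunE; case: eqP => [->|_]; last by rewrite !mulr0 !addr0.
rewrite /= aj modnn !mulr1 mulr0 addr0 -addrA; congr (_ + _).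
rewrite -stepN; have -> : N%:R = (a j)%:R + 1 :> R by rewrite natr1 aj.
by ring.
Qed.

Lemma wrapM j r F G : wraps j r F -> wraps j r G -> wraps j r (fun z => F z * G z).
Proof. by move=> hF hG z bz zr; rewrite hF ?hG. Qed.

Lemma wrap_expi j r K : wraps j r (fun z => expi (- dotR (zvec K) z)).
Proof.
move=> z _ _; rewrite dotRDr dotRZr dotR_unit_vec mxE opprD expiD.
by rewrite -mulrN -mulrNz expi2piz mulr1.
Qed.

Lemma le_wrap j r r' F : r' <= r -> wraps j r F -> wraps j r' F.
Proof. by move=> h hF z bz zr; apply: hF => //; lra. Qed.

(** Each difference looks one step further beyond the face and so consumes one step of depth; this
    is why [wraps] has a depth. *)
Lemma wrap_fdiff j r F : step <= r -> r <= 1 -> wraps j r F -> wraps j (r - step) (fdiff j step F).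
Proof.
move=> sr r1 hF z bz zr; have p2 := @pi_ge2 R; have s0 := step_gt0.
rewrite /fdiff -addrA [_ *: _ + _]addrC addrA !hF//; try lra.
- move=> i; rewrite unit_vecE; have := bz i; case: eqP => [->|_]; last by rewrite mulr0 addr0.
  by rewrite mulr1 => /andP[? ?]; apply/andP; split; lra.
- by rewrite unit_vecE eqxx mulr1; lra.
Qed.

(** Summation by parts on the grid, the discrete form of the rule that a derivative multiplies the
    transform by the frequency. *)
Lemma dft_fdiff j F K : wraps j 0 F ->
  dft (fdiff j step F) K = (expi (step * (K 0 j)%:~R) - 1) * dft F K.
Proof.
move=> hF; have := sum_grid_shift (wrapM hF (@wrap_expi j 0 K)) => H.
rewrite mulrBl mul1r -[X in _ = expi _ * X - _]H /dft mulr_sumr -sumrB.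
apply: eq_bigr => a _; rewrite /fdiff mulrBl; congr (_ - _).
rewrite mulrCA; congr (_ * _); rewrite -expiD dotRDr dotRZr dotR_unit_vec mxE; congr expi; ring.
Qed.

Lemma dft_iter_fdiff j m r F K : m%:R * step <= r -> r <= 1 -> wraps j r F ->
  dft (iter m (fdiff j step) F) K = (expi (step * (K 0 j)%:~R) - 1) ^+ m * dft F K.
Proof.
move=> mr r1 hF.
have [//] : wraps j (r - m%:R * step) (iter m (fdiff j step) F) /\
  dft (iter m (fdiff j step) F) K = (expi (step * (K 0 j)%:~R) - 1) ^+ m * dft F K.
have s0 := step_gt0.
elim: m mr => [|m IH] mr; first by rewrite mul0r subr0 expr0 mul1r.
have [|h1 h2] := IH; first by apply: le_trans mr; rewrite ler_pM2r// ler_nat.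
rewrite -natr1 mulrDl mul1r in mr *; split.
  rewrite opprD addrA; apply: wrap_fdiff h1; first lra.
  have h9 : 0 <= m%:R * step by rewrite mulr_ge0// ltW.
  by lra.
by rewrite iterS dft_fdiff ?h2 ?exprS ?mulrA//; apply: le_wrap h1; lra.
Qed.

(** Residues are centred so that [step] times a frequency stays in [- pi, pi], the range where
    |e^(ix) - 1| is comparable to |x|. *)
Definition freq (b : {ffun 'I_n -> 'I_N}) : Z := \row_i ((b i)%:Z - s.+1%:Z).

Lemma freq_orth (a a' : {ffun 'I_n -> 'I_N}) :
  \sum_b expi (dotR (zvec (freq b)) (grid a - grid a')) =
  if a == a' then (N%:R ^+ n)%:C else 0 :> R[i].
Proof.
pose f i (b : 'I_N) : R[i] := expi (((b%:Z - s.+1%:Z)%:~R) * (step * ((a i)%:R - (a' i)%:R))).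
transitivity (\sum_(b : {ffun 'I_n -> 'I_N}) \prod_i f i (b i)).
  apply: eq_bigr => b _; rewrite /dotR expi_sum; apply: eq_bigr => i _.
  by rewrite /f !mxE; congr (expi (_ * _)); ring.
rewrite -bigA_distr_bigA /=.
case: ifP => [/eqP e|/negbT na].
  rewrite /f e; under eq_bigr => i _ do
    (under eq_bigr => j _ do rewrite subrr mulr0 mulr0 expi0; rewrite big_const_ord iter_addr_0).
  by rewrite prodr_const card_ord rmorphXn /= rmorph_nat.
have [i nai] : exists i, a i != a' i by apply/existsP; apply: contraR na; rewrite negb_exists =>
  /forallP h; apply/eqP/ffunP => i; apply/eqP; have := h i; rewrite negbK.
rewrite (bigD1 i)//= (_ : \sum_j f i j = 0) ?mul0r//.
pose x := step * ((a i)%:R - (a' i)%:R) : R.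
transitivity (expi (- (s.+1%:R * x)) * \sum_(j < N) expi (x * j%:R)).
  rewrite mulr_sumr; apply: eq_bigr => j _; rewrite /f -/x -expiD; congr expi.
  by rewrite rmorphB /=; ring.
rewrite geometric_expi ?mulr0//.
  rewrite /x mulrAC stepN.
  rewrite (_ : 2 * pi * ((a i)%:R - (a' i)%:R) = 2 * pi * ((a i)%:Z - (a' i)%:Z)%:~R) ?expi2piz//.
  by rewrite rmorphB.
apply/eqP => /expi_eq1 h; have s0 := step_gt0.
have : x = 0.
  apply: h; rewrite /x normrM gtr0_norm// -stepN ltr_pM2l//.
  have h1 := ltn_ord (a i); have h2 := ltn_ord (a' i).
  rewrite -(ltr_nat R) in h1; rewrite -(ltr_nat R) in h2.
  have := ler0n R (a i); have := ler0n R (a' i); rewrite ltr_norml; lra.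
move/eqP; rewrite /x mulf_eq0 gt_eqF//= subr_eq0 eqr_nat => /eqP e.
by move/eqP: nai; apply; exact: val_inj.
Qed.

(** Extended by 0 outside the centred residues, so that all meshes share the index set Z^n and
    limits in s make sense. *)
Definition dcoef F K : R[i] :=
  if [forall i, - s.+1%:Z <= K 0 i < s.+1%:Z] then ((N%:R ^- n : R))%:C * dft F K else 0.

Lemma freq_range b i : - s.+1%:Z <= freq b 0 i < s.+1%:Z.
Proof.
rewrite mxE; have := ltn_ord (b i); lia.
Qed.

Lemma dft_inversion F a : hsum (fun K => dcoef F K * expi (dotR (zvec K) (grid a))) (F (grid a)).
Proof.
pose g (K : Z) : option {ffun 'I_n -> 'I_N} :=
  if [forall i, - s.+1%:Z <= K 0 i < s.+1%:Z] then
    Some [ffun i => insubd ord0 (absz (K 0 i + s.+1%:Z))] else None.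
have E0 : F (grid a) = \sum_b dcoef F (freq b) * expi (dotR (zvec (freq b)) (grid a)).
  have N0 : N%:R != 0 :> R by rewrite pnatr_eq0.
  transitivity (((N%:R ^- n : R))%:C * \sum_a' F (grid a') *
     \sum_b expi (dotR (zvec (freq b)) (grid a - grid a'))).
    under eq_bigr do rewrite freq_orth; rewrite (bigD1 a)//= eqxx big1 ?addr0; last first.
      by move=> b ba; rewrite eq_sym (negbTE ba) mulr0.
    by rewrite mulrCA -rmorphM mulVf ?expf_neq0// mulr1.
  under [in LHS]eq_bigr do rewrite mulr_sumr; rewrite exchange_big mulr_sumr; apply: eq_bigr => b _.
  rewrite /dcoef (_ : [forall i, _]); last by apply/forallP => i; exact: freq_range.
  rewrite -mulrA; congr (_ * _); rewrite /dft mulr_suml; apply: eq_bigr => a' _.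
  by rewrite -mulrA -expiD dotRDr dotRNr [- _ + _]addrC.
rewrite E0; apply: (@hsum_inj R _ _ freq g) (hsum_finType _) => //.
- move=> b; rewrite /g (_ : [forall i, _]); last by apply/forallP => i; exact: freq_range.
  congr Some; apply/ffunP => i; rewrite ffunE mxE subrK absz_nat.
  by apply: val_inj; rewrite val_insubd ltn_ord.
- move=> K; rewrite /g; case: ifP => //= /forallP h; apply/rowP => i.
  rewrite mxE ffunE val_insubd; have := h i; case: ifP; lia.
- by move=> K; rewrite /g /dcoef; case: ifP => // _ _; rewrite mul0r.
Qed.

Lemma normc_dcoef F D K : 0 <= D -> (forall z, fbox z -> normc (F z) <= D) -> normc (dcoef F K) <= D.
Proof.
move=> D0 hF; rewrite /dcoef; case: ifP => _; last by rewrite normc0.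
rewrite normcM normc_real ger0_norm ?invr_ge0 ?exprn_ge0//.
have N0 : 0 < (N%:R : R) ^+ n by rewrite exprn_gt0// ltr0n.
rewrite mulrC ler_pdivrMr//; apply: le_trans (normc_sum _ _ _) _.
apply: (@le_trans _ _ (\sum_(a : {ffun 'I_n -> 'I_N}) D)).
  apply: ler_sum => a _; rewrite normcM normc_expi mulr1; apply: hF; exact: grid_fbox.
by rewrite sumr_const card_ffun !card_ord -natrX mulr_natr.
Qed.

(** An m-fold difference multiplies the coefficient by a factor of modulus at least (step |K_j| /
    3)^m, while it is itself at most D step^m. The powers of the step cancel, so the bound does not
    depend on s. *)
Lemma dcoef_decay F D K j m : 0 <= D -> m%:R * step <= 2^-1 -> wraps j 2^-1 F ->
  (forall z, fbox z -> normc (iter m (fdiff j step) F z) <= D * step ^+ m) ->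
  normc (dcoef F K) * `|(K 0 j)%:~R| ^+ m <= 3 ^+ m * D.
Proof.
move=> D0 ms hw hF; have s0 := step_gt0.
have h12 : (2^-1 : R) <= 1 by lra.
have H := dft_iter_fdiff K ms h12 hw.
have hd := normc_dcoef K (mulr_ge0 D0 (exprn_ge0 m (ltW s0))) hF.
rewrite /dcoef in hd *; case: ifP hd => [/forallP/(_ j) hK|_ _]; last first.
  by rewrite normc0 mul0r mulr_ge0// exprn_ge0.
rewrite H mulrCA normcM normcX => hd.
have hk : `|step * (K 0 j)%:~R| <= pi.
  rewrite normrM gtr0_norm// /step -mulrA mulrC -[leRHS]mul1r ler_pM2r ?pi_gt0//.
  rewrite mulrC ler_pdivrMr// mul1r -intr_norm -[s.+1%:R]/(s.+1%:~R) ler_int; lia.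
have := expi_sub1_ge hk; rewrite normrM (gtr0_norm s0) => he.
have {he}he : (step * `|(K 0 j)%:~R| / 3) ^+ m <= normc (expi (step * (K 0 j)%:~R) - 1) ^+ m.
  by rewrite lerXn2r ?nnegrE ?normc_ge0// divr_ge0// mulr_ge0// ltW.
have sm : 0 < step ^+ m by exact: exprn_gt0.
have m3 : 0 < (3 : R) ^+ m by exact: exprn_gt0.
move: (normc _) (normc_ge0 (((N%:R ^- n : R))%:C * dft F K)) hd he => c c0 hd he.
rewrite expr_div_n (exprMn _ step) in he.
rewrite -(ler_pM2r sm); apply: (@le_trans _ _ (3 ^+ m * (D * step ^+ m))); last by rewrite mulrA.
rewrite mulrC -ler_pdivrMl//; apply: le_trans hd; rewrite mulrC; apply: le_trans (ler_wpM2r c0 he).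
by rewrite le_eqVlt; apply/orP; left; apply/eqP; ring.
Qed.

End discrete_fourier.

(** * Fourier series as a limit of discrete inversions *)

Section fourier_series.
Context {R : realType} {n : nat}.
Local Notation E := 'rV[R]_n.
Local Notation Z := 'rV[int]_n.

Lemma dotR_zvec_le (K : Z) (z : E) h : (forall i, `|z 0 i| <= h) ->
  `|dotR (zvec K) z| <= n%:R * (zweight K * h).
Proof.
move=> hz; apply: le_trans (ler_norm_sum _ _ _) _.
apply: (@le_trans _ _ (\sum_(i < n) zweight K * h)).
  by apply: ler_sum => i _; rewrite normrM !mxE; apply: ler_pM => //; exact: zweight_ge.
by rewrite sumr_const card_ord mulr_natl.
Qed.

Lemma grid_approx s (x : E) : fbox x -> exists a : {ffun 'I_n -> 'I_(s.+1.*2)},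
  forall i, `|grid a 0 i - x 0 i| <= @step R s.
Proof.
move=> bx; have s0 := @step_gt0 R s.
have hN := @stepN R s.
have H i : exists k : 'I_(s.+1.*2), `|- pi + step s * k%:R - x 0 i| <= step s.
  pose y := (x 0 i + pi) / step s.
  have /andP[x1 x2] := bx i.
  have y0 : 0 <= y by rewrite divr_ge0 ?(ltW s0)//; lra.
  have := truncn_itv y0; set k := Num.truncn y => /andP[k1 k2].
  have yE : y * step s = x 0 i + pi by rewrite divfK// gt_eqF.
  have kN : (k < s.+1.*2)%N.
    rewrite -(ltr_nat R); apply: le_lt_trans k1 _; rewrite ltr_pdivrMr//.
    by rewrite [_ * step s]mulrC hN; lra.
  exists (Ordinal kN) => /=.
  rewrite (_ : _ - _ = - (step s * (y - k%:R))); last by rewrite mulrBr [_ * y]mulrC yE; ring.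
  rewrite normrN normrM gtr0_norm// ler_piMr ?(ltW s0)// ger0_norm ?subr_ge0//.
  by rewrite -natr1 in k2; lra.
have {}H := fun i => cid (H i).
by exists [ffun i => sval (H i)] => i; rewrite mxE ffunE; exact: svalP (H i).
Qed.

Definition cont_at (F : E -> R[i]) (x : E) := forall eps : R, 0 < eps ->
  exists2 del : R, 0 < del & forall z : E, (forall i, `|z 0 i - x 0 i| <= del) -> normc (F z - F x) <= eps.

Lemma root_bound (x y : R) : (0 < n)%N -> 0 <= x -> 0 <= y -> x ^+ n <= y ^+ n -> x <= y.
Proof. by move=> n0 x0 y0; rewrite ler_pXn2r. Qed.

(** The coefficients are ultralimits of [dcoef s F]. Their decay is uniform in s and passes to the
    limit; inversion is exact at grid points, and the uniform summable majorant, continuity at x and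
    a fine mesh carry it over to x. *)
Theorem fourier_series (F : E -> R[i]) (D : R) (m : nat) : (0 < n)%N -> (2 <= m)%N -> 0 <= D ->
  (forall z, fbox z -> normc (F z) <= D) ->
  (forall j, wraps j 2^-1 F) ->
  (forall j z h, fbox z -> 0 < h -> (n * m)%:R * h <= 2^-1 ->
     normc (iter (n * m) (fdiff j h) F z) <= D * h ^+ (n * m)) ->
  exists c : Z -> R[i], exists C : R,
    (forall K, normc (c K) <= C * zweight K ^- m) /\
    forall x, fbox x -> cont_at F x -> hsum (fun K => c K * expi (dotR (zvec K) x)) (F x).
Proof.
move=> n0 m2 D0 hF hw hd.
(* Decay of order nm in each single direction is what order m of the product weight costs. In 6 = 2
   * 3, the 3 comes from [dcoef_decay] and the 2 from 1 + |k| <= 2 max(1, |k|). *)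
pose M := (n * m)%N; pose D' := 6 ^+ M * (D + 1).
have D'0 : 0 < D' by rewrite mulr_gt0 ?exprn_gt0//; lra.
pose good s := M%:R * @step R s <= 2^-1.
have dec s K : good s -> normc (dcoef s F K) <= D' * zweight K ^- m.
  move=> gs; set c := normc _; have c0 : 0 <= c by exact: normc_ge0.
  have W0 : 0 < zweight K ^+ m :> R by rewrite exprn_gt0// zweight_gt0.
  have step1 (j : 'I_n) : c * (1 + `|(K 0 j)%:~R|) ^+ M <= D'.
    have h1 : c <= D := normc_dcoef s K D0 hF.
    have h2 : c * `|(K 0 j)%:~R| ^+ M <= 3 ^+ M * D.
      by apply: (dcoef_decay K D0 gs (hw j)) => z bz; apply: hd => //; exact: step_gt0.
    have p3 : 1 <= (3 : R) ^+ M by apply: exprn_ege1; lra.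
    have p2 : 0 < (2 : R) ^+ M by exact: exprn_gt0.
    have e6 : (6 : R) ^+ M = 2 ^+ M * 3 ^+ M by rewrite -exprMn; congr (_ ^+ _); ring.
    have [k1|k1] := leP `|(K 0 j)%:~R : R| 1.
      have : (1 + `|(K 0 j)%:~R| : R) ^+ M <= 2 ^+ M by rewrite lerXn2r ?nnegrE ?addr_ge0//; lra.
      move=> /(ler_pM c0 _ h1) h; apply: le_trans (h _) _; first by rewrite exprn_ge0// addr_ge0.
      rewrite /D' e6 mulrC -mulrA ler_pM2l//.
      have h3 : D + 1 <= 3 ^+ M * (D + 1) by rewrite ler_peMl//; lra.
      by apply: le_trans h3; lra.
    have : (1 + `|(K 0 j)%:~R| : R) ^+ M <= (2 * `|(K 0 j)%:~R|) ^+ M.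
      by rewrite lerXn2r ?nnegrE ?addr_ge0 ?mulr_ge0//; lra.
    move=> /(ler_wpM2l c0) h; apply: le_trans h _; rewrite exprMn mulrCA.
    apply: le_trans (ler_wpM2l (ltW p2) h2) _; rewrite /D' e6 mulrA.
    rewrite ler_pM2l ?mulr_gt0 ?exprn_gt0//; lra.
  (* The n one-directional bounds are multiplied together; the claim is their n-th root. *)
  have : (c * zweight K ^+ m) ^+ n <= D' ^+ n.
    have -> : (c * zweight K ^+ m) ^+ n = \prod_(j < n) (c * (1 + `|(K 0 j)%:~R|) ^+ M).
      rewrite big_split /= prodr_const card_ord exprMn -exprM mulnC -/M.
      by rewrite /zweight prodrXl.
    apply: (@le_trans _ _ (\prod_(j < n) D')); last by rewrite prodr_const card_ord.
    apply: ler_prod => j _; rewrite step1 andbT mulr_ge0// exprn_ge0// addr_ge0.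
  move/(root_bound n0) => h; rewrite ler_pdivlMr//; apply: h; last exact: ltW.
  by rewrite mulr_ge0// ltW.
have [s0 hs0] : exists s0, forall s, (s0 <= s)%N -> good s.
  exists (Num.truncn (2 * M%:R * pi : R)).+1 => s hs.
  have h1 : 2 * M%:R * pi <= s.+1%:R :> R.
    apply: ltW; apply: lt_le_trans (truncnS_gt _) _; rewrite ler_nat.
    exact: leq_trans hs (leqnSn _).
  by rewrite /good /step mulrA ler_pdivrMr ?ltr0n//; lra.
pose u s (p : Z * bool) : R := let c := dcoef (s0 + s) F p.1 in
  if p.2 then complex.Re c else complex.Im c.
have uB s p : `|u s p| <= D' * zweight p.1 ^- m.
  apply: le_trans (dec (s0 + s)%N p.1 (hs0 _ (leq_addr _ _))).
  by rewrite /u; case: p.2; [exact: normc_Re|exact: normc_Im].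
have [v hv] := ultra_family uB.
pose c K : R[i] := v (K, true) +i* v (K, false).
have hc (l : seq Z) S eps : 0 < eps -> exists2 s, (S <= s)%N & good s /\
    forall K, K \in l -> normc (dcoef s F K - c K) <= eps.
  move=> e0; have e2 : 0 < eps / 2 by rewrite divr_gt0.
  have [s Ss h] := hv ([seq (K, true) | K <- l] ++ [seq (K, false) | K <- l]) S _ e2.
  exists (s0 + s)%N; first exact: leq_trans Ss (leq_addl _ _).
  split; first by apply: hs0; exact: leq_addr.
  move=> K Kl; apply: le_trans (normc_le_ReIm _) _.
  have h1 := h (K, true); have h2 := h (K, false).
  rewrite mem_cat (map_f (fun K => (K, true)) Kl) /= in h1.
  rewrite mem_cat (map_f (fun K => (K, false)) Kl) orbT /= in h2.
  have {}h1 := h1 isT; have {}h2 := h2 isT; move: h1 h2; rewrite /u /c /=.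
  by case: (dcoef _ _ _) => p q /=; lra.
exists c; exists D'; split.
  move=> K; apply/ler_addgt0Pr => e e0; have [s _ [gs h]] := hc [:: K] 0%N e e0.
  have {}h := h K (mem_head _ _).
  rewrite (_ : c K = dcoef s F K - (dcoef s F K - c K)); last by ring.
  apply: le_trans (le_normcD _ _) _; rewrite normcN; apply: lerD => //; exact: dec.
move=> x bx cx e e0.
have e4 : 0 < e / 4 by rewrite divr_gt0.
have hB k (K : Z) : 0 <= zweight K ^- k :> R by rewrite invr_ge0 exprn_ge0// ltW// zweight_gt0.
have hB' (K : Z) : 0 <= D' * zweight K ^- m by apply: mulr_ge0 (hB m K); exact: ltW.
have aW : asum (fun K : Z => (D' * zweight K ^- m)%:C) (D' * 4 ^+ n).
  apply: asum_le (@asum_zweight R n) => [|K]; first exact: ltW.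
  rewrite !normc_real (ger0_norm (hB' K)) (ger0_norm (hB 2 K)).
  rewrite ler_pM2l// lef_pV2 ?posrE ?exprn_gt0 ?zweight_gt0//.
  by apply: ler_weXn2l => //; exact: zweight_ge1.
have [G0 hG0] := asum_tail aW e4.
(* [G0] depends only on the majorant common to all meshes. The mesh is chosen afterwards, in terms
   of [G], and the error is split into four parts of size e / 4: continuity of F, tail of the
   discrete inversion, coefficients, characters. *)
exists G0 => G GG0.
have [del del0 hdel] := cx _ e4.
pose Q := \sum_(K <- G) normc (c K) * (2 * n%:R * zweight K) + 1.
have Q1 : 1 <= Q.
  rewrite lerDr; apply: sumr_ge0 => K _; rewrite !mulr_ge0 ?normc_ge0// ltW ?zweight_gt0//.
pose et := e / 4 / ((size G)%:R + 1).
have sG0 : 0 < (size G)%:R + 1 :> R by rewrite ltr_wpDl.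
have et0 : 0 < et by rewrite divr_gt0.
pose S := (Num.truncn (pi / Num.min del (e / 4 / Q))).+1.
have [s Ss [gs hs]] := hc G S et et0.
have mn0 : 0 < Num.min del (e / 4 / Q) by rewrite lt_min del0 divr_gt0//; lra.
have hstep : step s <= Num.min del (e / 4 / Q).
  rewrite /step ler_pdivrMr ?ltr0n// mulrC -ler_pdivrMr//.
  apply: ltW; apply: lt_le_trans (truncnS_gt _) _; rewrite ler_nat.
  exact: leq_trans Ss (leqnSn _).
move: hstep; rewrite le_min => /andP[st1 st2].
have [a ha] := grid_approx s bx.
have H1 : normc (F (grid a) - F x) <= e / 4.
  by apply: hdel => i; exact: le_trans (ha i) st1.
have H2 : normc (\sum_(K <- G) dcoef s F K * expi (dotR (zvec K) (grid a)) - F (grid a)) <= e / 4.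
  apply: (hsum_tail (dft_inversion F a) _ GG0) => G' dG.
  apply: le_trans (hG0 _ dG); apply: ler_sum => K _.
  rewrite normcM normc_expi mulr1 normc_real (ger0_norm (hB' K)); exact: dec.
have H3 : normc (\sum_(K <- G) (c K - dcoef s F K) * expi (dotR (zvec K) (grid a))) <= e / 4.
  apply: le_trans (normc_sum _ _ _) _.
  apply: (@le_trans _ _ (\sum_(K <- G) et)).
    rewrite big_seq [leRHS]big_seq; apply: ler_sum => K KG.
    by rewrite normcM normc_expi mulr1 normc_distC; exact: hs.
  rewrite big_const_seq count_predT iter_addr_0 -[leLHS]mulr_natr.
  apply: (@le_trans _ _ (et * ((size G)%:R + 1))); first by rewrite ler_pM2l// lerDl.
  by rewrite /et divfK// lt0r_neq0.
have H4 : normc (\sum_(K <- G) c K * (expi (dotR (zvec K) x) - expi (dotR (zvec K) (grid a)))) <= e / 4.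
  apply: le_trans (normc_sum _ _ _) _.
  apply: (@le_trans _ _ (\sum_(K <- G) normc (c K) * (2 * n%:R * zweight K) * step s)).
    apply: ler_sum => K _; rewrite normcM -mulrA ler_wpM2l ?normc_ge0//.
    apply: le_trans (expi_lip _ _) _; rewrite -mulrA -mulrA ler_pM2l//.
    rewrite -dotRNr -dotRDr -mulrA; apply: dotR_zvec_le => i.
    by rewrite !mxE distrC; have := ha i; rewrite !mxE.
  rewrite -mulr_suml; apply: (@le_trans _ _ (Q * step s)).
    by rewrite ler_wpM2r ?lerDl// ltW// step_gt0.
  by rewrite mulrC -ler_pdivlMr//; lra.
rewrite (_ : _ - F x = (F (grid a) - F x) +
  ((\sum_(K <- G) dcoef s F K * expi (dotR (zvec K) (grid a)) - F (grid a)) +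
  (\sum_(K <- G) (c K - dcoef s F K) * expi (dotR (zvec K) (grid a)) +
   \sum_(K <- G) c K * (expi (dotR (zvec K) x) - expi (dotR (zvec K) (grid a)))))); last first.
  have -> : \sum_(K <- G) c K * expi (dotR (zvec K) x) =
    \sum_(K <- G) dcoef s F K * expi (dotR (zvec K) (grid a)) +
    (\sum_(K <- G) (c K - dcoef s F K) * expi (dotR (zvec K) (grid a)) +
    \sum_(K <- G) c K * (expi (dotR (zvec K) x) - expi (dotR (zvec K) (grid a)))).
    by rewrite -!big_split; apply: eq_bigr => K _ /=; ring.
  by ring.
apply: le_trans (le_normcD _ _) _; apply: le_trans (lerD (lexx _) (le_normcD _ _)) _.
apply: le_trans (lerD (lexx _) (lerD (lexx _) (le_normcD _ _))) _.
lra.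
Qed.

End fourier_series.

(** * Fourier representation of smooth functions on the sphere bundle *)

Section finite_differences.
Context {R : realType}.

Definition rdiff (h : R) (g : R -> R) : R -> R := fun t => g (t + h) - g t.

Lemma mean_value_le (g g' : R -> R) (D a h : R) : 0 < h ->
  (forall t : R, is_derive t 1 g (g' t)) -> (forall t, a <= t <= a + h -> `|g' t| <= D) ->
  `|g (a + h) - g a| <= D * h.
Proof.
move=> h0 hg hD; have ab : a <= a + h by lra.
have h1 (c t : R) : a <= t <= a + h -> is_derive t 1 (fun t : R => c * t) c.
  by move=> _; apply: is_derive_eq (is_deriveZ1 c (is_derive_id1 t)) _; rewrite mulr1.
have k1 := deriv_le ab (fun t _ => hg t) (h1 D) (fun t ht => le_trans (ler_norm _) (hD t ht)).
have h2 t : a <= t <= a + h -> - D <= g' t by move=> /hD; rewrite ler_norml => /andP[].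
have k2 := deriv_le ab (h1 (- D)) (fun t _ => hg t) h2.
by rewrite ler_norml; lra.
Qed.

(** The differences of a chain of successive derivatives form again such a chain, on an interval
    shorter by h; the mean value theorem is applied once per step. *)
Lemma iter_rdiff_le (M : nat) (g : nat -> R -> R) (D a b h : R) : 0 < h ->
  (forall i (t : R), (i < M)%N -> is_derive t 1 (g i) (g i.+1 t)) ->
  (forall t, a <= t <= b -> `|g M t| <= D) -> a + M%:R * h <= b ->
  `|iter M (rdiff h) (g 0%N) a| <= D * h ^+ M.
Proof.
move=> h0; elim: M g b D => [|M IH] g b D hg hD ab.
  by rewrite expr0 mulr1 /=; apply: hD; rewrite lexx; rewrite mul0r addr0 in ab.
have hb : a + M%:R * h <= b - h by rewrite -natr1 in ab; lra.
rewrite iterSr exprS mulrA; apply: (IH (fun i => rdiff h (g i)) (b - h)) => //.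
- move=> i t iM; have h1 := hg i (t + h) (leqW iM); have h2 := hg i t (leqW iM).
  have h3 : is_derive t 1 (fun t : R => t + h) 1.
    by apply: is_derive_eq (is_deriveD1 (is_derive_id1 t) (is_derive_const h t)) _; rewrite addr0.
  have h4 := @is_derive1_comp R (g i) (fun t : R => t + h) t _ _ h1 h3.
  have h5 := is_deriveD1 h4 (is_deriveZ1 (-1) h2).
  apply: is_derive_eq (eq_is_derive _ h5) _; last by rewrite /rdiff; ring.
  by move=> y /=; rewrite /rdiff mulN1r.
- move=> t /andP[t1 t2]; apply: (mean_value_le h0 (fun t => hg M t (ltnSn M))) => u /andP[u1 u2].
  by apply: hD; apply/andP; split; lra.
Qed.

Lemma is_derive_line (V : normedModType R) (f : V -> R) (p w : V) (t df : R) :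
  is_derive (p + t *: w) w f df <-> is_derive t 1 (fun t : R => f (p + t *: w)) df.
Proof.
have E : (fun h : R => h^-1 *: ((f \o shift (p + t *: w)) (h *: w) - f (p + t *: w))) =
  (fun h : R => h^-1 *: (((fun t : R => f (p + t *: w)) \o shift t) (h *: 1) - f (p + t *: w))).
  apply/funext => h; congr (_ *: (f _ - _)) => /=.
  have -> : h *: (1 : R) = h by exact: mulr1.
  by rewrite scalerDl addrCA.
by split => -[h1 h2]; apply: DeriveDef; move: h1 h2; rewrite /derivable /derive E.
Qed.

(** Its powers are cut-offs of finite order whose derivatives are again powers of it, so that all
    derivatives stay explicit. *)
Definition pospart (x : R) : R := if 0 < x then x else 0.

Lemma pospart_gt0 x : 0 < x -> pospart x = x. Proof. by rewrite /pospart => ->. Qed.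

Lemma pospart_le0 x : x <= 0 -> pospart x = 0.
Proof. by rewrite /pospart leNgt => /negbTE ->. Qed.

Lemma pospart_ge0 x : 0 <= pospart x.
Proof. by rewrite /pospart; case: ifP => // /ltW. Qed.

Lemma pospart_norm x : pospart x <= `|x|.
Proof. by rewrite /pospart; case: ifP => // _; rewrite ler_norm. Qed.

Lemma pospartM x : x * pospart x = pospart x * pospart x.
Proof. by rewrite /pospart; case: ifP => // _; rewrite !mulr0. Qed.

Lemma is_derive_pospow (m : nat) (x : R) :
  is_derive x 1 (fun y : R => pospart y ^+ m.+2) (m.+2%:R * pospart x ^+ m.+1).
Proof.
have [x0|x0|->] := ltgtP x 0.
- rewrite (pospart_le0 (ltW x0)) expr0n mulr0.
  apply: near_eq_is_derive (is_derive_const 0 x).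
  near=> y; rewrite pospart_le0 ?expr0n//; apply: ltW.
  by near: y; exact: lt_nbhsl.
- rewrite (pospart_gt0 x0).
  apply: near_eq_is_derive (is_deriveX1 m.+1 x).
  near=> y; rewrite pospart_gt0//.
  by near: y; exact: lt_nbhsr.
rewrite pospart_le0// expr0n mulr0.
have H : (fun h : R => h^-1 *: (((fun y : R => pospart y ^+ m.+2) \o shift 0) (h *: 1) -
    pospart 0 ^+ m.+2)) @ 0^' --> (0 : R).
  apply/cvgr0Pnorm_le => e e0; near=> h.
  have h0 : h != 0 by near: h; exact: nbhs_dnbhs_neq.
  have h1 : `|h| <= 1 by near: h; exact: dnbhs0_le.
  have he : `|h| <= e by near: h; exact: dnbhs0_le.
  rewrite pospart_le0// expr0n subr0 /= addr0 (_ : h *: (1 : R) = h); last exact: mulr1.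
  rewrite normrM normfV mulrC ler_pdivrMr ?normr_gt0//.
  rewrite normrX ger0_norm ?pospart_ge0//.
  apply: (@le_trans _ _ (`|h| ^+ m.+2)); first by rewrite lerXn2r ?nnegrE ?pospart_ge0// pospart_norm.
  rewrite exprSr ler_wpM2r//; apply: le_trans he.
  by rewrite exprS ler_piMr// exprn_ile1.
apply: DeriveDef; first by apply/cvg_ex; exists 0.
exact: cvg_lim.
Unshelve. all: by end_near.
Qed.

Lemma pospart_lip (x y : R) : `|pospart x - pospart y| <= `|x - y|.
Proof.
wlog yx : x y / y <= x.
  move=> H; have /orP[yx|xy] := le_total y x; first exact: H.
  by rewrite [leLHS]distrC [leRHS]distrC; exact: H.
rewrite (ger0_norm (x := x - y)) ?subr_ge0// ler_norml /pospart.
by case: (ltP 0 x) => h1; case: (ltP 0 y) => h2; apply/andP; split; lra.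
Qed.

Lemma continuous_pospart : continuous pospart.
Proof.
move=> x; apply/cvgrPdist_le => e e0; near=> y; apply: le_trans (pospart_lip _ _) _.
by near: y; exact: cvgr_dist_le.
Unshelve. all: by end_near.
Qed.

End finite_differences.

(** * Derivatives of a function times the cut-off *)

Section cutoff.
Context {R : realType} {e : nat}.
Local Notation d := e.+1.
Local Notation E := 'rV[R]_d.
Local Notation V := (E * E)%type.
Let U : set V := [set p : V | p.2 != 0].
Variables (G : V -> R) (w : V) (M : nat).
Hypothesis sG : smooth_on U G.

(* Polynomials in the iterated derivatives of G along w, in N(x, v) = |v|^2 and in its
   derivative along w. *)
Inductive jet :=
  JG of nat | JN | JL | Jcst of R | Jadd of jet & jet | Jmul of jet & jet.

Fixpoint jeval (a : jet) (p : V) : R :=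
  match a with
  | JG l => iter_derive (nseq l w) G p | JN => dotR p.2 p.2 | JL => 2 * dotR p.2 w.2
  | Jcst c => c | Jadd a b => jeval a p + jeval b p | Jmul a b => jeval a p * jeval b p end.

Fixpoint jderiv (a : jet) : jet :=
  match a with
  | JG l => JG l.+1 | JN => JL | JL => Jcst (2 * dotR w.2 w.2)
  | Jcst _ => Jcst 0 | Jadd a b => Jadd (jderiv a) (jderiv b)
  | Jmul a b => Jadd (Jmul a (jderiv b)) (Jmul b (jderiv a)) end.

Lemma continuous_sum_at (T : topologicalType) (I : Type) (r : seq I) (f : I -> T -> R) (x : T) :
  (forall i, {for x, continuous (f i)}) -> {for x, continuous (fun y => \sum_(i <- r) f i y)}.
Proof.
move=> h; elim: r => [|i r IH].
  by rewrite (_ : (fun _ => _) = fun=> 0); [exact: cvg_cst|apply/funext => y; rewrite big_nil].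
rewrite (_ : (fun _ => _) = fun y => f i y + \sum_(i <- r) f i y).
  by apply: cvgD; [exact: h|exact: IH].
by apply/funext => y; rewrite big_cons.
Qed.

Lemma continuous_dotR2 (u : V -> E) (v : V -> E) (p : V) :
  {for p, continuous u} -> {for p, continuous v} -> {for p, continuous (fun p => dotR (u p) (v p))}.
Proof.
move=> cu cv; rewrite /dotR; apply: continuous_sum_at => i; apply: cvgM.
- by apply: (continuous_comp (f := u) (g := fun x : E => x 0 i)); [exact: cu|exact: coord_continuous].
- by apply: (continuous_comp (f := v) (g := fun x : E => x 0 i)); [exact: cv|exact: coord_continuous].
Qed.

Let csnd (p : V) : {for p, continuous (snd : V -> E)}.
Proof. exact: cvg_snd. Qed.

Lemma continuous_jeval a p : U p -> {for p, continuous (jeval a)}.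
Proof.
move=> Up; elim: a => [l|||c|a ha b hb|a ha b hb] /=.
- by have [] := sG (nseq l w) Up.
- by apply: continuous_dotR2; exact: csnd.
- apply: cvgM; first exact: cvg_cst.
  by apply: (@continuous_dotR2 snd (fun _ => w.2)); [exact: csnd|exact: cvg_cst].
- exact: cvg_cst.
- exact: cvgD.
- exact: cvgM.
Qed.

Lemma is_derive_jeval a (p : V) (t : R) : U (p + t *: w) ->
  is_derive t 1 (fun t : R => jeval a (p + t *: w)) (jeval (jderiv a) (p + t *: w)).
Proof.
move=> Up; elim: a => [l|||c|a ha b hb|a ha b hb] /=.
- have [_ hd] := sG (nseq l w) Up; have {}hd := hd w.
  have h1 := DeriveDef hd erefl.
  exact: (proj1 (is_derive_line _ _ _ _ _) h1).
- have h1 : is_derive t 1 (fun t : R => dotR p.2 p.2 + 2 * dotR p.2 w.2 * t + dotR w.2 w.2 * t ^+ 2)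
     (2 * dotR p.2 w.2 + 2 * dotR w.2 w.2 * t).
    have h := is_deriveD1 (is_deriveD1 (is_derive_const (dotR p.2 p.2) t)
      (is_deriveZ1 (2 * dotR p.2 w.2) (is_derive_id1 t))) (is_deriveZ1 (dotR w.2 w.2) (is_deriveX1 1 t)).
    by apply: is_derive_eq h _; ring.
  apply: is_derive_eq (eq_is_derive _ h1) _.
    by move=> s /=; rewrite dotRDl !dotRDr !dotRZl !dotRZr (dotRC w.2 p.2); ring.
  by rewrite dotRDl dotRZl; ring.
- have h1 := is_deriveD1 (is_derive_const (2 * dotR p.2 w.2) t)
    (is_deriveZ1 (2 * dotR w.2 w.2) (is_derive_id1 t)).
  apply: is_derive_eq (eq_is_derive _ h1) _; last by rewrite mulr1 add0r.
  by move=> s /=; rewrite dotRDl dotRZl; ring.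
- exact: is_derive_const.
- exact: is_deriveD1.
- exact: is_deriveM1.
Qed.

(** 1 - 4 (|v|^2 - 1)^2, equal to 1 on the sphere and positive only for 1/2 < |v|^2 < 3/2. *)
Definition Jcut : jet := Jadd (Jcst 1)
  (Jmul (Jcst (-4)) (Jmul (Jadd JN (Jcst (-1))) (Jadd JN (Jcst (-1))))).

Lemma JcutE p : jeval Jcut p = 1 - 4 * (dotR p.2 p.2 - 1) ^+ 2.
Proof. by rewrite /=; ring. Qed.

(** Cofactor of the remaining power M + 1 - i of the cut-off in the i-th derivative along [w] of G
    times the power M + 1. The recurrence is the product rule with one factor of the cut-off taken
    out; at i = M one factor is left, enough for the derivative to vanish off the support. *)
Fixpoint Jchain (i : nat) : jet :=
  if i is i'.+1 then Jadd (Jmul (jderiv (Jchain i')) Jcut)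
    (Jmul (Jcst (M.+1 - i')%N%:R) (Jmul (Jchain i') (jderiv Jcut)))
  else JG 0.

Definition cut_chain (i : nat) (p : V) : R :=
  jeval (Jchain i) p * pospart (jeval Jcut p) ^+ (M.+1 - i).

Lemma is_derive_cut_chain i p (t : R) : (i < M)%N ->
  is_derive t 1 (fun t : R => cut_chain i (p + t *: w)) (cut_chain i.+1 (p + t *: w)).
Proof.
move=> iM; set q := p + t *: w.
have [m mE] : exists m, (M.+1 - i)%N = m.+2 by exists (M - i).-1; lia.
have mE' : (M.+1 - i.+1)%N = m.+1 by lia.
(* At v = 0 nothing is known about [G], but the cut-off is negative there, hence on a neighbourhood,
   where the whole product is 0. *)
have [q0|q0] := eqVneq q.2 0.
  have cutq : jeval Jcut q < 0 by rewrite JcutE q0 dot0R; lra.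
  rewrite {2}/cut_chain (pospart_le0 (ltW cutq)) mE' expr0n mulr0.
  apply: near_eq_is_derive (is_derive_const 0 t).
  have hN : {for t, continuous (fun t : R => jeval Jcut (p + t *: w))}.
    rewrite (_ : (fun t => _) = (fun t : R => 1 - 4 * ((dotR p.2 p.2 + 2 * dotR p.2 w.2 * t + dotR w.2 w.2 * t ^+ 2) - 1) ^+ 2)); last first.
      by apply/funext => s; rewrite JcutE /= dotRDl !dotRDr !dotRZl !dotRZr (dotRC w.2 p.2); congr (1 - 4 * (_ - 1) ^+ 2); ring.
    have h := is_deriveD1 (is_deriveD1 (is_derive_const (dotR p.2 p.2) t)
      (is_deriveZ1 (2 * dotR p.2 w.2) (is_derive_id1 t))) (is_deriveZ1 (dotR w.2 w.2) (is_deriveX1 1 t)).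
    have h1 := is_deriveD1 h (is_derive_const (-1) t).
    have h2 := is_deriveD1 (is_derive_const 1 t) (is_deriveZ1 (-4) (is_deriveM1 h1 h1)).
    apply: is_derive_continuous (eq_is_derive _ h2) => s; by rewrite expr2 mulNr.
  near=> s; rewrite /cut_chain pospart_le0 ?mE ?expr0n ?mulr0//.
  near: s; exact: (cvgr_le _ hN _ cutq).
have h1 := @is_derive_jeval (Jchain i) p t q0.
have h2 := @is_derive_jeval Jcut p t q0.
have h3 := @is_derive1_comp R (fun y : R => pospart y ^+ m.+2) _ t _ _ (is_derive_pospow m _) h2.
have h4 := is_deriveM1 h1 h3.
apply: is_derive_eq (eq_is_derive _ h4) _; first by move=> s; rewrite /cut_chain mE.
rewrite -/q /cut_chain mE' -/Jchain.
have -> : jeval (Jchain i.+1) q = jeval (jderiv (Jchain i)) q * jeval Jcut q +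
  m.+2%:R * (jeval (Jchain i) q * jeval (jderiv Jcut) q) by rewrite -mE.
rewrite [X in _ + X * _](_ : _ = pospart (jeval Jcut q) ^+ m.+2)//.
move: (jeval (jderiv (Jchain i)) q) (jeval (Jchain i) q) (jeval (jderiv Jcut) q) (jeval Jcut q) => a b c x.
rewrite (exprS (pospart x) m.+1) (exprS (pospart x) m).
transitivity (b * (m.+2%:R * (pospart x * pospart x ^+ m) * c) +
  (pospart x * pospart x) * pospart x ^+ m * a); first by ring.
by rewrite -pospartM; ring.
Unshelve. all: by end_near.
Qed.

Lemma cut_region p : 0 < jeval Jcut p -> 2^-1 <= dotR p.2 p.2 <= 3 / 2.
Proof. by rewrite JcutE => h; apply/andP; split; nra. Qed.

(** Where the cut-off is positive, the point lies in a compact set that avoids v = 0, on which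
    [Jchain M] is continuous. *)
Lemma cut_chain_bounded (B : R) : exists2 D : R, 0 <= D &
  forall p : V, (forall i, `|p.1 0 i| <= B) -> `|cut_chain M p| <= D.
Proof.
pose A1 := [set v : E | forall i, (`[- B, B]%classic : set R) (v ord0 i)].
pose A2 := [set v : E | forall i, (`[- 2, 2]%classic : set R) (v ord0 i)].
have c1 : compact A1 := @rV_compact R d _ (fun i => @segment_compact R (- B) B).
have c2 : compact A2 := @rV_compact R d _ (fun i => @segment_compact R (- 2) 2).
pose A3 := [set p : V | 2^-1 <= dotR p.2 p.2].
have cN : closed A3.
  apply: (@closed_comp _ _ (fun p : V => dotR p.2 p.2) [set x | 2^-1 <= x]); last exact: closed_ge.
  by move=> p _; apply: continuous_dotR2; exact: csnd.
have cK : compact ((A1 `*` A2) `&` A3) by apply: compact_closedI => //; exact: compact_setX.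
have KU p : ((A1 `*` A2) `&` A3) p -> U p.
  move=> [_]; rewrite /A3 /U /= => h; apply/eqP => p0; move: h; rewrite p0 dot0R; lra.
have cf : {within ((A1 `*` A2) `&` A3), continuous (jeval (Jchain M))}.
  by apply: continuous_in_subspaceT => p /set_mem /KU; exact: continuous_jeval.
have [D0 [_ hD]] := compact_bounded (continuous_compact cf cK).
exists (`|D0| + 1); first by rewrite addr_ge0.
move=> p pB; rewrite /cut_chain subSnn expr1.
have [W0|W0] := ltP 0 (jeval Jcut p); last by rewrite pospart_le0// mulr0 normr0 addr_ge0.
have /andP[N1 N2] := cut_region W0.
have W1 : jeval Jcut p <= 1 by rewrite JcutE; have := sqr_ge0 (dotR p.2 p.2 - 1); lra.
rewrite (pospart_gt0 W0) normrM (gtr0_norm W0) -[leRHS]mulr1; apply: ler_pM W1 => //; first exact: ltW.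
apply: hD; first by have := ler_norm D0; lra.
exists p => //; split => //; split => i /=; rewrite in_itv/= -ler_norml//.
have : p.2 0 i ^+ 2 <= dotR p.2 p.2.
  by rewrite /dotR (bigD1 i)//= -expr2 lerDl; apply: sumr_ge0 => j _; rewrite -expr2 sqr_ge0.
by rewrite ler_norml => h; apply/andP; split; nra.
Qed.

End cutoff.

(** * Extension off the sphere and its Fourier series *)

Section smooth_fourier.
Context {R : realType} {e : nat}.
Local Notation d := e.+1.
Local Notation E := 'rV[R]_d.
Local Notation V := (E * E)%type.
Local Notation E2 := 'rV[R]_(d + d).
Variable f : E -> E -> R[i].
Hypothesis sf : smooth_storus f.

Let Gre (p : V) := complex.Re (pull_back f p).
Let Gim (p : V) := complex.Im (pull_back f p).

Let pairing (z : E2) : V := (lsubmx z, rsubmx z).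

Let cutp (p : V) : R := 1 - 4 * (dotR p.2 p.2 - 1) ^+ 2.

Let Fext (M : nat) (z : E2) : R[i] :=
  (Gre (pairing z) * pospart (cutp (pairing z)) ^+ M.+1) +i*
  (Gim (pairing z) * pospart (cutp (pairing z)) ^+ M.+1).

Let FextE M z : Fext M z = f (lsubmx z) (direction (rsubmx z)) *
  (pospart (cutp (pairing z)) ^+ M.+1)%:C.
Proof.
rewrite /Fext /Gre /Gim /pull_back /=; case: (f _ _) => a b.
by simpc; congr (_ +i* _); rewrite /= ?mulr0 ?subr0 ?add0r.
Qed.

Let dir (j : 'I_(d + d)) : V := pairing (unit_vec j).

Let pairing_line (z : E2) t j : pairing (z + t *: unit_vec j) = pairing z + t *: dir j.
Proof. by congr pair; apply/rowP => i; rewrite !mxE. Qed.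

Let iter_fdiff_ReIm M (j : 'I_(d + d)) h m (z : E2) (t : R) :
  iter m (fdiff j h) (Fext M) (z + t *: unit_vec j) =
  iter m (rdiff h) (fun t : R => Gre (pairing z + t *: dir j) *
    pospart (cutp (pairing z + t *: dir j)) ^+ M.+1) t +i*
  iter m (rdiff h) (fun t : R => Gim (pairing z + t *: dir j) *
    pospart (cutp (pairing z + t *: dir j)) ^+ M.+1) t.
Proof.
elim: m t => [|m IH] t /=; first by rewrite /Fext pairing_line.
by rewrite /fdiff -addrA -scalerDl !IH /rdiff; simpc.
Qed.

Let small_cut (i : 'I_d) (v : E) : 3 / 2 <= `|v 0 i| -> 1 - 4 * (dotR v v - 1) ^+ 2 <= 0 :> R.
Proof.
move=> h; have : (v 0 i) ^+ 2 <= dotR v v.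
  by rewrite /dotR (bigD1 i)//= -expr2 lerDl; apply: sumr_ge0 => j _; rewrite -expr2 sqr_ge0.
rewrite -real_normK ?num_real//; move: (`|v 0 i|) (dotR v v) h => a N h h2.
have h3 : 5 / 4 <= N - 1 by nra.
have : 25 / 16 <= (N - 1) ^+ 2 by nra.
lra.
Qed.

(** In a direction x_j this is periodicity. In a direction v_j both sides are 0: points within 1/2
    of a face have |v_j| >= pi - 1/2 >= 3/2, outside the support of the cut-off; this fixes the
    depth 1/2. *)
Let wraps_Fext M j : wraps j 2^-1 (Fext M).
Proof.
move=> z bz zj; have p2 := @pi_ge2 R; rewrite !FextE.
case: (split_ordP j) bz zj => i ->{j} bz zj.
  have rE : rsubmx (z + (2 * pi) *: unit_vec (lshift d i)) = rsubmx z.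
    apply/rowP => k; rewrite !mxE eqxx /=.
    by rewrite (_ : (rshift d k == lshift d i) = false) ?mulr0 ?addr0// eq_sym eq_lrshift.
  have lE : lsubmx (z + (2 * pi) *: unit_vec (lshift d i)) =
      lsubmx z + (2 * pi) *: zvec (delta_mx 0 i : 'rV[int]_d).
    apply/rowP => k; rewrite !mxE eqxx /= eq_lshift; by case: (k == i); rewrite /= ?mulr0.
  (* Periodicity is available for directions on the sphere only; at v = 0 the cut-off gives 0 on
     both sides. *)
  rewrite /pairing rE lE /cutp /=; have [->|v0] := eqVneq (rsubmx z) 0.
    rewrite dot0R pospart_le0; last lra.
    by rewrite expr0n /= !mulr0.
  by have [+ _] := sf => /(_ _ (direction_sphere v0)) -> .
have c1 : pospart (cutp (pairing (z + (2 * pi) *: unit_vec (rshift d i)))) = 0.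
  apply/pospart_le0/(@small_cut i); rewrite /pairing /= mxE unit_vecE eqxx mulr1.
  have /andP[z1 z2] := bz (rshift d i).
  by rewrite ger0_norm; lra.
have c2 : pospart (cutp (pairing z)) = 0.
  apply/pospart_le0/(@small_cut i); rewrite /pairing /= mxE.
  by rewrite -normrN ger0_norm; lra.
by rewrite c1 c2 expr0n /= !mulr0.
Qed.

Let box_bound (z : E2) t j : fbox z -> 0 <= t <= 2^-1 ->
  forall i, `|(pairing z + t *: dir j).1 0 i| <= pi + 2^-1.
Proof.
move=> bz /andP[t0 t1] i; rewrite -pairing_line /pairing /= mxE unit_vecE.
have /andP[z1 z2] := bz (lshift d i).
have : 0 <= t * (lshift d i == j)%:R <= 2^-1.
  by case: (_ == _); rewrite ?mulr1 ?mulr0 ?lexx ?t0 ?t1//= invr_ge0.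
by move=> /andP[? ?]; rewrite ler_norml; apply/andP; split; lra.
Qed.

Let chain_bound M : exists2 D : R, 0 <= D & forall j h z, fbox z -> 0 < h -> M%:R * h <= 2^-1 ->
  normc (iter M (fdiff j h) (Fext M) z) <= D * h ^+ M.
Proof.
have [_ [sre sim]] := sf.
have H (G : V -> R) : smooth_on [set p : V | p.2 != 0] G ->
    exists2 D : R, 0 <= D & forall j h z, fbox z -> 0 < h -> M%:R * h <= 2^-1 ->
    `|iter M (rdiff h) (fun t : R => G (pairing z + t *: dir j) *
       pospart (cutp (pairing z + t *: dir j)) ^+ M.+1) 0| <= D * h ^+ M.
  move=> sG.
  have hb j := cid2 (cut_chain_bounded (dir j) M sG (pi + 2^-1)).
  exists (\sum_j s2val (hb j)).
    by apply: sumr_ge0 => j _; exact: (s2valP (hb j)).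
  move=> j h z bz h0 Mh.
  have := @iter_rdiff_le R M (fun i t => cut_chain G (dir j) M i (pairing z + t *: dir j))
    (s2val (hb j)) 0 2^-1 h h0.
  have E : (fun t : R => cut_chain G (dir j) M 0 (pairing z + t *: dir j)) =
    (fun t : R => G (pairing z + t *: dir j) * pospart (cutp (pairing z + t *: dir j)) ^+ M.+1).
    by apply/funext => t; rewrite /cut_chain JcutE.
  rewrite E add0r => h1; apply: le_trans (h1 _ _ Mh) _.
  - by move=> i t iM; exact: is_derive_cut_chain.
  - by move=> t ht; apply: (s2valP' (hb j)); exact: box_bound.
  rewrite ler_wpM2r ?exprn_ge0 ?(ltW h0)// (bigD1 j)//= lerDl.
  by apply: sumr_ge0 => k _; exact: (s2valP (hb k)).
have [D1 D10 h1] := H _ sre; have [D2 D20 h2] := H _ sim.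
exists (D1 + D2); first exact: addr_ge0.
move=> j h z bz h0 Mh; apply: le_trans (normc_le_ReIm _) _.
rewrite -[z](_ : z + 0 *: unit_vec j = z); last by rewrite scale0r addr0.
rewrite iter_fdiff_ReIm /= mulrDl; apply: lerD; [exact: h1|exact: h2].
Qed.

Let cont_Fext M (x v : E) : sphere v -> cont_at (Fext M) (row_mx x v).
Proof.
move=> sv; have [_ [sre sim]] := sf.
have v0 : v != 0.
  by apply/eqP => v0; move: sv; rewrite /sphere /= v0 enorm0 => /esym/eqP; rewrite oner_eq0.
have cc (G : V -> R) : smooth_on [set p : V | p.2 != 0] G ->
    {for (x, v), continuous (fun p : V => G p * pospart (cutp p) ^+ M.+1)}.
  move=> sG; apply: cvgM; first by have [] := sG [::] (x, v) v0.
  have cN : {for (x, v), continuous (cutp : V -> R)}.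
    have := @continuous_jeval R e G 0 sG Jcut (x, v) v0.
    by rewrite (_ : jeval G 0 Jcut = cutp)//; apply/funext => p; rewrite JcutE.
  apply: (@continuous_comp _ _ _ (cutp : V -> R) (fun y : R => pospart y ^+ M.+1) (x, v)); first exact: cN.
  apply: (@continuous_comp _ _ _ pospart (fun y : R => y ^+ M.+1)).
    exact: continuous_pospart.
  exact: exprn_continuous.
move=> eps eps0; have e2 : 0 < eps / 2 by rewrite divr_gt0.
have near_del (g : V -> R) : {for (x, v), continuous g} -> exists2 del : R, 0 < del &
    forall z : E2, (forall i, `|z 0 i - row_mx x v 0 i| <= del) -> `|g (pairing z) - g (x, v)| <= eps / 2.
  move=> cg; have h0 : \forall p \near nbhs (x, v), `|g (x, v) - g p| <= eps / 2.
    by apply: cvgr_dist_le => //; exact: cg.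
  move: h0 => /nbhs_ballP[r r0 hr]; have {}r0 : 0 < r := r0; exists (r / 2); first exact: divr_gt0.
  move=> z hz; rewrite distrC; apply: hr; split; split => // i j; rewrite /ball /= ord1.
  - have := hz (lshift d j); rewrite row_mxEl !mxE distrC => h.
    by apply: le_lt_trans h _; rewrite ltr_pdivrMr//; lra.
  - have := hz (rshift d j); rewrite row_mxEr !mxE distrC => h.
    by apply: le_lt_trans h _; rewrite ltr_pdivrMr//; lra.
have [d1 d10 h1] := near_del _ (cc _ sre); have [d2 d20 h2] := near_del _ (cc _ sim).
exists (Num.min d1 d2); first by rewrite lt_min d10.
move=> z hz; apply: le_trans (normc_le_ReIm _) _.
have hz1 i : `|z 0 i - row_mx x v 0 i| <= d1 by have := hz i; rewrite le_min => /andP[].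
have hz2 i : `|z 0 i - row_mx x v 0 i| <= d2 by have := hz i; rewrite le_min => /andP[].
have := h1 z hz1; have := h2 z hz2; rewrite /Fext; simpc => /=.
rewrite /pairing /= row_mxKl row_mxKr; lra.
Qed.

Let bounded_Fext M : exists2 D : R, 0 <= D & forall z, fbox z -> normc (Fext M z) <= D.
Proof.
have [_ [sre sim]] := sf.
have H (G : V -> R) : smooth_on [set p : V | p.2 != 0] G ->
    exists2 D : R, 0 <= D & forall z, fbox z -> `|G (pairing z) * pospart (cutp (pairing z)) ^+ M.+1| <= D.
  move=> sG; have [D D0 hD] := cut_chain_bounded 0 0 sG pi.
  exists D => // z bz.
  have hc : jeval G 0 Jcut (pairing z) = cutp (pairing z) by exact: JcutE.
  have c1 : pospart (cutp (pairing z)) <= 1.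
    apply: (@le_trans _ _ (Num.max 1 0)); last by rewrite ge_max lexx ler01.
    rewrite /pospart; case: ifP => _; rewrite le_max ?lexx ?orbT//.
    by rewrite /cutp; have := sqr_ge0 (dotR (pairing z).2 (pairing z).2 - 1); move=> ?; apply/orP; left; lra.
  rewrite exprS mulrA normrM.
  apply: (@le_trans _ _ (D * 1)); last by rewrite mulr1.
  apply: ler_pM => //; last first.
    by rewrite normrX ger0_norm ?pospart_ge0// exprn_ile1// pospart_ge0.
  have hh : forall i, `|(pairing z).1 0 i| <= pi.
    move=> i; rewrite /pairing /= mxE ler_norml; have /andP[? ?] := bz (lshift d i).
    by apply/andP; split; lra.
  by have := hD (pairing z) hh; rewrite /cut_chain hc subn0 expr1.
have [D1 D10 h1] := H _ sre; have [D2 D20 h2] := H _ sim.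
exists (D1 + D2); first exact: addr_ge0.
move=> z bz; apply: le_trans (normc_le_ReIm _) _.
by apply: lerD; [exact: h1|exact: h2].
Qed.

Lemma expi_zvec_periodic n (K k : 'rV[int]_n) (x : 'rV[R]_n) :
  expi (dotR (zvec K) (x + (2 * pi) *: zvec k)) = expi (dotR (zvec K) x).
Proof.
rewrite dotRDr dotRZr expiD (_ : dotR (zvec K) (zvec k) = (\sum_i K 0 i * k 0 i)%:~R); last first.
  by rewrite /dotR rmorph_sum; apply: eq_bigr => i _; rewrite !mxE rmorphM.
by rewrite expi2piz mulr1.
Qed.

Lemma periodic_reduce (x : E) : exists k : 'rV[int]_d, fbox (x + (2 * pi) *: zvec k).
Proof.
have p2 : 0 < 2 * pi :> R by have := @pi_ge2 R; lra.
exists (\row_i - Num.floor ((x 0 i + pi) / (2 * pi))) => i; rewrite !mxE mulrNz.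
set y := (x 0 i + pi) / (2 * pi); have := floor_itv y => /andP[].
have yE : y * (2 * pi) = x 0 i + pi by rewrite divfK// gt_eqF.
rewrite -(ler_pM2r p2) -(ltr_pM2r p2) yE rmorphD /= => h1 h2.
by apply/andP; split; lra.
Qed.

Theorem smooth_storus_fourier (m : nat) : exists c : 'rV[int]_(d + d) -> R[i], exists C : R,
  (forall K, normc (c K) <= C * zweight K ^- m) /\
  forall x v, sphere v -> hsum (fun K => c K * expi (dotR (zvec K) (row_mx x v))) (f x v).
Proof.
(* Two extra orders meet the condition [2 <= m] of [fourier_series]. The box has dimension 2d, hence
   M. *)
pose m' := m.+2; pose M := ((d + d) * m')%N.
have [D1 D10 h1] := bounded_Fext M; have [D2 D20 h2] := chain_bound M.
have [|||||| c [C [hc hs]]] := @fourier_series R (d + d) (Fext M) (D1 + D2) m'.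
- by rewrite addSn.
- by [].
- exact: addr_ge0.
- by move=> z bz; apply: le_trans (h1 z bz) _; rewrite lerDl.
- exact: wraps_Fext.
- move=> j z h bz h0 Mh; apply: le_trans (h2 j h z bz h0 Mh) _.
  by rewrite ler_wpM2r ?exprn_ge0 ?(ltW h0)// lerDr.
have C0 : 0 <= C.
  have := le_trans (normc_ge0 _) (hc 0).
  by rewrite pmulr_lge0// invr_gt0 exprn_gt0// zweight_gt0.
exists c; exists C; split.
  move=> K; apply: le_trans (hc K) _; rewrite ler_wpM2l// lef_pV2 ?posrE ?exprn_gt0 ?zweight_gt0//.
  by apply: ler_weXn2l; [exact: zweight_ge1|rewrite /m'; lia].
move=> x v sv; have [k bk] := periodic_reduce x.
have [per _] := sf; rewrite -(per v sv k x).
set y := x + _ in bk *.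
have bz : fbox (row_mx y v).
  move=> i; case: (split_ordP i) => j ->; first by rewrite row_mxEl; exact: bk.
  have : `|v 0 j| <= 1.
    have := punctured_ball_le1 (v := v) j; apply; rewrite /punctured_ball /=.
    by move: sv; rewrite /sphere /= => ->; rewrite ltr01 lexx.
  have p2 := @pi_ge2 R.
  by rewrite row_mxEr ler_norml => /andP[? ?]; apply/andP; split; lra.
have := hs _ bz (@cont_Fext M y v sv).
rewrite FextE row_mxKl row_mxKr direction_id// (_ : cutp _ = 1); last first.
  by rewrite /cutp /pairing /= row_mxKr -enorm_sqr; move: sv; rewrite /sphere /= => ->; rewrite expr1n subrr; ring.
rewrite pospart_gt0// expr1n mulr1; apply: eq_hsum => K; congr (_ * _).
rewrite (_ : row_mx y v = row_mx x v + (2 * pi) *: zvec (row_mx k 0)) ?expi_zvec_periodic//.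
apply/rowP => i; case: (split_ordP i) => j ->; rewrite !mxE ?(unsplitK (inl _)) ?(unsplitK (inr _)) !mxE //=.
by rewrite mulr0 addr0.
Qed.

End smooth_fourier.

(** * The correlation function *)

Section torus_integrals.
Context {R : realType}.
Local Notation mu := (@lebesgue_measure R).
Local Notation lam := (@lebesgue_rV R).

Let I : set (measurableTypeR R) := [set x | 0 <= x < 2 * pi].

Let IE : I = `[0, 2 * pi[%classic.
Proof. by apply/seteqP; split => x /=; rewrite in_itv. Qed.

Let p2 : 0 < 2 * pi :> R. Proof. by have := @pi_ge2 R; lra. Qed.

Let mI : measurable I. Proof. by rewrite IE. Qed.

Let muI : mu I = (2 * pi)%:E.
Proof.
by rewrite IE; have /= -> := @lebesgue_measure_itv R `[0, 2 * pi[; rewrite lte_fin p2 oppr0 adde0.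
Qed.

Lemma cintegral_expi (k : int) :
  cintegral mu I (fun x => expi (k%:~R * x)) = if k == 0 then (2 * pi)%:C else 0.
Proof.
have oc (g : R -> R) : (forall x : R, {for x, continuous g}) ->
    \int[mu]_(x in I) g x = \int[mu]_(x in `[0, 2 * pi]) g x.
  move=> cg; rewrite IE /Rintegral -integral_itv_bndo_bndc//.
  apply/measurable_EFinP/measurable_funTS; apply: continuous_measurable_fun; exact: cg.
have cmul (f : R -> R) x : continuous f -> {for x, continuous (fun x : R => f (k%:~R * x))}.
  move=> cf; apply: (continuous_comp (f := fun x : R => k%:~R * x)); last exact: cf.
  by apply: cvgM; [exact: cvg_cst|exact: cvg_id].
rewrite /cintegral /= !oc; try by move=> x; apply: cmul; first [exact: continuous_cos|exact: continuous_sin].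
have hk (x : R) : is_derive x 1 (fun x : R => k%:~R * x) (k%:~R : R).
  by apply: is_derive_eq (is_deriveZ1 k%:~R (is_derive_id1 x)) _; rewrite mulr1.
case: eqP => [->|/eqP k0].
  have p0 := ltW p2.
  have c1 (x : R) : 0 <= x <= 2 * pi -> is_derive x 1 (fun x : R => x) 1 by move=> _; exact: is_derive_id1.
  have c0 (x : R) : 0 <= x <= 2 * pi -> is_derive x 1 (fun x : R => 0 : R) 0 by move=> _; exact: is_derive_const.
  have E1 := ftcR p0 c1 (fun x _ => @cst_continuous _ _ (1 : R) x).
  have E0 := ftcR p0 c0 (fun x _ => @cst_continuous _ _ (0 : R) x).
  under eq_Rintegral do rewrite mul0r cos0.
  under [X in _ +i* X]eq_Rintegral do rewrite mul0r sin0.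
  by rewrite E1 E0 !subr0.
have k0' : (k%:~R : R) != 0 by rewrite intr_eq0.
have h1 (x : R) : 0 <= x <= 2 * pi -> is_derive x 1 (fun x : R => k%:~R^-1 * sin (k%:~R * x)) (cos (k%:~R * x)).
  move=> _; apply: is_derive_eq (is_deriveZ1 k%:~R^-1 (is_derive_sin_comp (hk x))) _; by field.
have h2 (x : R) : 0 <= x <= 2 * pi -> is_derive x 1 (fun x : R => - k%:~R^-1 * cos (k%:~R * x)) (sin (k%:~R * x)).
  move=> _; apply: is_derive_eq (is_deriveZ1 (- k%:~R^-1) (is_derive_cos_comp (hk x))) _; by field.
rewrite (ftcR (ltW p2) h1 (fun x _ => cmul cos x (@continuous_cos R))).
rewrite (ftcR (ltW p2) h2 (fun x _ => cmul sin x (@continuous_sin R))).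
have := @expi2piz R k; rewrite /expi mulrC => -[-> ->].
by rewrite !mulr0 sin0 cos0 mulr0 !subrr.
Qed.

Let cbI (k : int) : cbounded I (fun x => expi (k%:~R * x : R)) 1.
Proof.
have mk : measurable_fun I (fun x : measurableTypeR R => k%:~R * x : R).
  by apply: measurable_funM => //; exact: measurable_cst.
split.
- by apply: (measurableT_comp (continuous_measurable_fun (@continuous_cos R)) mk).
- by apply: (measurableT_comp (continuous_measurable_fun (@continuous_sin R)) mk).
- by move=> x _; rewrite normc_expi.
Qed.

Lemma cbounded_expi_rV n (D : set 'rV[R]_n) (v : 'rV[R]_n) : cbounded D (fun x => expi (dotR v x)) 1.
Proof.
have mk : measurable_fun D (dotR v) by apply: measurable_funTS; exact: measurable_dotR.
split.
- by apply: (measurableT_comp (continuous_measurable_fun (@continuous_cos R)) mk).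
- by apply: (measurableT_comp (continuous_measurable_fun (@continuous_sin R)) mk).
- by move=> x _; rewrite normc_expi.
Qed.

Lemma torus_cube_facts n : [/\ measurable (@torus_cube R n),
  lam n torus_cube = ((2 * pi) ^+ n)%:E &
  forall k : 'rV[int]_n, cintegral (lam n) torus_cube (fun x => expi (dotR (zvec k) x)) =
    if k == 0 then ((2 * pi) ^+ n)%:C else 0].
Proof.
elim: n => [|n [mC lC hC]].
  have E0 : @torus_cube R 0 = setT by apply/seteqP; split => x // _ [].
  have l1 : lam 0 (@torus_cube R 0) = 1%:E by rewrite E0 /= diracT.
  split; [by rewrite E0|by rewrite l1 expr0|].
  move=> k; rewrite (_ : k = 0) ?eqxx; last by apply/rowP => -[].
  have -> : (fun x : 'rV[R]_0 => expi (dotR (zvec 0) x)) = fun=> 1.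
    by apply/funext => x; rewrite /dotR big_ord0 expi0.
  rewrite /cintegral /= expr0.
  have mT : measurable (@torus_cube R 0) by rewrite E0.
  rewrite (@Rintegral_cst _ _ R (lam 0) _ mT) (@Rintegral_cst _ _ R (lam 0) _ mT).
  have l1' : fine (lam 0 (@torus_cube R 0)) = 1 by rewrite l1.
  by rewrite mul1r mul0r; congr (_ +i* 0); exact: l1'.
have CE : rV_cons @^-1` (@torus_cube R n.+1) = I `*` torus_cube.
  apply/seteqP; split => -[x v] /=.
    move=> h; split => [|i]; first by have := h ord0; rewrite mxE unlift_none.
    by have := h (lift ord0 i); rewrite mxE liftK.
  by move=> [h1 h2] i; rewrite mxE; case: unliftP => [j|] _ //=; exact: h2.
have mS : measurable (@torus_cube R n.+1).
  rewrite (_ : torus_cube = rV_uncons @^-1` (I `*` torus_cube)).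
    by rewrite -[X in measurable X]setTI; apply: measurable_rV_uncons => //; exact: measurableX.
  rewrite -CE -comp_preimage (_ : rV_cons \o rV_uncons = id)//.
  apply/funext => v /=; apply/rowP => i; rewrite !mxE.
  by case: unliftP => [j|] -> //=; rewrite ?mxE.
split => //.
  transitivity (mu I * lam n torus_cube)%E.
    by rewrite /= /lebesgue_rV_step /pushforward CE product_measure1E.
  by rewrite muI lC -EFinM -exprS.
move=> k; pose k' : 'rV[int]_n := \row_j k 0 (lift ord0 j).
have FE : (fun x : 'rV[R]_n.+1 => expi (dotR (zvec k) x)) \o rV_cons =
    (fun z => expi ((k 0 0)%:~R * z.1) * expi (dotR (zvec k') z.2)).
  apply/funext => -[x v] /=; rewrite -expiD; congr expi.
  rewrite /dotR big_ord_recl !mxE unlift_none; congr (_ + _).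
  by apply: eq_bigr => i _; rewrite !mxE liftK.
have fI : (mu I < +oo)%E by rewrite muI ltry.
have fC : (lam n torus_cube < +oo)%E by rewrite lC ltry.
have P := cintegral_prod mI mC fI fC (cbI (k 0 0)) (@cbounded_expi_rV n torus_cube (zvec k')).
have mP := measurableX mI mC.
have fP : ((mu \x lam n)%E (I `*` torus_cube) < +oo)%E.
  rewrite product_measure1E//; have := lte_mul_pinfty; apply => //.
  by rewrite ge0_fin_numE.
have [mre mim _] := @cbounded_expi_rV n.+1 setT (zvec k).
have pf (g : R[i] -> R) : measurable_fun setT (fun x : 'rV[R]_n.+1 => g (expi (dotR (zvec k) x))) ->
   (forall z, `|g z| <= normc z) ->
   \int[lam n.+1]_(x in torus_cube) g (expi (dotR (zvec k) x)) =
   \int[(mu \x lam n)%E]_(z in I `*` torus_cube)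
      g (expi ((k 0 0)%:~R * z.1) * expi (dotR (zvec k') z.2)).
  move=> mg g1.
  have E (z : measurableTypeR R * 'rV[R]_n) : expi (dotR (zvec k) (rV_cons z)) =
     expi ((k 0 0)%:~R * z.1) * expi (dotR (zvec k') z.2) by move: FE => /(congr1 (fun f => f z)).
  rewrite /Rintegral /= (integral_pushforward (@measurable_rV_cons R n))//.
  - by rewrite CE; congr fine; apply: eq_integral => z _ /=; rewrite E.
  - exact/measurable_EFinP.
  - rewrite CE; apply: (bounded_integrable mP fP (B := 1)).
      by apply: measurable_funTS; apply: (measurableT_comp mg (@measurable_rV_cons R n)).
    by move=> z _ /=; apply: le_trans (g1 _) _; rewrite normc_expi.
have -> : cintegral (lam n.+1) torus_cube (fun x => expi (dotR (zvec k) x)) =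
   cintegral (mu \x lam n)%E (I `*` torus_cube)
     (fun z => expi ((k 0 0)%:~R * z.1) * expi (dotR (zvec k') z.2)).
  rewrite /cintegral (pf (@complex.Re R))//; last exact: normc_Re.
  by rewrite (pf (@complex.Im R))//; exact: normc_Im.
rewrite P cintegral_expi hC.
have -> : (k == 0) = (k 0 0 == 0) && (k' == 0).
  apply/eqP/andP => [k0|[/eqP e0 /eqP/rowP e1]].
    by rewrite /k' k0 mxE eqxx; split => //; apply/eqP/rowP => j; rewrite !mxE.
  apply/rowP => i; rewrite mxE; case: (unliftP ord0 i) => [j|] -> //.
  by have := e1 j; rewrite !mxE.
case: eqP => _; case: eqP => _; rewrite /= ?mulr0 ?mul0r//.
by rewrite exprS [RHS](rmorphM _ (2 * pi)).
Qed.

Lemma measurable_torus_cube n : measurable (@torus_cube R n).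
Proof. by have [] := torus_cube_facts n. Qed.

Lemma torus_cube_vol n : lam n torus_cube = ((2 * pi) ^+ n)%:E.
Proof. by have [] := torus_cube_facts n. Qed.

Lemma torus_cube_lty n : (lam n torus_cube < +oo)%E.
Proof. by rewrite torus_cube_vol ltry. Qed.

Lemma torus_int_expi n (k : 'rV[int]_n) :
  torus_int (fun x => expi (dotR (zvec k) x)) = if k == 0 then ((2 * pi) ^+ n)%:C else 0 :> R[i].
Proof. by have [_ _ h] := torus_cube_facts n; exact: h. Qed.

End torus_integrals.

Section reindexing.
Context {R : realType} {I J : choiceType}.

Lemma hsum_sub (f : J -> I) (g : I -> option J) (c : I -> R[i]) B t :
  pcancel f g -> ocancel g f -> (forall i, g i = None -> c i = 0) -> asum c B ->
  hsum c t -> hsum (fun j => c (f j)) t.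
Proof.
move=> fg gf c0 cB ct.
have aJ : asum (fun j => c (f j)) B.
  by apply: (asum_inj (f := f)) cB => // x y /(congr1 g); rewrite !fg => -[].
have h := asum_hsum aJ.
by rewrite (hsum_uniq ct (hsum_inj fg gf (fun=> erefl) c0 h)).
Qed.

Lemma hsum_bij (f : J -> I) (g : I -> J) (c : I -> R[i]) t :
  cancel f g -> cancel g f -> hsum (fun j => c (f j)) t -> hsum c t.
Proof.
move=> fg gf; apply: (@hsum_inj R I J f (fun i => Some (g i)) (fun j => c (f j))) => //.
by move=> j /=; rewrite fg.
Qed.

End reindexing.

Section zvec_algebra.
Context {R : realType} {n : nat}.
Local Notation Z := 'rV[int]_n.

Lemma zvecD (k l : Z) : zvec (k + l) = zvec k + zvec l :> 'rV[R]_n.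
Proof. by apply/rowP => i; rewrite !mxE rmorphD. Qed.

Lemma zvecN (k : Z) : zvec (- k) = - zvec k :> 'rV[R]_n.
Proof. by apply/rowP => i; rewrite !mxE rmorphN. Qed.

Lemma zvec0 : zvec 0 = 0 :> 'rV[R]_n.
Proof. by apply/rowP => i; rewrite !mxE. Qed.

Lemma enorm_zvec_le (k : Z) : enorm (zvec k : 'rV[R]_n) <= zweight k.
Proof.
have W0 := @zweight_gt0 R _ k.
have hs : \sum_i `|(k 0 i)%:~R| <= zweight k :> R.
  have H (r : seq 'I_n) : 1 + \sum_(i <- r) `|(k 0 i)%:~R| <= \prod_(i <- r) (1 + `|(k 0 i)%:~R|) :> R.
    elim: r => [|i r IH]; first by rewrite !big_nil addr0.
    rewrite !big_cons; have := normr_ge0 ((k 0 i)%:~R : R).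
    have : 0 <= \sum_(j <- r) `|(k 0 j)%:~R| :> R by apply: sumr_ge0.
    move: (\sum_(j <- r) _) (\prod_(j <- r) _) (`|_|) IH => x y z; nra.
  by have := H (index_enum _); rewrite /zweight; lra.
rewrite -(@ler_pXn2r _ 2) ?nnegrE ?enorm_ge0 ?(ltW W0)// enorm_sqr.
apply: (@le_trans _ _ ((\sum_i `|(k 0 i)%:~R|) ^+ 2)); last first.
  by rewrite lerXn2r ?nnegrE ?(ltW W0)//; apply: sumr_ge0.
rewrite expr2 mulr_suml; apply: ler_sum => i _; rewrite !mxE -expr2 -real_normK ?num_real// expr2.
by rewrite ler_wpM2l// (bigD1 i)//= lerDl; apply: sumr_ge0.
Qed.

Lemma enorm_zvec_ge1 (k : Z) : k != 0 -> 1 <= enorm (zvec k : 'rV[R]_n).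
Proof.
move=> k0; have [i ki] : exists i, k 0 i != 0.
  by apply/existsP; apply: contraR k0; rewrite negb_exists => /forallP h;
    apply/eqP/rowP => i; rewrite mxE; apply/eqP; have := h i; rewrite negbK.
rewrite -(@ler_pXn2r _ 2) ?nnegrE ?enorm_ge0// enorm_sqr expr1n.
rewrite /dotR (bigD1 i)//= !mxE -expr2 -real_normK ?num_real//.
have h1 : 1 <= `|(k 0 i)%:~R : R| by rewrite -intr_norm -[1]/(1%:~R) ler_int; lia.
have h2 : 1 <= `|(k 0 i)%:~R : R| ^+ 2 by rewrite exprn_ege1.
apply: le_trans h2 _; rewrite lerDl; apply: sumr_ge0 => j _; rewrite -expr2 sqr_ge0//.
Qed.

Lemma zweightN (k : Z) : zweight (- k) = zweight k :> R.
Proof. by apply: eq_bigr => i _; rewrite !mxE rmorphN normrN. Qed.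

Lemma zvec_neq0 (k : Z) : k != 0 -> zvec k != 0 :> 'rV[R]_n.
Proof. by move/enorm_zvec_ge1 => h; rewrite -enorm_gt0 (lt_le_trans ltr01). Qed.

Lemma signed_direction_sphere s (k : Z) : k != 0 -> sphere (signed_direction s k : 'rV[R]_n).
Proof.
move=> k0; have := direction_sphere (zvec_neq0 k0); rewrite /signed_direction /sphere /= => h.
by rewrite enormZ h mulr1 /pm; case: s; rewrite ?normrN normr1.
Qed.

End zvec_algebra.

(** * Double series on the sphere bundle *)

Section representation.
Context {R : realType} {e : nat}.
Local Notation d := e.+1.
Local Notation E := 'rV[R]_d.
Local Notation Z := 'rV[int]_d.
Implicit Types (f g : E -> E -> R[i]) (c : Z * Z -> R[i]).

(** The series in v is imposed on the sphere only, so [c] is not determined by [f]. What is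
    intrinsic is recovered by summing over the second frequency, as in [fourier_rep]. *)
Definition frep f c := forall x v, sphere v ->
  hsum (fun p => c p * (expi (dotR (zvec p.1) x) * expi (dotR (zvec p.2) v))) (f x v).

Definition decays (N : nat) c (B : R) :=
  asum (fun p => c p * ((zweight p.1 * zweight p.2) ^+ N)%:C) B.

Lemma le_decays N N' c B : (N' <= N)%N -> decays N c B -> decays N' c B.
Proof.
move=> NN; apply: asum_le1 => p; rewrite !normcM ler_wpM2l ?normc_ge0// !normc_real.
have W1 : 1 <= zweight p.1 * zweight p.2 :> R by rewrite -[1]mulr1; apply: ler_pM => //; exact: zweight_ge1.
by rewrite !ger0_norm ?exprn_ge0 ?(le_trans ler01)//; exact: ler_weXn2l.
Qed.

Lemma decays0 c B : decays 0 c B -> asum c B.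
Proof. by apply: eq_asum => p; rewrite expr0 mulr1. Qed.

Lemma storus_rep f N : smooth_storus f -> exists c B, decays N c B /\ frep f c.
Proof.
move=> sf; have [c [C [hc hs]]] := smooth_storus_fourier sf N.+2.
have C0 : 0 <= C.
  have := le_trans (normc_ge0 _) (hc 0).
  by rewrite pmulr_lge0// invr_gt0 exprn_gt0// zweight_gt0.
exists (fun p => c (row_mx p.1 p.2)), (C * (4 ^+ d * 4 ^+ d)).
have WE (k l : Z) : zweight (row_mx k l) = zweight k * zweight l :> R.
  rewrite /zweight big_split_ord; congr (_ * _); apply: eq_bigr => i _;
    by rewrite ?row_mxEl ?row_mxEr.
split.
  apply: asum_le (asum_prod (@asum_zweight R d) (@asum_zweight R d)) => // p.
  have W0 : 0 < zweight p.1 * zweight p.2 :> R by rewrite mulr_gt0 ?zweight_gt0.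
  rewrite !normcM !normc_real -normrM -invfM -exprMn !ger0_norm ?invr_ge0 ?exprn_ge0 ?(ltW W0)//.
  apply: le_trans (ler_wpM2r _ (hc _)) _; first by rewrite exprn_ge0// ltW.
  rewrite WE -mulrA ler_wpM2l//; move: (_ * _) W0 => x x0.
  by rewrite -addn2 addnC exprD invfM -mulrA mulVf ?mulr1// expf_neq0// lt0r_neq0.
move=> x v sv; have := hs x v sv.
have dE (p : Z * Z) : expi (dotR (zvec (row_mx p.1 p.2)) (row_mx x v)) =
    expi (dotR (zvec p.1) x) * expi (dotR (zvec p.2) v) :> R[i].
  rewrite -expiD; congr expi; rewrite /dotR big_split_ord /=.
  by congr (_ + _); apply: eq_bigr => i _; rewrite !mxE ?(unsplitK (inl _)) ?(unsplitK (inr _)) ?mxE.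
move=> h; apply: (hsum_bij (f := fun K : 'rV[int]_(d + d) => (lsubmx K, rsubmx K))
  (g := fun p => row_mx p.1 p.2)).
- by move=> K; rewrite /= hsubmxK.
- by move=> [k l]; rewrite /= row_mxKl row_mxKr.
by apply: eq_hsum h => K; rewrite -dE /= hsubmxK.
Qed.

Definition conj_coef c : Z * Z -> R[i] := fun p => (c (- p.1, - p.2))^*.

Lemma frep_conj f c : frep f c -> frep (fun x v => (f x v)^*) (conj_coef c).
Proof.
move=> fc x v /(fc x) /hsum_conj h.
apply: (hsum_bij (f := fun p : Z * Z => (- p.1, - p.2)) (g := fun p => (- p.1, - p.2))).
- by move=> [k l]; rewrite /= !opprK.
- by move=> [k l]; rewrite /= !opprK.
apply: eq_hsum h => -[k l]; rewrite /conj_coef /= !opprK !zvecN !dotRNl.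
by rewrite -!conj_expi -!rmorphM.
Qed.

Lemma decays_conj N c B : decays N c B -> decays N (conj_coef c) B.
Proof.
move=> h; apply: (asum_inj (f := fun p : Z * Z => (- p.1, - p.2))) h => [[k l] [k' l'] []|[k l]].
  by move=> /oppr_inj -> /oppr_inj ->.
by rewrite /= !normcM normc_conj !zweightN.
Qed.

Lemma fourier_rep f c B k v : frep f c -> asum c B -> sphere v ->
  hsum (fun l => c (k, l) * expi (dotR (zvec l) v)) (fourier (f ^~ v) k).
Proof.
move=> fc cB sv; have mC := @measurable_torus_cube R d; have fC := @torus_cube_lty R d.
pose a (p : Z * Z) := c p * expi (dotR (zvec p.2) v).
have aB : asum a B by apply: asum_le1 cB => p; rewrite normcM normc_expi mulr1.
have H := @cintegral_hsum _ _ R (lebesgue_rV d) torus_cube mC fC _ a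
  (fun p x => expi (dotR (zvec (p.1 - k)) x)) (fun x => f x v * expi (- dotR (zvec k) x)) B aB
  (fun p => cbounded_expi_rV torus_cube _).
have {}H : hsum (fun p => a p * (if p.1 - k == 0 then ((2 * pi) ^+ d)%:C else 0))
    (torus_int (fun x => f x v * expi (- dotR (zvec k) x))).
  apply: eq_hsum (H _) => [p|x _]; first by rewrite -torus_int_expi.
  have := hsumZ (expi (- dotR (zvec k) x)) (fc x v sv); rewrite [X in hsum _ X]mulrC.
  apply: eq_hsum => p; rewrite zvecD zvecN dotRDl dotRNl expiD /a.
  by move: (c p) (expi (dotR (zvec p.2) v)) => ? ?; ring.
have p0 : (2 * pi) ^+ d != 0 :> R.
  by rewrite expf_neq0// mulf_neq0// lt0r_neq0// pi_gt0.
have := hsumZ ((2 * pi) ^- d)%:C H; rewrite -/(torus_mean _) -/(fourier _ _) => {}H.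
have {}H : hsum (fun p => if p.1 == k then a p else 0) (fourier (f ^~ v) k).
  apply: eq_hsum H => p; rewrite subr_eq0; case: eqP => _; last by rewrite !mulr0.
  by rewrite mulrCA -rmorphM mulVf// mulr1.
have := @hsum_sub R _ _ (fun l : Z => (k, l)) (fun p : Z * Z => if p.1 == k then Some p.2 else None)
  _ B _ _ _ _ _ H.
rewrite /= => h; apply: eq_hsum (h _ _ _ _) => [l|l|[k' l]|[k' l] /=|].
- by rewrite eqxx.
- by rewrite /= eqxx.
- by rewrite /=; case: eqP => [->|].
- by case: eqP.
- by apply: asum_le1 aB => p; case: ifP => // _; rewrite normc0 normc_ge0.
Qed.

Let tri := (Z * (Z * Z))%type.

Let tri_pair (j : tri) : (Z * Z) * (Z * Z) := ((j.1, j.2.1), (- j.1, j.2.2)).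

Let pair_tri (p : (Z * Z) * (Z * Z)) : option tri :=
  if p.1.1 + p.2.1 == 0 then Some (p.1.1, (p.1.2, p.2.2)) else None.

Let tri_pairK : pcancel tri_pair pair_tri.
Proof. by move=> [k [l l']]; rewrite /pair_tri /= subrr eqxx. Qed.

Let pair_triK : ocancel pair_tri tri_pair.
Proof.
move=> [[k l] [k' l']]; rewrite /pair_tri /=; case: eqP => //= /eqP.
by rewrite addr_eq0 /tri_pair /= => /eqP ->; rewrite opprK.
Qed.

(* The product of the modes (k, l) and (k', l') has a nonzero mean in x only if k' = - k. *)
Definition bcoef c c' (j : tri) : R[i] := c (j.1, j.2.1) * c' (- j.1, j.2.2).

Definition bphase (t : R) (j : tri) : E := t *: zvec j.1 + zvec (j.2.1 + j.2.2).

Lemma cbounded_storus (u v : E) :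
  cbounded (torus_cube `*` sphere) (fun z : E * E => expi (dotR u z.1) * expi (dotR v z.2)) 1.
Proof.
have [a1 a2 _] := @cbounded_expi_rV R d setT u; have [b1 b2 _] := @cbounded_expi_rV R d setT v.
rewrite -[X in cbounded _ _ X]mulr1; apply: cboundedM; split; try by move=> z _; rewrite normc_expi.
- by apply: measurable_funTS; apply: (measurableT_comp a1 measurable_fst).
- by apply: measurable_funTS; apply: (measurableT_comp a2 measurable_fst).
- by apply: measurable_funTS; apply: (measurableT_comp b1 measurable_snd).
- by apply: measurable_funTS; apply: (measurableT_comp b2 measurable_snd).
Qed.

Lemma measurable_storus : measurable (@torus_cube R d `*` @sphere R d).
Proof. by apply: measurableX; [exact: measurable_torus_cube|exact: measurable_sphere]. Qed.

Lemma storus_lty : ((lebesgue_rV d \x sphere_vol)%E (@torus_cube R d `*` @sphere R d) < +oo)%E.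
Proof.
rewrite product_measure1E; [|exact: measurable_torus_cube|exact: measurable_sphere].
by apply: lte_mul_pinfty => //; [rewrite ge0_fin_numE// torus_cube_lty|exact: sphere_vol_lty].
Qed.

Let pair_hsum f g c c' (t : R) x v : frep f c -> frep g c' -> forall B B', asum c B -> asum c' B' ->
  sphere v -> hsum (fun p : (Z * Z) * (Z * Z) => (c p.1 * c' p.2) *
    (expi (dotR (zvec (p.1.1 + p.2.1)) x) *
     expi (dotR (t *: zvec p.1.1 + zvec (p.1.2 + p.2.2)) v))) (f (x + t *: v) v * g x v).
Proof.
move=> fc gc B B' cB cB' sv; have h1 := fc (x + t *: v) v sv; have h2 := gc x v sv.
have n1 y (q : Z * Z) : normc (expi (dotR (zvec q.1) y) * expi (dotR (zvec q.2) v)) = 1 :> R.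
  by rewrite normcM !normc_expi mulr1.
have a1 : asum (fun q => c q * (expi (dotR (zvec q.1) (x + t *: v)) * expi (dotR (zvec q.2) v))) B.
  by apply: asum_le1 cB => q; rewrite normcM n1 mulr1.
have a2 : asum (fun q => c' q * (expi (dotR (zvec q.1) x) * expi (dotR (zvec q.2) v))) B'.
  by apply: asum_le1 cB' => q; rewrite normcM n1 mulr1.
apply: eq_hsum (hsum_prod a1 a2 h1 h2) => -[[k l] [k' l']] /=.
rewrite mulrACA; congr (_ * _); rewrite -!expiD; congr expi.
by rewrite !zvecD !dotRDl !dotRDr dotRZl dotRZr; ring.
Qed.

Lemma cbounded_shift_mul f g c c' B B' (t : R) : frep f c -> frep g c' -> asum c B -> asum c' B' ->
  cbounded (torus_cube `*` sphere) (fun z : E * E => f (z.1 + t *: z.2) z.2 * g z.1 z.2) (B * B').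
Proof.
move=> fc gc cB cB'.
apply: (cbounded_hsum (asum_prod cB cB')
  (fun p => cbounded_storus (zvec (p.1.1 + p.2.1)) (t *: zvec p.1.1 + zvec (p.1.2 + p.2.2)))).
by move=> [x v] [_ sv]; exact: pair_hsum cB cB' sv.
Qed.

(** Integration over the torus kills every pair of modes with k + k' <> 0, and on the remaining ones
    the flow contributes the frequency t k to the integral over the sphere. *)
Lemma correlation_hsum f g c c' B B' (t : R) : frep f c -> frep g c' -> asum c B -> asum c' B' ->
  hsum (fun j : tri => ((2 * pi) ^+ d)%:C * (bcoef c c' j * sphere_hat (bphase t j)))
    (storus_int (fun x v => f (x + t *: v) v * g x v)).
Proof.
move=> fc gc cB cB'.
have H := @cintegral_hsum _ _ R (lebesgue_rV d \x sphere_vol)%E _ measurable_storus storus_lty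
  _ _ _ (fun z : E * E => f (z.1 + t *: z.2) z.2 * g z.1 z.2) _ (asum_prod cB cB')
  (fun p => cbounded_storus (zvec (p.1.1 + p.2.1)) (t *: zvec p.1.1 + zvec (p.1.2 + p.2.2))) _.
have {}H : hsum (fun p : (Z * Z) * (Z * Z) => (c p.1 * c' p.2) *
    ((if p.1.1 + p.2.1 == 0 then ((2 * pi) ^+ d)%:C else 0) *
     sphere_hat (t *: zvec p.1.1 + zvec (p.1.2 + p.2.2)))) (storus_int (fun x v => f (x + t *: v) v * g x v)).
  apply: eq_hsum (H _) => [p|[x v] [_ sv]]; last exact: pair_hsum cB cB' sv.
  congr (_ * _); rewrite -torus_int_expi /torus_int /sphere_hat /sphere_int.
  apply: (cintegral_prod (@measurable_torus_cube R d) (@measurable_sphere R e)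
    (@torus_cube_lty R d) (@sphere_vol_lty R e) (cbounded_expi_rV _ _) (cbounded_expi_rV _ _)).
have p0 : 0 <= ((2 * pi) ^+ d : R) by rewrite exprn_ge0// mulr_ge0// pi_ge0.
pose S : R := 2 * fine (@sphere_vol R d sphere).
have S0 : 0 <= S by rewrite mulr_ge0// fine_ge0.
have := hsum_sub tri_pairK pair_triK _ _ H => h.
apply: eq_hsum (h _ _ (asum_le (mulr_ge0 p0 S0) _ (asum_prod cB cB'))) => [[k [l l']]|[[k l] [k' l']]|p].
- by rewrite /tri_pair /bcoef /bphase /= subrr eqxx; ring.
- by rewrite /pair_tri /=; case: eqP => // _ _; rewrite mul0r mulr0.
rewrite normcM mulrC ler_wpM2r ?normc_ge0// normcM; apply: ler_pM; rewrite ?normc_ge0//.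
  by case: ifP => _; rewrite ?normc0// normc_real ger0_norm.
exact: normc_sphere_hat.
Qed.

End representation.

(** * Asymptotics of the correlation *)

Section asymptotics.
Context {R : realType} {e : nat}.
Local Notation d := e.+1.
Local Notation E := 'rV[R]_d.
Local Notation Z := 'rV[int]_d.
Local Notation tri := (Z * (Z * Z))%type.
Implicit Types (f g : E -> E -> R[i]) (c : Z * Z -> R[i]).
Let a : R := e%:R / 2.

Let vol : R[i] := ((2 * pi) ^+ d)%:C.

Let vol_ge0 : 0 <= ((2 * pi) ^+ d : R).
Proof. by rewrite exprn_ge0// mulr_ge0// pi_ge0. Qed.

(** The error of [sphere_hat_asymp] grows with l + l' and is uniform in k, so only the weights of l
    and l' are retained. *)
Lemma bcoef_decays N c c' B B' : decays N c B -> decays N c' B' ->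
  asum (fun j : tri => bcoef c c' j * ((zweight j.2.1 * zweight j.2.2) ^+ N)%:C) (B * B').
Proof.
move=> cB cB'.
apply: (asum_inj (f := fun j : tri => ((j.1, j.2.1), (- j.1, j.2.2)))) (asum_prod cB cB').
  by move=> [k [l l']] [k2 [l2 l2']] [-> ->] _ ->.
move=> j; rewrite /bcoef !normcM !normc_real /=.
rewrite [leRHS]mulrACA ler_wpM2l ?mulr_ge0 ?normc_ge0//.
rewrite -normrM -exprMn !ger0_norm ?exprn_ge0 ?mulr_ge0 ?(ltW (zweight_gt0 _))//.
apply: lerXn2r; rewrite ?nnegrE ?mulr_ge0 ?(ltW (zweight_gt0 _))//.
by apply: ler_pM; rewrite ?(ltW (zweight_gt0 _))// ler_peMl ?zweight_ge1// ltW// zweight_gt0.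
Qed.

Lemma asum_bcoef c c' B B' : asum c B -> asum c' B' -> asum (bcoef c c') (B * B').
Proof.
move=> cB cB'.
have d0 (x : Z * Z -> R[i]) A : asum x A -> decays 0 x A by apply: eq_asum => p; rewrite expr0 mulr1.
by have := bcoef_decays (d0 _ _ cB) (d0 _ _ cB'); apply: eq_asum => j; rewrite expr0 mulr1.
Qed.

Definition mode_factor (s : bool) (t : R) (k : Z) : R[i] :=
  expi (- (pm s * (pi / 4) * e%:R)) *
  (expi (pm s * (t * enorm (zvec k))) / (enorm (zvec k) `^ a)%:C).

(* The contribution of the stationary points theta = k / |k| and - k / |k| of t k . theta. *)
Definition mode f g (s : bool) (t : R) (k : Z) : R[i] := if k == 0 then 0 else
  vol * (mode_factor s t k *
    (fourier (f ^~ (signed_direction s k : E)) k * fourier (g ^~ (signed_direction s k : E)) (- k))).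

Definition mode_tri c c' (s : bool) (t : R) (j : tri) : R[i] :=
  vol * (bcoef c c' j * (if j.1 == 0 then 0 else
    wave (zvec j.1) (zvec (j.2.1 + j.2.2)) t s / (enorm (zvec j.1) `^ a)%:C)).

Lemma normc_factor s t (k : Z) : k != 0 -> normc (mode_factor s t k) <= 1.
Proof.
move=> k0; have k1 := @enorm_zvec_ge1 R d k k0.
rewrite /mode_factor normcM normc_expi mul1r normcM normc_expi mul1r normcV normc_real.
have h : 1 <= enorm (zvec k : E) `^ a.
  by rewrite -[leLHS](powR1N a); apply: ge0_ler_powR; rewrite ?nnegrE ?divr_ge0// (le_trans ler01).
by rewrite ger0_norm ?powR_ge0// invf_le1// (lt_le_trans ltr01).
Qed.

Lemma wave_factor s t (k : Z) (q : E) :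
  wave (zvec k) q t s / (enorm (zvec k) `^ a)%:C = mode_factor s t k * expi (dotR (signed_direction s k) q).
Proof. by rewrite /wave /mode_factor /signed_direction -!mulrA; congr (_ * (_ * _)); rewrite mulrC. Qed.

Lemma asum_mode_tri c c' B B' s t : asum c B -> asum c' B' ->
  asum (mode_tri c c' s t) ((2 * pi) ^+ d * (B * B')).
Proof.
move=> cB cB'; apply: asum_le (asum_bcoef cB cB') => // j.
rewrite /mode_tri normcM normc_real (ger0_norm vol_ge0) ler_wpM2l// normcM ler_piMr ?normc_ge0//.
case: eqP => [_|/eqP k0]; first by rewrite normc0 ler01.
by rewrite wave_factor normcM normc_expi mulr1 normc_factor.
Qed.

(** For fixed k, [wave] depends on l and l' through a character at the stationary point, so the sum
    over l and l' factorises into the Fourier coefficients of [f] and [g] at that point. *)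
Lemma mode_fiber f g c c' B B' s t k : frep f c -> frep g c' -> asum c B -> asum c' B' ->
  hsum (fun j : tri => if j.1 == k then mode_tri c c' s t j else 0) (mode f g s t k).
Proof.
move=> fc gc cB cB'; rewrite /mode; case: eqP => [k0|/eqP k0].
  apply: eq_hsum (@hsum0 R tri) => j; case: eqP => // jk.
  by rewrite /mode_tri jk k0 eqxx !mulr0.
have sv := @signed_direction_sphere R d s k k0; set v := signed_direction s k in sv *.
have h1 := fourier_rep k fc cB sv; have h2 := fourier_rep (- k) gc cB' sv.
have sub (x : Z * Z -> R[i]) A k' : asum x A -> asum (fun l => x (k', l) * expi (dotR (zvec l) v)) A.
  move=> xA; apply: (asum_inj (f := fun l : Z => (k', l))) xA => [l l' [] //|l].
  by rewrite normcM normc_expi mulr1.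
have H := hsumZ vol (hsumZ (mode_factor s t k) (hsum_prod (sub _ _ _ cB) (sub _ _ _ cB') h1 h2)).
apply: (@hsum_inj R tri _ (fun q => (k, q)) (fun j => if j.1 == k then Some j.2 else None) _ _ _ _ _ _ _ H).
- by move=> q /=; rewrite eqxx.
- by move=> [k' q] /=; case: eqP => //= ->.
- move=> [l l'] /=; rewrite eqxx /mode_tri /= (negbTE k0) wave_factor /bcoef /= -/v.
  rewrite zvecD dotRDr expiD (dotRC v (zvec l)) (dotRC v (zvec l')).
  by move: (expi _) (expi _) (mode_factor _ _ _) (c _) (c' _) => *; ring.
- by move=> [k' q] /=; case: eqP.
Qed.

Lemma mode_hsum f g c c' B B' s t : frep f c -> frep g c' -> asum c B -> asum c' B' ->
  exists S, hsum (mode f g s t) S /\ hsum (mode_tri c c' s t) S.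
Proof.
move=> fc gc cB cB'; have aT := asum_mode_tri s t cB cB'.
exists (csum setT (mode_tri c c' s t)); split; last exact: asum_hsum aT.
by apply: (fiber_hsum aT (asum_hsum aT)) => k; exact: mode_fiber fc gc cB cB'.
Qed.

Definition mean_coef c : Z * Z -> R[i] := fun p => if p.1 == 0 then c p else 0.

Lemma frep_mean f c B : frep f c -> asum c B ->
  frep (fun _ v => fourier (f ^~ v) 0) (mean_coef c).
Proof.
move=> fc cB x v sv; have H := fourier_rep 0 fc cB sv.
apply: (@hsum_inj R _ _ (fun l : Z => (0, l)) (fun p => if p.1 == 0 then Some p.2 else None) _ _ _ _ _ _ _ H).
- by move=> l /=; rewrite eqxx.
- by move=> [k l] /=; case: eqP => //= ->.
- by move=> l; rewrite /mean_coef /= eqxx zvec0 dot0R expi0 mul1r.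
- by move=> [k l] /=; rewrite /mean_coef /=; case: eqP => // _ _; rewrite mul0r.
Qed.

Lemma asum_mean c B : asum c B -> asum (mean_coef c) B.
Proof. by apply: asum_le1 => p; rewrite /mean_coef; case: ifP => // _; rewrite normc0 normc_ge0. Qed.

Lemma mean_hsum f g c c' B B' : frep f c -> frep g c' -> asum c B -> asum c' B' ->
  hsum (fun j : tri => vol * (bcoef c c' j *
      (if j.1 == 0 then sphere_hat (zvec (j.2.1 + j.2.2)) else 0)))
    (storus_int (fun x v => fourier (f ^~ v) 0 * g x v)).
Proof.
move=> fc gc cB cB'.
have := correlation_hsum 0 (frep_mean fc cB) gc (asum_mean cB) cB'; apply: eq_hsum => j.
rewrite /bcoef /mean_coef /bphase /= scale0r add0r -/vol; congr (_ * _).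
by case: ifP => _; rewrite ?mul0r ?mulr0.
Qed.

(** Since bilinear coefficients pair k with - k, keeping only k = 0 in [f] has the same effect as
    keeping it in both factors: the two integrals have the same series. *)
Lemma mean_sphere_int f g c c' B B' : frep f c -> frep g c' -> asum c B -> asum c' B' ->
  storus_int (fun x v => fourier (f ^~ v) 0 * g x v) =
  vol * sphere_int (fun v => fourier (f ^~ v) 0 * fourier (g ^~ v) 0).
Proof.
move=> fc gc cB cB'.
have -> : storus_int (fun x v => fourier (f ^~ v) 0 * g x v) =
    storus_int (fun (x : E) v => fourier (f ^~ v) 0 * fourier (g ^~ v) 0).
  apply: (hsum_uniq (mean_hsum fc gc cB cB')).
  have := correlation_hsum 0 (frep_mean fc cB) (frep_mean gc cB') (asum_mean cB) (asum_mean cB').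
  apply: eq_hsum => j; rewrite /bcoef /mean_coef /bphase /= scale0r add0r -/vol; congr (_ * _).
  by rewrite oppr_eq0; case: ifP => _; rewrite ?mul0r ?mulr0.
have cb (h : E -> E -> R[i]) (x : Z * Z -> R[i]) (A : R) : frep h x -> asum x A -> cbounded sphere (fun v => fourier (h ^~ v) 0) A.
  move=> hx xA; have aA : asum (fun l => x (0, l)) A.
    by apply: (asum_inj (f := fun l : Z => (0, l))) xA => // l l' [].
  apply: (cbounded_hsum aA (fun l => cbounded_expi_rV sphere (zvec l))) => v sv.
  exact: fourier_rep hx xA sv.
have := cintegral_prod (@measurable_torus_cube R d) (@measurable_sphere R e)
    (@torus_cube_lty R d) (@sphere_vol_lty R e) (cbounded_cst _ 1) (cboundedM (cb _ _ _ fc cB) (cb _ _ _ gc cB')).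
rewrite /storus_int /sphere_int => H.
transitivity (cintegral (lebesgue_rV d \x sphere_vol)%E (torus_cube `*` sphere)
  (fun z : E * E => 1 * (fourier (f ^~ z.2) 0 * fourier (g ^~ z.2) 0))).
  by congr cintegral; apply/funext => z; rewrite mul1r.
rewrite H; congr (_ * _); rewrite /vol -[RHS](_ : torus_int (fun x : E => expi (dotR (zvec 0) x)) = _).
  by congr cintegral; apply/funext => x; rewrite zvec0 dot0R expi0.
by rewrite torus_int_expi eqxx.
Qed.

(** The sums [S s] of the modes are left as a parameter, because the inner products of the first
    formula and the distributions of the second are both identified as such sums. The difference of
    the series is estimated term by term with [sphere_hat_asymp]; the decay exponent [e.+1] is the
    degree of its error in q. *)
Theorem correlation_asymp f g c c' B B' : (0 < e)%N -> frep f c -> frep g c' ->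
  decays e.+1 c B -> decays e.+1 c' B' ->
  exists2 C : R, 0 < C & forall (t : R) (S : bool -> R[i]), 1 <= t ->
    (forall s, hsum (mode f g s t) (S s)) ->
    normc (storus_int (fun x v => f (x + t *: v) v * g x v) -
      (storus_int (fun x v => fourier (f ^~ v) 0 * g x v) +
       ((2 * pi / t) `^ a)%:C * \sum_(s : bool) S s)) <= C * t `^ (- (a + 1)).
Proof.
move=> e0 fc gc cB cB'.
have cB0 := decays0 (le_decays (leq0n _) cB); have cB0' := decays0 (le_decays (leq0n _) cB').
have [C C0 hC] := @sphere_hat_asymp R e e0.
have bB := bcoef_decays cB cB'.
have BB0 := asum_ge0 bB.
(* The 3 comes from 1 + |l + l'| <= 1 + |l| + |l'|, at most three times the product of the weights
   of l and l'; the final 1 makes the constant positive. *)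
exists ((2 * pi) ^+ d * (C * 3 ^+ e.+1 * (B * B')) + 1).
  apply: ltr_wpDl => //; apply: mulr_ge0 => //; apply: mulr_ge0 => //; apply: mulr_ge0; first exact: ltW.
  exact: exprn_ge0.
move=> t S t1 hS.
have hS' s : hsum (mode_tri c c' s t) (S s).
  have [S' [h1 h2]] := mode_hsum s t fc gc cB0 cB0'.
  by rewrite (hsum_uniq (hS s) h1).
have H := hsumB (correlation_hsum t fc gc cB0 cB0') (hsumD (mean_hsum fc gc cB0 cB0')
  (hsumZ ((2 * pi / t) `^ a)%:C (hsum_fin (index_enum bool) hS'))).
have tp : 0 <= t `^ (- (a + 1)) by exact: powR_ge0.
apply: (@le_trans _ _ (((2 * pi) ^+ d * (C * 3 ^+ e.+1) * t `^ (- (a + 1))) * (B * B'))); last first.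
  by move: ((2 * pi) ^+ d) (3 ^+ d) (t `^ _) tp => x y z; lra.
apply: (hsum_norm H); apply: asum_le bB => [|[k [l l']]].
  by rewrite !mulr_ge0// ?exprn_ge0 ?(ltW C0).
set b := bcoef c c' _; rewrite /bphase /mode_tri -/b /=.
set q := zvec (l + l').
have -> : vol * (b * sphere_hat (t *: zvec k + q)) -
  (vol * (b * (if k == 0 then sphere_hat q else 0)) + ((2 * pi / t) `^ a)%:C *
   \sum_(s : bool) vol * (b * (if k == 0 then 0 else wave (zvec k) q t s / (enorm (zvec k) `^ a)%:C))) =
  vol * (b * (if k == 0 then 0 else sphere_hat (t *: zvec k + q) -
    ((2 * pi / t) `^ a)%:C * \sum_(s : bool) (wave (zvec k) q t s / (enorm (zvec k) `^ a)%:C))).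
  rewrite !big_bool /=; case: eqP => [->|_]; last by ring.
  by rewrite zvec0 scaler0 add0r; ring.
rewrite normcM normc_real (ger0_norm vol_ge0) -[leRHS]mulrA -[leRHS]mulrA; apply: ler_wpM2l => //.
clearbody b; rewrite !normcM normc_real [leRHS]mulrA [leRHS]mulrC -[leRHS]mulrA; apply: ler_wpM2l; first exact: normc_ge0.
have W0 : 0 < zweight l * zweight l' :> R by rewrite mulr_gt0 ?zweight_gt0.
rewrite ger0_norm ?exprn_ge0 ?(ltW W0)//.
case: eqP => [_|/eqP k0]; first by rewrite normc0 !mulr_ge0 ?exprn_ge0 ?(ltW W0) ?(ltW C0).
apply: le_trans (hC (zvec k) q t t1 (enorm_zvec_ge1 k0)) _.
rewrite [leRHS]mulrA; apply: ler_wpM2r => //; rewrite [leRHS]mulrC -mulrA ler_pM2l// -exprMn.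
apply: lerXn2r; rewrite ?nnegrE ?addr_ge0 ?enorm_ge0 ?mulr_ge0 ?(ltW (zweight_gt0 _))//.
have h1 := @enorm_zvec_le R d l; have h2 := @enorm_zvec_le R d l'.
have h3 : enorm q <= enorm (zvec l : E) + enorm (zvec l' : E) by rewrite /q zvecD; exact: enormD.
have := @zweight_ge1 R d l; have := @zweight_ge1 R d l'; nra.
Qed.

End asymptotics.

(** * Absolutely convergent Fourier series on the torus *)

Section torus_series.
Context {R : realType} {e : nat}.
Local Notation d := e.+1.
Local Notation E := 'rV[R]_d.
Local Notation Z := 'rV[int]_d.
Implicit Types (u : E -> R[i]) (b : Z -> R[i]) (f g : E -> E -> R[i]) (c : Z * Z -> R[i]).
Let a : R := e%:R / 2.
Let vol : R[i] := ((2 * pi) ^+ d)%:C.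

Let vol_neq0 : (2 * pi) ^+ d != 0 :> R.
Proof. by rewrite expf_neq0// mulf_neq0// lt0r_neq0// pi_gt0. Qed.

Lemma hsum_single (I : choiceType) (i0 : I) (z : R[i]) : hsum (fun i => if i == i0 then z else 0) z.
Proof.
move=> eps eps0; exists [fset i0]%fset => F /(big_fset_split (fun i => if i == i0 then z else 0)) ->.
rewrite big_seq_fset1 eqxx big_seq big1 ?addr0 ?subrr ?normc0 ?ltW// => i.
by rewrite !inE => /andP[/negbTE ->].
Qed.

Definition trep u b := forall x, hsum (fun k => b k * expi (dotR (zvec k) x)) (u x).

Lemma asum_expi b B x : asum b B -> asum (fun k => b k * expi (dotR (zvec k) (x : E))) B.
Proof. by apply: asum_le1 => k; rewrite normcM normc_expi mulr1. Qed.

Lemma cbounded_trep D u b B : trep u b -> asum b B -> cbounded D u B.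
Proof. by move=> ub bB; apply: (cbounded_hsum bB (fun k => cbounded_expi_rV D (zvec k))) => x _; exact: ub. Qed.

Lemma trep_conj u b : trep u b -> trep (fun x => (u x)^*) (fun k => (b (- k))^*).
Proof.
move=> ub x; have h := hsum_conj (ub x).
apply: (hsum_bij (f := fun k : Z => - k) (g := fun k => - k)); [exact: opprK|exact: opprK|].
by apply: eq_hsum h => k; rewrite opprK zvecN dotRNl -conj_expi -rmorphM.
Qed.

Lemma asum_conj b B : asum b B -> asum (fun k => (b (- k))^*) B.
Proof.
by apply: (asum_inj (f := fun k : Z => - k)) => [k l /oppr_inj//|k]; rewrite normc_conj.
Qed.

Lemma torus_int_mul u (v : E -> R[i]) b b' B B' : trep u b -> trep v b' -> asum b B -> asum b' B' ->
  hsum (fun k => vol * (b k * b' (- k))) (torus_int (fun x => u x * v x)).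
Proof.
move=> ub vb bB vB.
have pB := asum_prod bB vB.
have H := @cintegral_hsum _ _ R (lebesgue_rV d) torus_cube (@measurable_torus_cube R d) (@torus_cube_lty R d)
  _ _ (fun p x => expi (dotR (zvec (p.1 + p.2)) x)) (fun x => u x * v x) _ pB
  (fun p => cbounded_expi_rV torus_cube _).
have {}H : hsum (fun p => b p.1 * b' p.2 * (if p.1 + p.2 == 0 then vol else 0))
    (torus_int (fun x => u x * v x)).
  apply: eq_hsum (H _) => [p|x _]; first by rewrite -torus_int_expi.
  apply: eq_hsum (hsum_prod (asum_expi x bB) (asum_expi x vB) (ub x) (vb x)) => p.
  by rewrite zvecD dotRDl expiD mulrACA.
have := @hsum_sub R _ _ (fun k : Z => (k, - k)) (fun p : Z * Z => if p.1 + p.2 == 0 then Some p.1 else None)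
  _ (((2 * pi) ^+ d) * (B * B')) _ _ _ _ _ H => h.
apply: eq_hsum (h _ _ _ _) => [k|k|[k l]|[k l]|].
- by rewrite /= subrr eqxx; ring.
- by rewrite /= subrr eqxx.
- by rewrite /=; case: eqP => //= /eqP; rewrite addr_eq0 => /eqP ->; rewrite opprK.
- by rewrite /=; case: eqP => // _ _; rewrite mulr0.
have p0 : 0 <= ((2 * pi) ^+ d : R) by rewrite exprn_ge0// mulr_ge0// pi_ge0.
apply: asum_le pB => // p; rewrite normcM mulrC; apply: ler_wpM2r; first exact: normc_ge0.
by case: ifP => _; rewrite ?normc0// normc_real ger0_norm.
Qed.

(** Parseval in the bilinear form [torus_int_mul], applied to [u] and to a single character. *)
Lemma fourier_trep u b B k : trep u b -> asum b B -> fourier u k = b k.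
Proof.
move=> ub bB; pose b' (j : Z) : R[i] := if j == - k then 1 else 0.
have eb : trep (fun x => expi (- dotR (zvec k) x)) b'.
  move=> x; apply: eq_hsum (hsum_single (- k) (expi (- dotR (zvec k) x))) => j.
  by rewrite /b'; case: eqP => [->|_]; rewrite ?mul0r// mul1r zvecN dotRNl.
have b'1 : asum b' 1.
  move=> F; apply: (@le_trans _ _ (\sum_(i <- ([fset - k] `|` F)%fset) normc (b' i))).
    by apply: le_big_fset; [move=> i; exact: normc_ge0|exact: fsubsetUr].
  rewrite (big_fset_split _ (fsubsetUl [fset - k]%fset F)) big_seq_fset1 big_seq big1 => [|i].
    by rewrite addr0 /b' eqxx normc1.
  by rewrite !inE /b' => /andP[/negbTE ->]; rewrite normc0.
have := torus_int_mul ub eb bB b'1 => /hsum_uniq h.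
rewrite /fourier /torus_mean (h (vol * b k)).
  by rewrite mulrA /vol -rmorphM mulVf// mul1r.
apply: eq_hsum (hsum_single k (vol * b k)) => j.
by rewrite /b' eqr_opp; case: eqP => [->|_]; rewrite ?mulr1// !mulr0.
Qed.

Definition pi_coef s f (k : Z) : R[i] := if k == 0 then 0 else fourier (f ^~ (signed_direction s k : E)) k.

(** The point of evaluation moves with k, but characters have modulus 1: the fibre over k is
    dominated by the c (k, l), whatever the direction. *)
Lemma asum_pi_coef s f c N B : frep f c -> decays N c B ->
  asum (fun k => pi_coef s f k * (zweight k ^+ N)%:C) B.
Proof.
move=> fc cN; have cB := decays0 (le_decays (leq0n _) cN).
apply: (@fiber_sum_asum R _ _ (fun p : Z * Z => p.1) (fun k p => if k == 0 then 0 else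
  c p * expi (dotR (zvec p.2) (signed_direction s k)) * (zweight k ^+ N)%:C * (k == p.1)%:R) _ _ _ _ _ cN).
  move=> k p; case: eqP => _; first by rewrite normc0 normc_ge0.
  case: eqP => [->|_]; last by rewrite mulr0 normc0 normc_ge0.
  rewrite mulr1 !normcM normc_expi mulr1; apply: ler_wpM2l; first exact: normc_ge0.
  rewrite !normc_real !ger0_norm ?exprn_ge0 ?mulr_ge0 ?(ltW (zweight_gt0 _))//.
  by apply: lerXn2r; rewrite ?nnegrE ?mulr_ge0 ?(ltW (zweight_gt0 _))// ler_peMr ?zweight_ge1// ltW// zweight_gt0.
move=> k; rewrite /pi_coef; case: eqP => [->|/eqP k0].
  by rewrite mul0r; apply: eq_hsum (@hsum0 R _) => p; case: eqP.
have sv := @signed_direction_sphere R d s k k0.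
have H := hsumZ (zweight k ^+ N)%:C (fourier_rep k fc cB sv); rewrite [X in hsum _ X]mulrC.
apply: (@hsum_inj R _ _ (fun l : Z => (k, l)) (fun p => if p.1 == k then Some p.2 else None) _ _ _ _ _ _ _ H).
- by move=> l /=; rewrite eqxx.
- by move=> [k' l] /=; case: eqP => //= ->.
- by move=> l; rewrite /= eqxx mulr1 mulrC.
- by move=> [k' l] /=; case: eqP.
Qed.

Lemma asum_pi_coef0 s f c B : frep f c -> asum c B -> asum (pi_coef s f) B.
Proof.
move=> fc cB; have c0 : decays 0 c B by apply: eq_asum cB => p; rewrite expr0 mulr1.
by apply: eq_asum (asum_pi_coef s fc c0) => k; rewrite expr0 mulr1.
Qed.

Lemma trep_Pi0 s f c B : frep f c -> asum c B -> trep (Pi0 s f) (pi_coef s f).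
Proof.
move=> fc cB x; rewrite /Pi0 csum_mkcond.
set F := (X in csum setT X).
have -> : F = (fun k => pi_coef s f k * expi (dotR (zvec k) x)).
  apply/funext => k; rewrite /F /pi_coef; case: eqP => [->|/eqP k0].
    by rewrite memNset ?mul0r// /Zd_nonzero /= eqxx.
  by rewrite mem_set.
by apply: asum_hsum; apply: asum_expi; exact: asum_pi_coef0 fc cB.
Qed.

Lemma trep_fourier_mult (m : R -> R[i]) u b B : trep u b -> asum b B -> b 0 = 0 ->
  (forall k : Z, k != 0 -> normc (m (enorm (zvec k : E))) <= 1) ->
  trep (fourier_mult m u) (fun k => m (enorm (zvec k : E)) * b k) /\
  asum (fun k => m (enorm (zvec k : E)) * b k) B.
Proof.
move=> ub bB b0 m1.
have mB : asum (fun k => m (enorm (zvec k : E)) * b k) B.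
  apply: asum_le1 bB => k; rewrite normcM; have [->|k0] := eqVneq k 0.
    by rewrite b0 normc0 mulr0.
  by rewrite ler_piMl ?normc_ge0// m1.
split=> // x; rewrite /fourier_mult.
have -> : (fun k => m (enorm (zvec k : E)) * fourier u k * expi (dotR (zvec k) x)) =
  (fun k => m (enorm (zvec k : E)) * b k * expi (dotR (zvec k) x)).
  by apply/funext => k; rewrite (fourier_trep k ub bB).
by apply: asum_hsum; exact: asum_expi.
Qed.

Lemma cbounded_fiber f c B (v : E) : frep f c -> asum c B -> sphere v -> cbounded torus_cube (f ^~ v) B.
Proof.
move=> fc cB sv; apply: (cbounded_hsum (a := fun p => c p * expi (dotR (zvec p.2) v))
  (f := fun p x => expi (dotR (zvec p.1) x))).
- by apply: asum_le1 cB => p; rewrite normcM normc_expi mulr1.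
- by move=> p; exact: cbounded_expi_rV.
- by move=> x _; apply: eq_hsum (fc x v sv) => p; rewrite -mulrA [_ * expi _]mulrC.
Qed.

Lemma fourier_conj f c B (v : E) k : frep f c -> asum c B -> sphere v ->
  fourier (fun x => (f x v)^*) k = (fourier (f ^~ v) (- k))^*.
Proof.
move=> fc cB sv; rewrite /fourier /torus_mean rmorphM.
rewrite [X in _ = X * _](_ : _ = ((2 * pi) ^- d)%:C); last by rewrite /= oppr0.
congr (_ * _).
have fb := cbounded_fiber fc cB sv.
have eb : cbounded torus_cube (fun x : E => expi (- dotR (zvec (- k)) x)) 1.
  apply: eq_cbounded (cbounded_expi_rV torus_cube (zvec k)) => x _.
  by rewrite zvecN dotRNl opprK.
apply: etrans (cintegral_conj (@measurable_torus_cube R d) (@torus_cube_lty R d) (cboundedM fb eb)).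
by congr cintegral; apply/funext => x; rewrite zvecN dotRNl opprK -conj_expi -rmorphM.
Qed.

Lemma P0_fourier f : P0 f = fun v => fourier (f ^~ v) 0.
Proof.
apply/funext => v; rewrite /P0 /fourier; congr (_ * cintegral _ _ _).
by apply/funext => x; rewrite zvec0 dot0R oppr0 expi0 mulr1.
Qed.

Lemma mode_multiplier (s : bool) (t : R) (k : Z) : k != 0 ->
  normc (expi (pm s * (t * enorm (zvec k : E))) / (enorm (zvec k : E) `^ a)%:C) <= 1.
Proof.
by move=> /(@normc_factor R e s t k); rewrite /mode_factor normcM normc_expi mul1r.
Qed.

(** Parseval for the two series on the torus; conjugating [g] moves its coefficient from k to - k,
    where [mode] looks for it. *)
Lemma mode_torus_inner f g c c' B B' s t : frep f c -> frep g c' -> asum c B -> asum c' B' ->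
  hsum (mode f (fun x v => (g x v)^*) s t)
    (expi (- (pm s * (pi / 4) * e%:R)) *
     torus_inner (fourier_mult (fun r => expi (pm s * (t * r)) / (r `^ a)%:C) (Pi0 s f)) (Pi0 s g)).
Proof.
move=> fc gc cB cB'.
have p0 : pi_coef s f 0 = 0 by rewrite /pi_coef eqxx.
have [tf af] := @trep_fourier_mult (fun r => expi (pm s * (t * r)) / (r `^ a)%:C) _ _ _ (trep_Pi0 s fc cB) (asum_pi_coef0 s fc cB) p0 (mode_multiplier s t).
have H := hsumZ (expi (- (pm s * (pi / 4) * e%:R))) (torus_int_mul tf
  (trep_conj (trep_Pi0 s gc cB')) af (asum_conj (asum_pi_coef0 s gc cB'))).
apply: eq_hsum H => k; rewrite /mode /pi_coef opprK; case: eqP => [->|/eqP k0].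
  by rewrite mulr0 mul0r !mulr0.
rewrite (fourier_conj _ gc cB' (signed_direction_sphere s k0)) opprK /mode_factor -/vol.
by move: (expi _) (expi _ / _) (fourier _ _) ((fourier _ _)^*) => x y z w; ring.
Qed.

Lemma mean_sphere_inner f g c c' B B' : frep f c -> frep g c' -> asum c B -> asum c' B' ->
  storus_int (fun x v => fourier (f ^~ v) 0 * (g x v)^*) = vol * sphere_inner (P0 f) (P0 g).
Proof.
move=> fc gc cB cB'.
rewrite (mean_sphere_int fc (frep_conj gc) cB (decays0 (decays_conj (eq_asum _ cB')))).
  congr (_ * _); rewrite /sphere_inner !P0_fourier; apply: eq_cintegral => v /set_mem sv.
  by rewrite (fourier_conj _ gc cB' sv) oppr0.
by move=> p; rewrite expr0 mulr1.
Qed.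

Lemma bigO_pinftyP (F : R -> R[i]) (h : R -> R) (C : R) : 0 < C ->
  (forall t, 1 <= t -> normc (F t) <= C * h t) -> bigO_pinfty F h.
Proof.
move=> C0 H; exists C => //; near=> t.
rewrite normc_norm lecR; apply: le_trans (H t _) _.
  by near: t; apply: nbhs_pinfty_ge; exact: num_real.
by rewrite ler_wpM2l ?ler_norm// ltW.
Unshelve. all: by end_near. Qed.

Theorem correlation_bigO f g : (0 < e)%N -> smooth_storus f -> smooth_storus g ->
  bigO_pinfty (fun t => correlation f g t -
    (vol * sphere_inner (P0 f) (P0 g) + ((2 * pi / t) `^ a)%:C *
     \sum_(s : bool) expi (- (pm s * (pi / 4) * e%:R)) *
       torus_inner (fourier_mult (fun r => expi (pm s * (t * r)) / (r `^ a)%:C) (Pi0 s f)) (Pi0 s g)))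
    (fun t => t `^ (- (a + 1))).
Proof.
move=> e0 /(storus_rep e.+1)[c [B [cB fc]]] /(storus_rep e.+1)[c' [B' [cB' gc]]].
have cB0 := decays0 (le_decays (leq0n _) cB); have cB0' := decays0 (le_decays (leq0n _) cB').
have [C C0 h] := correlation_asymp e0 fc (frep_conj gc) cB (decays_conj cB').
apply: (bigO_pinftyP C0) => t t1.
by have := h t _ t1 (fun s => mode_torus_inner s t fc gc cB0 cB0'); rewrite (mean_sphere_inner fc gc cB0 cB0').
Qed.

End torus_series.

(** * The operators P and their adjoints *)

Section quadratic_remainders.
Context {R : realType}.

Lemma expi_remainder (y : R) : normc (expi y - 1 - (0 +i* y)) <= 2 * y ^+ 2.
Proof.
apply: le_trans (normc_le_ReIm _) _; rewrite /expi; simpc => /=.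
have hc : `|cos y - 1| <= y ^+ 2 / 2.
  by rewrite distrC ger0_norm ?subr_ge0 ?cos_le1//; have := cos_ge_quad y; lra.
suff hs : `|sin y - y| <= y ^+ 2 by have := sqr_ge0 y; lra.
wlog y0 : y {hc} / 0 <= y.
  move=> H; have /orP[/H//|y0] := le_total 0 y.
  have := H (- y); rewrite sinN sqrrN oppr_ge0 => /(_ y0); rewrite -normrN.
  by congr (`|_| <= _); ring.
have h1 := sin_ge_cubic y0.
have h2 : sin y <= y by have := sin_lip y 0; rewrite sin0 !subr0 (ger0_norm y0) ler_norml => /andP[].
rewrite distrC ger0_norm ?subr_ge0//.
(* For y <= 6 the cubic bound gives y - sin y <= y^3 / 6 <= y^2; beyond, y + 1 <= y^2. *)
have [y6|y6] := leP y 6; first by nra.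
by have := sin_geN1 y; nra.
Qed.

(** A quadratic remainder is what termwise differentiation of a Fourier series provides: |e^(iy) - 1
    - iy| <= 2 y^2 costs two powers of the frequency. *)
Lemma is_derive_quadratic (V : normedModType R) (f : V -> R) (x v : V) (L K : R) :
  (forall t : R, `|f (t *: v + x) - f x - t * L| <= K * t ^+ 2) -> is_derive x v f L.
Proof.
move=> h; have K0 : 0 <= K by have := le_trans (normr_ge0 _) (h 1); rewrite expr1n mulr1.
have cv : (fun t : R => t^-1 *: ((f \o shift x) (t *: v) - f x)) @ 0^' --> L.
  apply/cvgrPdist_le => eps eps0; near=> t.
  have t0 : t != 0 by near: t; exact: nbhs_dnbhs_neq.
  have -> : L - t^-1 *: ((f \o shift x) (t *: v) - f x) =
      - (t^-1 * (f (t *: v + x) - f x - t * L)).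
    by rewrite /= /shift /= -[t^-1 *: _]/(t^-1 * _); field.
  rewrite normrN normrM; apply: le_trans (ler_wpM2l (normr_ge0 _) (h t)) _.
  rewrite -[t ^+ 2]real_normK ?num_real// normrV ?unitfE// expr2 mulrCA mulKf ?normr_eq0//.
  have te : `|t| <= eps / (K + 1).
    near: t; apply: dnbhs0_le; apply: divr_gt0 => //; exact: ltr_wpDl.
  apply: le_trans (ler_wpM2l K0 te) _; rewrite mulrCA ger_pMr// ler_pdivrMr ?mul1r ?lerDl//.
  exact: ltr_wpDl.
exact: (DeriveDef (cvgP _ cv) (cvg_lim (@Rhausdorff R) cv)).
Unshelve. all: by end_near. Qed.

End quadratic_remainders.

(** * Smoothness of rapidly decreasing series *)

Section rapid_series.
Context {R : realType} {e : nat}.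
Local Notation d := e.+1.
Local Notation E := 'rV[R]_d.
Local Notation Z := 'rV[int]_d.
Implicit Types (u : E -> R[i]) (b : Z -> R[i]).

Definition rapid b := forall N, exists B : R, asum (fun k => b k * (zweight k ^+ N)%:C) B.

Lemma rapid_asum b : rapid b -> exists B, asum b B.
Proof. by move=> /(_ 0%N)[B bB]; exists B; apply: eq_asum bB => k; rewrite expr0 mulr1. Qed.

Definition vsize v : R := d%:R * \sum_i `|(v : E) 0 i|.

Let vsize_ge0 v : 0 <= vsize v.
Proof. by rewrite mulr_ge0// sumr_ge0. Qed.

Let dotR_zvec_vsize (k : Z) v : `|dotR (zvec k) v| <= zweight k * vsize v.
Proof.
apply: le_trans (dotR_zvec_le (h := \sum_i `|v 0 i|) k _) _.
  by move=> i; rewrite (bigD1 i)//= lerDl sumr_ge0.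
by rewrite /vsize mulrCA.
Qed.

Definition dcoef_dir (v : E) b : Z -> R[i] := fun k => b k * (0 +i* dotR (zvec k) v).

Lemma normc_imag (y : R) : normc (0 +i* y) = `|y|.
Proof. by rewrite /= expr0n/= add0r sqrtr_sqr. Qed.

Lemma rapid_dir v b : rapid b -> rapid (dcoef_dir v b).
Proof.
move=> rb N; have [B bB] := rb N.+1; exists (vsize v * B).
apply: asum_le bB => // k; rewrite /dcoef_dir !normcM normc_imag !normc_real mulrCA -[leLHS]mulrA.
apply: ler_wpM2l; first exact: normc_ge0.
have W0 := @zweight_gt0 R _ k; have := dotR_zvec_vsize k v; move: (vsize v) => sz h.
rewrite !normrX (ger0_norm (ltW W0)) exprS mulrA; apply: ler_wpM2r; first by rewrite exprn_ge0// ltW.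
by rewrite mulrC.
Qed.

Lemma rapid_trep b : rapid b -> exists u, trep u b.
Proof.
move=> /rapid_asum[B bB]; exists (fun x => csum setT (fun k => b k * expi (dotR (zvec k) x))) => x.
by apply: asum_hsum; exact: asum_expi.
Qed.

Lemma is_derive_trep u u' b v (x : E) : rapid b -> trep u b -> trep u' (dcoef_dir v b) ->
  is_derive x v (fun x => complex.Re (u x)) (complex.Re (u' x)).
Proof.
move=> rb ub ub'; have [B bB] := rb 2.
apply: (is_derive_quadratic (K := 2 * vsize v ^+ 2 * B)) => t.
have -> : complex.Re (u (t *: v + x)) - complex.Re (u x) - t * complex.Re (u' x) =
    complex.Re (u (t *: v + x) - u x - t%:C * u' x).
  by case: (u _) (u x) (u' x) => ? ? [? ?] [? ?] /=; ring.
apply: le_trans (normc_Re _) _.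
have H := hsumB (hsumB (ub (t *: v + x)) (ub x)) (hsumZ t%:C (ub' x)).
rewrite -mulrA [B * _]mulrC mulrA; apply: (hsum_norm H); apply: asum_le bB => [|k].
  by apply: mulr_ge0; [apply: mulr_ge0|]; rewrite ?sqr_ge0.
have -> : b k * expi (dotR (zvec k) (t *: v + x)) - b k * expi (dotR (zvec k) x) -
    t%:C * (dcoef_dir v b k * expi (dotR (zvec k) x)) =
  b k * (expi (dotR (zvec k) x) * (expi (t * dotR (zvec k) v) - 1 - (0 +i* (t * dotR (zvec k) v)))).
  have -> : 0 +i* (t * dotR (zvec k) v) = t%:C * (0 +i* dotR (zvec k) v) by simpc.
  rewrite dotRDr dotRZr expiD /dcoef_dir; move: (expi _) (expi _) (0 +i* _) (b k) => *; ring.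
rewrite !normcM normc_expi mul1r normc_real mulrCA; apply: ler_wpM2l; first exact: normc_ge0.
apply: le_trans (expi_remainder _) _; have W0 := @zweight_gt0 R _ k.
rewrite ger0_norm ?exprn_ge0 ?(ltW W0)//.
have := dotR_zvec_vsize k v; have := vsize_ge0 v; move: (vsize v) => sz s0 h.
rewrite exprMn (_ : 2 * sz ^+ 2 * t ^+ 2 * _ = 2 * (t ^+ 2 * (zweight k * sz) ^+ 2)); last by ring.
rewrite ler_wpM2l// ler_wpM2l ?sqr_ge0// -real_normK ?num_real// lerXn2r ?nnegrE//.
by rewrite mulr_ge0// ltW.
Qed.

Lemma continuous_trep u b (x : E) : rapid b -> trep u b ->
  {for x, continuous (fun x => complex.Re (u x))}.
Proof.
move=> rb ub; have [B bB] := rb 1%N; have B0 := asum_ge0 bB.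
have d0 : (0 : R) < d%:R by rewrite ltr0n.
have lip y : `|complex.Re (u x) - complex.Re (u y)| <= 2 * d%:R * B * `|x - y|.
  have -> : complex.Re (u x) - complex.Re (u y) = complex.Re (u x - u y) by case: (u x) (u y) => ? ? [].
  apply: le_trans (normc_Re _) _.
  have H := hsumB (ub x) (ub y).
  rewrite -mulrA [B * _]mulrC mulrA; apply: (hsum_norm H); apply: asum_le bB => [|k].
    by rewrite !mulr_ge0.
  rewrite -mulrBr !normcM normc_real mulrCA; apply: ler_wpM2l; first exact: normc_ge0.
  apply: le_trans (expi_lip _ _) _; have W0 := @zweight_gt0 R _ k.
  rewrite -!mulrA ler_wpM2l// -dotRNr -dotRDr; apply: le_trans (dotR_zvec_le (h := `|x - y|) k _) _.
    by move=> i; rewrite [leRHS]/Num.norm /= mx_normrE; apply/bigmax_geP; right => /=; exists (0, i).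
  by rewrite expr1 (ger0_norm (ltW W0)) [zweight k * _]mulrC.
set K := 2 * d%:R * B in lip; have K0 : 0 <= K by rewrite !mulr_ge0.
have K1 : 0 < K + 1 by exact: ltr_wpDl.
apply/(@cvgrPdist_le _ R E (nbhs x)) => eps eps0; have e0 : 0 < eps / (K + 1) by exact: divr_gt0.
near=> y; apply: le_trans (lip y) _.
have te : `|x - y| <= eps / (K + 1) by near: y; apply: cvgr_dist_le => //; exact: cvg_id.
apply: le_trans (ler_wpM2l K0 te) _.
by rewrite mulrCA ger_pMr// ler_pdivrMr// mul1r lerDl.
Unshelve. all: by end_near. Qed.

(** A class of continuous functions stable under directional derivatives, so that smoothness of all
    orders is an induction on the list of directions. *)
Let real_class (h : E -> R) := exists u b, [/\ rapid b, trep u b & h = fun x => complex.Re (u x)].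

Let real_class_derive h v : real_class h -> (forall x : E, derivable h x v) /\ real_class ('D_v h).
Proof.
move=> [u [b [rb ub ->]]]; have [u' ub'] := rapid_trep (rapid_dir v rb).
have D x := @is_derive_trep u u' b v x rb ub ub'.
split=> [x|]; first by have [] := D x.
by exists u', (dcoef_dir v b); split=> //; [exact: rapid_dir|apply/funext => x; have [_] := D x].
Qed.

Let real_class_smooth h : real_class h -> smooth_on setT h.
Proof.
move=> hc w x _.
have {}hc : real_class (iter_derive w h).
  by elim: w => //= v w /(real_class_derive v)[].
split; last by move=> v; have [] := real_class_derive v hc.
by have [u [b [rb ub ->]]] := hc; exact: continuous_trep rb ub.
Qed.

Lemma smooth_trep u b : rapid b -> trep u b -> smooth_torus u.
Proof.
move=> rb ub; split.
  move=> k x; apply: (hsum_uniq (ub _)); apply: eq_hsum (ub x) => l.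
  by rewrite expi_zvec_periodic.
split; apply: real_class_smooth; first by exists u, b.
(* The imaginary part of u is the real part of - i u. *)
exists (fun x => - 'i * u x), (fun k => - 'i * b k); split.
- move=> N; have [B bB] := rb N; exists B; apply: asum_le1 bB => k.
  by rewrite !normcM normcN (normc_imag 1) normr1 mul1r.
- by move=> x; apply: eq_hsum (hsumZ (- 'i) (ub x)) => k; rewrite mulrA.
- by apply/funext => x; case: (u x) => p q; simpc.
Qed.

End rapid_series.

(** * The operators P *)

Section Pop_operators.
Context {R : realType} {e : nat}.
Local Notation d := e.+1.
Local Notation E := 'rV[R]_d.
Local Notation Z := 'rV[int]_d.
Implicit Types (f : E -> E -> R[i]) (c : Z * Z -> R[i]).

Lemma signed_directionN s (k : Z) : signed_direction s (- k) = signed_direction (~~ s) k :> E.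
Proof.
rewrite /signed_direction zvecN directionN scalerN -scaleNr; congr (_ *: _).
by case: s; rewrite /pm ?opprK.
Qed.

Lemma torus_mean_shift (u : E -> R[i]) A k x : cbounded torus_cube u A ->
  torus_mean (fun y => u y * expi (dotR (y - x) (zvec k))) =
  fourier u (- k) * expi (dotR (zvec (- k)) x).
Proof.
move=> uA; rewrite /fourier /torus_mean -mulrA [torus_int _ * _]mulrC; congr (_ * _).
have ub : cbounded torus_cube (fun y => u y * expi (- dotR (zvec (- k)) y)) (A * 1).
  apply: cboundedM uA _; apply: eq_cbounded (cbounded_expi_rV torus_cube (zvec k)) => y _.
  by rewrite zvecN dotRNl opprK.
rewrite /torus_int -(cintegralZ (@measurable_torus_cube R d) (@torus_cube_lty R d) _ ub).
congr cintegral; apply/funext => y.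
rewrite dotRC dotRDr dotRNr zvecN !dotRNl opprK expiD.
by move: (expi _) (expi _) (u y) => *; ring.
Qed.

(** The kernel e^(i (y - x) . k) extracts the mode - k, and the direction of k with sign [s] is that
    of - k with the opposite sign; hence the [~~ s]. *)
Lemma Pop_termE s f c B x k : frep f c -> asum c B ->
  (if k \in Zd_nonzero then Pop_term s f x k else 0) =
  pi_coef (~~ s) f (- k) * expi (dotR (zvec (- k)) x).
Proof.
move=> fc cB; rewrite /pi_coef oppr_eq0; case: eqP => [->|/eqP k0].
  by rewrite memNset ?mul0r// /Zd_nonzero /= eqxx.
rewrite mem_set// signed_directionN negbK /Pop_term.
exact: torus_mean_shift (cbounded_fiber fc cB (signed_direction_sphere s k0)).
Qed.

Lemma asum_Pop s f c B x : frep f c -> asum c B ->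
  asum (fun k => if k \in Zd_nonzero then Pop_term s f x k else 0) B.
Proof.
move=> fc cB; apply: (asum_inj (f := fun k : Z => - k)) (asum_pi_coef0 (~~ s) fc cB).
  by move=> k l /oppr_inj.
by move=> k; rewrite (Pop_termE _ _ _ fc cB) normcM normc_expi mulr1.
Qed.

Lemma trep_Pop s f c B : frep f c -> asum c B -> trep (Pop s f) (pi_coef (~~ s) f).
Proof.
move=> fc cB x; rewrite /Pop csum_mkcond.
apply: (hsum_bij (f := fun k : Z => - k) (g := fun k => - k)); [exact: opprK|exact: opprK|].
apply: eq_hsum (asum_hsum (asum_Pop s x fc cB)) => k.
by rewrite (Pop_termE _ _ _ fc cB).
Qed.

(** The double series changes with the order [N], but [pi_coef] is intrinsic to [f], so the bounds
    of all orders apply to the same family. *)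
Lemma rapid_pi_coef s f : smooth_storus f -> rapid (pi_coef s f).
Proof.
by move=> sf N; have [c [B [cB fc]]] := storus_rep N sf; exists B; exact: asum_pi_coef fc cB.
Qed.

Theorem Pop_smooth s f : smooth_storus f ->
  (forall x, abs_summable Zd_nonzero (Pop_term s f x)) /\ smooth_torus (Pop s f).
Proof.
move=> sf; have [c [B [cB fc]]] := storus_rep 0 sf; have cB0 := decays0 cB.
split=> [x|]; first exact: asum_abs_summable (asum_Pop s x fc cB0).
exact: smooth_trep (rapid_pi_coef _ sf) (trep_Pop s fc cB0).
Qed.

End Pop_operators.

(** * Distributions of order 0 *)

Section distributions.
Context {R : realType} {e : nat}.
Local Notation d := e.+1.
Local Notation E := 'rV[R]_d.
Local Notation Z := 'rV[int]_d.
Local Notation distr := ((E -> E -> R[i]) -> R[i]).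
Implicit Types (u : E -> R[i]) (b : Z -> R[i]) (f phi psi : E -> E -> R[i]) (c : Z * Z -> R[i]) (T : distr).
Let vol : R[i] := ((2 * pi) ^+ d)%:C.

Let vol_gt0 : 0 < (2 * pi) ^+ d :> R.
Proof. by rewrite exprn_gt0// mulr_gt0// pi_gt0. Qed.

Let storus := @torus_cube R d `*` @sphere R d.

Lemma ex_sphere : exists v : E, sphere v.
Proof.
have [w w1 _] := unit_direction (0 : E).
by exists w; rewrite /sphere /= /enorm w1 sqrtr1.
Qed.

(** Continuity for the supremum norm on the sphere bundle, a notion stable under sums and multiples;
    it implies [is_distribution] with N = 0, where only the empty list of directions is
    consulted. *)
Definition order0 T : Prop :=
  (forall z phi psi, smooth_storus phi -> smooth_storus psi ->
     T (fun x v => z * phi x v + psi x v) = z * T phi + T psi) /\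
  exists2 K : R, 0 <= K & forall phi, smooth_storus phi -> forall M : R,
    (forall x v, sphere v -> normc (phi x v) <= M) -> normc (T phi) <= K * M.

Lemma order0_distribution T : order0 T -> is_distribution T.
Proof.
move=> [lin [K K0 hK]]; split=> //; exists 0%N, (K * 2) => phi sphi M hM.
rewrite normc_norm lecR -mulrA; apply: hK => // x v sv.
have [] // := hM [::] x v; rewrite /= /pull_back /= direction_id// => hr hi.
by apply: le_trans (normc_le_ReIm _) _; lra.
Qed.

Lemma order0D T U : order0 T -> order0 U -> order0 (fun phi => T phi + U phi).
Proof.
move=> [l1 [K1 K10 h1]] [l2 [K2 K20 h2]]; split.
  by move=> z phi psi sf sg; rewrite l1// l2//; ring.
exists (K1 + K2); first exact: addr_ge0.
move=> phi sphi M hM; apply: le_trans (le_normcD _ _) _; rewrite mulrDl.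
by apply: lerD; [exact: h1|exact: h2].
Qed.

Lemma order0Z z T : order0 T -> order0 (fun phi => z * T phi).
Proof.
move=> [l1 [K1 K10 h1]]; split.
  by move=> z' phi psi sf sg; rewrite l1//; ring.
exists (normc z * K1); first by rewrite mulr_ge0// normc_ge0.
by move=> phi sphi M hM; rewrite normcM -mulrA ler_wpM2l ?normc_ge0//; exact: h1.
Qed.

Lemma bound_ge0 phi (M : R) : (forall x v, sphere v -> normc (phi x v) <= M) -> 0 <= M.
Proof. by have [v sv] := ex_sphere => /(_ 0 v sv); apply: le_trans; exact: normc_ge0. Qed.

Lemma cbounded_shift f c B (t : R) : frep f c -> asum c B ->
  cbounded storus (fun z : E * E => f (z.1 + t *: z.2) z.2) B.
Proof.
move=> fc cB; apply: (cbounded_hsum cB (fun p => cbounded_storus (zvec p.1) (t *: zvec p.1 + zvec p.2))).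
move=> [x v] [_ sv]; apply: eq_hsum (fc _ v sv) => p; congr (_ * _); rewrite -!expiD; congr expi.
by rewrite !dotRDl !dotRDr dotRZl dotRZr; ring.
Qed.

Lemma cbounded_sup phi c B M : frep phi c -> asum c B ->
  (forall x v, sphere v -> normc (phi x v) <= M) -> cbounded storus (fun z : E * E => phi z.1 z.2) M.
Proof.
move=> fc cB hM; have [m1 m2 _] : cbounded storus (fun z : E * E => phi z.1 z.2) B.
  by apply: eq_cbounded (cbounded_shift 0 fc cB) => z _; rewrite scale0r addr0.
by split=> // -[x v] [_ sv]; exact: hM.
Qed.

Lemma order0_function f A : 0 <= A -> cbounded storus (fun z : E * E => f z.1 z.2) A ->
  order0 (function_distr f).
Proof.
move=> A0 fA; have mS := @measurable_storus R e; have lS := @storus_lty R e.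
have cb phi : smooth_storus phi -> exists B, cbounded storus (fun z : E * E => phi z.1 z.2) B.
  move=> /(storus_rep 0)[c [B [/decays0 cB fc]]]; exists B.
  by apply: eq_cbounded (cbounded_shift 0 fc cB) => z _; rewrite scale0r addr0.
split=> [z phi psi /cb[B hB] /cb[B' hB']|].
  rewrite /function_distr /storus_int.
  rewrite -(cintegralZ mS lS z (cboundedM fA hB)).
  rewrite -(cintegralD mS lS (cboundedZ z (cboundedM fA hB)) (cboundedM fA hB')).
  by congr cintegral; apply/funext => p; ring.
exists (2 * fine ((lebesgue_rV d \x sphere_vol)%E storus) * A).
  by rewrite !mulr_ge0// fine_ge0.
move=> phi /(storus_rep 0)[c [B [/decays0 cB fc]]] M hM.
rewrite -[leRHS]mulrA.
exact: (normc_cintegral mS lS (mulr_ge0 A0 (bound_ge0 hM)) (cboundedM fA (cbounded_sup fc cB hM))).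
Qed.

Lemma fourierD u (w : E -> R[i]) A B z k : cbounded torus_cube u A -> cbounded torus_cube w B ->
  fourier (fun x => z * u x + w x) k = z * fourier u k + fourier w k.
Proof.
move=> uA wB; have mC := @measurable_torus_cube R d; have lC := @torus_cube_lty R d.
have eb : cbounded torus_cube (fun x : E => expi (- dotR (zvec k) x)) 1.
  by apply: eq_cbounded (cbounded_expi_rV torus_cube (- zvec k)) => x _; rewrite dotRNl.
rewrite /fourier /torus_mean mulrCA -mulrDr; congr (_ * _); rewrite /torus_int.
rewrite -(cintegralZ mC lC z (cboundedM uA eb)).
rewrite -(cintegralD mC lC (cboundedZ z (cboundedM uA eb)) (cboundedM wB eb)).
by congr cintegral; apply/funext => x; rewrite mulrDl mulrA.
Qed.

Lemma pi_coefD s phi psi c c' B B' z k : frep phi c -> asum c B -> frep psi c' -> asum c' B' ->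
  pi_coef s (fun x v => z * phi x v + psi x v) k = z * pi_coef s phi k + pi_coef s psi k.
Proof.
move=> fc cB gc cB'; rewrite /pi_coef; case: eqP => [_|/eqP k0]; first by rewrite mulr0 addr0.
have sv := @signed_direction_sphere R d s k k0.
exact: (fourierD _ _ (cbounded_fiber fc cB sv) (cbounded_fiber gc cB' sv)).
Qed.

Lemma frepD phi psi c c' z : frep phi c -> frep psi c' ->
  frep (fun x v => z * phi x v + psi x v) (fun p => z * c p + c' p).
Proof.
move=> fc gc x v sv; apply: eq_hsum (hsumD (hsumZ z (fc x v sv)) (gc x v sv)) => p.
by rewrite mulrDl mulrA.
Qed.

Lemma normc_torus_int u A : 0 <= A -> cbounded torus_cube u A ->
  normc (torus_int u) <= 2 * (2 * pi) ^+ d * A.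
Proof.
move=> A0 uA; have -> : (2 * pi) ^+ d = fine (lebesgue_rV d (@torus_cube R d)) by rewrite torus_cube_vol.
have h := normc_cintegral (@measurable_torus_cube R d) (@torus_cube_lty R d) A0 uA.
by apply: le_trans h _; rewrite lexx.
Qed.

Lemma normc_pi_coef s phi c B M k : frep phi c -> asum c B ->
  (forall x v, sphere v -> normc (phi x v) <= M) -> normc (pi_coef s phi k) <= 2 * M.
Proof.
move=> fc cB hM; have M0 := bound_ge0 hM; rewrite /pi_coef; case: eqP => [_|/eqP k0].
  by rewrite normc0 mulr_ge0.
have sv := @signed_direction_sphere R d s k k0.
have [m1 m2 _] := cbounded_fiber fc cB sv.
have fM : cbounded torus_cube (phi ^~ (signed_direction s k : E)) M by split=> // x _; exact: hM.
have eb : cbounded torus_cube (fun x : E => expi (- dotR (zvec k) x)) 1.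
  by apply: eq_cbounded (cbounded_expi_rV torus_cube (- zvec k)) => x _; rewrite dotRNl.
have := normc_torus_int (mulr_ge0 M0 ler01) (cboundedM fM eb); rewrite mulr1 => h.
rewrite /fourier /torus_mean normcM normc_real ger0_norm ?invr_ge0 ?(ltW vol_gt0)//.
apply: le_trans (ler_wpM2l _ h) _; first by rewrite invr_ge0 ltW.
by rewrite mulrA mulrCA mulVf ?mulr1// lt0r_neq0.
Qed.

Section Pop_dag_series.
Variables (u : E -> R[i]) (b : Z -> R[i]) (B : R).
Hypotheses (ub : trep u b) (bB : asum b B).

Lemma Pop_dag_termE s phi c A k : frep phi c -> asum c A ->
  (if k \in Zd_nonzero then Pop_dag_term s u k phi else 0) =
  vol * (b (- k) * pi_coef s phi k).
Proof.
move=> fc cA; rewrite /pi_coef; case: eqP => [->|/eqP k0].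
  by rewrite memNset ?mulr0// /Zd_nonzero /= eqxx.
rewrite mem_set// /Pop_dag_term /tensor_dirac.
have sv := @signed_direction_sphere R d s k k0.
have eb : cbounded torus_cube (fun x : E => expi (- dotR (zvec k) x)) 1.
  by apply: eq_cbounded (cbounded_expi_rV torus_cube (- zvec k)) => x _; rewrite dotRNl.
have fb := cboundedM (cbounded_fiber fc cA sv) eb.
rewrite /fourier /torus_mean mulrCA [vol * (_ * _)]mulrA -rmorphM mulfV ?(lt0r_neq0 vol_gt0)// mul1r.
rewrite /torus_int -(cintegralZ (@measurable_torus_cube R d) (@torus_cube_lty R d) _ fb).
congr cintegral; apply/funext => x.
rewrite -/(torus_int _) -/(torus_mean _) (torus_mean_shift _ _ (cbounded_trep torus_cube ub bB)).
rewrite (fourier_trep _ ub bB) zvecN dotRNl; move: (expi _) (b _) (phi _ _) => *; ring.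
Qed.

Lemma asum_Pop_dag s phi c A : frep phi c -> asum c A ->
  asum (fun k => if k \in Zd_nonzero then Pop_dag_term s u k phi else 0) ((2 * pi) ^+ d * A * B).
Proof.
move=> fc cA; have A0 := asum_ge0 cA.
have bB' : asum (fun k => b (- k)) B.
  by apply: (asum_inj (f := fun k : Z => - k)) bB => // k l /oppr_inj.
apply: asum_le bB' => [|k]; first by rewrite mulr_ge0// ltW.
rewrite (Pop_dag_termE _ _ fc cA) !normcM normc_real ger0_norm ?(ltW vol_gt0)// -mulrA.
apply: ler_wpM2l; first exact: ltW.
rewrite mulrC; apply: ler_wpM2r; first exact: normc_ge0.
exact: asum_term (asum_pi_coef0 s fc cA).
Qed.

Lemma Pop_dag_hsum s phi c A : frep phi c -> asum c A ->
  hsum (fun k => vol * (b (- k) * pi_coef s phi k)) (Pop_dag s u phi).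
Proof.
move=> fc cA; rewrite /Pop_dag csum_mkcond.
by apply: eq_hsum (asum_hsum (asum_Pop_dag s fc cA)) => k; exact: Pop_dag_termE fc cA.
Qed.

Lemma order0_Pop_dag s : order0 (Pop_dag s u).
Proof.
split=> [z phi psi /(storus_rep 0)[c [A [/decays0 cA fc]]] /(storus_rep 0)[c' [A' [/decays0 cA' gc]]]|].
  have zA : asum (fun p => z * c p + c' p) (normc z * A + A').
    by apply: asumD cA'; apply: asum_le cA => [|p]; rewrite ?normc_ge0// normcM.
  apply: (hsum_uniq (Pop_dag_hsum s (frepD z fc gc) zA)).
  apply: eq_hsum (hsumD (hsumZ z (Pop_dag_hsum s fc cA)) (Pop_dag_hsum s gc cA')) => k.
  by rewrite (pi_coefD _ _ _ fc cA gc cA'); ring.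
exists ((2 * pi) ^+ d * 2 * B).
  by rewrite !mulr_ge0 ?(ltW vol_gt0)// (asum_ge0 bB).
move=> phi /(storus_rep 0)[c [A [/decays0 cA fc]]] M hM.
rewrite -mulrA [B * M]mulrC mulrA; apply: (hsum_norm (Pop_dag_hsum s fc cA)).
have bB' : asum (fun k => b (- k)) B.
  by apply: (asum_inj (f := fun k : Z => - k)) bB => // k l /oppr_inj.
have M0 := bound_ge0 hM.
apply: asum_le bB' => [|k]; first by rewrite !mulr_ge0 ?(ltW vol_gt0).
rewrite !normcM normc_real ger0_norm ?(ltW vol_gt0)// -!mulrA.
apply: ler_wpM2l; first exact: ltW.
rewrite mulrA mulrC; apply: ler_wpM2r; first exact: normc_ge0.
exact: normc_pi_coef fc cA hM.
Qed.

End Pop_dag_series.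

Lemma iter_derive_fst (w : seq (E * E)) (h : E -> R) :
  iter_derive w (fun p : E * E => h p.1) = fun p : E * E => iter_derive (map fst w) h p.1.
Proof. by elim: w => // v w IH; rewrite /= IH. Qed.

Lemma smooth_storus_fst u : smooth_torus u -> smooth_storus (fun x _ => u x).
Proof.
move=> [up [ur ui]]; split=> [v _|]; first exact: up.
have H (h : E -> R) : smooth_on setT h -> smooth_on [set p : E * E | p.2 != 0] (fun p => h p.1).
  move=> hs w x _; rewrite iter_derive_fst; have [h1 h2] := hs (map fst w) x.1 I.
  split; last by move=> v; exact: h2 v.1.
  apply: (@continuous_comp _ _ _ (fst : E * E -> E) (iter_derive (map fst w) h)) h1.
  exact: cvg_fst.
by split; [exact: H ur|exact: H ui].
Qed.

(** [u] is regarded as a function on the sphere bundle constant in theta. Its double series, taken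
    at one fixed point of the sphere and summed over the second frequency, is the Fourier series of
    [u]. *)
Lemma smooth_torus_rep u : smooth_torus u -> exists B, trep u (fourier u) /\ asum (fourier u) B.
Proof.
move=> /smooth_storus_fst/(storus_rep 0)[c [B [/decays0 cB fc]]]; have [v sv] := ex_sphere.
have aB x : asum (fun p => c p * (expi (dotR (zvec p.1) x) * expi (dotR (zvec p.2) v))) B.
  by apply: asum_le1 cB => p; rewrite !normcM !normc_expi !mulr1.
have F (x : E) k : hsum (fun p : Z * Z => if p.1 == k then
    c p * (expi (dotR (zvec p.1) x) * expi (dotR (zvec p.2) v)) else 0)
    (fourier u k * expi (dotR (zvec k) x)).
  have H := hsumZ (expi (dotR (zvec k) x)) (fourier_rep k fc cB sv); rewrite mulrC.
  apply: (@hsum_inj R _ _ (fun l : Z => (k, l)) (fun p => if p.1 == k then Some p.2 else None) _ _ _ _ _ _ _ H).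
  - by move=> l /=; rewrite eqxx.
  - by move=> [k' l] /=; case: eqP => //= ->.
  - by move=> l; rewrite /= eqxx; ring.
  - by move=> [k' l] /=; case: eqP.
exists B; split=> [x|].
  exact: (fiber_hsum (aB x) (fc x v sv) (F x)).
have := @fiber_sum_asum R _ _ (fun p : Z * Z => p.1) (fun _ p => c p * (expi (dotR (zvec p.1) 0) * expi (dotR (zvec p.2) v)))
  _ _ B (fun _ _ => lexx _) (F 0) (aB 0).
by apply: asum_le1 => k; rewrite [leRHS]normcM normc_expi mulr1.
Qed.

Theorem Pop_dag_distribution s u : smooth_torus u ->
  (forall phi, smooth_storus phi -> abs_summable Zd_nonzero (fun k => Pop_dag_term s u k phi)) /\
  is_distribution (Pop_dag s u).
Proof.
move=> /smooth_torus_rep[B [ub bB]]; split; last exact: order0_distribution (order0_Pop_dag ub bB s).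
move=> phi /(storus_rep 0)[c [A [/decays0 cA fc]]].
exact: asum_abs_summable (asum_Pop_dag ub bB s fc cA).
Qed.

End distributions.

(** * The formula with the operators P and their adjoints *)

Section operator_form.
Context {R : realType} {e : nat}.
Local Notation d := e.+1.
Local Notation E := 'rV[R]_d.
Local Notation Z := 'rV[int]_d.
Local Notation tri := (Z * (Z * Z))%type.
Implicit Types (f phi psi : E -> E -> R[i]) (c : Z * Z -> R[i]).
Let a : R := e%:R / 2.
Let vol : R[i] := ((2 * pi) ^+ d)%:C.

(** Invariance of the Liouville measure under the flow, read on the series: (k, l, l') is replaced
    by (- k, l', l). *)
Lemma correlation_sym phi psi c c' B B' (t : R) : frep psi c -> frep phi c' -> asum c B -> asum c' B' ->
  storus_int (fun x v => psi (x + - t *: v) v * phi x v) =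
  storus_int (fun x v => phi (x + t *: v) v * psi x v).
Proof.
move=> fc gc cB cB'; apply: (hsum_uniq (correlation_hsum (- t) fc gc cB cB')).
pose swap (j : tri) : tri := (- j.1, (j.2.2, j.2.1)).
have sK : cancel swap swap by move=> [k [l l']]; rewrite /swap /= opprK.
apply: (hsum_bij sK sK); apply: eq_hsum (correlation_hsum t gc fc cB' cB) => -[k [l l']].
by rewrite /bcoef /bphase /swap /= opprK zvecN scalerN scaleNr opprK [l' + l]addrC [c _ * _]mulrC.
Qed.

Lemma mean_sym phi psi c c' B B' : frep psi c -> frep phi c' -> asum c B -> asum c' B' ->
  storus_int (fun x v => fourier (psi ^~ v) 0 * phi x v) =
  storus_int (fun x v => fourier (phi ^~ v) 0 * psi x v).
Proof.
move=> fc gc cB cB'; rewrite (mean_sphere_int fc gc cB cB') (mean_sphere_int gc fc cB' cB).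
by congr (_ * cintegral _ _ _); apply/funext => v; rewrite mulrC.
Qed.

(** The denominator is written as a power of r^2, in accordance with (- Delta)^((d - 1) / 4); on
    integer frequencies the multiplier is [mode_factor]. *)
Definition wave_multiplier (s : bool) (t r : R) : R[i] :=
  expi (pm s * (t * r - pi / 4 * e%:R)) / ((r ^+ 2) `^ (e%:R / 4))%:C.

Lemma wave_multiplierE s t (k : Z) :
  wave_multiplier s t (enorm (zvec k : E)) = mode_factor s t k.
Proof.
have k0 := enorm_ge0 (zvec k : E); rewrite /wave_multiplier /mode_factor mulrA -expiD; congr (expi _ / _%:C).
  by ring.
by rewrite -powR_mulrn// -powRrM; congr (_ `^ _); field.
Qed.

Section one_function.
Variables (psi : E -> E -> R[i]) (c : Z * Z -> R[i]) (B : R).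
Hypotheses (fc : frep psi c) (cB : asum c B).

Lemma trep_wave_Pop s t :
  trep (fourier_mult (wave_multiplier s t) (Pop s psi))
    (fun k => wave_multiplier s t (enorm (zvec k : E)) * pi_coef (~~ s) psi k) /\
  asum (fun k => wave_multiplier s t (enorm (zvec k : E)) * pi_coef (~~ s) psi k) B.
Proof.
apply: trep_fourier_mult (trep_Pop s fc cB) (asum_pi_coef0 (~~ s) fc cB) _ _.
  by rewrite /pi_coef eqxx.
by move=> k k0; rewrite wave_multiplierE; exact: normc_factor.
Qed.

(** [Pop s] puts the coefficient of psi for the sign [~~ s] at each frequency and the adjoint reads
    it at - k. The two sign changes cancel, so both phi and psi are evaluated at
    [signed_direction s k]. *)
Lemma mode_Pop_dag s t phi c' B' : frep phi c' -> asum c' B' ->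
  hsum (mode phi psi s t) (Pop_dag s (fourier_mult (wave_multiplier s t) (Pop s psi)) phi).
Proof.
move=> gc cB'; have [ub bB] := trep_wave_Pop s t.
apply: eq_hsum (Pop_dag_hsum ub bB s gc cB') => k.
rewrite /mode /pi_coef oppr_eq0; case: eqP => [->|/eqP k0]; first by rewrite !mulr0.
rewrite zvecN enormN wave_multiplierE signed_directionN negbK -/vol.
by move: (mode_factor _ _ _) (fourier _ _) (fourier _ _) => *; ring.
Qed.

Definition fluctuation (t : R) : E -> E -> R[i] := fun x v =>
  (t `^ a)%:C * (geodesic_pull (- t) psi x v - ((2 * pi) ^- d)%:C * torus_int (psi ^~ v)).

Lemma fluctuationE t x v : fluctuation t x v =
  (t `^ a)%:C * (psi (x + - t *: v) v - fourier (psi ^~ v) 0).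
Proof. by have /(congr1 (fun F : E -> R[i] => F v)) <- := P0_fourier psi. Qed.

Lemma order0_fluctuation t : order0 (function_distr (fluctuation t)).
Proof.
have B0 := asum_ge0 cB.
have h1 := cbounded_shift (- t) fc cB.
have h2 := cbounded_shift 0 (frep_mean fc cB) (asum_mean cB).
have h := cboundedZ (t `^ a)%:C (cboundedD h1 (cboundedZ (-1) h2)).
apply: (order0_function _ (eq_cbounded _ h)) => [|z _].
  by rewrite mulr_ge0 ?normc_ge0// addr_ge0// mulr_ge0// normc_ge0.
by rewrite fluctuationE mulN1r.
Qed.

Definition remainder (t : R) (phi : E -> E -> R[i]) : R[i] :=
  function_distr (fluctuation t) phi - ((2 * pi) `^ a)%:C *
    \sum_(s : bool) Pop_dag s (fourier_mult (wave_multiplier s t) (Pop s psi)) phi.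

Lemma order0_remainder t : order0 (remainder t).
Proof.
have P s := order0_Pop_dag (trep_wave_Pop s t).1 (trep_wave_Pop s t).2 s.
have := order0D (order0_fluctuation t) (order0Z (- ((2 * pi) `^ a)%:C) (order0D (P true) (P false))).
congr order0; apply/funext => phi; rewrite /remainder big_bool mulNr; congr (_ - _ * _).
Qed.

(** The backward flow on psi is moved to a forward flow on phi, and t^a (2 pi / t)^a = (2 pi)^a; the
    remainder becomes t^a times the quantity estimated by [correlation_asymp] with phi in the first
    place. *)
Lemma remainderE t phi c' B' : 1 <= t -> frep phi c' -> asum c' B' ->
  remainder t phi = (t `^ a)%:C * (storus_int (fun x v => phi (x + t *: v) v * psi x v) -
    (storus_int (fun x v => fourier (phi ^~ v) 0 * psi x v) + ((2 * pi / t) `^ a)%:C *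
      \sum_(s : bool) Pop_dag s (fourier_mult (wave_multiplier s t) (Pop s psi)) phi)).
Proof.
move=> t1 gc cB'; have t0 : 0 < t by exact: lt_le_trans t1.
rewrite -(correlation_sym t fc gc cB cB') -(mean_sym fc gc cB cB') /remainder.
rewrite opprD addrA mulrBr mulrA -rmorphM -powRM ?(ltW t0)//; last first.
  by rewrite divr_ge0 ?mulr_ge0 ?pi_ge0 ?(ltW t0).
rewrite [t * _]mulrC divfK ?lt0r_neq0//; congr (_ - _).
have mS := @measurable_storus R e; have lS := @storus_lty R e.
have h1 := cbounded_shift_mul (- t) fc gc cB cB'.
have h2 := cbounded_shift_mul 0 (frep_mean fc cB) gc (asum_mean cB) cB'.
have h3 := cboundedZ (-1) h2.
have I1 := cintegralZ mS lS (t `^ a)%:C (cboundedD h1 h3).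
have I2 := cintegralD mS lS h1 h3; have I3 := cintegralZ mS lS (-1) h2.
rewrite mulN1r in I3; apply: etrans (etrans I1 (congr1 _ (etrans I2 (congr1 _ I3)))).
rewrite /function_distr /storus_int; congr cintegral; apply/funext => z.
by rewrite fluctuationE; ring.
Qed.

End one_function.

Theorem remainder_bigO psi : (0 < e)%N -> smooth_storus psi -> bigO_distr (remainder psi) (fun t => t^-1).
Proof.
move=> e0 /(storus_rep e.+1)[c [B [cB fc]]].
have cB0 := decays0 (le_decays (leq0n _) cB).
split=> [t _|phi]; first exact: order0_distribution (order0_remainder fc cB0 t).
move=> /(storus_rep e.+1)[c' [B' [cB' gc]]].
have cB0' := decays0 (le_decays (leq0n _) cB').
have [C C0 h] := correlation_asymp e0 gc fc cB' cB.
apply: (bigO_pinftyP C0) => t t1; have t0 : 0 < t by exact: lt_le_trans t1.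
rewrite (remainderE fc cB0 t1 gc cB0') normcM normc_real ger0_norm ?powR_ge0//.
apply: le_trans (ler_wpM2l (powR_ge0 _ _) (h t _ t1 (fun s => mode_Pop_dag fc cB0 s t gc cB0'))) _.
rewrite mulrCA ler_wpM2l ?(ltW C0)// -powRD; last by rewrite (lt0r_neq0 t0) implybT.
by rewrite -/a (_ : a + - (a + 1) = -1); [rewrite powR_inv1// ltW|ring].
Qed.

End operator_form.

Theorem theorem2p6 (R : realType) (d : nat) (hd : (2 <= d)%N) :
  (forall phi psi : 'rV[R]_d -> 'rV[R]_d -> R[i],
     smooth_storus phi -> smooth_storus psi ->
     bigO_pinfty
       (fun t : R =>
          correlation phi psi t -
          (((2 * pi) ^+ d)%:C * sphere_inner (P0 phi) (P0 psi) +
           ((2 * pi / t) `^ ((d%:R - 1) / 2))%:C *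
           \sum_(s : bool)
             expi (- (pm s * (pi / 4) * (d%:R - 1))) *
             torus_inner
               (fourier_mult
                  (fun r : R =>
                     expi (pm s * (t * r)) / (r `^ ((d%:R - 1) / 2))%:C)
                  (Pi0 s phi))
               (Pi0 s psi)))
       (fun t : R => t `^ (- ((d%:R - 1) / 2 + 1)))) /\
  (forall (s : bool) (psi : 'rV[R]_d -> 'rV[R]_d -> R[i]),
     smooth_storus psi ->
     (forall x : 'rV[R]_d, abs_summable Zd_nonzero (Pop_term s psi x)) /\
     smooth_torus (Pop s psi)) /\
  (forall (s : bool) (f : 'rV[R]_d -> R[i]),
     smooth_torus f ->
     (forall phi : 'rV[R]_d -> 'rV[R]_d -> R[i], smooth_storus phi ->
        abs_summable Zd_nonzero (fun k => Pop_dag_term s f k phi)) /\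
     is_distribution (Pop_dag s f)) /\
  (forall psi : 'rV[R]_d -> 'rV[R]_d -> R[i],
     smooth_storus psi ->
     bigO_distr
       (fun (t : R) (phi : 'rV[R]_d -> 'rV[R]_d -> R[i]) =>
          function_distr
            (fun x theta : 'rV[R]_d =>
               (t `^ ((d%:R - 1) / 2))%:C *
               (geodesic_pull (- t) psi x theta -
                ((2 * pi) ^- d)%:C *
                torus_int (fun y : 'rV[R]_d => psi y theta)))
            phi -
          ((2 * pi) `^ ((d%:R - 1) / 2))%:C *
          \sum_(s : bool)
            Pop_dag s
              (fourier_mult
                 (fun r : R =>
                    expi (pm s * (t * r - pi / 4 * (d%:R - 1))) /
                    ((r ^+ 2) `^ ((d%:R - 1) / 4))%:C)
                 (Pop s psi))
              phi)
       (fun t : R => t^-1)).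
Proof.
case: d hd => [//|e] hd; have e0 : (0 < e)%N by [].
have de : e.+1%:R - 1 = e%:R :> R by rewrite -natr1 addrK.
rewrite de; split; [|split; [|split]].
- by move=> phi psi; exact: correlation_bigO.
- by move=> s psi; exact: Pop_smooth.
- by move=> s f; exact: Pop_dag_distribution.
- by move=> psi; exact: remainder_bigO.
Qed.
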